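(* There exists a finite set $\mathcal{R}$ of at most $10^6$ rectangular tiles such that the following counting problem is $\#\mathsf{P}$-complete: given as input a simply connected region $\Gamma$, compute the number of tilings of $\Gamma$ by translated copies of tiles from $\mathcal{R}$.
   Context: Consider $\mathbb{Z}^2$ as a union of closed unit squares with pairwise disjoint interiors. A region is a finite union of such unit squares whose interior is connected; it is simply connected if it is simply connected as a subset of the plane. A rectangular tile is an $a\times b$ rectangle of unit squares. An $\mathcal{R}$-tiling of a region $\Gamma$ is a collection of translated copies of tiles from $\mathcal{R}$ (rotations not allowed) with pairwise disjoint interiors whose union is $\Gamma$. The input region is given as the finite list of unit squares it contains; the tile set $\mathcal{R}$ is fixed and not part of the input. *)

(* Defs.v *)
From HB Require Import structures.
From mathcomp Require Import all_boot all_order all_algebra finmap.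
From mathcomp Require Import all_classical all_reals all_analysis.

Set Implicit Arguments.
Unset Strict Implicit.
Unset Printing Implicit Defensive.

Import Order.TTheory GRing.Theory Num.Theory.
Import numFieldNormedType.Exports.

Local Open Scope classical_set_scope.
Local Open Scope ring_scope.

Inductive direction := Left | Stay | Right.

(* A two-way infinite tape: [Tape l r] has [head None r] under the head,
   [behead r] to the right of the head, and [l] to its left, nearest cell
   first; all cells not listed are blank. *)
Record tape (S : Type) := Tape {tape_left : seq (option S);
                                tape_right : seq (option S)}.

Section Tape.
Variable S : Type.
Implicit Type t : tape S.

Definition tape_read t : option S := head None (tape_right t).

Definition tape_write (c : option S) t : tape S :=
  Tape (tape_left t) (c :: behead (tape_right t)).

Definition tape_move (d : direction) t : tape S :=
  let: Tape l r := t in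
  match d with
  | Left => Tape (behead l) (head None l :: r)
  | Stay => t
  | Right => Tape (head None r :: l) (behead r)
  end.

End Tape.

(* The tape alphabet is {0,1} + [tm_extra] together with a blank (None).
   Tape [ord0] holds the input at the start and the output at the end, tape
   [ord_max] is the oracle tape, and the [tm_work] others are work tapes.
   [tm_query q = Some q'] makes [q] a query state, left for [q']. *)
Record machine := Machine {
  tm_work : nat;
  tm_extra : finType;
  tm_state : finType;
  tm_start : tm_state;
  tm_halt : pred tm_state;
  tm_query : tm_state -> option tm_state;
  tm_step : tm_state -> {ffun 'I_tm_work.+2 -> option (bool + tm_extra)} ->
    tm_state * ('I_tm_work.+2 -> option (bool + tm_extra) * direction)
}.

Section Run.
Variable M : machine.

Definition mtape := tape (bool + tm_extra M).
Definition config := (tm_state M * ('I_(tm_work M).+2 -> mtape))%type.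

Definition blank_tape : mtape := Tape [::] [::].

Definition tape_of_bits (w : seq bool) : mtape :=
  Tape [::] [seq Some (inl b) | b <- w].

Fixpoint leading_bits (r : seq (option (bool + tm_extra M))) : seq bool :=
  if r is Some (inl b) :: r' then b :: leading_bits r' else [::].

(* The word written on a tape: the maximal block of bits starting at the
   head. *)
Definition bits_of_tape (t : mtape) : seq bool := leading_bits (tape_right t).

Definition init (x : seq bool) : config :=
  (tm_start M, fun i => if i == ord0 then tape_of_bits x else blank_tape).

(* A query replaces the word [w] on the oracle tape by [oracle w], in a single
   step. *)
Definition step (oracle : seq bool -> seq bool) (c : config) : config :=
  let: (q, ts) := c in
  if tm_halt q then c
  else if tm_query q is Some q' then
    (q', fun i => if i == ord_max
                  then tape_of_bits (oracle (bits_of_tape (ts i))) else ts i)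
  else
    let: (q', act) := tm_step q [ffun i => tape_read (ts i)] in
    (q', fun i => tape_move (act i).2 (tape_write (act i).1 (ts i))).

Definition computes_within (oracle : seq bool -> seq bool)
    (x y : seq bool) (n : nat) : Prop :=
  exists2 t : nat, (t <= n)%N &
    let c := iter t (step oracle) (init x) in
    tm_halt c.1 /\ bits_of_tape (c.2 ord0) = y.

Definition oracle_free : Prop := forall q : tm_state M, tm_query q = None.

End Run.

Definition polytime_oracle_machine (M : machine) (oracle F : seq bool -> seq bool)
    : Prop :=
  exists p : {poly nat}, forall x, computes_within M oracle x (F x) p.[size x].

(* The oracle is irrelevant for an oracle-free machine. *)
Definition polytime (F : seq bool -> seq bool) : Prop :=
  exists2 M, oracle_free M & polytime_oracle_machine M (fun=> [::]) F.

Definition polytime_turing (oracle F : seq bool -> seq bool) : Prop :=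
  exists M, polytime_oracle_machine M oracle F.

(* Binary expansion, least significant bit first; 0 is the empty word. *)
Fixpoint bits_of_positive (p : BinNums.positive) : seq bool :=
  match p with
  | BinNums.xH => [:: true]
  | BinNums.xO p' => false :: bits_of_positive p'
  | BinNums.xI p' => true :: bits_of_positive p'
  end.

Definition bits (n : nat) : seq bool :=
  if bin_of_nat n is BinNums.Npos p then bits_of_positive p else [::].

(* Self-delimiting code: every bit is doubled, and 10 marks the end. *)
Definition delimited (w : seq bool) : seq bool :=
  flatten [seq [:: b; b] | b <- w] ++ [:: true; false].

Definition string_pair (x y : seq bool) : seq bool := delimited x ++ y.

Definition sharpP (f : seq bool -> nat) : Prop :=
  exists (p : {poly nat}) (V : pred (seq bool)),
    polytime (fun w => [:: V w]) /\
    forall x, f x = #|[pred y : (p.[size x]).-tuple bool | V (string_pair x y)]|.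

Definition turing_reducible (g f : seq bool -> nat) : Prop :=
  polytime_turing (bits \o f) (bits \o g).

Definition sharpP_hard (f : seq bool -> nat) : Prop :=
  forall g, sharpP g -> turing_reducible g f.

Definition sharpP_complete (f : seq bool -> nat) : Prop :=
  sharpP f /\ sharpP_hard f.

(* The function on words given by a counting problem [f] with set of instances
   [D]; words that encode no instance are sent to 0. *)
Definition counting_problem (T : Type) (enc : T -> seq bool) (D : set T)
    (f : T -> nat) (w : seq bool) : nat :=
  if pselect (exists x, D x /\ enc x = w) is left ex
  then f (projT1 (cid ex)) else 0%N.

Section Topology.
Variables (R : realType) (X : topologicalType).

Definition path_in (A : set X) (g : R -> X) : Prop :=
  {within `[0, 1], continuous g} /\ g @` `[0, 1] `<=` A.

Definition path_connected (A : set X) : Prop :=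
  forall x y, A x -> A y -> exists g, [/\ path_in A g, g 0 = x & g 1 = y].

(* [H (s, t)] is the loop at time [s]; the homotopy fixes the base point. *)
Definition null_homotopic_in (A : set X) (g : R -> X) : Prop :=
  exists H : R * R -> X,
    [/\ {within `[0, 1] `*` `[0, 1], continuous H},
        H @` (`[0, 1] `*` `[0, 1]) `<=` A,
        forall t : R, t \in `[0, 1] -> H (0, t) = g t,
        forall t : R, t \in `[0, 1] -> H (1, t) = g 0 &
        forall s : R, s \in `[0, 1] -> H (s, 0) = g 0 /\ H (s, 1) = g 0].

Definition simply_connected (A : set X) : Prop :=
  [/\ A !=set0, path_connected A &
      forall g, path_in A g -> g 0 = g 1 -> null_homotopic_in A g].

End Topology.

(* A unit square of the grid is named by its lower left corner, and a tile by
   its width and height. *)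
Notation square := (int * int)%type.
Notation tile := (nat * nat)%type.

Definition is_tile (t : tile) : Prop := (0 < t.1)%N /\ (0 < t.2)%N.

Section Tilings.
Variable R : realType.

Definition rectangle (c : square) (t : tile) : set (R * R) :=
  `[c.1%:~R, c.1%:~R + t.1%:R] `*` `[c.2%:~R, c.2%:~R + t.2%:R].

Definition unit_square (c : square) : set (R * R) := rectangle c (1, 1)%N.

Definition union_of_squares (s : seq square) : set (R * R) :=
  \bigcup_(c in [set` s]) unit_square c.

Definition is_region (s : seq square) : Prop :=
  uniq s /\ connected (interior (union_of_squares s)).

Definition simply_connected_region (s : seq square) : Prop :=
  is_region s /\ simply_connected R (union_of_squares s).

(* A tiling is the set of its placed tiles, each a pair of a lower left corner
   and a tile. *)
Definition is_tiling (T : {fset tile}) (Gamma : set (R * R))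
    (P : {fset square * tile}) : Prop :=
  [/\ forall u : square * tile, u \in P -> u.2 \in T,
      forall u v : square * tile, u \in P -> v \in P -> u <> v ->
        interior (rectangle u.1 u.2) `&` interior (rectangle v.1 v.2) = set0 &
      \bigcup_(u in [set` P]) rectangle u.1 u.2 = Gamma].

Definition nb_tilings (T : {fset tile}) (s : seq square) : nat :=
  #|` fset_set [set P | is_tiling T (union_of_squares s) P]|.

Definition encode_int (z : int) : seq bool := delimited ((z < 0) :: bits `|z|%N).

Definition encode_squares (s : seq square) : seq bool :=
  flatten [seq encode_int c.1 ++ encode_int c.2 | c <- s].

Definition tiling_problem (T : {fset tile}) : seq bool -> nat :=
  counting_problem encode_squares simply_connected_region (nb_tilings T).

End Tilings.

(* The lemmas up to [encode_squares_inj] show that the choice made in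
   [counting_problem] is unique for this encoding. *)
Lemma delimited_inj (s s' u u' : seq bool) :
  delimited s ++ u = delimited s' ++ u' -> s = s' /\ u = u'.
Proof.
rewrite /delimited; elim: s s' => [|b s IHs] [|b' s'] //=.
- by case.
- by case: b' => -[].
- by case: b => -[].
by case=> -> _ /IHs [-> ->].
Qed.

Lemma bits_of_positive_inj : injective bits_of_positive.
Proof.
have nz p : bits_of_positive p <> [::] by case: p.
elim=> [p IHp|p IHp|] [q|q|] //=; first by case=> /IHp ->.
- by case=> /nz.
- by case=> /IHp ->.
- by case=> /esym /nz.
Qed.

Lemma bits_inj : injective bits.
Proof.
have nz p : bits_of_positive p <> [::] by case: p.
move=> m n; rewrite /bits => e; apply: (can_inj bin_of_natK); move: e.
case: (bin_of_nat m) (bin_of_nat n) => [|p] [|q] //.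
- by move=> /esym /nz.
- by move=> /nz.
by move=> /bits_of_positive_inj ->.
Qed.

Lemma encode_int_inj (z z' : int) (u u' : seq bool) :
  encode_int z ++ u = encode_int z' ++ u' -> z = z' /\ u = u'.
Proof.
move=> /delimited_inj [[sz] /bits_inj az ->]; split=> //.
by rewrite (intEsign z) (intEsign z') sz az.
Qed.

Lemma encode_squares_inj : injective encode_squares.
Proof.
have E a b s : encode_squares ((a, b) :: s) =
    encode_int a ++ (encode_int b ++ encode_squares s).
  by rewrite [LHS]/flatten /= -catA.
elim=> [|[a b] s IHs] [|[a' b'] s'] //.
by rewrite !E => /encode_int_inj [-> /encode_int_inj [-> /IHs ->]].
Qed.

(* Ensures that [fset_set] in [nb_tilings] never takes its default value. *)
Lemma finite_tilings (R : realType) (T : {fset tile}) (s : seq square) :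
  finite_set [set P | is_tiling T (@union_of_squares R s) P].
Proof.
pose F : seq (square * tile) :=
  [seq (c, t) | c <- [seq (a, b) |
      a <- [seq c.1 | c <- s] ++ [seq c.1 + 1 | c <- s],
      b <- [seq c.2 | c <- s] ++ [seq c.2 + 1 | c <- s]], t <- enum_fset T].
apply: (@sub_finite_set _ _ [set` fpowerset [fset x in F]%fset]); last exact: finite_fset.
move=> P [PT _ PU] /=; rewrite fpowersetE; apply/fsubsetP => -[[a b] [w h]] uP.
have wT : (w, h) \in T by exact: (PT _ uP).
have : @union_of_squares R s (a%:~R, b%:~R).
  rewrite -PU; exists (a, b, (w, h)) => //=.
  by split; rewrite /= in_itv /= lexx lerDl ler0n.
have itvE (x y : int) :
    (x%:~R <= y%:~R :> R) && (y%:~R <= x%:~R + 1 :> R) -> y = x \/ y = x + 1.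
  case/andP; rewrite ler_int => h1 h2.
  have {}h2 : y <= x + 1 by rewrite -(ler_int R) intrD.
  move: h1; rewrite le_eqVlt => /orP[/eqP -> |]; first by left.
  by rewrite -lezD1 => h1; right; apply/le_anti; rewrite h1 h2.
case=> -[c d] /= cs [] /=; rewrite !in_itv /= => /itvE Ha /itvE Hb.
rewrite !inE; apply/allpairsP; exists ((a, b), (w, h)); split=> //=.
apply/allpairsP; exists (a, b); split=> //=; rewrite mem_cat; apply/orP.
- case: Ha => ->; [left|right].
  + by apply/mapP; exists (c, d).
  + by apply/mapP; exists (c, d).
- case: Hb => ->; [left|right].
  + by apply/mapP; exists (c, d).
  + by apply/mapP; exists (c, d).
Qed.

(* Main.v *)
Require Import Defs.
From HB Require Import structures.
From mathcomp Require Import all_boot all_order all_algebra finmap.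
From mathcomp Require Import all_classical all_reals all_analysis.
From mathcomp Require Import zify ring lra.

(** Hardness.  A machine deciding the witnesses of a counting function is
    turned into a formula in conjunctive normal form by a tableau whose cells
    are coded in unary and which is determined by the witness, so that the
    reduction preserves the number of solutions.  The formula is compiled into
    a straight-line program for a row of registers (guess an assignment, move a
    marker, test a literal, assert a clause, clear), and the runs of the
    program correspond to the labellings of a grid with prescribed border,
    neighbouring labels being constrained by two fixed relations.  The grid is
    a slanted wall of bricks of height 4 separated by fillers of height 2 or 3
    in columns of alternate parity: the horizontal position of every cut
    between two bricks is a multiple of a unit plus a code of its label, the
    codes are distinct powers of 4 small compared to the unit, and a tile is
    available for each pair of labels in relation.  The staircase shape of the
    wall forces the tiles one by one from the bottom, so tilings are exactly
    labellings.  The wall is a chain of horizontal bars, each overlapping the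
    next, hence a simply connected region.

    Membership.  Cut the squares of the input into maximal horizontal bars.
    The union of the bars is simply connected iff repeatedly removing a bar
    that touches exactly one other bar leaves a single bar: a chain of bars
    closing up would give a loop whose number of crossings of a contact is odd.
    Connectedness of the interior is reachability among the bars that overlap
    in a segment.  So the instances are recognized in polynomial time, and a
    tiling is a subset of the placed tiles that meet the region.

    Polynomial time is proved in a small stack language, closed under the
    usual list operations, whose programs are run by the machines. *)

Set Implicit Arguments.
Unset Strict Implicit.
Unset Printing Implicit Defensive.

Import Order.TTheory GRing.Theory Num.Theory.
Import numFieldNormedType.Exports.

Local Open Scope nat_scope.

(** * A stack language for polynomial time *)

(** Base 4 is used because a brick and the filler next to it compare three codes with three others:
    with fewer than four summands there are no carries, so equal sums are equal multisets. Codes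
    also record the parities of row and column; otherwise a code could be mistaken for one of a
    neighbouring cut. Widths near [3 * U] and [2 * U] let a gap of about [5 * U] hold only one brick
    and one filler, and each wrong order or wrong filler height makes a tile overshoot the step
    where it should end; the overshoot is passed on to the right until it leaves the region. A count
    has to be preserved, so every choice bit of the grid except the guessed assignment is
    determined, and the program ends by erasing the assignment, as the top border must be known in
    advance. There are 16 modes, 6 symbols and one choice bit, hence 208 labels and at most
    [8 * 208 ^ 2] tiles. The unit is enormous but fixed, so the hardness reduction may compute in
    unary. Membership may not: input coordinates are binary, and only offsets bounded by the number
    of squares are unary. *)

Definition poly_bounded (h : nat -> nat) : Prop :=
  exists c d, forall n, h n <= c * n.+1 ^ d.

Lemma poly_bounded_le (g h : nat -> nat) :
  (forall n, g n <= h n) -> poly_bounded h -> poly_bounded g.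
Proof. by move=> gh [c [d H]]; exists c, d => n; exact: leq_trans (gh n) (H n). Qed.

Lemma poly_boundedC c : poly_bounded (fun=> c).
Proof. by exists c, 0 => n; rewrite expn0 muln1. Qed.

Lemma poly_bounded_id : poly_bounded id.
Proof. by exists 1, 1 => n; rewrite expn1 mul1n. Qed.

Lemma poly_boundedD g h :
  poly_bounded g -> poly_bounded h -> poly_bounded (fun n => g n + h n).
Proof.
move=> [c [d H]] [c' [d' H']]; exists (c + c'), (d + d') => n.
rewrite mulnDl leq_add //.
- by apply: leq_trans (H n) _; rewrite leq_mul2l leq_pexp2l ?leq_addr ?orbT.
- by apply: leq_trans (H' n) _; rewrite leq_mul2l leq_pexp2l ?leq_addl ?orbT.
Qed.

Lemma poly_boundedM g h :
  poly_bounded g -> poly_bounded h -> poly_bounded (fun n => g n * h n).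
Proof.
move=> [c [d H]] [c' [d' H']]; exists (c * c'), (d + d') => n.
by rewrite expnD mulnACA leq_mul.
Qed.

Lemma poly_bounded_comp g h :
  poly_bounded g -> poly_bounded h -> poly_bounded (fun n => g (h n)).
Proof.
move=> [c [d H]] [c' [d' H']]; exists (c * c'.+1 ^ d), (d' * d) => n.
apply: leq_trans (H _) _; rewrite -mulnA leq_mul2l; apply/orP; right.
rewrite expnM -expnMn; case: d {H} => // d; rewrite leq_exp2r //.
rewrite mulSn addnC -addn1 leq_add // expn_gt0 //.
Qed.

Lemma poly_bounded_mono h : poly_bounded h ->
  exists g, [/\ poly_bounded g, {homo g : m n / m <= n} & forall n, h n <= g n].
Proof.
move=> [c [d H]]; exists (fun n => c * n.+1 ^ d); split=> //; first by exists c, d.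
move=> m n mn; rewrite leq_mul2l; apply/orP; right.
by case: d {H} => // d; rewrite leq_exp2r.
Qed.

Ltac pb := repeat first
  [ apply: poly_boundedC | apply: poly_bounded_id | assumption
  | apply: poly_boundedD | apply: poly_boundedM ].

Definition store := nat -> seq bool.

Definition upd (s : store) r w : store := fun r' => if r' == r then w else s r'.

(* [Case] and [Loop] pop the tested register; [Ask] is an oracle query. *)
Inductive prog :=
| Skip
| Push of nat & bool
| Seq of prog & prog
| Case of nat & prog & prog & prog
| Loop of nat & prog & prog
| Ask of nat.

(** The last index is the running time. With [o = None] there is no rule for [Ask], so one semantics
    covers programs with and without an oracle; otherwise [o] fixes the only register that may be
    queried. *)
Inductive exec (o : option (nat * (seq bool -> seq bool))) :
    prog -> store -> store -> nat -> Prop :=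
| exec_skip s : exec o Skip s s 1
| exec_push r b s : exec o (Push r b) s (upd s r (b :: s r)) 1
| exec_seq p q s s1 s2 m n : exec o p s s1 m -> exec o q s1 s2 n ->
    exec o (Seq p q) s s2 (m + n).+1
| exec_case_nil r p0 p1 p2 s s' n : s r = [::] -> exec o p0 s s' n ->
    exec o (Case r p0 p1 p2) s s' n.+1
| exec_case_cons r p0 p1 p2 b w s s' n : s r = b :: w ->
    exec o (if b then p1 else p2) (upd s r w) s' n ->
    exec o (Case r p0 p1 p2) s s' n.+1
| exec_loop_nil r p1 p2 s : s r = [::] -> exec o (Loop r p1 p2) s s 1
| exec_loop_cons r p1 p2 b w s s1 s2 m n : s r = b :: w ->
    exec o (if b then p1 else p2) (upd s r w) s1 m ->
    exec o (Loop r p1 p2) s1 s2 n ->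
    exec o (Loop r p1 p2) s s2 (m + n).+1
| exec_ask f r s : o = Some (r, f) -> exec o (Ask r) s (upd s r (f (s r))) 1.

Lemma exec_oracle o p s s' n : exec None p s s' n -> exec o p s s' n.
Proof.
elim=> {p s s' n}; try by [econstructor | econstructor; eauto].
Qed.

(** One unit of time pushes at most one bit. An oracle answer could be arbitrarily long, whence the
    restriction to [None]. *)
Lemma exec_size p s s' n r : exec None p s s' n -> size (s' r) <= size (s r) + n.
Proof.
elim=> {p s s' n} //=.
- by move=> s; rewrite leq_addr.
- by move=> r' b s; rewrite /upd; case: eqP => [->|_] /=; lia.
- by move=> p q s s1 s2 m n _ H1 _ H2; lia.
- by move=> r' p0 p1 p2 s s' n _ _ H; lia.
- move=> r' p0 p1 p2 b w s s' n E _ H; apply: leq_trans H _; rewrite /upd.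
  by case: eqP => [->|_]; rewrite ?E /=; lia.
- by move=> *; lia.
- move=> r' p1 p2 b w s s1 s2 m n E _ H1 _ H2.
  suff: size (upd s r' w r) <= size (s r) by lia.
  by rewrite /upd; case: eqP => [->|_] //; rewrite E.
Qed.

Definition runs p s s' n := exists2 m, m <= n & exec None p s s' m.

Lemma runs_le p s s' m n : m <= n -> runs p s s' m -> runs p s s' n.
Proof. by move=> mn [k km H]; exists k => //; exact: leq_trans km mn. Qed.

Lemma runs_eq p s s1 s2 n : s1 =1 s2 -> runs p s s1 n -> runs p s s2 n.
Proof. by move=> /funext ->. Qed.

Lemma runs_seq p q s s1 s2 m n :
  runs p s s1 m -> runs q s1 s2 n -> runs (Seq p q) s s2 (m + n).+1.
Proof.
move=> [m' mm' H] [n' nn' H']; exists (m' + n').+1; first by rewrite ltnS leq_add.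
exact: exec_seq H H'.
Qed.

Lemma runs_push r b s : runs (Push r b) s (upd s r (b :: s r)) 1.
Proof. by exists 1 => //; constructor. Qed.

Lemma runs_case r p0 p1 p2 s s' n :
  (if s r is b :: w then runs (if b then p1 else p2) (upd s r w) s' n
   else runs p0 s s' n) ->
  runs (Case r p0 p1 p2) s s' n.+1.
Proof.
case E: (s r) => [|b w] [m mn H]; exists m.+1 => //.
- exact: exec_case_nil.
- exact: exec_case_cons E H.
Qed.

Lemma runs_loop r p1 p2 s s' n :
  (if s r is b :: w then
     exists s1 m1 m2, [/\ runs (if b then p1 else p2) (upd s r w) s1 m1,
       runs (Loop r p1 p2) s1 s' m2 & m1 + m2 <= n]
   else s = s') ->
  runs (Loop r p1 p2) s s' n.+1.
Proof.
case E: (s r) => [|b w].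
  by move=> <-; exists 1 => //; exact: exec_loop_nil.
move=> [s1 [m1 [m2 [[k1 l1 H1] [k2 l2 H2] l]]]]; exists (k1 + k2).+1; first by lia.
exact: exec_loop_cons E H1 H2.
Qed.

Ltac neqs := repeat match goal with H : is_true (_ != _) |- _ => move/eqP: H => H end.

Ltac store_eq :=
  let r := fresh "r" in
  neqs; move=> r; rewrite /upd; repeat (case: (@eqP _ r _) => [->|?]);
  rewrite ?eqxx //=; repeat (case: eqP => ? //=); try congruence; try lia.

Ltac upd_at := rewrite /upd; repeat (case: eqP => ? //=); try congruence; try lia.

Definition move_reg a b := Loop a (Push b true) (Push b false).

Lemma runs_move a b s : a != b ->
  runs (move_reg a b) s (upd (upd s b (catrev (s a) (s b))) a [::])
    (2 * size (s a)).+1.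
Proof.
move=> ab; move E: (s a) => w; elim: w s E => [|c w IH] s E.
  by apply: runs_loop; rewrite E; apply/funext; store_eq.
apply: (@runs_le _ _ _ (1 + (2 * size w).+1).+1); first by rewrite /=; lia.
apply: runs_loop; rewrite E.
exists (upd (upd s a w) b (c :: s b)), 1, (2 * size w).+1; split=> //.
  apply: (@runs_eq _ _ (upd (upd s a w) b (c :: upd s a w b))); first by store_eq.
  by case: c {E}; exact: runs_push.
apply: runs_eq (IH _ _); first by store_eq.
by rewrite /upd eqxx (negbTE ab).
Qed.

Definition clear_reg a := Loop a Skip Skip.

Lemma runs_clear a s : runs (clear_reg a) s (upd s a [::]) (2 * size (s a)).+1.
Proof.
move E: (s a) => w; elim: w s E => [|c w IH] s E.
  by apply: runs_loop; rewrite E; apply/funext; store_eq.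
apply: (@runs_le _ _ _ (1 + (2 * size w).+1).+1); first by rewrite /=; lia.
apply: runs_loop; rewrite E; exists (upd s a w), 1, (2 * size w).+1; split=> //.
  by exists 1 => //; case: c {E}; constructor.
apply: runs_eq (IH _ _); first by store_eq.
by rewrite /upd eqxx.
Qed.

(** A single [move_reg] reverses the word; the detour through the scratch register [t] restores its
    order. *)
Definition transfer a b t := Seq (move_reg a t) (move_reg t b).

Lemma runs_transfer a b t s : a != b -> t != a -> t != b -> s t = [::] ->
  runs (transfer a b t) s (upd (upd s b (s a ++ s b)) a [::]) (4 * size (s a) + 3).
Proof.
move=> ab ta tb st.
pose s1 := upd (upd s t (rev (s a))) a [::].
have H1 : runs (move_reg a t) s s1 (2 * size (s a)).+1.
  apply: runs_eq (runs_move _ _); last by rewrite eq_sym.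
  by move=> r; rewrite /s1 st.
have H2 := @runs_move t b s1 tb.
apply: runs_eq (runs_le _ (runs_seq H1 H2)).
  rewrite /s1 /upd (negbTE ta) !eqxx [b == a]eq_sym (negbTE ab) [b == t]eq_sym (negbTE tb).
  by rewrite catrevE revK; store_eq.
by rewrite /s1 /upd (negbTE ta) eqxx size_rev; lia.
Qed.

Definition copy_reg a b t := Seq (move_reg a t)
  (Loop t (Seq (Push a true) (Push b true)) (Seq (Push a false) (Push b false))).

Lemma runs_copy a b t s : a != b -> t != a -> t != b -> s t = [::] ->
  runs (copy_reg a b t) s (upd s b (s a ++ s b)) (7 * size (s a) + 3).
Proof.
move=> ab ta tb st.
pose s1 := upd (upd s t (rev (s a))) a [::].
have H1 : runs (move_reg a t) s s1 (2 * size (s a)).+1.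
  apply: runs_eq (runs_move _ _); last by rewrite eq_sym.
  by move=> r; rewrite /s1 st.
have H2 w s' : s' t = w -> runs (Loop t (Seq (Push a true) (Push b true))
      (Seq (Push a false) (Push b false))) s'
      (upd (upd (upd s' a (rev w ++ s' a)) b (rev w ++ s' b)) t [::]) (5 * size w).+1.
  elim: w s' => [|c w IH] s' E.
    by apply: runs_loop; rewrite E; apply/funext; store_eq.
  apply: (@runs_le _ _ _ (3 + (5 * size w).+1).+1); first by rewrite /=; lia.
  apply: runs_loop; rewrite E.
  exists (upd (upd (upd s' t w) a (c :: s' a)) b (c :: s' b)), 3, (5 * size w).+1; split=> //.
    have X : runs (Seq (Push a c) (Push b c)) (upd s' t w)
      (upd (upd (upd s' t w) a (c :: upd s' t w a)) b
        (c :: upd (upd s' t w) a (c :: upd s' t w a) b)) 3.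
      by apply: (@runs_seq _ _ _ _ _ 1 1); exact: runs_push.
    have {X} : runs (Seq (Push a c) (Push b c)) (upd s' t w)
        (upd (upd (upd s' t w) a (c :: s' a)) b (c :: s' b)) 3.
      by apply: runs_eq X; store_eq.
    by case: c {E}.
  apply: runs_eq (IH _ _); last by rewrite /upd eqxx (negbTE ta) (negbTE tb).
  by rewrite !rev_cons !cat_rcons; store_eq.
have e1 : s1 t = rev (s a) by rewrite /s1 /upd (negbTE ta) eqxx.
apply: runs_eq (runs_le _ (runs_seq H1 (H2 _ _ e1))).
  by rewrite revK /s1; store_eq; rewrite ?cats0; congruence.
by rewrite size_rev; lia.
Qed.

(* [D] is the set of inputs on which [f] has to be computed; the registers
   above [k] serve as empty work space. *)
Definition computable_in_ptime (D : seq bool -> Prop) (f : seq bool -> seq bool) : Prop :=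
  exists P : nat -> prog, exists2 h, poly_bounded h & forall k s,
    D (s k) -> (forall r, k < r -> s r = [::]) ->
    runs (P k) s (upd s k (f (s k))) (h (size (s k))).
Notation PF := computable_in_ptime.

Lemma runs_at (D : seq bool -> Prop) (P : nat -> prog) f h :
  (forall k s, D (s k) -> (forall r, k < r -> s r = [::]) ->
    runs (P k) s (upd s k (f (s k))) (h (size (s k)))) ->
  forall k s s' x, D x -> s k = x -> (forall r, k < r -> s r = [::]) ->
    upd s k (f x) =1 s' -> runs (P k) s s' (h (size x)).
Proof. by move=> H k s s' x Dx e; rewrite -e in Dx *; move=> s0 e'; apply: runs_eq e' (H _ _ Dx s0). Qed.

Section ComputablePtime.
Variable D : seq bool -> Prop.

(** A result cannot be longer than the input plus the running time, as is seen by running the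
    program on register 0 of an otherwise empty store. *)
Lemma PF_size f : PF D f ->
  exists2 h, poly_bounded h & forall x, D x -> size (f x) <= h (size x).
Proof.
move=> [P [h ph H]]; exists (fun n => n + h n).
  by apply: poly_boundedD => //; exact: poly_bounded_id.
move=> x Dx; have [//||n nh /exec_size] := H 0 (upd (fun=> [::]) 0 x).
  by case.
by move=> /(_ 0); rewrite /upd eqxx => l; apply: leq_trans l _; rewrite leq_add2l.
Qed.

Lemma PF_ext f g : (forall x, D x -> f x = g x) -> PF D f -> PF D g.
Proof.
move=> fg [P [h ph H]]; exists P, h => // k s Dx s0.
by rewrite -fg //; exact: H.
Qed.

Lemma PF_comp (D' : seq bool -> Prop) f g :
  (forall x, D x -> D' (f x)) -> PF D f -> PF D' g -> PF D (g \o f).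
Proof.
move=> DD' Pf; have [hs phs Hs] := PF_size Pf.
move: Pf => [P [h ph H]] [Q [h' ph' H']].
have [m [pm mono hm]] := poly_bounded_mono ph'.
exists (fun k => Seq (P k) (Q k)), (fun n => (h n + m (hs n)).+1).
  by apply: (poly_boundedD (poly_boundedC 1)); apply: poly_boundedD => //; exact: poly_bounded_comp.
move=> k s Dx s0; have H1 := H k s Dx s0.
have [||m2 l2 H2] := H' k (upd s k (f (s k))).
- by rewrite /upd eqxx; exact: DD'.
- by move=> r kr; rewrite /upd gtn_eqF // s0.
apply: runs_eq (runs_le _ (runs_seq H1 (ex_intro2 _ _ m2 l2 H2))).
  by rewrite /upd eqxx; store_eq.
rewrite ltnS leq_add2l /upd eqxx.
by apply: leq_trans (hm _) _; exact/mono/Hs.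
Qed.

Lemma PF_cons b : PF D (cons b).
Proof.
exists (fun k => Push k b), (fun=> 1); first exact: poly_boundedC.
by move=> k s _ _; exact: runs_push.
Qed.

Lemma PF_behead : PF D behead.
Proof.
exists (fun k => Case k Skip Skip Skip), (fun=> 2); first exact: poly_boundedC.
move=> k s _ _; apply: runs_case; case E: (s k) => [|b w].
  by apply: (@runs_eq _ _ s); [store_eq | exists 1 => //; constructor].
by exists 1 => //; case: b {E}; constructor.
Qed.

Lemma PF_const w : PF D (fun=> w).
Proof.
elim: w => [|b w IH].
  exists clear_reg, (fun n => 2 * n + 1).
    by apply: poly_boundedD; [apply: poly_boundedM|]; [exact: poly_boundedC|exact: poly_bounded_id|exact: poly_boundedC].
  by move=> k s _ _; rewrite addn1; exact: runs_clear.
move: IH => [P [h ph H]]; exists (fun k => Seq (P k) (Push k b)), (fun n => h n + 1 + 1); first by pb.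
move=> k s Dx s0; apply: runs_eq (runs_le _ (runs_seq (H k s Dx s0) (runs_push _ _ _))); last by lia.
by store_eq.
Qed.

Lemma PF_cat f g : PF D f -> PF D g -> PF D (fun x => f x ++ g x).
Proof.
move=> Pf Pg; have [hs phs Hs] := PF_size Pf; have [hs' phs' Hs'] := PF_size Pg.
move: Pf Pg => [P [h ph H]] [Q [h' ph' H']].
(* Work space has to be empty above the argument, so [x] is moved to [k.+2], above the finished
   value of [g], before [f] is evaluated. Transfers prepend, hence [g x] returns to [k] before [f x]
   does. *)
exists (fun k => Seq (copy_reg k k.+1 k.+2) (Seq (Q k.+1) (Seq (transfer k k.+2 (k + 3))
   (Seq (P k.+2) (Seq (transfer k.+1 k (k + 3)) (transfer k.+2 k (k + 3))))))),
  (fun n => 11 * n + h n + h' n + 4 * hs n + 4 * hs' n + 30).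
  by pb.
move=> k s Dx s0.
have nk a b : a != b -> k + a != k + b by rewrite eqn_add2l.
have k1 : k.+1 = k + 1 by lia. have k2 : k.+2 = k + 2 by lia.
have k0 : k = k + 0 by lia.
pose x := s k.
pose s1 := upd s k.+1 x.
have H1 : runs (copy_reg k k.+1 k.+2) s s1 (7 * size x + 3).
  apply: runs_eq (runs_copy _ _ _ _); try lia; last by rewrite s0 //; lia.
  by move=> r; rewrite /s1 [s k.+1]s0 ?cats0 //; lia.
have H2 : runs (Q k.+1) s1 (upd s k.+1 (g x)) (h' (size x)).
  apply: (runs_at H'); rewrite /s1 //; first by rewrite /upd eqxx.
    by move=> r kr; rewrite /upd gtn_eqF // s0 //; lia.
  by store_eq.
set s2 := upd s k.+1 (g x) in H2.
pose s3 := upd (upd s2 k [::]) k.+2 x.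
have H3 : runs (transfer k k.+2 (k + 3)) s2 s3 (4 * size x + 3).
  have e : s2 k = x by rewrite /s2; upd_at.
  rewrite -e; apply: runs_eq (runs_transfer _ _ _ _); try lia.
    have e2 : s2 k.+2 = [::] by rewrite /s2; upd_at; rewrite s0 //; lia.
    by move=> r; rewrite e e2 cats0 /s3; move: r; store_eq.
  by rewrite /s2; upd_at; rewrite s0 //; lia.
have H4 : runs (P k.+2) s3 (upd s3 k.+2 (f x)) (h (size x)).
  apply: (runs_at H); rewrite /s3 //; first by rewrite /upd eqxx.
  by move=> r kr; rewrite /s2 /upd !gtn_eqF ?s0 //; lia.
set s4 := upd s3 k.+2 (f x) in H4.
pose s5 := upd (upd s4 k.+1 [::]) k (g x).
have e0 : s (k + 3) = [::] by rewrite s0 //; lia.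
have H5 : runs (transfer k.+1 k (k + 3)) s4 s5 (4 * size (g x) + 3).
  have e : s4 k.+1 = g x by rewrite /s4 /s3 /s2; upd_at.
  have e' : s4 k = [::] by rewrite /s4 /s3 /s2; upd_at.
  rewrite -e; apply: runs_eq (runs_transfer _ _ _ _); try lia.
    by move=> r; rewrite e e' cats0 /s5; move: r; store_eq.
  by rewrite /s4 /s3 /s2; upd_at.
have H6 : runs (transfer k.+2 k (k + 3)) s5 (upd s k (f x ++ g x)) (4 * size (f x) + 3).
  have e : s5 k.+2 = f x by rewrite /s5 /s4; upd_at.
  have e' : s5 k = g x by rewrite /s5 /upd eqxx.
  rewrite -{2}e; apply: runs_eq (runs_transfer _ _ _ _); try lia.
    rewrite e e' /s5 /s4 /s3 /s2; store_eq; rewrite s0 //; lia.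
  by rewrite /s5 /s4 /s3 /s2; upd_at.
apply: runs_le (runs_seq H1 (runs_seq H2 (runs_seq H3 (runs_seq H4 (runs_seq H5 H6))))).
have := Hs x Dx; have := Hs' x Dx; rewrite -/x; lia.
Qed.

(* Splits off a complete prefix of [n] codes of binary trees, where a leaf is
   coded by 0 and a node by 1 followed by the codes of its subtrees. *)
Fixpoint scan n w : seq bool * seq bool :=
  match n, w with
  | 0, _ => ([::], w)
  | _, [::] => ([::], [::])
  | n'.+1, b :: w' => let: (p, r) := scan (if b then n'.+2 else n') w' in (b :: p, r)
  end.

Definition scan_prog k := Seq (Push k.+1 true) (Loop k.+1
  (Case k Skip (Seq (Push k.+2 true) (Seq (Push k.+1 true) (Push k.+1 true))) (Push k.+2 false))
  (Case k Skip (Seq (Push k.+2 true) (Seq (Push k.+1 true) (Push k.+1 true))) (Push k.+2 false))).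

Lemma runs_scan k s : (forall r, k < r -> s r = [::]) ->
  runs (scan_prog k) s (upd (upd s k (scan 1 (s k)).2) k.+2 (rev (scan 1 (s k)).1))
    (20 * size (s k) + 20).
Proof.
move=> s0.
rewrite /scan_prog; set body := Case k _ _ _.
(* The bound is a potential: consuming a bit raises the counter [n] by at most one, which costs 4
   and is paid by the 18 allotted to the bit. On a truncated word the loop merely empties the
   counter. *)
have H w : forall n s p, s k = w -> s k.+1 = nseq n true -> s k.+2 = p ->
  runs (Loop k.+1 body body) s
    (upd (upd (upd s k (scan n w).2) k.+1 [::]) k.+2 (catrev (scan n w).1 p))
    (4 * n + 18 * size w + 1).
  elim: w => [|b w IH].
    elim=> [|n IHn] s' p sk sn sp /=.
      by rewrite addn1; apply: runs_loop; rewrite sn /=; apply/funext; store_eq.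
    have -> : 4 * n.+1 + 18 * 0 + 1 = (4 * n + 4).+1 by lia.
    apply: runs_loop; rewrite sn /=; exists (upd s' k.+1 (nseq n true)), 2, (4 * n + 1).
    split; last by lia.
      apply: runs_case; rewrite {1}/upd ltn_eqF // sk; exists 1 => //; constructor.
    have -> : 4 * n + 1 = 4 * n + 18 * 0 + 1 by lia.
    apply: runs_eq (IHn _ p _ _ _); [|by upd_at..].
    by case: (n) => [|?] /=; store_eq.
  move=> [|n] s' p sk sn sp.
    rewrite /= addn1; apply: runs_loop; rewrite sn /=; apply/funext; store_eq.
  have -> : 4 * n.+1 + 18 * size (b :: w) + 1 = (4 * n + 18 * size w + 22).+1 by rewrite /=; lia.
  apply: runs_loop; rewrite sn /=.
  pose n' := if b then n.+2 else n.
  pose s1 := upd (upd (upd s' k w) k.+1 (nseq n' true)) k.+2 (b :: p).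
  exists s1, 8, (4 * n' + 18 * size w + 1); split.
  - apply: (@runs_case _ _ _ _ _ _ 7); rewrite {1}/upd ltn_eqF // sk.
    case: b @n' @s1 {sk} => n' s1; last first.
      apply: runs_eq (runs_le _ (runs_push _ _ _)) => //.
      by rewrite /s1 /n'; store_eq.
    apply: runs_eq (runs_le _ (runs_seq (runs_push _ _ _) (runs_seq (runs_push _ _ _) (runs_push _ _ _)))) => //.
    by rewrite /s1 /n'; store_eq.
  - apply: runs_eq (IH n' s1 (b :: p) _ _ _); [|by rewrite /s1; upd_at..].
    rewrite /= -/n'; case: (scan n' w) => p' r /=.
    by rewrite /s1; store_eq.
  - by rewrite /n'; case: (b); lia.
have H1 := runs_push k.+1 true s.
have H2 := H (s k) 1 (upd s k.+1 (true :: s k.+1)) [::].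
apply: runs_eq (runs_le _ (runs_seq H1 (H2 _ _ _))); last 3 first.
- by upd_at.
- by rewrite /upd eqxx s0.
- by upd_at; rewrite s0 //; lia.
- by rewrite /rev; store_eq; rewrite s0 //; lia.
- by lia.
Qed.

Lemma PF_scan1 : PF D (fun w => (scan 1 w).1).
Proof.
exists (fun k => Seq (scan_prog k) (Seq (clear_reg k) (move_reg k.+2 k))),
  (fun n => 30 * n + 30); first by pb.
move=> k s Dx s0; have H1 := runs_scan s0.
set s1 := upd _ _ _ in H1.
have H2 := runs_clear k s1.
set s2 := upd s1 _ _ in H2.
have H3 : runs (move_reg k.+2 k) s2 _ _ := runs_move s2 (_ : k.+2 != k).
have sz : size (scan 1 (s k)).1 + size (scan 1 (s k)).2 <= size (s k).
  move: (1) (s k) => n w; elim: w n => [|b w IH] [|n] //=.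
  by have := IH (if b then n.+2 else n); case: scan => p r /=; lia.
apply: runs_eq (runs_le _ (runs_seq H1 (runs_seq H2 (H3 _)))); last by lia.
  rewrite /s2 /s1 /upd !eqxx; rewrite (_ : (k.+2 == k) = false); last by lia.
  by rewrite catrevE revK cats0; store_eq; rewrite s0 //; lia.
rewrite /s2 /s1 /upd !eqxx; rewrite (_ : (k.+2 == k) = false); last by lia.
rewrite (_ : (k == k.+2) = false); last by lia.
by rewrite size_rev; lia.
Qed.

Lemma PF_scan2 : PF D (fun w => (scan 1 w).2).
Proof.
exists (fun k => Seq (scan_prog k) (clear_reg k.+2)),
  (fun n => 30 * n + 30); first by pb.
move=> k s Dx s0; have H1 := runs_scan s0.
set s1 := upd _ _ _ in H1.
have H2 := runs_clear k.+2 s1.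
have sz : size (scan 1 (s k)).1 + size (scan 1 (s k)).2 <= size (s k).
  move: (1) (s k) => n w; elim: w n => [|b w IH] [|n] //=.
  by have := IH (if b then n.+2 else n); case: scan => p r /=; lia.
apply: runs_eq (runs_le _ (runs_seq H1 H2)).
  by rewrite /s1; store_eq; rewrite s0 //; lia.
by rewrite /s1 /upd !eqxx size_rev; lia.
Qed.

Lemma PF_if c f g : PF D c -> PF D f -> PF D g ->
  PF D (fun x => if head false (c x) then f x else g x).
Proof.
move=> Pc; have [hs phs Hs] := PF_size Pc.
move: Pc => [C [hc phc Hc]] [P [h ph H]] [Q [h' ph' H']].
exists (fun k => Seq (copy_reg k k.+1 k.+2) (Seq (C k.+1) (Case k.+1 (Q k)
  (Seq (clear_reg k.+1) (P k)) (Seq (clear_reg k.+1) (Q k))))),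
  (fun n => 7 * n + hc n + 2 * hs n + h n + h' n + 30); first by pb.
move=> k s Dx s0; pose x := s k.
have H1 : runs (copy_reg k k.+1 k.+2) s (upd s k.+1 x) (7 * size x + 3).
  apply: runs_eq (runs_copy _ _ _ _); try lia; last by rewrite s0 //; lia.
  by move=> r; rewrite [s k.+1]s0 ?cats0 //; lia.
have H2 : runs (C k.+1) (upd s k.+1 x) (upd s k.+1 (c x)) (hc (size x)).
  apply: (runs_at Hc) => //; first by upd_at.
    by move=> r kr; upd_at; rewrite s0 //; lia.
  by store_eq.
suff H3 : runs (Case k.+1 (Q k) (Seq (clear_reg k.+1) (P k)) (Seq (clear_reg k.+1) (Q k)))
    (upd s k.+1 (c x)) (upd s k (if head false (c x) then f x else g x))
    (2 * size (c x) + 10 + h (size x) + h' (size x)).+1.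
  apply: runs_le (runs_seq H1 (runs_seq H2 H3)).
  by have := Hs x Dx; rewrite -/x; lia.
apply: runs_case; rewrite {1}/upd eqxx.
case E: (c x) => [|b w] /=.
  apply: runs_le; last apply: (runs_at H' (x := x)); [by lia|by []|by upd_at|..].
    by move=> r kr; upd_at; rewrite s0 //; lia.
  by store_eq; rewrite s0 //; lia.
set s1 := upd (upd _ _ _) _ _.
have K := runs_clear k.+1 s1.
have e1 : s1 k.+1 = w by rewrite /s1; upd_at.
rewrite e1 in K.
clear E; case: b @s1 K e1 => s1 K e1.
- apply: runs_le; last apply: (runs_seq K (runs_at H (x := x) Dx _ _ _)); first by lia.
  + by rewrite /s1; upd_at.
  + by move=> r kr; rewrite /s1; upd_at; rewrite s0 //; lia.
  + by rewrite /s1; store_eq; rewrite s0 //; lia.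
- apply: runs_le; last apply: (runs_seq K (runs_at H' (x := x) Dx _ _ _)); first by lia.
  + by rewrite /s1; upd_at.
  + by move=> r kr; rewrite /s1; upd_at; rewrite s0 //; lia.
  + by rewrite /s1; store_eq; rewrite s0 //; lia.
Qed.

(** The word [c x] is consumed as loop counter. A bound on all intermediate values has to be
    assumed, since iterating a polynomially bounded function may produce exponential growth. *)
Lemma PF_iter (D' : seq bool -> Prop) c z f b : PF D c -> PF D z -> PF D' f -> poly_bounded b ->
  (forall x i, D x -> i <= size (c x) ->
    D' (iter i f (z x)) /\ size (iter i f (z x)) <= b (size x)) ->
  PF D (fun x => iter (size (c x)) f (z x)).
Proof.
move=> Pc Pz; have [hs phs Hs] := PF_size Pc; have [hsz phsz Hsz] := PF_size Pz.
move: Pc Pz => [C [hc phc Hc]] [Z [hz phz Hz]] [P [h ph H]] pb_b Hb.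
have [m [pm mono hm]] := poly_bounded_mono ph.
exists (fun k => Seq (copy_reg k k.+1 k.+2) (Seq (Z k.+1) (Seq (transfer k k.+2 (k + 3))
   (Seq (C k.+2) (Seq (move_reg k.+2 k) (Seq (Loop k (P k.+1) (P k.+1))
     (transfer k.+1 k (k + 3)))))))),
  (fun n => 11 * n + hz n + hc n + 2 * hs n + hs n * (m (b n)).+1 + 4 * b n + 30).
  by pb; apply: (poly_boundedD (poly_boundedC 1)); exact: poly_bounded_comp.
move=> k s Dx s0; pose x := s k.
have H1 : runs (copy_reg k k.+1 k.+2) s (upd s k.+1 x) (7 * size x + 3).
  apply: runs_eq (runs_copy _ _ _ _); try lia; last by rewrite s0 //; lia.
  by move=> r; rewrite [s k.+1]s0 ?cats0 //; lia.
pose s2 := upd s k.+1 (z x).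
have H2 : runs (Z k.+1) (upd s k.+1 x) s2 (hz (size x)).
  apply: (runs_at Hz) => //; first by upd_at.
    by move=> r kr; upd_at; rewrite s0 //; lia.
  by rewrite /s2; store_eq.
pose s3 := upd (upd s2 k [::]) k.+2 x.
have H3 : runs (transfer k k.+2 (k + 3)) s2 s3 (4 * size x + 3).
  have e : s2 k = x by rewrite /s2; upd_at.
  rewrite -e; apply: runs_eq (runs_transfer _ _ _ _); try lia.
    have e2 : s2 k.+2 = [::] by rewrite /s2; upd_at; rewrite s0 //; lia.
    by move=> r; rewrite e e2 cats0 /s3; move: r; store_eq.
  by rewrite /s2; upd_at; rewrite s0 //; lia.
pose s4 := upd s3 k.+2 (c x).
have H4 : runs (C k.+2) s3 s4 (hc (size x)).
  apply: (runs_at Hc); rewrite /s3 //; first by rewrite /upd eqxx.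
  by move=> r kr; rewrite /s2; upd_at; rewrite s0 //; lia.
pose s5 w v := upd (upd s k w) k.+1 v.
have H5 : runs (move_reg k.+2 k) s4 (s5 (rev (c x)) (z x)) (2 * size (c x)).+1.
  have e : s4 k.+2 = c x by rewrite /s4; upd_at.
  have e' : s4 k = [::] by rewrite /s4 /s3; upd_at.
  rewrite -{2}e; apply: runs_eq (runs_move _ _); last by lia.
  by rewrite e e' /s5 /s4 /s3 /s2 /rev; store_eq; rewrite s0 //; lia.
have H6 w i : size w + i = size (c x) ->
    runs (Loop k (P k.+1) (P k.+1)) (s5 w (iter i f (z x)))
      (s5 [::] (iter (size (c x)) f (z x))) (size w * (m (b (size x))).+1).+1.
  elim: w i => [|a w IH] i /= wi.
    apply: runs_loop; rewrite {1}/s5 /upd ltn_eqF // eqxx -wi.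
    by apply/funext.
  apply: (@runs_le _ _ _ (m (b (size x)) + (size w * (m (b (size x))).+1).+1).+1); first by lia.
  apply: runs_loop; rewrite {1}/s5 /upd ltn_eqF // eqxx.
  exists (s5 w (iter i.+1 f (z x))), (m (b (size x))), (size w * (m (b (size x))).+1).+1.
  split=> //; last by apply: IH; lia.
  rewrite if_same -!/(upd _ _ _).
  have /(Hb x _ Dx)[D'i Hbi] : i <= size (c x) by lia.
  apply: runs_le; last apply: (runs_at H (x := iter i f (z x)) D'i).
  - by apply: leq_trans (hm _) _; apply/mono.
  - by rewrite /s5; upd_at.
  - by move=> r kr; rewrite /s5; upd_at; rewrite s0 //; lia.
  - by rewrite /s5 /=; store_eq.
have {}H6 := H6 (rev (c x)) 0 (etrans (addn0 _) (size_rev _)).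
have H7 : runs (transfer k.+1 k (k + 3)) (s5 [::] (iter (size (c x)) f (z x)))
    (upd s k (iter (size (c x)) f (z x))) (4 * size (iter (size (c x)) f (z x)) + 3).
  set v := iter _ _ _; have e : s5 [::] v k.+1 = v by rewrite /s5; upd_at.
  have e' : s5 [::] v k = [::] by rewrite /s5; upd_at.
  rewrite -{3}e; apply: runs_eq (runs_transfer _ _ _ _); try lia.
    by rewrite e e' cats0 /s5; store_eq; rewrite s0 //; lia.
  by rewrite /s5; upd_at; rewrite s0 //; lia.
apply: runs_le (runs_seq H1 (runs_seq H2 (runs_seq H3 (runs_seq H4 (runs_seq H5 (runs_seq H6 H7)))))).
rewrite size_rev; have := Hs x Dx; have [_] := Hb x _ Dx (leqnn _); rewrite -/x => h1 h2.
have : size (c x) * (m (b (size x))).+1 <= hs (size x) * (m (b (size x))).+1 by rewrite leq_mul2r h2 orbT.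
lia.
Qed.

(* The head of the result says whether the first two tree codes are equal. *)
Definition eq_codes w : seq bool :=
  [:: (scan 1 (behead w)).1 == (scan 1 (behead w)).2].

(** Both codes are popped in step, from their last bits. Register [k] starts as a single [true], and
    each mismatch or left-over bit pushes a [false] on it, so the codes agree exactly when [true] is
    still on top. *)
Lemma PF_eq_codes : PF D eq_codes.
Proof.
pose body := Case 1 (Push 0 false) Skip (Push 0 false).
exists (fun k => Seq (Case k Skip Skip Skip) (Seq (scan_prog k) (Seq (move_reg k k.+1)
  (Seq (Push k true) (Seq (Loop k.+2
     (Case k.+1 (Push k false) Skip (Push k false)) (Case k.+1 (Push k false) (Push k false) Skip))
  (Seq (Loop k.+1 (Push k false) (Push k false))
   (Case k (Push k true) (Seq (clear_reg k) (Push k true)) (Seq (clear_reg k) (Push k false))))))))),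
  (fun n => 60 * n + 60); first by pb.
move=> k s Dx s0; pose x := behead (s k).
have H1 : runs (Case k Skip Skip Skip) s (upd s k x) 2.
  apply: runs_case; rewrite /x; case E: (s k) => [|b w].
    by apply: (@runs_eq _ _ s); [store_eq | exists 1 => //; constructor].
  by exists 1 => //; case: b {E}; constructor.
have sx : size x <= size (s k) by rewrite /x size_behead leq_pred.
have s0' r : k < r -> upd s k x r = [::] by move=> kr; upd_at; rewrite s0.
have := runs_scan s0'.
have -> : upd s k x k = x by upd_at.
set u := (scan 1 x).1; set v := (scan 1 x).2; set s2 := upd (upd _ _ _) _ _ => H2.
have sz : size u + size v <= size x.
  rewrite /u /v; move: (1) (x) => n w; elim: w n => [|b w IH] [|n] //=.
  by have := IH (if b then n.+2 else n); case: scan => p r /=; lia.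
pose st a b c := upd (upd (upd s k a) k.+1 b) k.+2 c.
have H3 : runs (move_reg k k.+1) s2 (st [::] (rev v) (rev u)) (2 * size v).+1.
  have e : s2 k = v by rewrite /s2; upd_at.
  rewrite -e; apply: runs_eq (runs_move _ _); last by lia.
  have e' : s2 k.+1 = [::] by rewrite /s2; upd_at; rewrite s0.
  by rewrite e' e /st /s2 /rev; store_eq.
have H4 := runs_push k true (st [::] (rev v) (rev u)).
have {}H4 : runs (Push k true) (st [::] (rev v) (rev u)) (st [:: true] (rev v) (rev u)) 1.
  by apply: runs_eq H4; rewrite /st; store_eq.
have H5 a b m : exists m' b', runs (Loop k.+2
     (Case k.+1 (Push k false) Skip (Push k false)) (Case k.+1 (Push k false) (Push k false) Skip))
    (st (nseq m false ++ [:: true]) b a) (st (nseq m' false ++ [:: true]) b' [::]) (10 * size a).+1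
   /\ [/\ (m' == 0) && (b' == [::]) = (m == 0) && (a == b), m' <= m + size a & size b' <= size b].
  elim: a b m => [|c a IH] b m.
    exists m, b; split; last by rewrite addn0 [_ == b]eq_sym.
    by apply: runs_loop; rewrite {1}/st /upd eqxx.
  pose ok := if b is d :: _ then c == d else false.
  have [m' [b' [Hr [He Hm Hb]]]] := IH (behead b) (if ok then m else m.+1).
  exists m', b'; split; last first.
    split; [rewrite He /ok|by move: Hm => /=; case: (ok); lia|by move: Hb; rewrite size_behead; lia].
    by clear; case: b => [|d b]; rewrite ?eqseq_cons ?andbF //; case: (c == d); rewrite ?andbF.
  rewrite (_ : (10 * size (c :: a)).+1 = (9 + (10 * size a).+1).+1); last by rewrite /=; lia.
  apply: runs_loop; rewrite {1}/st /upd eqxx.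
  exists (st (nseq (if ok then m else m.+1) false ++ [:: true]) (behead b) a), 9, (10 * size a).+1.
  split=> //; rewrite -!/(upd _ _ _).
  set s' := upd _ _ _.
  have e : s' k.+1 = b by rewrite /s' /st; upd_at.
  have e' : s' = st (nseq m false ++ [:: true]) b a by apply/funext; rewrite /s' /st; store_eq.
  have X d : runs (Push k false) (upd s' k.+1 d) (st (false :: nseq m false ++ [:: true]) d a) 8.
    apply: runs_eq (runs_le _ (runs_push _ _ _)) => //.
    by rewrite e' /st; store_eq.
  have Y d : runs Skip (upd s' k.+1 d) (st (nseq m false ++ [:: true]) d a) 8.
    exists 1 => //; rewrite (_ : st _ _ _ = upd s' k.+1 d); first by constructor.
    by apply/funext; rewrite e' /st; store_eq.
  have Z : b = [::] -> upd s' k.+1 [::] = s'.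
    by move=> eb; apply/funext; rewrite e' eb /st; store_eq.
  rewrite /ok; case: (c); apply: (@runs_case _ _ _ _ _ _ 8); rewrite e;
    case E: (b) => [|[] b1] //=; rewrite -[X in runs _ X _ _]Z //.
have H6 b m : runs (Loop k.+1 (Push k false) (Push k false))
    (st (nseq m false ++ [:: true]) b [::]) (st (nseq (m + size b) false ++ [:: true]) [::] [::]) (5 * size b).+1.
  elim: b m => [|c b IH] m.
    by apply: runs_loop; rewrite addn0 {1}/st /upd ltn_eqF // eqxx.
  rewrite (_ : (5 * size (c :: b)).+1 = (4 + (5 * size b).+1).+1); last by rewrite /=; lia.
  apply: runs_loop; rewrite {1}/st /upd ltn_eqF // eqxx.
  exists (st (nseq m.+1 false ++ [:: true]) b [::]), 4, (5 * size b).+1; split=> //.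
    rewrite if_same -!/(upd _ _ _); apply: runs_eq (runs_le _ (runs_push _ _ _)) => //.
    by rewrite /st; store_eq.
  by have := IH m.+1; rewrite addSnnS.
have [m [b [{}H5 [He Hm Hb]]]] := H5 (rev u) (rev v) 0.
have H7 : runs (Case k (Push k true) (Seq (clear_reg k) (Push k true)) (Seq (clear_reg k) (Push k false)))
    (st (nseq (m + size b) false ++ [:: true]) [::] [::]) (upd s k [:: u == v]) (2 * (m + size b) + 10).+1.
  apply: runs_case; rewrite {1}/st {1}/upd ltn_eqF // {1}/upd ltn_eqF // {1}/upd eqxx.
  have -> : (u == v) = (m + size b == 0).
    rewrite addn_eq0 size_eq0 He /=; apply/eqP/eqP => [->//|].
    by move=> /(congr1 rev); rewrite !revK.
  case E: (m + size b) => [|n] /=;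
    apply: runs_eq (runs_le _ (runs_seq (runs_clear _ _) (runs_push _ _ _)));
    rewrite /st /=; try by store_eq; rewrite ?s0 //; lia.
  - by rewrite /upd eqxx /=; lia.
  - by rewrite /upd eqxx /= size_cat size_nseq /=; lia.
apply: runs_le (runs_seq H1 (runs_seq H2 (runs_seq H3 (runs_seq H4 (runs_seq H5 (runs_seq (H6 b m) H7)))))).
move: Hm Hb; rewrite !size_rev; lia.
Qed.

End ComputablePtime.

(** * Compilation to Turing machines *)

HB.instance Definition _ := gen_eqMixin prog.
HB.instance Definition _ := gen_choiceMixin prog.

(* The control state of the machine is the list of programs still to be run;
   only finitely many such lists are reachable. *)
Fixpoint continuations (p : prog) (k : seq prog) : seq (seq prog) :=
  (p :: k) :: match p with
  | Seq a b => continuations a (b :: k) ++ continuations b k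
  | Case _ a b c => continuations a k ++ continuations b k ++ continuations c k
  | Loop _ a b => continuations a (p :: k) ++ continuations b (p :: k)
  | _ => [::]
  end.

Definition successors (c : seq prog) : seq (seq prog) :=
  if c isn't p :: k then [::] else match p with
  | Seq a b => [:: [:: a, b & k]]
  | Case _ a b c => [:: a :: k; b :: k; c :: k]
  | Loop _ a b => [:: k; [:: a, p & k]; [:: b, p & k]]
  | _ => [:: k]
  end.

Lemma continuations_head p k : p :: k \in continuations p k.
Proof. by case: p => *; rewrite /= inE eqxx. Qed.

Lemma continuations_closed p k c c' : c \in continuations p k ->
  c' \in successors c -> c' \in k :: continuations p k.
Proof.
elim: p k => [|r b|a IHa b IHb|r a IHa b IHb d IHd|r a IHa b IHb|r] k /=;
  rewrite in_cons => /predU1P[-> /=|]; rewrite ?in_nil //=.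
- by rewrite !inE => ->.
- by rewrite !inE => ->.
- by rewrite !inE => /eqP ->; rewrite mem_cat continuations_head !orbT.
- rewrite mem_cat => /orP[/IHa|/IHb] /[apply]; rewrite !(inE, mem_cat).
    by case/orP=> [/eqP ->|->]; rewrite ?continuations_head ?orbT.
  by case/orP=> ->; rewrite ?orbT.
- rewrite !inE !mem_cat => /or3P[]/eqP ->; rewrite continuations_head ?orbT //.
- rewrite !mem_cat => /or3P[/IHa|/IHb|/IHd] /[apply]; rewrite !(inE, mem_cat);
  by case/orP=> ->; rewrite ?orbT.
- by rewrite !inE !mem_cat => /or3P[]/eqP ->; rewrite ?continuations_head ?eqxx ?orbT.
- rewrite !mem_cat => /orP[/IHa|/IHb] /[apply]; rewrite !(inE, mem_cat);
  by case/orP=> ->; rewrite ?orbT.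
- by rewrite !inE => ->.
Qed.

Fixpoint fits w (p : prog) : bool :=
  match p with
  | Push r _ => r < w
  | Seq a b => fits w a && fits w b
  | Case r a b c => [&& r < w, fits w a, fits w b & fits w c]
  | Loop r a b => [&& r < w, fits w a & fits w b]
  | _ => true
  end.

Lemma fits_le w w' p : w <= w' -> fits w p -> fits w' p.
Proof.
move=> ww'; have L r : r < w -> r < w' by move/leq_trans; apply.
elim: p => [|r b|a IHa b IHb|r a IHa b IHb c IHc|r a IHa b IHb|r] //=.
- exact: L.
- by case/andP=> /IHa -> /IHb.
- by case/and4P=> /L -> /IHa -> /IHb -> /IHc.
- by case/and3P=> /L -> /IHa -> /IHb.
Qed.

Lemma fits_ex p : exists w, fits w p.
Proof.
have M a b : fits a =1 fits a -> a <= maxn a b /\ b <= maxn a b by lia.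
elim: p => [|r b|a [wa Ha] b [wb Hb]|r a [wa Ha] b [wb Hb] c [wc Hc]|r a [wa Ha] b [wb Hb]|r] /=.
- by exists 0.
- by exists r.+1.
- by exists (wa + wb); rewrite (fits_le _ Ha) ?(fits_le _ Hb) //; lia.
- by exists (r.+1 + wa + wb + wc); rewrite (fits_le _ Ha) ?(fits_le _ Hb) ?(fits_le _ Hc) //; lia.
- by exists (r.+1 + wa + wb); rewrite (fits_le _ Ha) ?(fits_le _ Hb) //; lia.
- by exists 0.
Qed.

Section Compile.
Variables (p0 : prog) (w : nat) (ora : bool).

Let L := [::] :: continuations p0 [::].

Lemma successors_in c c' : c \in L -> c' \in successors c -> c' \in L.
Proof.
rewrite {1}/L inE => /predU1P[-> //|cL]; exact: (continuations_closed cL).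
Qed.

(** The boolean marks the middle of a [Push], which takes two machine steps: move left, then
    write. *)
Definition cstate : finType := (seq_sub L * bool)%type.
Definition symbol := option (bool + void).

(** The default [q.1] of [insubd] is never taken, thanks to [successors_in]. *)
Definition goto (q : cstate) (c : seq prog) : cstate := (insubd q.1 c, false).

Lemma val_goto q c : c \in L -> val (goto q c).1 = c.
Proof. by move=> cL; rewrite /goto /= val_insubd cL. Qed.

Definition keep (rd : {ffun 'I_w.+2 -> symbol}) (r : nat) (a : symbol * direction) :
    'I_w.+2 -> symbol * direction :=
  fun i => if val i == r then a else (rd i, Stay).

Definition cstep (q : cstate) (rd : {ffun 'I_w.+2 -> symbol}) :
    cstate * ('I_w.+2 -> symbol * direction) :=
  let nop := fun i => (rd i, Stay) in
  match val q.1 with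
  | [::] => (q, nop)
  | p :: k => match p with
    | Skip => (goto q k, nop)
    | Push r b => if q.2 then (goto q k, keep rd r (Some (inl b), Stay))
                  else ((q.1, true), keep rd r (rd (inord r), Left))
    | Seq a b => (goto q [:: a, b & k], nop)
    | Case r a b c => if rd (inord r) is Some (inl x)
        then (goto q ((if x then b else c) :: k), keep rd r (rd (inord r), Right))
        else (goto q (a :: k), nop)
    | Loop r a b => if rd (inord r) is Some (inl x)
        then (goto q [:: if x then a else b, p & k], keep rd r (rd (inord r), Right))
        else (goto q k, nop)
    | Ask _ => (goto q k, nop)
    end
  end.

Lemma start_in : [:: p0] \in L.
Proof. by rewrite inE continuations_head orbT. Qed.

Definition cquery (q : cstate) : option cstate :=
  if ora then if val q.1 is Ask _ :: k then Some (goto q k) else None else None.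

Definition compiled : machine :=
  @Machine w void cstate (SeqSub start_in, false)
    (fun q => nilp (val q.1)) cquery cstep.

(** Only the tape from the head onwards matters: popped symbols stay behind on the left and are
    overwritten by later pushes, and blanks may have been visited on the right. *)
Definition represents (t : tape (bool + void)) (x : seq bool) :=
  exists m, tape_right t = [seq Some (inl b) | b <- x] ++ nseq m None.

Lemma represents_read t x : represents t x ->
  tape_read t = if x is b :: _ then Some (inl b) else None.
Proof. by rewrite /tape_read => -[m ->]; case: x => [|b x] //=; case: m. Qed.

Lemma represents_keep t x : represents t x ->
  represents (tape_move Stay (tape_write (tape_read t) t)) x.
Proof.
case: t => l r [m /= E]; rewrite /represents /tape_write /tape_read /=.
by rewrite E; case: x {E} => [|b x] /=; [case: m => [|m] /=; [exists 1|exists m.+1]|exists m].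
Qed.

Lemma represents_pop t b x : represents t (b :: x) ->
  represents (tape_move Right (tape_write (tape_read t) t)) x.
Proof. by case: t => l r [m /= ->]; exists m. Qed.

Lemma represents_push t b x : represents t x ->
  represents (tape_move Stay (tape_write (Some (inl b))
    (tape_move Left (tape_write (tape_read t) t)))) (b :: x).
Proof.
case: t => l r [m /= ->]; rewrite /represents /tape_write /tape_read /=.
by case: x => [|a x] /=; [case: m => [|m] /=; [exists 1|exists m.+1]|exists m].
Qed.

Lemma represents_bits t x : represents t x -> @bits_of_tape compiled t = x.
Proof.
rewrite /bits_of_tape => -[m ->]; elim: x => [|b x IH] /=; last by rewrite IH.
by case: m.
Qed.

Variable oracle : seq bool -> seq bool.

Definition corres (ts : 'I_w.+2 -> tape (bool + void)) (s : store) :=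
  forall i : 'I_w.+2, represents (ts i) (s i).

Let mstep := @step compiled oracle.

Definition reaches q ts c' s' n := exists t q' ts',
  [/\ t <= n, iter t mstep ((q, false), ts) = ((q', false), ts'),
      val q' = c' & corres ts' s'].

Lemma reaches_step q ts c s q1 ts1 n : mstep ((q, false), ts) = ((q1, false), ts1) ->
  reaches q1 ts1 c s n -> reaches q ts c s n.+1.
Proof.
move=> E [t [q' [ts' [tn Et vq cr]]]]; exists t.+1, q', ts'; split=> //.
by rewrite iterSr E.
Qed.

Lemma reaches_le q ts c s m n : m <= n -> reaches q ts c s m -> reaches q ts c s n.
Proof.
by move=> mn [t [q' [ts' [tm ? ? ?]]]]; exists t, q', ts'; split=> //; exact: leq_trans mn.
Qed.

Lemma reaches_trans q ts c s c' s' m n : reaches q ts c s m ->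
  (forall q1 ts1, val q1 = c -> corres ts1 s -> reaches q1 ts1 c' s' n) ->
  reaches q ts c' s' (m + n).
Proof.
move=> [t [q1 [ts1 [tn Et vq cr]]]] /(_ _ _ vq cr) [t' [q2 [ts2 [tn' Et' vq' cr']]]].
exists (t' + t), q2, ts2; split=> //; first by lia.
by rewrite iterD Et.
Qed.

Lemma corres_nop ts s : corres ts s ->
  corres (fun i => tape_move (([ffun i => tape_read (ts i)] i : symbol, Stay).2)
     (tape_write ([ffun i => tape_read (ts i)] i : symbol, Stay).1 (ts i))) s.
Proof. by move=> H i; rewrite /= ffunE; apply: represents_keep. Qed.

Lemma corres_pop ts s r b x : r < w.+2 -> s r = b :: x -> corres ts s ->
  corres (fun i => tape_move (keep [ffun i => tape_read (ts i)] r
       ([ffun i => tape_read (ts i)] (inord r), Right) i).2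
     (tape_write (keep [ffun i => tape_read (ts i)] r
       ([ffun i => tape_read (ts i)] (inord r), Right) i).1 (ts i))) (upd s r x).
Proof.
move=> rw sr H i; rewrite /keep /upd; case: eqP => [ir|ir] /=; rewrite !ffunE.
  have -> : inord r = i by apply: val_inj; rewrite /= inordK.
  by apply: (@represents_pop _ b); rewrite -sr -ir; exact: H.
exact: represents_keep.
Qed.

Lemma corres_push ts s r b : r < w.+2 -> corres ts s -> forall rd,
  let ts1 := fun i => tape_move (keep [ffun i => tape_read (ts i)] r
       ([ffun i => tape_read (ts i)] (inord r), Left) i).2
     (tape_write (keep [ffun i => tape_read (ts i)] r
       ([ffun i => tape_read (ts i)] (inord r), Left) i).1 (ts i)) in
  rd = [ffun i => tape_read (ts1 i)] ->
  corres (fun i => tape_move (keep rd r (Some (inl b), Stay) i).2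
     (tape_write (keep rd r (Some (inl b), Stay) i).1 (ts1 i))) (upd s r (b :: s r)).
Proof.
move=> rw H rd ts1 -> i; rewrite /keep /upd; case: eqP => [ir|ir] /=.
  rewrite /ts1 /keep ir eqxx !ffunE.
  have -> : inord r = i by apply: val_inj; rewrite /= inordK.
  by apply: represents_push; rewrite -ir; exact: H.
rewrite ffunE; apply: represents_keep; rewrite /ts1 /keep; move/eqP: ir => /negbTE -> /=.
by rewrite ffunE; apply: represents_keep.
Qed.

(** Register [r] is tape [r], and the factor 2 pays for the two steps of [Push]. Reachable control
    states are suffix lists of programs, so the induction is over runs with an arbitrary
    continuation [k]. *)
Lemma exec_reaches o p s s' n : exec o p s s' n ->
  (forall r f, o = Some (r, f) -> [/\ ora, r = w.+1 & f = oracle]) ->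
  forall k q ts, fits w.+2 p -> val q = p :: k -> corres ts s ->
  reaches q ts k s' (2 * n).
Proof.
move=> E Ho; elim: E => {p s s' n}.
- move=> s k q ts _ vq H.
  have kL : k \in L by apply: successors_in (ssvalP q) _; rewrite [ssval q]vq /= inE.
  apply: (@reaches_step _ _ _ _ (goto (q, false) k).1 _ 1).
    by rewrite /mstep /step /= /cquery /= /cstep /= vq /= if_same.
  exists 0; eexists; eexists; split=> //; first exact: (val_goto (q, false)).
  exact: corres_nop.
- move=> r b s k q ts /= rw vq H.
  have kL : k \in L by apply: successors_in (ssvalP q) _; rewrite [ssval q]vq /= inE.
  exists 2; eexists; eexists; split=> //=.
  + by rewrite /mstep /step /= /cquery /= /cstep /= vq /= if_same /= vq /= if_same.
  + exact: (val_goto (q, true)).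
  + exact: corres_push.
- move=> p q s s1 s2 m n _ IH1 _ IH2 k st ts /= /andP[fp fq] vq H.
  have kL : [:: p, q & k] \in L by apply: successors_in (ssvalP st) _; rewrite [ssval st]vq /= inE.
  have -> : 2 * (m + n).+1 = (2 * (m + n) + 1).+1 by lia.
  apply: (@reaches_step _ _ _ _ (goto (st, false) [:: p, q & k]).1 _ (2 * (m + n) + 1)).
    by rewrite /mstep /step /= /cquery /= /cstep /= vq /= if_same.
  have -> : 2 * (m + n) + 1 = 2 * m + (2 * n).+1 by lia.
  apply: reaches_trans.
    by apply: (IH1 (q :: k)) => //; [exact: (val_goto (st, false))|exact: corres_nop].
  by move=> q1 ts1 vq1 c1; apply: (reaches_le (leqnSn _)); exact: IH2.
- move=> r a b c s s' n sr _ IH k q ts /= /and4P[rw fa fb fc] vq H.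
  have kL : a :: k \in L by apply: successors_in (ssvalP q) _; rewrite [ssval q]vq /= inE eqxx.
  have rd : tape_read (ts (inord r)) = None.
    by rewrite (represents_read (H _)) inordK // sr.
  have -> : 2 * n.+1 = (2 * n).+2 by lia.
  apply: (@reaches_step _ _ _ _ (goto (q, false) (a :: k)).1 _ (2 * n).+1).
    by rewrite /mstep /step /= /cquery /= /cstep /= vq /= if_same ffunE rd.
  apply: (reaches_le (leqnSn _)); apply: IH => //; first exact: (val_goto (q, false)).
  exact: corres_nop.
- move=> r a b c x y s s' n sr _ IH k q ts /= /and4P[rw fa fb fc] vq H.
  have kL : (if x then b else c) :: k \in L.
    by apply: successors_in (ssvalP q) _; rewrite [ssval q]vq /= !inE; case: (x); rewrite eqxx ?orbT.
  have rd : tape_read (ts (inord r)) = Some (inl x).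
    by rewrite (represents_read (H _)) inordK // sr.
  have -> : 2 * n.+1 = (2 * n).+2 by lia.
  apply: (@reaches_step _ _ _ _ (goto (q, false) ((if x then b else c) :: k)).1 _ (2 * n).+1).
    by rewrite /mstep /step /= /cquery /= /cstep /= vq /= if_same [X in if X is Some _ then _ else _]ffunE rd.
  apply: (reaches_le (leqnSn _)); apply: IH; [by case: (x)|exact: (val_goto (q, false))|].
  exact: corres_pop sr H.
- move=> r a b s sr k q ts /= /and3P[rw fa fb] vq H.
  have kL : k \in L by apply: successors_in (ssvalP q) _; rewrite [ssval q]vq /= inE eqxx.
  have rd : tape_read (ts (inord r)) = None.
    by rewrite (represents_read (H _)) inordK // sr.
  apply: (@reaches_step _ _ _ _ (goto (q, false) k).1 _ 1).
    by rewrite /mstep /step /= /cquery /= /cstep /= vq /= if_same ffunE rd.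
  exists 0; eexists; eexists; split=> //; first exact: (val_goto (q, false)).
  exact: corres_nop.
- move=> r a b x y s s1 s2 m n sr _ IH1 _ IH2 k q ts /= /and3P[rw fa fb] vq H.
  have kL : [:: (if x then a else b), Loop r a b & k] \in L.
    by apply: successors_in (ssvalP q) _; rewrite [ssval q]vq /= !inE; case: (x); rewrite eqxx ?orbT.
  have rd : tape_read (ts (inord r)) = Some (inl x).
    by rewrite (represents_read (H _)) inordK // sr.
  have -> : 2 * (m + n).+1 = (2 * m + (2 * n).+1).+1 by lia.
  apply: (@reaches_step _ _ _ _ (goto (q, false) [:: (if x then a else b), Loop r a b & k]).1 _ (2 * m + (2 * n).+1)).
    by rewrite /mstep /step /= /cquery /= /cstep /= vq /= if_same [X in if X is Some _ then _ else _]ffunE rd.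
  apply: reaches_trans.
    apply: (IH1 (Loop r a b :: k)); [by case: (x)|exact: (val_goto (q, false))|exact: corres_pop sr H].
  move=> q1 ts1 vq1 c1; apply: (reaches_le (leqnSn _)); apply: IH2 => //=.
  by rewrite rw fa fb.
- move=> f r s /Ho[oT -> ->] k q ts _ vq H.
  have kL : k \in L by apply: successors_in (ssvalP q) _; rewrite [ssval q]vq /= inE.
  apply: (@reaches_step _ _ _ _ (goto (q, false) k).1 _ 1).
    by rewrite /mstep /step /= /cquery /= vq /= oT.
  exists 0; eexists; eexists; split=> //; first exact: (val_goto (q, false)).
  move=> i /=; rewrite /upd; case: eqP => [->|ni] /=.
    by rewrite eqxx; exists 0; rewrite cats0 (represents_bits (H _)).
  case: eqP => // E; case: ni; exact: val_inj.
Qed.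

End Compile.

Lemma compiled_computes p w (ora : bool) oracle o x s n : exec o p (upd (fun=> [::]) 0 x) s n ->
  (forall r f, o = Some (r, f) -> [/\ ora, r = w.+1 & f = oracle]) -> fits w.+2 p ->
  computes_within (compiled p w ora) oracle x (s 0) (2 * n).
Proof.
move=> E Ho fp.
have [|t [q [ts [tn Et vq H]]]] := @exec_reaches p w ora oracle _ _ _ _ _ E Ho [::]
  (SeqSub (start_in p)) (fun i => if i == ord0 then tape_of_bits (compiled p w ora) x else blank_tape (compiled p w ora)) fp erefl.
  move=> i; rewrite /upd; case: eqP => [->|ni] /=; first by exists 0; rewrite cats0.
  case: eqP => [E0|_]; last by exists 0.
  by case: ni; exact: val_inj.
exists t => //; rewrite /init Et /=; split; first by rewrite vq.
exact: represents_bits (H ord0).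
Qed.

Lemma poly_bounded_poly h : poly_bounded h ->
  exists p : {poly nat}, forall n, h n <= p.[n]%R.
Proof.
move=> [c [d H]]; exists (c%:P * ('X + 1%:P) ^+ d)%R => n.
apply: leq_trans (H n) _; rewrite hornerM hornerC horner_exp hornerD hornerX hornerC.
by rewrite -[(n + 1)%R]/(n + 1)%N addn1 -natrXE.
Qed.

Lemma PF_polytime F : PF (fun=> True) F -> polytime F.
Proof.
move=> [P [h ph H]]; have [w fw] := fits_ex (P 0).
have [p Hp] := poly_bounded_poly (poly_boundedM (poly_boundedC 2) ph).
exists (compiled (P 0) w false); first by move=> q; rewrite /= /cquery.
exists p => x.
have [//||n nh E] := H 0 (upd (fun=> [::]) 0 x); first by case.
have [//||t tn C] := @compiled_computes _ w false (fun=> [::]) _ _ _ _ E.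
  by apply: fits_le fw; lia.
exists t; last by move: C; rewrite /upd /=.
by apply: leq_trans tn _; apply: leq_trans _ (Hp _); move: nh; rewrite /upd eqxx; lia.
Qed.

(** One query is enough: the word computed in register 0 goes to the oracle tape [w.+1] and the
    answer comes back. Copying the answer takes time, hence the bound on the size of [G x]. *)
Lemma polytime_turing_query (F G oracle : seq bool -> seq bool) b : PF (fun=> True) F ->
  (forall x, oracle (F x) = G x) -> poly_bounded b ->
  (forall x, size (G x) <= b (size x)) -> polytime_turing oracle G.
Proof.
move=> PFF; have [hs phs Hs] := PF_size PFF.
move: PFF => [P [h ph H]] FG pb_b Hb; have [w0 fw0] := fits_ex (P 0).
pose w := w0.+1; pose q := Seq (P 0) (Seq (transfer 0 w.+1 w) (Seq (Ask w.+1) (transfer w.+1 0 w))).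
have [p Hp] := poly_bounded_poly (poly_boundedM (poly_boundedC 2)
  (poly_boundedD (poly_boundedD ph (poly_boundedM (poly_boundedC 4) phs))
    (poly_boundedD (poly_boundedM (poly_boundedC 4) pb_b) (poly_boundedC 20)))).
exists (compiled q w true); exists p => x.
have fq : fits w.+2 q.
  rewrite /= (fits_le _ fw0) ?andbT //=; lia.
pose s y := upd (fun=> [::]) 0 y : store.
have [//||n1 nh1 E1] := H 0 (s x); first by case.
have {nh1 E1} [nh1 E1] : n1 <= h (size x) /\ exec None (P 0) (s x) (s (F x)) n1.
  split; first by move: nh1; rewrite /s /upd eqxx.
  have <- : upd (s x) 0 (F (s x 0)) = s (F x) by apply: boolp.funext; rewrite /s; store_eq.
  by [].
pose s' y := upd (fun=> [::]) w.+1 y : store.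
have [n2 nh2 E2] : runs (transfer 0 w.+1 w) (s (F x)) (s' (F x)) (4 * size (F x) + 3).
  apply: runs_eq (runs_transfer _ _ _ _) => //; try lia.
  by rewrite /s /s'; store_eq; rewrite cats0.
have [n3 nh3 E3] : runs (transfer w.+1 0 w) (s' (G x)) (s (G x)) (4 * size (G x) + 3).
  have e : s' (G x) w.+1 = G x by rewrite /s' /upd eqxx.
  rewrite -{3}e; apply: runs_eq (runs_transfer _ _ _ _) => //; try lia.
    by rewrite /s /s'; store_eq; rewrite ?cats0.
  by rewrite /s'; upd_at.
pose o := Some (w.+1, oracle).
have E : exec o q (s x) (s (G x)) (n1 + (n2 + (1 + n3).+1).+1).+1.
  apply: exec_seq (exec_oracle _ E1) (exec_seq (exec_oracle _ E2) (exec_seq _ (exec_oracle _ E3))).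
  have -> : s' (G x) = upd (s' (F x)) w.+1 (oracle (s' (F x) w.+1)).
    by apply: boolp.funext; rewrite /s' -FG; store_eq.
  by constructor.
have [||t tn C] := @compiled_computes _ w true oracle _ _ _ _ E; [by move=> r f [-> ->]|by []|].
exists t; last by move: C; rewrite /s /upd /=.
apply: leq_trans tn _; apply: leq_trans _ (Hp _).
have := Hs x I; have := Hb x; lia.
Qed.

(** * Polynomial-time functions on encoded data *)

Inductive tree := Leaf | Node of tree & tree.

Fixpoint code t : seq bool :=
  if t is Node a b then true :: code a ++ code b else [:: false].

Lemma scan_code n t w : scan n.+1 (code t ++ w) =
  (code t ++ (scan n w).1, (scan n w).2).
Proof.
elim: t n w => [|a IHa b IHb] n w /=; first by case: (scan n w).
by rewrite -catA IHa IHb /= catA.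
Qed.

Lemma scan1_code t w : scan 1 (code t ++ w) = (code t, w).
Proof. by rewrite scan_code; case: w => [|? ?] /=; rewrite cats0. Qed.

Lemma code_inj : injective code.
Proof.
suff H: forall t t' w w', code t ++ w = code t' ++ w' -> t = t'.
  by move=> t t' e; apply: (H t t' [::] [::]); rewrite e.
elim=> [|a IHa b IHb] [|a' b'] w w' //= [].
rewrite -!catA => e; rewrite (IHa _ _ _ e); congr Node.
have /(congr1 snd) := congr1 (scan 1) e; rewrite !scan1_code /=; exact: IHb.
Qed.

(** All data become binary trees, so that a nonempty list has the code of the pair of its head and
    its tail, and a number, in unary, the code of a list of units. [ptime_recode] turns such
    coincidences into functions that cost nothing. *)
Structure encType := EncType {enc_sort :> Type; encode : enc_sort -> tree}.
Arguments encode {e}.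
Canonical unit_encType := EncType (fun _ : unit => Leaf).
Canonical bool_encType := EncType (fun b : bool => if b then Node Leaf Leaf else Leaf).
Canonical nat_encType := EncType (fun n : nat => iter n (Node Leaf) Leaf).
Canonical prod_encType (A B : encType) :=
  EncType (fun p : A * B => Node (encode p.1) (encode p.2)).
Canonical seq_encType (A : encType) :=
  EncType (foldr (fun a : A => Node (encode a)) Leaf).

Definition cod (A : encType) (a : A) : seq bool := code (encode a).
Definition csize (A : encType) (a : A) : nat := size (cod a).

(** The word function [F] has to behave only on codes of elements of [A]; validity of an input is
    never tested. *)
Definition ptime (A B : encType) (f : A -> B) : Prop :=
  exists2 F, PF (fun w => exists a : A, w = cod a) F & forall a, F (cod a) = cod (f a).

Definition pgrowth (A B : encType) (f : A -> B) : Prop :=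
  exists h, [/\ poly_bounded h, {homo h : m n / m <= n} & forall a, csize (f a) <= h (csize a)].

Section Ptime.
Variables (A B C : encType).

Lemma ptime_growth (f : A -> B) : ptime f -> pgrowth f.
Proof.
move=> [F /PF_size[h ph Hh] FE]; have [g [pg mono hg]] := poly_bounded_mono ph.
exists g; split=> // a; rewrite /csize -FE.
by apply: leq_trans (hg _); apply: Hh; exists a.
Qed.

Lemma ptime_ext (f g : A -> B) : f =1 g -> ptime f -> ptime g.
Proof. by move=> fg [F PF_F FE]; exists F => // a; rewrite FE fg. Qed.

Lemma ptime_recode (f : A -> B) (g : A -> C) :
  (forall a, encode (f a) = encode (g a)) -> ptime f -> ptime g.
Proof. by move=> fg [F PF_F FE]; exists F => // a; rewrite FE /cod fg. Qed.

Lemma ptime_recode_id (f : A -> B) : (forall a, encode (f a) = encode a) -> ptime f.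
Proof.
move=> fE; exists id; last by move=> a; rewrite /cod fE.
exists (fun=> Skip), (fun=> 1); first exact: poly_boundedC.
move=> k s _ _; apply: (@runs_eq _ _ s); last by exists 1 => //; constructor.
by store_eq.
Qed.

Lemma ptime_comp (f : A -> B) (g : B -> C) : ptime f -> ptime g -> ptime (g \o f).
Proof.
move=> [F PF_F FE] [G PF_G GE]; exists (G \o F); last by move=> a /=; rewrite FE GE.
by apply: (PF_comp _ PF_F PF_G) => _ [a ->]; exists (f a).
Qed.

Lemma ptime_const (b : B) : ptime (fun _ : A => b).
Proof. by exists (fun=> cod b) => //; exact: PF_const. Qed.

Lemma ptime_pair (f : A -> B) (g : A -> C) : ptime f -> ptime g ->
  ptime (fun a => (f a, g a)).
Proof.
move=> [F PF_F FE] [G PF_G GE]; exists (fun w => true :: (F w ++ G w)); last first.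
  by move=> a; rewrite FE GE.
have := PF_comp (D' := fun=> True) _ (PF_cat PF_F PF_G) (PF_cons _ true).
by apply.
Qed.

Lemma ptime_if (c : A -> bool) (f g : A -> B) : ptime c -> ptime f -> ptime g ->
  ptime (fun a => if c a then f a else g a).
Proof.
move=> [F PF_F FE] [G PF_G GE] [K PF_K KE].
exists (fun w => if head false (F w) then G w else K w); first exact: PF_if.
by move=> a; rewrite FE GE KE; case: (c a).
Qed.

Lemma ptime_list_case (l : A -> seq B) (f : A * (B * seq B) -> C) (g : A -> C) :
  ptime l -> ptime f -> ptime g ->
  ptime (fun a => if l a is x :: r then f (a, (x, r)) else g a).
Proof.
move=> [F PF_F FE] [G PF_G GE] [K PF_K KE].
(* A nonempty list has a code beginning with 1, and prefixing [true] to [w ++ F w] gives the code of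
   [(a, l a)], which is also that of [(a, (x, r))]. *)
exists (fun w => if head false (F w) then G (true :: w ++ F w) else K w); last first.
  move=> a; rewrite FE KE; case: (l a) => [|x r] //=.
  by rewrite -GE.
pose G' w := if head false (F w) then G (true :: w ++ F w) else K w.
have PF_id (D : seq bool -> Prop) : PF D id.
  exists (fun=> Skip), (fun=> 1); first exact: poly_boundedC.
  move=> k s _ _; apply: (@runs_eq _ _ s); last by exists 1 => //; constructor.
  by store_eq.
(* Outside of the domain of [G] a code is replaced by that of a fixed element. *)
case: (pselect (exists a, l a <> [::])) => [[a0 l0]|none]; last first.
  apply: PF_ext PF_K => w [a ->]; rewrite FE.
  by case E: (l a) => [|x r] //; case: none; exists a; rewrite E.
case El0: (l a0) l0 => [//|x0 r0] _.
have P1 : PF (fun w => exists a : A, w = cod a) (fun w => true :: (w ++ F w)).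
  have := PF_comp (D' := fun=> True) _ (PF_cat (PF_id _) PF_F) (PF_cons _ true).
  by apply.
have P2 : PF (fun w => exists a : A, w = cod a)
   (fun w => if head false (F w) then true :: w ++ F w else cod (a0, (x0, r0))).
  exact: PF_if PF_F P1 (PF_const _ _).
have P3 : PF (fun w => exists a : A, w = cod a)
   (fun w => G (if head false (F w) then true :: w ++ F w else cod (a0, (x0, r0)))).
  apply: (PF_comp _ P2 PF_G) => _ [a ->]; rewrite FE.
  by case: (l a) => [|x r] /=; [exists (a0, (x0, r0))|exists (a, (x, r))].
apply: PF_ext (PF_if PF_F P3 PF_K) => w _.
by case: ifP => // ->.
Qed.

End Ptime.

Section Projections.
Variables (A B : encType).

Lemma ptime_fst : ptime (@fst A B).
Proof.
exists (fun w => (scan 1 (behead w)).1).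
  by apply: (PF_comp (D' := fun=> True) _ (PF_behead _) (PF_scan1 _)).
by move=> [a b]; rewrite /cod /= scan1_code.
Qed.

Lemma ptime_snd : ptime (@snd A B).
Proof.
exists (fun w => (scan 1 (behead w)).2).
  by apply: (PF_comp (D' := fun=> True) _ (PF_behead _) (PF_scan2 _)).
by move=> [a b]; rewrite /cod /= scan1_code.
Qed.

Lemma ptime_cons : ptime (fun p : A * seq A => p.1 :: p.2).
Proof. exact: ptime_recode_id. Qed.

Lemma ptime_id : ptime (@id A).
Proof. exact: ptime_recode_id. Qed.

End Projections.
Arguments ptime_fst {A B}.
Arguments ptime_snd {A B}.
Arguments ptime_cons {A}.
Arguments ptime_id {A}.
Arguments ptime_const {A B} b.

Lemma ptime_eq (A : encType) : injective (@encode A) ->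
  ptime (fun p : A * A => `[< p.1 = p.2 >]).
Proof.
move=> inj; exists (fun w => if head false (eq_codes w) then cod true else cod false).
  exact: PF_if (PF_eq_codes _) (PF_const _ _) (PF_const _ _).
move=> [a b]; rewrite /eq_codes {1 2}/cod /= scan1_code /=.
by case: eqP => [/code_inj/inj ->|ne]; case: asboolP => // e; case: ne; rewrite e.
Qed.

Section Uncurried.
Variables (A B B' C X S : encType).

Lemma ptime2 (g : B -> B' -> C) (f : A -> B) (f' : A -> B') :
  ptime (fun p : B * B' => g p.1 p.2) -> ptime f -> ptime f' ->
  ptime (fun a => g (f a) (f' a)).
Proof. by move=> Pg Pf Pf'; exact: (ptime_comp (ptime_pair Pf Pf') Pg). Qed.

Lemma ptime1 (g : B -> C) (f : A -> B) : ptime g -> ptime f -> ptime (fun a => g (f a)).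
Proof. by move=> Pg Pf; exact: ptime_comp Pf Pg. Qed.

Lemma ptime3 (g : B -> B' -> C -> S) (f : A -> B) (f' : A -> B') (h : A -> C) :
  ptime (fun p : B * B' * C => g p.1.1 p.1.2 p.2) -> ptime f -> ptime f' -> ptime h ->
  ptime (fun a => g (f a) (f' a) (h a)).
Proof.
move=> Pg Pf Pf' Ph; exact: (ptime_comp (ptime_pair (ptime_pair Pf Pf') Ph) Pg).
Qed.

End Uncurried.

Lemma csize_gt0 (A : encType) (a : A) : 0 < csize a.
Proof. by rewrite /csize /cod; case: (encode a). Qed.

Lemma csize_pair (A B : encType) (a : A) (b : B) :
  csize (a, b) = (csize a + csize b).+1.
Proof. by rewrite /csize /cod /= size_cat. Qed.

Lemma csize_cons (A : encType) (a : A) l : csize (a :: l) = (csize a + csize l).+1.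
Proof. by rewrite /csize /cod /= size_cat. Qed.

Lemma csize_nil (A : encType) : csize ([::] : seq A) = 1.
Proof. by []. Qed.

Lemma csize_bool (b : bool) : csize b <= 3.
Proof. by case: b. Qed.

Lemma csize_nat (n : nat) : csize n = n.*2.+1.
Proof. by rewrite /csize /cod; elim: n => //= n ->; rewrite doubleS. Qed.

Lemma csize_cat (A : encType) (l l' : seq A) : (csize (l ++ l')).+1 = csize l + csize l'.
Proof. by elim: l => [|a l IH]; rewrite ?csize_nil //= !csize_cons; lia. Qed.

Lemma size_le_csize (A : encType) (l : seq A) : size l < csize l.
Proof. by elim: l => //= a l IH; rewrite csize_cons; have := csize_gt0 a; lia. Qed.

Lemma csize_drop (A : encType) i (l : seq A) : csize (drop i l) <= csize l.
Proof. by have := csize_cat (take i l) (drop i l); rewrite cat_take_drop; have := csize_gt0 (take i l); lia. Qed.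

Lemma csize_take (A : encType) i (l : seq A) : csize (take i l) <= csize l.
Proof. by have := csize_cat (take i l) (drop i l); rewrite cat_take_drop; have := csize_gt0 (drop i l); lia. Qed.

Lemma csize_rev (A : encType) (l : seq A) : csize (rev l) = csize l.
Proof.
elim: l => // a l IH; rewrite rev_cons -cats1; have := csize_cat (rev l) [:: a].
by rewrite !csize_cons IH csize_nil; lia.
Qed.

Lemma csize_map (X Y : encType) (f : X -> Y) l m :
  (forall x, csize x <= csize l -> csize (f x) <= m) -> csize (map f l) <= (csize l) * m.+1.
Proof.
move=> Hm; suff: csize (map f l) <= (size l) * m.+1 + 1.
  have := size_le_csize l; nia.
move E: (csize l) Hm => c Hm; have {E} lc : csize l <= c by rewrite E.
elim: l lc => // x l IH; rewrite csize_cons => lc /=.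
rewrite csize_cons mulSn; have := Hm x; have /IH : csize l <= c by lia.
lia.
Qed.

Section Fold.
Variables (A X S : encType).

Lemma ptime_foldl (f : A -> S -> X -> S) (z : A -> S) (l : A -> seq X) b :
  ptime (fun p : A * S * X => f p.1.1 p.1.2 p.2) -> ptime z -> ptime l ->
  poly_bounded b ->
  (forall a i, csize (foldl (f a) (z a) (take i (l a))) <= b (csize a)) ->
  ptime (fun a => foldl (f a) (z a) (l a)).
Proof.
move=> Pf Pz Pl pb_b Hb.
pose step (q : A * (S * seq X)) : A * (S * seq X) :=
  if q.2.2 is x :: r then (q.1, (f q.1 q.2.1 x, r)) else q.
have Pstep : ptime step.
  have P1 : ptime (fun q : A * (S * seq X) => q.2.2).
    exact: ptime1 ptime_snd ptime_snd.
  apply: (ptime_list_case (f := fun t : (A * (S * seq X)) * (X * seq X) =>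
     (t.1.1, (f t.1.1 t.1.2.1 t.2.1, t.2.2))) P1); last exact: ptime_id.
  have Q1 : ptime (fun t : (A * (S * seq X)) * (X * seq X) => t.1.1).
    exact: ptime1 ptime_fst ptime_fst.
  apply: ptime_pair => //; apply: ptime_pair; last exact: ptime1 ptime_snd ptime_snd.
  apply: (ptime3 Pf) => //; first exact: ptime1 ptime_fst (ptime1 ptime_snd ptime_fst).
  exact: ptime1 ptime_fst ptime_snd.
have iterE i a s r : iter i step (a, (s, r)) =
    (a, iter i (fun p : S * seq X => if p.2 is x :: r then (f a p.1 x, r) else p) (s, r)).
  by elim: i => //= i ->; rewrite /step /=; case: (iter _ _ _) => s' [|x r'].
have iterE2 i a s (r : seq X) :
    iter i (fun p : S * seq X => if p.2 is x :: r then (f a p.1 x, r) else p) (s, r) =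
    (foldl (f a) s (take i r), drop i r).
  by elim: i s r => [|i IH] s [|x r]; rewrite ?iterSr //= IH.
have Pst : ptime (fun a => (a, (z a, l a))).
  by apply: ptime_pair; [exact: ptime_id|exact: ptime_pair].
have [hl [phl _ Hl]] := ptime_growth Pl.
(* The code of a list is longer than the list, so [csize (l a)] rounds are enough; once the list is
   exhausted [step] is the identity. *)
suff K : ptime (fun a => iter (csize (l a)) step (a, (z a, l a))).
  have := ptime1 ptime_fst (ptime1 ptime_snd K).
  apply: ptime_ext => a; rewrite iterE iterE2 /= take_oversize //.
  by apply: ltnW; exact: size_le_csize.
move: Pl Pst Pstep => [F PF_F FE] [Z PF_Z ZE] [G PF_G GE].
exists (fun w => iter (size (F w)) G (Z w)); last first.
  move=> a; rewrite FE ZE /csize; elim: size => // i IH.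
  by rewrite !iterS IH GE.
pose bd n := n + b n + hl n + 2.
apply: (PF_iter PF_F PF_Z PF_G (b := bd)); first by rewrite /bd; pb.
move=> _ i [a ->] _; rewrite ZE.
have -> : iter i G (cod (a, (z a, l a))) = cod (iter i step (a, (z a, l a))).
  by elim: i => // i IH; rewrite !iterS IH GE.
split; first by eexists.
rewrite iterE iterE2 -/(csize _) !csize_pair -/(csize a) /bd.
have := Hb a i; have := csize_drop i (l a); have := Hl a; lia.
Qed.

End Fold.

Section Lists0.
Variable X : encType.

Lemma foldl_cons_rev (s l : seq X) : foldl (fun s x => x :: s) s l = rev l ++ s.
Proof. by elim: l s => //= x l IH s; rewrite IH rev_cons cat_rcons. Qed.

Lemma ptime_rev : ptime (@rev X).
Proof.
apply: (ptime_ext (f := foldl (fun s x => x :: s) [::])).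
  by move=> l; rewrite foldl_cons_rev cats0.
apply: (ptime_foldl (f := fun _ s x => x :: s) (z := fun=> [::]) (l := id) (b := id)).
- exact: ptime2 ptime_cons ptime_snd (ptime1 ptime_snd ptime_fst).
- exact: ptime_const.
- exact: ptime_id.
- exact: poly_bounded_id.
- by move=> l i; rewrite foldl_cons_rev cats0 csize_rev csize_take.
Qed.

Lemma ptime_cat : ptime (fun p : seq X * seq X => p.1 ++ p.2).
Proof.
apply: (ptime_ext (f := fun p => foldl (fun s x => x :: s) p.2 (rev p.1))).
  by move=> p; rewrite foldl_cons_rev revK.
apply: (ptime_foldl (f := fun _ s x => x :: s) (b := id)).
- exact: ptime2 ptime_cons ptime_snd (ptime1 ptime_snd ptime_fst).
- exact: ptime_snd.
- exact: ptime1 ptime_rev ptime_fst.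
- exact: poly_bounded_id.
- move=> [l l'] i /=; rewrite foldl_cons_rev csize_pair.
  have := csize_cat (rev (take i (rev l))) l'.
  by rewrite csize_rev; have := csize_take i (rev l); rewrite csize_rev; lia.
Qed.

End Lists0.
Arguments ptime_rev {X}.
Arguments ptime_cat {X}.

Section Lists.
Variables (A X Y : encType).

Lemma foldl_map_rev (f : X -> Y) s (l : seq X) :
  foldl (fun s x => f x :: s) s l = rev (map f l) ++ s.
Proof. by elim: l s => //= x l IH s; rewrite IH rev_cons cat_rcons. Qed.

Lemma ptime_map (f : A -> X -> Y) (l : A -> seq X) :
  ptime (fun p : A * X => f p.1 p.2) -> ptime l -> ptime (fun a => map (f a) (l a)).
Proof.
move=> Pf Pl; have [hf [phf mf Hf]] := ptime_growth Pf; have [hl [phl ml Hl]] := ptime_growth Pl.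
apply: (ptime_ext (f := fun a => rev (foldl (fun s x => f a x :: s) [::] (l a)))).
  by move=> a; rewrite foldl_map_rev cats0 revK.
apply: (ptime1 ptime_rev).
apply: (ptime_foldl (f := fun a s x => f a x :: s) (b := fun n => hl n * (1 + hf (n + hl n + 1)))).
- apply: (ptime2 ptime_cons); last exact: ptime1 ptime_snd ptime_fst.
  exact: ptime2 Pf (ptime1 ptime_fst ptime_fst) ptime_snd.
- exact: ptime_const.
- exact: Pl.
- by pb; apply: poly_bounded_comp => //; pb.
- move=> a i; rewrite foldl_map_rev cats0 csize_rev.
  apply: leq_trans (csize_map (m := hf (csize a + hl (csize a) + 1)) _) _.
    move=> x xl; apply: leq_trans (Hf (a, x)) _; apply: mf; rewrite csize_pair.
    by have := csize_take i (l a); have := Hl a; lia.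
  by rewrite add1n leq_mul2r; apply/orP; right; apply: leq_trans (csize_take _ _) (Hl _).
Qed.

End Lists.

Section Flatten.
Variables (A X : encType).

Lemma ptime_flatten : ptime (@flatten X).
Proof.
apply: (ptime_ext (f := fun ll => foldl (fun s l => l ++ s) [::] (rev ll))).
  move=> ll; rewrite -[ll in RHS]revK; elim/last_ind: (rev ll) => // s l IH.
  by rewrite -cats1 foldl_cat /= IH rev_cat /=.
apply: (ptime_foldl (f := fun _ s l => l ++ s) (z := fun=> [::]) (b := id)).
- exact: ptime2 ptime_cat ptime_snd (ptime1 ptime_snd ptime_fst).
- exact: ptime_const.
- exact: ptime_rev.
- exact: poly_bounded_id.
- move=> ll i; apply: leq_trans (_ : csize (take i (rev ll)) <= _); last first.
    by apply: leq_trans (csize_take _ _) _; rewrite csize_rev.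
  elim/last_ind: (take i (rev ll)) => // s l IH.
  rewrite -cats1 foldl_cat /=; move: (foldl _ _ _) IH => F IH; have := csize_cat s [:: l].
  by rewrite csize_cons csize_nil; have := csize_cat l F; move: IH; rewrite /=; lia.
Qed.

End Flatten.
Arguments ptime_flatten {X}.

Section Bool.
Variables (A X : encType).

Lemma ptime_foldb (f : A -> bool -> X -> bool) (z : A -> bool) (l : A -> seq X) :
  ptime (fun p : A * bool * X => f p.1.1 p.1.2 p.2) -> ptime z -> ptime l ->
  ptime (fun a => foldl (f a) (z a) (l a)).
Proof.
move=> Pf Pz Pl; apply: (ptime_foldl (b := fun=> 3) Pf Pz Pl); first exact: poly_boundedC.
by move=> a i; exact: csize_bool.
Qed.

Lemma ptime_negb : ptime negb.
Proof.
apply: (ptime_ext (f := fun b : bool => if b then false else true)); first by case.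
exact: ptime_if ptime_id (ptime_const _) (ptime_const _).
Qed.

Lemma ptime_and : ptime (fun p : bool * bool => p.1 && p.2).
Proof.
apply: (ptime_ext (f := fun p : bool * bool => if p.1 then p.2 else false)); first by case=> -[].
exact: ptime_if ptime_fst ptime_snd (ptime_const _).
Qed.

Lemma ptime_or : ptime (fun p : bool * bool => p.1 || p.2).
Proof.
apply: (ptime_ext (f := fun p : bool * bool => if p.1 then true else p.2)); first by case=> -[].
exact: ptime_if ptime_fst (ptime_const _) ptime_snd.
Qed.

Lemma ptime_all (f : A -> X -> bool) (l : A -> seq X) :
  ptime (fun p : A * X => f p.1 p.2) -> ptime l -> ptime (fun a => all (f a) (l a)).
Proof.
move=> Pf Pl; apply: (ptime_ext (f := fun a => foldl (fun s x => s && f a x) true (l a))).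
  move=> a; rewrite -[RHS]andTb; elim: (l a) true => [|x r IH] b /=; first by rewrite andbT.
  by rewrite IH andbA.
apply: (ptime_foldb (f := fun a s x => s && f a x)) => //; last exact: ptime_const.
apply: (ptime2 ptime_and); first exact: ptime1 ptime_snd ptime_fst.
exact: ptime2 Pf (ptime1 ptime_fst ptime_fst) ptime_snd.
Qed.

Lemma ptime_has (f : A -> X -> bool) (l : A -> seq X) :
  ptime (fun p : A * X => f p.1 p.2) -> ptime l -> ptime (fun a => has (f a) (l a)).
Proof.
move=> Pf Pl; apply: (ptime_ext (f := fun a => ~~ all (fun x => ~~ f a x) (l a))).
  by move=> a; rewrite -has_predC; apply: eq_has => x /=; rewrite negbK.
apply: (ptime1 ptime_negb); apply: ptime_all => //.
exact: ptime1 ptime_negb Pf.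
Qed.

Lemma ptime_filter (f : A -> X -> bool) (l : A -> seq X) :
  ptime (fun p : A * X => f p.1 p.2) -> ptime l -> ptime (fun a => [seq x <- l a | f a x]).
Proof.
move=> Pf Pl; have [hl [phl ml Hl]] := ptime_growth Pl.
apply: (ptime_ext (f := fun a => rev (foldl (fun s x => if f a x then x :: s else s) [::] (l a)))).
  move=> a; rewrite -[RHS]revK; congr rev; rewrite -[RHS]cats0.
  by elim: (l a) [::] => //= x r IH s; rewrite IH; case: ifP; rewrite // rev_cons cat_rcons.
apply: (ptime1 ptime_rev).
apply: (ptime_foldl (f := fun a s x => if f a x then x :: s else s) (b := hl)) => //.
- apply: ptime_if.
  + exact: ptime2 Pf (ptime1 ptime_fst ptime_fst) ptime_snd.
  + exact: ptime2 ptime_cons ptime_snd (ptime1 ptime_snd ptime_fst).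
  + exact: ptime1 ptime_snd ptime_fst.
- exact: ptime_const.
- move=> a i; apply: leq_trans (leq_trans (csize_take i (l a)) (Hl a)).
  elim/last_ind: (take i (l a)) => // s x IH.
  rewrite -cats1 foldl_cat /=; move: (foldl _ _ _) IH => F IH.
  have := csize_cat s [:: x]; rewrite csize_cons csize_nil => e.
  by case: ifP => _; rewrite ?csize_cons /=; move: IH e; rewrite /=; lia.
Qed.

Lemma ptime_behead : ptime (@behead X).
Proof.
apply: (ptime_ext (f := fun l : seq X => if l is x :: r then r else [::])); first by case.
apply: (ptime_list_case (l := id) (f := fun t : seq X * (X * seq X) => t.2.2)).
- exact: ptime_id.
- exact: ptime1 ptime_snd ptime_snd.
- exact: ptime_const.
Qed.

Lemma ptime_head (x0 : X) : ptime (head x0).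
Proof.
apply: (ptime_ext (f := fun l : seq X => if l is x :: r then x else x0)); first by case.
apply: (ptime_list_case (l := id) (f := fun t : seq X * (X * seq X) => t.2.1)).
- exact: ptime_id.
- exact: ptime1 ptime_fst ptime_snd.
- exact: ptime_const.
Qed.

End Bool.
Arguments ptime_behead {X}.
Arguments ptime_head {X} x0.

Lemma encode_nseq n : encode (nseq n tt) = encode n.
Proof. by elim: n => //= n ->. Qed.

Lemma ptime_unary : ptime (fun n => nseq n tt).
Proof. by apply: ptime_recode_id => n; rewrite encode_nseq. Qed.

Section Nat.
Variables (A X S : encType).

Lemma ptime_iter (f : A -> S -> S) (n : A -> nat) (z : A -> S) b :
  ptime (fun p : A * S => f p.1 p.2) -> ptime n -> ptime z -> poly_bounded b ->
  (forall a i, i <= n a -> csize (iter i (f a) (z a)) <= b (csize a)) ->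
  ptime (fun a => iter (n a) (f a) (z a)).
Proof.
move=> Pf Pn Pz pb_b Hb.
have E a i s : foldl (fun s _ => f a s) s (nseq i tt) = iter i (f a) s.
  by elim: i s => // i IH s; rewrite iterSr /= IH.
apply: (ptime_ext (f := fun a => foldl (fun s _ => f a s) (z a) (nseq (n a) tt))).
  by move=> a; rewrite E.
apply: (ptime_foldl (f := fun a s _ => f a s) (b := b)) => //.
- exact: ptime1 Pf ptime_fst.
- exact: ptime1 ptime_unary Pn.
- move=> a i; case: (leqP i (n a)) => ni.
    by rewrite take_nseq // E; exact: Hb.
  by rewrite take_oversize ?E ?Hb // size_nseq ltnW.
Qed.

Lemma ptime_size : ptime (@size X).
Proof.
have : ptime (fun l : seq X => map (fun=> tt) l).
  by apply: (ptime_map (f := fun _ _ => tt)); [exact: ptime_const|exact: ptime_id].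
apply: ptime_recode => l; rewrite -encode_nseq; congr encode.
by elim: l => //= x l ->.
Qed.

End Nat.
Arguments ptime_size {X}.

Section Nat2.
Variables X S : encType.

Lemma ptime_nseq : ptime (fun p : nat * X => nseq p.1 p.2).
Proof.
apply: (ptime_ext (f := fun p : nat * X => map (fun=> p.2) (nseq p.1 tt))).
  by case=> n x; rewrite map_nseq.
apply: (ptime_map (f := fun (p : nat * X) _ => p.2)); first exact: ptime1 ptime_snd ptime_fst.
exact: ptime1 ptime_unary ptime_fst.
Qed.

Lemma ptime_succ : ptime succn.
Proof.
apply: (ptime_recode (f := fun n => tt :: nseq n tt)); first by move=> n; rewrite -encode_nseq.
exact: ptime2 ptime_cons (ptime_const _) ptime_unary.
Qed.

Lemma ptime_pred : ptime predn.
Proof.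
apply: (ptime_recode (f := fun n => behead (nseq n tt))).
  by case=> [|n] //=; rewrite encode_nseq.
exact: ptime1 ptime_behead ptime_unary.
Qed.

Lemma ptime_add : ptime (fun p : nat * nat => p.1 + p.2).
Proof.
have : ptime (fun p : nat * nat => nseq p.1 tt ++ nseq p.2 tt).
  apply: (ptime2 ptime_cat); [exact: ptime1 ptime_unary ptime_fst|exact: ptime1 ptime_unary ptime_snd].
by apply: ptime_recode => -[m n]; rewrite -nseqD; exact: encode_nseq.
Qed.

Lemma ptime_mul : ptime (fun p : nat * nat => p.1 * p.2).
Proof.
have : ptime (fun p : nat * nat => flatten (nseq p.1 (nseq p.2 tt))).
  apply: (ptime1 ptime_flatten); apply: (ptime_ext (f := fun p : nat * nat =>
    map (fun=> nseq p.2 tt) (nseq p.1 tt))); first by case=> m n; rewrite map_nseq.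
  apply: (ptime_map (f := fun (p : nat * nat) _ => nseq p.2 tt)).
    exact: ptime1 ptime_unary (ptime1 ptime_snd ptime_fst).
  exact: ptime1 ptime_unary ptime_fst.
apply: ptime_recode => -[m n]; rewrite -[RHS]encode_nseq; congr encode.
by elim: m => //= m ->; rewrite mulSn nseqD.
Qed.

Lemma ptime_drop : ptime (fun p : nat * seq X => drop p.1 p.2).
Proof.
apply: (ptime_ext (f := fun p : nat * seq X => iter p.1 behead p.2)).
  case=> n l /=; elim: n l => [|n IH] l; first by rewrite drop0.
  by rewrite iterSr IH; case: l.
apply: (ptime_iter (f := fun _ => behead) (b := id)).
- exact: ptime1 ptime_behead ptime_snd.
- exact: ptime_fst.
- exact: ptime_snd.
- exact: poly_bounded_id.
- move=> [n l] i _; rewrite csize_pair /=.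
  have: csize (iter i behead l) <= csize l.
    elim: i => //= i IH; apply: leq_trans _ IH.
    by case: (iter i behead l) => // x r; rewrite csize_cons /=; lia.
  lia.
Qed.

Lemma ptime_sub : ptime (fun p : nat * nat => p.1 - p.2).
Proof.
apply: (ptime_ext (f := fun p : nat * nat => iter p.2 predn p.1)).
  by case=> m n /=; elim: n => [|n IH] /=; rewrite ?subn0 // IH subnS.
apply: (ptime_iter (f := fun _ => predn) (b := id)).
- exact: ptime1 ptime_pred ptime_snd.
- exact: ptime_snd.
- exact: ptime_fst.
- exact: poly_bounded_id.
- move=> [m n] i _; rewrite csize_pair /= !csize_nat.
  have: iter i predn m <= m by elim: i => //= i IH; lia.
  lia.
Qed.

Lemma encode_nat_inj : injective (@encode nat_encType).
Proof. by elim=> [|m IH] [|n] //= [] /IH ->. Qed.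

Lemma ptime_eqn : ptime (fun p : nat * nat => p.1 == p.2).
Proof.
apply: ptime_ext (ptime_eq encode_nat_inj) => p.
by apply/asboolP/eqP.
Qed.

Lemma ptime_leq : ptime (fun p : nat * nat => p.1 <= p.2).
Proof. exact: ptime2 ptime_eqn ptime_sub (ptime_const 0). Qed.

Lemma ptime_iota : ptime (fun p : nat * nat => iota p.1 p.2).
Proof.
apply: (ptime_ext (f := fun p : nat * nat =>
   rev (iter p.2 (fun s => (p.1 + size s) :: s) [::]))).
  case=> m n /=; rewrite -[RHS]revK; congr rev.
  elim: n => // n IH; rewrite iterS IH -[in RHS]addn1 iotaD rev_cat /=.
  by rewrite size_rev size_iota.
apply: (ptime1 ptime_rev).
apply: (ptime_iter (f := fun (p : nat * nat) s => (p.1 + size s) :: s)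
   (b := fun n => n * (4 * n + 4) + 1)).
- apply: (ptime2 ptime_cons _ ptime_snd); apply: (ptime2 ptime_add).
    exact: ptime1 ptime_fst ptime_fst.
  exact: ptime1 ptime_size ptime_snd.
- exact: ptime_snd.
- exact: ptime_const.
- by pb.
- move=> [m n] i /= ni; rewrite csize_pair.
  have [szi ci] : size (iter i (fun s => m + size s :: s) [::]) = i /\
     csize (iter i (fun s => m + size s :: s) [::]) <= i * (m + i).*2.+2 + 1.
    elim: i ni => // i IH ni; have [|si IH'] := IH; first by lia.
    split; rewrite iterS /= ?si // csize_cons csize_nat; nia.
  apply: leq_trans ci _; rewrite !csize_nat leq_add2r leq_mul //; lia.
Qed.

Lemma ptime_zip : ptime (fun p : seq X * seq S => zip p.1 p.2).
Proof.
apply: (ptime_ext (f := fun p : seq X * seq S => rev (foldl (fun (q : seq S * seq (X * S)) x =>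
    if q.1 is y :: r then (r, (x, y) :: q.2) else q) (p.2, [::]) p.1).2)).
  case=> l l' /=; rewrite -[RHS]revK; congr rev; rewrite -[RHS]cats0.
  elim: l l' [::] => [|x l IH] [|y l'] acc //=.
    by elim: l {IH}.
  by rewrite IH rev_cons cat_rcons.
apply: (ptime1 ptime_rev); apply: (ptime1 ptime_snd).
apply: (ptime_foldl (f := fun _ (q : seq S * seq (X * S)) x =>
    if q.1 is y :: r then (r, (x, y) :: q.2) else q) (b := fun n => 2 * n + 4)).
- apply: (ptime_list_case (l := fun p : (seq X * seq S) * (seq S * seq (X * S)) * X => p.1.2.1)
   (f := fun t : ((seq X * seq S) * (seq S * seq (X * S)) * X) * (S * seq S) =>
     (t.2.2, (t.1.2, t.2.1) :: t.1.1.2.2))).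
  + exact: ptime1 ptime_fst (ptime1 ptime_snd ptime_fst).
  + apply: ptime_pair; first exact: ptime1 ptime_snd ptime_snd.
    apply: (ptime2 ptime_cons).
      apply: ptime_pair; [exact: ptime1 ptime_snd ptime_fst|exact: ptime1 ptime_fst ptime_snd].
    exact: ptime1 ptime_snd (ptime1 ptime_snd (ptime1 ptime_fst ptime_fst)).
  + exact: ptime1 ptime_snd ptime_fst.
- by apply: ptime_pair; [exact: ptime_snd|exact: ptime_const].
- exact: ptime_fst.
- by pb.
- move=> [l l'] i /=; rewrite csize_pair.
  suff: forall (acc : seq (X * S)), csize (foldl (fun (q : seq S * seq (X * S)) x =>
    if q.1 is y :: r then (r, (x, y) :: q.2) else q) (l', acc) (take i l)) <=
     2 * (csize (take i l) + csize l') + csize acc.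
    by move=> /(_ [::]) K; apply: leq_trans K _; rewrite csize_nil; have := csize_take i l; lia.
  elim: (take i l) l' => [|x r IH] [|y l'] acc /=.
  + by rewrite csize_pair csize_nil; lia.
  + by rewrite csize_pair csize_nil; lia.
  + have -> : foldl (fun (q : seq S * seq (X * S)) x =>
      if q.1 is y :: r then (r, (x, y) :: q.2) else q) ([::], acc) r = ([::], acc) by elim: r {IH}.
    by rewrite csize_pair csize_nil; lia.
  + by apply: leq_trans (IH _ _) _; rewrite !csize_cons !csize_pair; lia.
Qed.

Lemma ptime_nth (x0 : X) : ptime (fun p : seq X * nat => nth x0 p.1 p.2).
Proof.
apply: (ptime_ext (f := fun p : seq X * nat => head x0 (drop p.2 p.1))).
  by case=> l n /=; rewrite -nth0 nth_drop addn0.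
apply: (ptime1 (ptime_head x0)); exact: ptime2 ptime_drop ptime_snd ptime_fst.
Qed.

End Nat2.
Arguments ptime_nseq {X}.
Arguments ptime_drop {X}.
Arguments ptime_zip {X S}.
Arguments ptime_nth {X} x0.

Lemma encode_bool_inj : injective (@encode bool_encType).
Proof. by case=> -[]. Qed.

Lemma encode_pair_inj (A B : encType) :
  injective (@encode A) -> injective (@encode B) ->
  injective (@encode (prod_encType A B)).
Proof. by move=> ia ib [a b] [a' b'] [/ia -> /ib ->]. Qed.

Lemma encode_seq_inj (A : encType) :
  injective (@encode A) -> injective (@encode (seq_encType A)).
Proof. by move=> ia; elim=> [|a l IH] [|b l'] //= [/ia -> /IH ->]. Qed.

Lemma PF_raw_to_list : PF (fun=> True) (fun w : seq bool => cod w).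
Proof.
exists (fun k => Seq (move_reg k k.+1) (Seq (Push k false) (Loop k.+1
   (Seq (Push k false) (Seq (Push k false) (Seq (Push k true) (Push k true))))
   (Seq (Push k false) (Push k true))))), (fun n => 20 * n + 20); first by pb.
move=> k s _ s0; pose st a b := upd (upd s k a) k.+1 b.
have H1 : runs (move_reg k k.+1) s (st [::] (rev (s k))) (2 * size (s k)).+1.
  apply: runs_eq (runs_move _ _); last by lia.
  by rewrite [s k.+1]s0 // /st /rev; store_eq.
have H2 : runs (Push k false) (st [::] (rev (s k))) (st [:: false] (rev (s k))) 1.
  by apply: runs_eq (runs_push _ _ _); rewrite /st; store_eq.
have H3 a b : runs (Loop k.+1
   (Seq (Push k false) (Seq (Push k false) (Seq (Push k true) (Push k true))))
   (Seq (Push k false) (Push k true))) (st (cod a) b) (st (cod (catrev b a)) [::]) (10 * size b).+1.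
  elim: b a => [|c b IH] a.
    by apply: runs_loop; rewrite {1}/st /upd eqxx.
  rewrite (_ : (10 * size (c :: b)).+1 = (9 + (10 * size b).+1).+1); last by rewrite /=; lia.
  apply: runs_loop; rewrite {1}/st /upd eqxx.
  exists (st (cod (c :: a)) b), 9, (10 * size b).+1; split=> //.
  rewrite -!/(upd _ _ _); case: c.
    apply: runs_eq (runs_le _ (runs_seq (runs_push _ _ _) (runs_seq (runs_push _ _ _) (runs_seq (runs_push _ _ _) (runs_push _ _ _))))) => //.
    by rewrite /st; store_eq.
  apply: runs_eq (runs_le _ (runs_seq (runs_push _ _ _) (runs_push _ _ _))) => //.
  by rewrite /st; store_eq.
apply: runs_eq (runs_le _ (runs_seq H1 (runs_seq H2 (H3 [::] _)))).
  by rewrite -[catrev (rev (s k)) [::]]/(rev (rev (s k))) revK /st; store_eq; rewrite s0 //; lia.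
by rewrite size_rev; lia.
Qed.

Lemma PF_list_to_raw : exists2 F, PF (fun w => exists l : seq bool, w = cod l) F &
  forall l : seq bool, F (cod l) = l.
Proof.
pose F (w : seq bool) : seq bool := xget [::] (fun l : seq bool => w = cod l).
have FE (l : seq bool) : F (cod l) = l.
  rewrite /F; case: xgetP => [l' _ /code_inj|/(_ l)//].
  by move/(encode_seq_inj encode_bool_inj).
exists F => //.
(* Each turn of the loop pops the 1 of a list cell and then the code of a bit, which is 100 for
   [true] and 0 for [false]; the 0 of the empty list ends the work. *)
exists (fun k => Seq (Seq (transfer k k.+1 k.+2) (Loop k.+1
   (Case k.+1 Skip (Seq (Case k.+1 Skip Skip Skip) (Seq (Case k.+1 Skip Skip Skip) (Push k.+2 true)))
      (Push k.+2 false)) Skip)) (move_reg k.+2 k)), (fun n => 30 * n + 30); first by pb.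
move=> k s [l E] s0; rewrite E FE.
pose st a b c := upd (upd (upd s k a) k.+1 b) k.+2 c.
have H1 : runs (transfer k k.+1 k.+2) s (st [::] (cod l) [::]) (4 * size (cod l) + 3).
  rewrite -{2}E; apply: runs_eq (runs_transfer _ _ _ _); try lia; last by rewrite s0 //; lia.
  by rewrite [s k.+1]s0 // cats0 E /st; store_eq; rewrite s0 //; lia.
have pop b w c a : runs (Case k.+1 Skip Skip Skip) (st a (b :: w) c) (st a w c) 2.
  apply: runs_case; rewrite {1}/st {1}/upd ltn_eqF // {1}/upd eqxx; exists 1 => //.
  rewrite (_ : upd _ _ _ = st a w c); first by case: b; constructor.
  by apply/funext; rewrite /st; store_eq.
have push b w c a : runs (Push k.+2 b) (st a w c) (st a w (b :: c)) 1.
  by apply: runs_eq (runs_push _ _ _); rewrite /st; store_eq.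
have H2 (m : seq bool) c : runs (Loop k.+1
   (Case k.+1 Skip (Seq (Case k.+1 Skip Skip Skip) (Seq (Case k.+1 Skip Skip Skip) (Push k.+2 true)))
      (Push k.+2 false)) Skip) (st [::] (cod m) c) (st [::] [::] (catrev m c)) (12 * size (cod m)).+1.
  elim: m c => [|b m IH] c.
    apply: (@runs_loop _ _ _ _ _ 12); rewrite {1}/st {1}/upd ltn_eqF // {1}/upd eqxx /=.
    exists (st [::] [::] c), 1, 1; split=> //.
      exists 1 => //; rewrite (_ : upd _ _ _ = st [::] [::] c); first by constructor.
      by apply/funext; rewrite /st; store_eq.
    by apply: runs_loop; rewrite {1}/st {1}/upd ltn_eqF // {1}/upd eqxx.
  apply: (@runs_le _ _ _ (11 + (12 * size (cod m)).+1).+1).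
    rewrite -[size (cod (b :: m))]/(csize (b :: m)) csize_cons.
    have := csize_gt0 b; move: (csize b) => cb; rewrite /csize; lia.
  apply: runs_loop; rewrite {1}/st {1}/upd ltn_eqF // {1}/upd eqxx.
  have -> : cod (b :: m) = true :: cod b ++ cod m by [].
  exists (st [::] (cod m) (b :: c)), 11, (12 * size (cod m)).+1; split=> //.
  rewrite (_ : upd _ _ _ = st [::] (cod b ++ cod m) c); last first.
    by apply/funext; rewrite /st; store_eq.
  apply: (@runs_case _ _ _ _ _ _ 10); rewrite {1}/st {1}/upd ltn_eqF // {1}/upd eqxx.
  case: b => /=; set s'' := upd _ _ _.
    have -> : s'' = st [::] (false :: false :: cod m) c.
      by apply/funext; rewrite /s'' /st; store_eq.
    by apply: runs_le (runs_seq (pop _ _ _ _) (runs_seq (pop _ _ _ _) (push _ _ _ _))).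
  have -> : s'' = st [::] (cod m) c by apply/funext; rewrite /s'' /st; store_eq.
  by apply: runs_le (push _ _ _ _).
have H3 : runs (move_reg k.+2 k) (st [::] [::] (rev l)) (upd s k l) (2 * size l).+1.
  have e : st [::] [::] (rev l) k.+2 = rev l by rewrite /st; upd_at.
  have e' : st [::] [::] (rev l) k = [::] by rewrite /st; upd_at.
  rewrite -(size_rev l) -{2}e; apply: runs_eq (runs_move _ _); last by lia.
  by rewrite e e' catrevE revK cats0 /st; store_eq; rewrite s0 //; lia.
apply: runs_le (runs_seq (runs_seq H1 (H2 l [::])) H3).
have := size_le_csize l; rewrite -[size (cod l)]/(csize l); move: (csize l) => c; rewrite /=; lia.
Qed.

Lemma ptime_PF (f : seq bool -> seq bool) : ptime f -> PF (fun=> True) f.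
Proof.
move=> [F PF_F FE]; have [G PF_G GE] := PF_list_to_raw.
apply: (@PF_ext _ ((G \o F) \o (fun w => cod w))); first by move=> w _ /=; rewrite FE GE.
apply: (PF_comp _ PF_raw_to_list (PF_comp _ PF_F PF_G)); first by move=> w _; exists w.
by move=> _ [l ->]; exists (f l).
Qed.

Local Open Scope classical_set_scope.
Local Open Scope ring_scope.

(** * Gluing convex sets *)

Section EpsilonDelta.
Variable R : realType.
Implicit Types V W Z : normedModType R.

Definition cont V W (A : set V) (f : V -> W) : Prop := forall x, A x ->
  forall e : R, 0 < e -> exists2 d : R, 0 < d & forall y, A y -> `|x - y| < d -> `|f x - f y| < e.

Lemma contP V W (A : set V) (f : V -> W) : {within A, continuous f} <-> cont A f.
Proof.
rewrite (subspace_continuousP A f); split=> H x Ax.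
  move=> e e0; have /cvgrPdist_lt/(_ e e0) := H x Ax.
  rewrite near_withinE => /nbhs_ballP[d d0 Hd]; exists d => // y Ay xy.
  by apply: Hd => //; rewrite -ball_normE.
apply/cvgrPdist_lt => e e0; have [d d0 Hd] := H x Ax e e0.
rewrite near_withinE; apply/nbhs_ballP; exists d => // y; rewrite -ball_normE => xy Ay.
exact: Hd.
Qed.

Lemma cont_sub V W (A B : set V) (f : V -> W) : A `<=` B -> cont B f -> cont A f.
Proof.
move=> AB H x Ax e e0; have [d d0 Hd] := H x (AB _ Ax) e e0.
by exists d => // y Ay; apply: Hd; exact: AB.
Qed.

Lemma cont_comp V W Z (A : set V) (B : set W) (f : V -> W) (g : W -> Z) :
  (forall x, A x -> B (f x)) -> cont A f -> cont B g -> cont A (g \o f).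
Proof.
move=> AB Hf Hg x Ax e e0; have [d d0 Hd] := Hg (f x) (AB _ Ax) e e0.
have [d' d0' Hd'] := Hf x Ax d d0; exists d' => // y Ay xy.
by apply: Hd; [exact: AB|exact: Hd'].
Qed.

Lemma cont_eq V W (A : set V) (f g : V -> W) : (forall x, A x -> f x = g x) ->
  cont A f -> cont A g.
Proof.
move=> fg H x Ax e e0; have [d d0 Hd] := H x Ax e e0.
by exists d => // y Ay; rewrite -!fg //; exact: Hd.
Qed.

Lemma cont_cst V W (A : set V) (c : W) : cont A (fun=> c).
Proof. by move=> x _ e e0; exists 1 => // y _ _; rewrite subrr normr0. Qed.

Lemma cont_id V (A : set V) : cont A id.
Proof. by move=> x _ e e0; exists e. Qed.

Lemma norm_pair_lt V W (p : V * W) (e : R) : `|p| < e = (`|p.1| < e) && (`|p.2| < e).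
Proof. by rewrite prod_normE gt_max. Qed.

Lemma cont_fst V W (A : set (V * W)) : cont A fst.
Proof. by move=> x _ e e0; exists e => // y _; rewrite norm_pair_lt => /andP[]. Qed.

Lemma cont_snd V W (A : set (V * W)) : cont A snd.
Proof. by move=> x _ e e0; exists e => // y _; rewrite norm_pair_lt => /andP[]. Qed.

Lemma cont_pair V W Z (A : set V) (f : V -> W) (g : V -> Z) :
  cont A f -> cont A g -> cont A (fun x => (f x, g x)).
Proof.
move=> Hf Hg x Ax e e0; have [d d0 Hd] := Hf x Ax e e0; have [d' d0' Hd'] := Hg x Ax e e0.
exists (Num.min d d'); first by rewrite lt_min d0.
by move=> y Ay; rewrite lt_min => /andP[h h']; rewrite norm_pair_lt Hd //= Hd'.
Qed.

Lemma cont_D V W (A : set V) (f g : V -> W) : cont A f -> cont A g -> cont A (fun x => f x + g x).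
Proof.
move=> /contP/(subspace_continuousP A) Hf /contP/(subspace_continuousP A) Hg.
by apply/contP/(subspace_continuousP A) => x Ax; apply: cvgD; [exact: Hf|exact: Hg].
Qed.

Lemma cont_Z V W (A : set V) (f : V -> R) (g : V -> W) : cont A f -> cont A g -> cont A (fun x => f x *: g x).
Proof.
move=> /contP/(subspace_continuousP A) Hf /contP/(subspace_continuousP A) Hg.
by apply/contP/(subspace_continuousP A) => x Ax; apply: cvgZ; [exact: Hf|exact: Hg].
Qed.

Lemma cont_M V (A : set V) (f g : V -> R) : cont A f -> cont A g -> cont A (fun x => f x * g x).
Proof. exact: cont_Z. Qed.

Lemma cont_N V W (A : set V) (f : V -> W) : cont A f -> cont A (fun x => - f x).
Proof.
move=> H x Ax e e0; have [d d0 Hd] := H x Ax e e0; exists d => // y Ay xy.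
by rewrite -opprD normrN; exact: Hd.
Qed.

Lemma cont_B V W (A : set V) (f g : V -> W) : cont A f -> cont A g -> cont A (fun x => f x - g x).
Proof. by move=> Hf Hg; apply: cont_D => //; exact: cont_N. Qed.

Lemma cont_min V (A : set V) (f g : V -> R) : cont A f -> cont A g -> cont A (fun x => Num.min (f x) (g x)).
Proof.
move=> Hf Hg x Ax e e0; have [d d0 Hd] := Hf x Ax e e0; have [d' d0' Hd'] := Hg x Ax e e0.
exists (Num.min d d'); first by rewrite lt_min d0.
move=> y Ay; rewrite lt_min => /andP[/(Hd _ Ay) h /(Hd' _ Ay) h'].
move: h h'; rewrite !ltr_norml => /andP[? ?] /andP[? ?].
by case: (leP (f x) (g x)) => ?; case: (leP (f y) (g y)) => ?; lra.
Qed.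

Lemma cont_max V (A : set V) (f g : V -> R) : cont A f -> cont A g -> cont A (fun x => Num.max (f x) (g x)).
Proof.
move=> Hf Hg; apply: (@cont_eq _ _ _ (fun x => - Num.min (- f x) (- g x))).
  by move=> x _; rewrite -oppr_max opprK.
by apply/cont_N/cont_min; exact: cont_N.
Qed.

Definition clamp (l u x : R) : R := Num.max l (Num.min u x).

Lemma clamp_bounds l u x : l <= u -> l <= clamp l u x <= u.
Proof. by move=> lu; rewrite /clamp le_max lexx /= ge_max lu ge_min lexx. Qed.

Lemma clamp_id l u x : l <= x <= u -> clamp l u x = x.
Proof. by move=> /andP[lx xu]; rewrite /clamp (min_idPr xu) (max_idPr lx). Qed.

Lemma clamp_l l u x : l <= u -> x <= l -> clamp l u x = l.
Proof. by move=> lu xl; rewrite /clamp (min_idPr (le_trans xl lu)) (max_idPl xl). Qed.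

Lemma clamp_u l u x : l <= u -> u <= x -> clamp l u x = u.
Proof. by move=> lu ux; rewrite /clamp (min_idPl ux) (max_idPr lu). Qed.

Lemma cont_clamp V (A : set V) l u (f : V -> R) : cont A f -> cont A (fun x => clamp l u (f x)).
Proof. by move=> Hf; apply: cont_max; [exact: cont_cst|apply: cont_min => //; exact: cont_cst]. Qed.

(** Off the level [c] the continuity of [phi] keeps nearby points on one side; on the level both
    halves apply. Unlike [cont_paste] this works relative to a domain [D] that need not be
    closed. *)
Lemma cont_split V W (D : set V) (phi : V -> R) c (f : V -> W) : cont D phi ->
  cont (D `&` [set x | phi x <= c]) f -> cont (D `&` [set x | c <= phi x]) f -> cont D f.
Proof.
move=> Hp H1 H2 x Dx e e0.
have sep (s : R) : 0 < s -> exists2 d : R, 0 < d & forall y, D y -> `|x - y| < d -> `|phi x - phi y| < s.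
  exact: Hp.
case: (ltgtP (phi x) c) => xc.
- have [|d d0 Hd] := sep (c - phi x); first by rewrite subr_gt0.
  have [d' d0' Hd'] := H1 x (conj Dx (ltW xc)) e e0.
  exists (Num.min d d'); first by rewrite lt_min d0.
  move=> y Dy; rewrite lt_min => /andP[/(Hd _ Dy) h /Hd']; apply; split=> //=.
  by move: h; rewrite ltr_norml => /andP[? ?]; lra.
- have [|d d0 Hd] := sep (phi x - c); first by rewrite subr_gt0.
  have [d' d0' Hd'] := H2 x (conj Dx (ltW xc)) e e0.
  exists (Num.min d d'); first by rewrite lt_min d0.
  move=> y Dy; rewrite lt_min => /andP[/(Hd _ Dy) h /Hd']; apply; split=> //=.
  by move: h; rewrite ltr_norml => /andP[? ?]; lra.
- have [|d d0 Hd] := H1 x _ e e0; first by split=> //=; rewrite xc.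
  have [|d' d0' Hd'] := H2 x _ e e0; first by split=> //=; rewrite xc.
  exists (Num.min d d'); first by rewrite lt_min d0.
  move=> y Dy; rewrite lt_min => /andP[h h'].
  by case: (leP (phi y) c) => yc; [apply: Hd|apply: Hd'] => //; split=> //=; exact: ltW.
Qed.

Lemma cont_paste V W (A B : set V) (f : V -> W) : closed A -> closed B ->
  cont A f -> cont B f -> cont (A `|` B) f.
Proof. by move=> cA cB /contP Hf /contP Hg; apply/contP; exact: withinU_continuous. Qed.

Lemma cont_uniform V W (K : set V) (f : V -> W) : compact K -> cont K f ->
  forall e : R, 0 < e -> exists2 d : R, 0 < d &
    forall x y, K x -> K y -> `|x - y| < d -> `|f x - f y| < e.
Proof.
move=> /compact_near_coveringP cK Hf e e0.
pose P (d : R) (x : V) := K x -> forall y, K y -> `|x - y| < d -> `|f x - f y| < e.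
have : \forall d \near 0^'+, K `<=` P d.
  apply: cK => x Kx; have e20 : 0 < e / 2 by rewrite divr_gt0.
  have [d d0 Hd] := Hf x Kx (e / 2) e20.
  exists ([set y : V | `|x - y| < d / 2], [set t : R | t < d / 2]).
    split=> /=.
      apply/nbhs_ballP; exists (d / 2) => /=; first by rewrite divr_gt0.
      by move=> y; rewrite -ball_normE.
    by apply: nbhs_right_lt; rewrite divr_gt0.
  move=> [y t] /= [xy td] Ky z Kz yz.
  have h1 : `|f x - f y| < e / 2 by apply: Hd => //; lra.
  have h2 : `|f x - f z| < e / 2.
    apply: Hd => //; have := ler_distD y x z; lra.
  have := ler_distD (f x) (f y) (f z); rewrite (distrC (f y) (f x)); lra.
move=> /nbhs_ballP[d /= d0 Hd]; have d20 : 0 < d / 2 by rewrite divr_gt0.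
have Pd : K `<=` P (d / 2).
  by apply: Hd => //; rewrite -ball_normE /= sub0r normrN gtr0_norm //; lra.
by exists (d / 2) => // x y Kx Ky; apply: Pd.
Qed.

End EpsilonDelta.

(** * Contractible plane sets, retracts and gluing *)

Section Contraction.
Variable R : realType.
Notation plane := (R * R)%type.
Notation I01 := `[0 : R, 1]%classic.

Definition contraction (A : set plane) (C : plane * R -> plane) (p0 : plane) : Prop :=
  [/\ cont (A `*` I01) C, forall p s, A p -> 0 <= s <= 1 -> A (C (p, s)),
      forall p, A p -> C (p, 0) = p & forall p, A p -> C (p, 1) = p0].

Definition contractible (A : set plane) : Prop := exists C p0, A p0 /\ contraction A C p0.

Lemma I01P (s : R) : I01 s <-> 0 <= s <= 1.
Proof. by rewrite /= in_itv. Qed.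

(** A contraction may move the base point [g 0] and so gives only a free homotopy. The loop is
    therefore first slowed down so as to rest at [g 0] on its outer thirds; these follow the track
    of [g 0] under the contraction, out and back, while the middle third is contracted; the
    remaining out-and-back path is then shrunk along itself. *)
Lemma contractible_simply_connected A : contractible A -> simply_connected R A.
Proof.
move=> [C [p0 [Ap0 [cC AC C0 C1]]]]; split; first by exists p0.
- move=> x y Ax Ay.
  exists (fun t => if t <= 2^-1 then C (x, 2 * t) else C (y, 2 - 2 * t)); split.
  + split.
      apply/contP; apply: (@cont_split _ _ _ _ id 2^-1); first exact: cont_id.
        apply: (@cont_eq _ _ _ _ (C \o (fun t => (x, 2 * t)))).
          by move=> t [_ /= ->].
        apply: (cont_comp _ _ cC); last first.
          apply: cont_pair; first exact: cont_cst.
          by apply: cont_M; [exact: cont_cst|exact: cont_id].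
        by move=> t [/I01P/andP[t0 t1] /= th]; split=> //; apply/I01P; lra.
      apply: (@cont_eq _ _ _ _ (C \o (fun t => (y, 2 - 2 * t)))).
        move=> t [_ /=]; rewrite le_eqVlt => /orP[/eqP <-|]; last by case: ltgtP.
        have h2 : 2 * 2^-1 = 1 :> R by rewrite mulfV.
        have h3 : 2 - 1 = 1 :> R by lra.
        by rewrite lexx h2 h3 !C1.
      apply: (cont_comp _ _ cC); last first.
        apply: cont_pair; first exact: cont_cst.
        by apply: cont_B; [exact: cont_cst|apply: cont_M; [exact: cont_cst|exact: cont_id]].
      by move=> t [/I01P/andP[t0 t1] /= th]; split=> //; apply/I01P; lra.
    move=> _ [t /I01P/andP[t0 t1] <-]; case: ifP => th; apply: AC => //; first by lra.
    by move/negbT: th; rewrite -ltNge => th; lra.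
  + by rewrite invr_ge0 ler0n mulr0 C0.
  + have h2 : ((1 : R) <= 2^-1) = false by lra.
    have h3 : 2 - 2 * 1 = 0 :> R by lra.
    by rewrite h2 h3 C0.
move=> g [/contP cg gA] g01.
(* [c] runs through the loop during the middle third of its time, and the trapezoid [m] is the depth
   of the contraction at time [t]. *)
pose c t : R := clamp 0 1 (3 * t - 1).
pose m t : R := clamp 0 1 (Num.min (3 * t) (3 - 3 * t)).
pose lam (z : plane) : R := (1 - clamp 0 1 (3 * z.1)) * z.2 + clamp 0 1 (3 * z.1) * c z.2.
pose mu (z : plane) : R := Num.min (clamp 0 1 (3 * z.1 - 1)) (m z.2).
pose H (z : plane) := if z.1 <= 2 / 3 then C (g (lam z), mu z)
  else C (g 0, Num.min (m z.2) (3 - 3 * z.1)).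
have ag t : 0 <= t <= 1 -> A (g t) by move=> t01; apply: gA; exists t => //; exact/I01P.
have b01 (x : R) : 0 <= clamp 0 1 x <= 1 by apply: clamp_bounds; lra.
have lam01 z : 0 <= z.2 <= 1 -> 0 <= lam z <= 1.
  by move=> z2; rewrite /lam /c; have := b01 (3 * z.1); have := b01 (3 * z.2 - 1); nra.
have mu01 z : 0 <= mu z <= 1.
  by rewrite /mu /m le_min ge_min; have := b01 (3 * z.1 - 1); have := b01 (Num.min (3 * z.2) (3 - 3 * z.2)); case/andP=> -> -> /andP[-> ->].
(* At [z.1 = 2 / 3] both formulas give the track of [g 0]: on the outer thirds [c] is 0 or 1, and on
   the middle third the depth is 1, where [C] takes the value [p0]. *)
have join z : 0 <= z.2 <= 1 -> z.1 = 2 / 3 -> C (g (lam z), mu z) = C (g 0, Num.min (m z.2) (3 - 3 * z.1)).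
  move=> z2 z1; have -> : lam z = c z.2.
    by rewrite /lam z1 clamp_u; [ring|lra|lra].
  have -> : mu z = m z.2.
    rewrite /mu z1 clamp_u; [|lra|lra]; apply/min_idPr; rewrite /m.
    by have := b01 (Num.min (3 * z.2) (3 - 3 * z.2)); lra.
  have -> : Num.min (m z.2) (3 - 3 * z.1) = m z.2.
    by apply/min_idPl; rewrite z1 /m; have := b01 (Num.min (3 * z.2) (3 - 3 * z.2)); lra.
  have [lt|ge] := ltP z.2 (1 / 3).
    by rewrite (_ : c z.2 = 0) // /c clamp_l //; lra.
  have [lt|ge'] := ltP (2 / 3) z.2.
    by rewrite (_ : c z.2 = 1) ?g01 // /c clamp_u //; lra.
  have -> : m z.2 = 1.
    by rewrite /m clamp_u // le_min; lra.
  by rewrite !C1 //; apply: ag; [lra|apply: b01].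
exists H; split.
- apply/contP; apply: (@cont_split _ _ _ _ fst (2 / 3)); first exact: cont_fst.
    apply: (@cont_eq _ _ _ _ (C \o (fun z => (g (lam z), mu z)))).
      by move=> z [_ /=]; rewrite /H => ->.
    apply: (cont_comp _ _ cC).
      move=> z [[/I01P z1 /I01P z2] _]; split=> /=; first exact/ag/lam01.
      exact/I01P/mu01.
    have c1 : cont (I01 `*` I01 `&` [set x : plane | x.1 <= 2 / 3]) (fun z : plane => clamp 0 1 (3 * z.1)).
      by apply: cont_clamp; apply: cont_M; [exact: cont_cst|exact: cont_fst].
    apply: cont_pair.
      apply: (cont_comp (B := I01) _ _ cg).
        by move=> z [[_ /I01P z2] _]; apply/I01P/lam01.
      apply: cont_D; apply: cont_M => //.
      - by apply: cont_B => //; exact: cont_cst.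
      - exact: cont_snd.
      - apply: cont_clamp; apply: cont_B; last exact: cont_cst.
        by apply: cont_M; [exact: cont_cst|exact: cont_snd].
    apply: cont_min.
      apply: cont_clamp; apply: cont_B; last exact: cont_cst.
      by apply: cont_M; [exact: cont_cst|exact: cont_fst].
    apply: cont_clamp; apply: cont_min; first by apply: cont_M; [exact: cont_cst|exact: cont_snd].
    by apply: cont_B; [exact: cont_cst|apply: cont_M; [exact: cont_cst|exact: cont_snd]].
  apply: (@cont_eq _ _ _ _ (C \o (fun z => (g 0, Num.min (m z.2) (3 - 3 * z.1))))).
    move=> z [[_ /I01P z2] /=]; rewrite /H le_eqVlt => /orP[/eqP e|]; last by case: ltgtP.
    by rewrite /= -join // -e lexx.
  apply: (cont_comp _ _ cC).
    move=> z [[/I01P z1 /I01P z2] /= z3]; split=> /=; first by apply: ag; lra.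
    apply/I01P; rewrite le_min ge_min; have := b01 (Num.min (3 * z.2) (3 - 3 * z.2)).
    by rewrite -/(m z.2) => /andP[-> ->]; rewrite andbT /=; lra.
  apply: cont_pair; first exact: cont_cst.
  apply: cont_min; last by apply: cont_B; [exact: cont_cst|apply: cont_M; [exact: cont_cst|exact: cont_fst]].
  apply: cont_clamp; apply: cont_min; first by apply: cont_M; [exact: cont_cst|exact: cont_snd].
  by apply: cont_B; [exact: cont_cst|apply: cont_M; [exact: cont_cst|exact: cont_snd]].
- move=> _ [z [/I01P z1 /I01P z2] <-]; rewrite /H; case: ifP => zh; apply: AC.
  + exact/ag/lam01.
  + exact: mu01.
  + by apply: ag; lra.
  + move/negbT: zh; rewrite -ltNge => zh.
    rewrite le_min ge_min; have := b01 (Num.min (3 * z.2) (3 - 3 * z.2)).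
    by rewrite -/(m z.2) => /andP[-> ->]; rewrite andbT /=; lra.
- move=> t; rewrite in_itv => t01; rewrite /H /= divr_ge0 //.
  have -> : lam (0, t) = t by rewrite /lam /= clamp_l; [ring|lra|lra].
  have -> : mu (0, t) = 0.
    rewrite /mu /= clamp_l; [|lra|lra]; apply/min_idPl; rewrite /m.
    by have := b01 (Num.min (3 * t) (3 - 3 * t)); lra.
  by rewrite C0 //; exact: ag.
- move=> t; rewrite in_itv => t01; rewrite /H /= (_ : (1 : R) <= 2 / 3 = false); last by lra.
  rewrite (_ : Num.min _ _ = 0) ?C0 //; first by apply: ag; lra.
  rewrite (_ : 3 - 3 * 1 = 0 :> R); last by lra.
  by apply/min_idPr; have := b01 (Num.min (3 * t) (3 - 3 * t)); rewrite -/(m t); lra.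
- move=> s; rewrite in_itv /= => s01.
  have m0 : m 0 = 0 by rewrite /m clamp_l // ge_min; lra.
  have m1 : m 1 = 0 by rewrite /m clamp_l // ge_min; lra.
  have c0 : c 0 = 0 by rewrite /c clamp_l //; lra.
  have c1 : c 1 = 1 by rewrite /c clamp_u //; lra.
  have mu0 t : m t = 0 -> mu (s, t) = 0.
    by move=> mt; rewrite /mu /= mt; apply/min_idPr; have := b01 (3 * s - 1); lra.
  have A0 : A (g 0) by apply: ag; lra.
  have mn : ~~ (s <= 2 / 3) -> Num.min 0 (3 - 3 * s) = 0.
    by rewrite -ltNge => sh; apply/min_idPl; lra.
  rewrite /H /=; split.
    rewrite mu0 // m0; have -> : lam (s, 0) = 0 by rewrite /lam /= c0; ring.
    by case: ifP => [|/negbT/mn ->]; rewrite C0.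
  rewrite mu0 // m1; have -> : lam (s, 1) = 1 by rewrite /lam /= c1; ring.
  by case: ifP => [|/negbT/mn ->]; rewrite C0 -?g01.
Qed.

Lemma retract_simply_connected (A U : set plane) (r : plane -> plane) : A `<=` U -> A !=set0 ->
  cont U r -> (forall p, U p -> A (r p)) -> (forall p, A p -> r p = p) ->
  simply_connected R U -> simply_connected R A.
Proof.
move=> AU A0 cr rA rid [_ pU hU]; split=> //.
- move=> x y Ax Ay; have [g [[/contP cg gU] g0 g1]] := pU x y (AU _ Ax) (AU _ Ay).
  exists (r \o g); split; [split|by rewrite /= g0 rid|by rewrite /= g1 rid].
    by apply/contP; apply: (cont_comp _ cg cr) => t t01; apply: gU; exists t.
  by move=> _ [t t01 <-]; apply: rA; apply: gU; exists t.
- move=> g [cg gA] g01; have gU : path_in U g by split=> //; exact: subset_trans AU.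
  have [H [/contP cH HU H0 H1 Hs]] := hU g gU g01.
  have gAt t : t \in `[0, 1] -> A (g t) by move=> t01; apply: gA; exists t.
  have i0 : (0 : R) \in `[0, 1] by rewrite in_itv /= lexx ler01.
  exists (r \o H); split.
  + by apply/contP; apply: (cont_comp _ cH cr) => z Hz; apply: HU; exists z.
  + by move=> _ [z Hz <-]; apply: rA; apply: HU; exists z.
  + by move=> t t01; rewrite /= H0 // rid //; exact: gAt.
  + by move=> t t01; rewrite /= H1 // rid //; exact: gAt.
  + by move=> s s01; rewrite /=; have [-> ->] := Hs s s01; rewrite !rid //; exact: gAt.
Qed.

(* A convex set [b] glued to [A] along a set onto which [b] retracts. *)
Lemma contractible_glue (A b : set plane) (r : plane -> plane) :
  closed A -> closed b -> cont b r -> (forall p, b p -> A (r p) /\ b (r p)) ->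
  (forall p, A p -> b p -> r p = p) ->
  (forall p q s, b p -> b q -> 0 <= s <= 1 -> b ((1 - s) *: p + s *: q)) ->
  contractible A -> contractible (A `|` b).
Proof.
move=> cA cb cr rb rid bconv [C [p0 [Ap0 [cC AC C0 C1]]]].
(* [h] slides [b] along segments onto its image under [r] and fixes [A]; the two rules agree on the
   overlap, where [r] is the identity. The contraction performs [h] during the first half of the
   time and [C] during the second. *)
pose h (z : plane * R) := if pselect (A z.1) then z.1 else (1 - z.2) *: z.1 + z.2 *: r z.1.
have hA p s : A p -> h (p, s) = p by move=> Ap; rewrite /h /=; case: pselect.
have hb p s : b p -> h (p, s) = (1 - s) *: p + s *: r p.
  move=> bp; rewrite /h /=; case: pselect => // Ap.
  by rewrite rid // -scalerDl subrK scale1r.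
have closedX (B : set plane) : closed B -> closed (B `*` I01).
  move=> cB; have -> : B `*` I01 = (fst @^-1` B) `&` (snd @^-1` I01) by [].
  apply: closedI.
    by apply: closed_comp cB => z _; exact: cvg_fst.
  apply: closed_comp (interval_closed _ _) => // z _; exact: cvg_snd.
have ch : cont ((A `|` b) `*` I01) h.
  have -> : (A `|` b) `*` I01 = (A `*` I01) `|` (b `*` I01).
    by apply/seteqP; split=> [[p s] [[?|?] ?]|[p s] [[? ?]|[? ?]]]; [left|right|split=> //; left|split=> //; right].
  apply: cont_paste; [exact: closedX|exact: closedX| |].
    by apply: (@cont_eq _ _ _ _ fst); [move=> [p s] [Ap _]; rewrite hA|exact: cont_fst].
  apply: (@cont_eq _ _ _ _ (fun z : plane * R => (1 - z.2) *: z.1 + z.2 *: r z.1)).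
    by move=> [p s] [bp _]; rewrite hb.
  apply: cont_D; apply: cont_Z.
  - by apply: cont_B; [exact: cont_cst|exact: cont_snd].
  - exact: cont_fst.
  - exact: cont_snd.
  - by apply: (cont_comp (B := b)) cr; [move=> z []|exact: cont_fst].
have hU p s : (A `|` b) p -> 0 <= s <= 1 -> (A `|` b) (h (p, s)).
  move=> [Ap|bp] s01; first by left; rewrite hA.
  by right; rewrite hb //; apply: bconv => //; have [] := rb p bp.
have h1A p : (A `|` b) p -> A (h (p, 1)).
  move=> [Ap|bp]; first by rewrite hA.
  by rewrite hb // subrr scale0r add0r scale1r; have [] := rb p bp.
have h0 p : (A `|` b) p -> h (p, 0) = p.
  by move=> [Ap|bp]; [rewrite hA|rewrite hb // subr0 scale1r scale0r addr0].
exists (fun z => if z.2 <= 2^-1 then h (z.1, 2 * z.2) else C (h (z.1, 1), 2 * z.2 - 1)), p0.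
split; first by left.
split.
- apply: (@cont_split _ _ _ _ snd 2^-1); first exact: cont_snd.
    apply: (@cont_eq _ _ _ _ (h \o (fun z => (z.1, 2 * z.2)))).
      by move=> z [_ /= ->].
    apply: (cont_comp _ _ ch).
      by move=> z [[Uz /I01P s01] /= s2]; split=> //; apply/I01P => /=; lra.
    apply: cont_pair; first exact: cont_fst.
    by apply: cont_M; [exact: cont_cst|exact: cont_snd].
  apply: (@cont_eq _ _ _ _ (C \o (fun z => (h (z.1, 1), 2 * z.2 - 1)))).
    move=> z [[Uz _] /=]; rewrite le_eqVlt => /orP[/eqP e|]; last by case: ltgtP.
    have h2 : 2 * 2^-1 = 1 :> R by rewrite mulfV.
    by rewrite -e lexx h2 subrr C0 //; exact: h1A.
  apply: (cont_comp _ _ cC).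
    by move=> z [[Uz /I01P s01] /= s2]; split=> /=; [exact: h1A|apply/I01P; lra].
  apply: cont_pair.
    apply: (cont_comp (B := (A `|` b) `*` I01) (f := fun z => (z.1, 1)) _ _ ch).
      by move=> z [[Uz _] _]; split=> //; apply/I01P => /=; lra.
    by apply: cont_pair; [exact: cont_fst|exact: cont_cst].
  apply: cont_B; last exact: cont_cst.
  by apply: cont_M; [exact: cont_cst|exact: cont_snd].
- move=> p s Up s01 /=; case: ifP => sh; first by apply: hU => //; lra.
  move/negbT: sh; rewrite -ltNge => sh.
  by left; apply: AC; [exact: h1A|lra].
- by move=> p Up /=; rewrite invr_ge0 ler0n mulr0 h0.
- move=> p Up /=; rewrite (_ : (1 : R) <= 2^-1 = false); last by lra.
  by rewrite (_ : 2 * 1 - 1 = 1 :> R) ?C1 //; [exact: h1A|lra].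
Qed.

End Contraction.

(** * Unions of horizontal bars *)

Notation bar := (square * nat)%type.

(** Sharing a single corner counts, as it must for the topology of the closed union; [overlap] below
    is the counterpart for the interior. *)
Definition touch (b c : bar) : bool :=
  [&& (b.1.2 == c.1.2 + 1) || (c.1.2 == b.1.2 + 1),
      b.1.1 <= c.1.1 + c.2%:Z & c.1.1 <= b.1.1 + b.2%:Z].

Definition bar_apart (b c : bar) : Prop :=
  b.1.2 = c.1.2 -> b.1.1 + b.2%:Z < c.1.1 \/ c.1.1 + c.2%:Z < b.1.1.

Definition bars_valid (bs : seq bar) : Prop :=
  [/\ uniq bs, forall b, b \in bs -> (0 < b.2)%N &
      forall b c, b \in bs -> c \in bs -> b <> c -> bar_apart b c].

Lemma touch_sym b c : touch b c = touch c b.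
Proof. by rewrite /touch; lia. Qed.

Lemma touch_irr b : touch b b = false.
Proof. by rewrite /touch; lia. Qed.

(** Touching bars lie in rows of opposite parity. *)
Lemma no_triangle a b c : touch a b -> touch b c -> touch a c -> False.
Proof. by rewrite /touch; lia. Qed.

Lemma touch_near b c : bar_apart b c -> b.1.1 <= c.1.1 + c.2%:Z -> c.1.1 <= b.1.1 + b.2%:Z ->
  b.1.2 <= c.1.2 + 1 -> c.1.2 <= b.1.2 + 1 -> touch b c.
Proof. by rewrite /bar_apart /touch => ap h1 h2 h3 h4; rewrite h1 h2 !andbT; lia. Qed.

Lemma touch_window b a : touch b a ->
  [/\ [/\ Num.max b.1.1 a.1.1 <= Num.min (b.1.1 + b.2%:Z) (a.1.1 + a.2%:Z),
          b.1.1 <= Num.max b.1.1 a.1.1, a.1.1 <= Num.max b.1.1 a.1.1,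
          Num.min (b.1.1 + b.2%:Z) (a.1.1 + a.2%:Z) <= b.1.1 + b.2%:Z &
          Num.min (b.1.1 + b.2%:Z) (a.1.1 + a.2%:Z) <= a.1.1 + a.2%:Z],
      b.1.2 <= Num.max b.1.2 a.1.2, a.1.2 <= Num.max b.1.2 a.1.2,
      Num.max b.1.2 a.1.2 <= b.1.2 + 1 & Num.max b.1.2 a.1.2 <= a.1.2 + 1].
Proof. by rewrite /touch => h; repeat split; lia. Qed.

Lemma touch_level b a : touch b a ->
  (Num.max b.1.2 a.1.2 = b.1.2 /\ b.1.2 = a.1.2 + 1) \/ (Num.max b.1.2 a.1.2 = a.1.2 /\ a.1.2 = b.1.2 + 1).
Proof. by rewrite /touch; lia. Qed.

Lemma bars_valid_cons b bs : bars_valid (b :: bs) -> bars_valid bs /\ (b \notin bs).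
Proof.
move=> [/= /andP[nb ubs] pos ap]; split=> //; split=> //.
  by move=> c cbs; apply: pos; rewrite inE cbs orbT.
by move=> c d cbs dbs; apply: ap; rewrite inE ?cbs ?dbs orbT.
Qed.

Section Bars.
Variable R : realType.
Notation plane := (R * R)%type.

Definition bar_set (b : bar) : set plane := @rectangle R b.1 (b.2, 1%N).

Definition bars_set (bs : seq bar) : set plane := \bigcup_(b in [set` bs]) bar_set b.

Lemma bar_setE (b : bar) (p : plane) : bar_set b p <->
  (b.1.1%:~R <= p.1 <= b.1.1%:~R + b.2%:R) /\ (b.1.2%:~R <= p.2 <= b.1.2%:~R + 1).
Proof. by rewrite /bar_set /rectangle /= !in_itv. Qed.

Lemma bars_set_nil : bars_set [::] = set0.
Proof. by apply/seteqP; split=> // p []. Qed.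

Lemma bars_set_cons b bs : bars_set (b :: bs) = bars_set bs `|` bar_set b.
Proof.
apply/seteqP; split=> [p [c /=]|p].
  by rewrite inE => /orP[/eqP ->|cbs] pc; [right|left; exists c].
by case=> [[c cbs pc]|pb]; [exists c => //=; rewrite inE [_ \in _]cbs orbT|exists b; rewrite //= inE eqxx].
Qed.

Lemma eq_bars_set bs cs : bs =i cs -> bars_set bs = bars_set cs.
Proof. by move=> e; apply/seteqP; split=> p [c /= cin pc]; exists c; rewrite //= ?e // -e. Qed.

Lemma lez_intr (a b : int) : a%:~R < b%:~R + 1 :> R -> a <= b.
Proof. have -> : b%:~R + 1 = (b + 1)%:~R :> R by rewrite intrD.
by rewrite ltr_int; lia. Qed.

Lemma closed_bar b : closed (bar_set b).
Proof.
have -> : bar_set b = (fst @^-1` `[b.1.1%:~R, b.1.1%:~R + b.2%:R]) `&` (snd @^-1` `[b.1.2%:~R, b.1.2%:~R + 1]) by [].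
apply: closedI; apply: closed_comp (interval_closed _ _) => // z _.
  exact: cvg_fst.
exact: cvg_snd.
Qed.

Lemma closed_bars bs : closed (bars_set bs).
Proof.
elim: bs => [|b bs IH]; first by rewrite bars_set_nil; exact: closed0.
by rewrite bars_set_cons; apply: closedU => //; exact: closed_bar.
Qed.

Lemma bar_convex b p q s : bar_set b p -> bar_set b q -> 0 <= s <= 1 ->
  bar_set b ((1 - s) *: p + s *: q).
Proof.
move=> /bar_setE[p1 p2] /bar_setE[q1 q2] s01; apply/bar_setE; split=> /=.
  rewrite /GRing.scale /=; nra.
rewrite /GRing.scale /=; nra.
Qed.

Lemma touch_meet b c : touch b c -> (exists p, bar_set b p /\ bar_set c p).
Proof.
case: b c => [[x y] n] [[x' y'] n'] /and3P[/= yy h1 h2].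
exists ((Num.max x x')%:~R, (Num.max y y')%:~R).
have cast (a b : int) (k : nat) : a <= b + k%:Z -> a%:~R <= b%:~R + k%:R :> R.
  by move=> ab; rewrite -[k%:R]/(k%:~R) -intrD ler_int.
have c1 (a b : int) : a <= b + 1 -> a%:~R <= b%:~R + 1 :> R := @cast a b 1%N.
by split; apply/bar_setE; split; apply/andP; split; rewrite /= ?ler_int;
  first [lia | apply: cast; lia | apply: c1; lia].
Qed.

(** All coordinates of bars are integers, so a distance below 1 between bars is 0; in one row
    [bar_apart] leaves a gap of at least 1. The constant 1/2 is the mesh of all subdivisions
    below. *)
Lemma near_touch b c p q : bar_apart b c -> bar_set b p -> bar_set c q ->
  `|p - q| < 2^-1 -> touch b c.
Proof.
case: b c => [[x y] n] [[x' y'] n']; rewrite /bar_apart /= => ap /bar_setE[/= p1 p2] /bar_setE[/= q1 q2].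
rewrite norm_pair_lt !ltr_norml /= => /andP[d1 d2].
have e1 : x%:~R < (x' + n'%:Z)%:~R + 1 :> R by rewrite intrD -pmulrn; lra.
have e2 : x'%:~R < (x + n%:Z)%:~R + 1 :> R by rewrite intrD -pmulrn; lra.
have e3 : y%:~R < (y' + 1)%:~R + 1 :> R by rewrite intrD; lra.
have e4 : y'%:~R < (y + 1)%:~R + 1 :> R by rewrite intrD; lra.
move/lez_intr: e1; move/lez_intr: e2; move/lez_intr: e3; move/lez_intr: e4 => e4 e3 e2 e1.
exact: touch_near.
Qed.

Lemma bars_meet_touch b c p : bar_apart b c -> bar_set b p -> bar_set c p -> touch b c.
Proof. by move=> ap pb pc; apply: (near_touch ap pb pc); rewrite subrr normr0 invr_gt0. Qed.

Lemma contractible_bar b : (0 < b.2)%N -> contractible (bar_set b).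
Proof.
move=> b0; pose p0 : plane := (b.1.1%:~R, b.1.2%:~R).
have bp0 : bar_set b p0 by apply/bar_setE; rewrite /= !lexx !lerDl ler0n ler01.
exists (fun z => (1 - z.2) *: z.1 + z.2 *: p0), p0; split=> //; split.
- apply: cont_D; apply: cont_Z.
  + by apply: cont_B; [exact: cont_cst|exact: cont_snd].
  + exact: cont_fst.
  + exact: cont_snd.
  + exact: cont_cst.
- by move=> p s bp s01; apply: bar_convex.
- by move=> p _ /=; rewrite subr0 scale1r scale0r addr0.
- by move=> p _ /=; rewrite subrr scale0r add0r scale1r.
Qed.

Lemma contractible_bars1 b : (0 < b.2)%N -> contractible (bars_set [:: b]).
Proof. by move=> b0; rewrite bars_set_cons bars_set_nil set0U; exact: contractible_bar. Qed.

Definition leaf (b a : bar) (bs : seq bar) : Prop :=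
  [/\ bars_valid (b :: bs), a \in bs, touch b a &
      forall c, c \in bs -> touch b c -> c = a].

(** The point is clamped horizontally to the contact window of the two bars and projected to their
    common line, whose height is the larger of the two row numbers. *)
Definition leaf_fold (b a : bar) (p : plane) : plane :=
  (clamp (Num.max b.1.1 a.1.1)%:~R (Num.min (b.1.1 + b.2%:Z) (a.1.1 + a.2%:Z))%:~R p.1,
   (Num.max b.1.2 a.1.2)%:~R).

Lemma leaf_foldP b a bs : leaf b a bs ->
  [/\ cont setT (leaf_fold b a),
      forall p, bar_set b p -> bars_set bs (leaf_fold b a p) /\ bar_set b (leaf_fold b a p) &
      forall p, bars_set bs p -> bar_set b p -> leaf_fold b a p = p].
Proof.
move=> [val abs tba uniq_nb]; have [_ pos ap] := val.
have [vbs nb] := bars_valid_cons val.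
have a0 : (0 < a.2)%N by apply: pos; rewrite inE abs orbT.
have b0 : (0 < b.2)%N by apply: pos; rewrite inE eqxx.
split.
- by apply: cont_pair; [apply: cont_clamp; exact: cont_fst|exact: cont_cst].
- move=> p pb; have [[i1 i2 i3 i4 i5] i6 i7 i8 i9] := touch_window tba.
  rewrite /leaf_fold; set l := Num.max b.1.1 _ in i1 i2 i3 *; set u := Num.min _ _ in i1 i4 i5 *.
  set Y := Num.max b.1.2 _ in i6 i7 i8 i9 *.
  have lu : l%:~R <= u%:~R :> R by rewrite ler_int.
  have /andP[c1 c2] := clamp_bounds p.1 lu.
  have cst (x y : int) (k : nat) : x <= y + k%:Z -> x%:~R <= y%:~R + k%:R :> R.
    by move=> xy; rewrite -[k%:R]/(k%:~R) -intrD ler_int.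
  split; [exists a => //|]; apply/bar_setE; split; apply/andP; split => /=.
  + by apply: le_trans c1; rewrite ler_int.
  + by apply: le_trans c2 _; exact: cst.
  + by rewrite ler_int.
  + exact: (cst _ _ 1%N).
  + by apply: le_trans c1; rewrite ler_int.
  + by apply: le_trans c2 _; exact: cst.
  + by rewrite ler_int.
  + exact: (cst _ _ 1%N).
move=> p [c cbs pc] pb.
have bc : b <> c by move=> e; move: nb; rewrite e [_ \in _]cbs.
have tbc : touch b c.
  by apply: (bars_meet_touch _ pb pc); apply: ap; rewrite ?inE ?eqxx // [_ \in bs]cbs orbT.
have ca := uniq_nb _ cbs tbc; subst c.
move/bar_setE: pb => [/andP[p1 p2] /andP[p3 p4]].
move/bar_setE: pc => [/andP[q1 q2] /andP[q3 q4]].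
case: p p1 p2 p3 p4 q1 q2 q3 q4 => px py /= p1 p2 p3 p4 q1 q2 q3 q4.
rewrite /leaf_fold /= clamp_id.
  congr pair; have [[-> yy]|[-> yy]] := touch_level tba.
    by apply/le_anti; rewrite p3 /= (le_trans q4) // yy intrD.
  by apply/le_anti; rewrite q3 /= (le_trans p4) // yy intrD.
apply/andP; split.
  by case: (lerP b.1.1 a.1.1).
by case: (lerP (b.1.1 + b.2%:Z) (a.1.1 + a.2%:Z)) => _; rewrite intrD -pmulrn.
Qed.

Lemma leaf_contractible b a bs : leaf b a bs ->
  contractible (bars_set bs) -> contractible (bars_set (b :: bs)).
Proof.
move=> /leaf_foldP[cf f1 f2] cbs; rewrite bars_set_cons.
apply: (contractible_glue (r := leaf_fold b a)) => //.
- exact: closed_bars.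
- exact: closed_bar.
- exact: cont_sub cf.
- exact: bar_convex.
Qed.

(** The fold that glues a leaf onto the rest also makes the rest a retract of the whole, so that
    removing a leaf neither creates nor destroys simple connectedness. *)
Lemma leaf_simply_connected b a bs : leaf b a bs ->
  simply_connected R (bars_set (b :: bs)) -> simply_connected R (bars_set bs).
Proof.
move=> lf; have [cf f1 f2] := leaf_foldP lf; rewrite bars_set_cons.
pose r p := if pselect (bars_set bs p) then p else leaf_fold b a p.
have rA p : bars_set bs p -> r p = p by rewrite /r; case: pselect.
have rB p : bar_set b p -> r p = leaf_fold b a p.
  by rewrite /r; case: pselect => // ? ?; rewrite f2.
apply: (@retract_simply_connected _ _ _ r) => //.
- case: lf => _ abs tba _; have [p [_ pa]] := touch_meet tba.
  by exists p, a.
- apply: cont_paste; [exact: closed_bars|exact: closed_bar| |].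
    by apply: (@cont_eq _ _ _ _ id) => [p /rA ->|]; last exact: cont_id.
  by apply: (@cont_eq _ _ _ _ (leaf_fold b a)) => [p /rB ->|]; last exact: cont_sub cf.
- by move=> p [pA|pB]; [rewrite rA|rewrite rB //; have [] := f1 p pB].
Qed.

Definition grid_point (N k : nat) : R := k%:R / N%:R.

Lemma grid_point01 N k : (0 < N)%N -> (k <= N)%N -> 0 <= grid_point N k <= 1.
Proof.
move=> N0 kN; rewrite divr_ge0 ?ler0n //= ler_pdivrMr ?ltr0n // mul1r ler_nat //.
Qed.

Lemma grid_pointS N k : grid_point N k.+1 = grid_point N k + N%:R^-1.
Proof. by rewrite /grid_point -natr1 mulrDl mul1r. Qed.

Lemma grid_fine (d : R) : 0 < d -> exists N0 : nat, forall N, (N0 <= N)%N -> (0 < N)%N /\ N%:R^-1 < d.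
Proof.
move=> d0; exists (Num.bound d^-1).+1 => N hN; have N0 : (0 < N)%N by apply: leq_trans hN.
split=> //; rewrite invf_plt ?posrE ?ltr0n //.
have := archi_boundP (ltW (_ : 0 < d^-1)); rewrite invr_gt0 => /(_ d0) h.
by apply: lt_le_trans h _; rewrite ler_nat; exact: ltnW.
Qed.

Lemma grid_steps (g : R -> plane) : {within `[0, 1], continuous g} -> exists N0 : nat, forall N k, (N0 <= N)%N ->
  (k < N)%N -> `|g (grid_point N k) - g (grid_point N k.+1)| < 2^-1.
Proof.
move=> /contP cg; have [|d d0 Hd] := cont_uniform (@segment_compact _ 0 1) cg (e := 2^-1).
  by rewrite invr_gt0.
have [N0 HN] := grid_fine d0; exists N0 => N k /HN[N1 Nd] kN; apply: Hd.
- by rewrite /= in_itv /= grid_point01 // ltnW.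
- by rewrite /= in_itv /= grid_point01.
by rewrite grid_pointS opprD addNKr normrN ger0_norm // invr_ge0 ler0n.
Qed.

(** A path sampled with mesh below 1/2 cannot step from [b] to another bar, since the two would
    touch. *)
Lemma isolated_not_path_connected b c bs : bars_valid (b :: c :: bs) ->
  (forall d, d \in c :: bs -> ~~ touch b d) -> ~ simply_connected R (bars_set (b :: c :: bs)).
Proof.
move=> val iso [_ pc _]; have [_ pos ap] := val; have [_ nb] := bars_valid_cons val.
have corner (d : bar) : (0 < d.2)%N -> bar_set d (d.1.1%:~R, d.1.2%:~R).
  by move=> d0; apply/bar_setE; rewrite /= !lexx !lerDl ler0n ler01.
have bb : b \in b :: c :: bs by rewrite inE eqxx.
have cc : c \in b :: c :: bs by rewrite !inE eqxx orbT.
have close p q : bar_set b p -> bars_set (b :: c :: bs) q -> `|p - q| < 2^-1 -> bar_set b q.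
  move=> pb [d din qd] pq; case: (pselect (b = d)) => [-> //|bd].
  have := near_touch (ap _ _ bb din bd) pb qd pq; have : d \in c :: bs.
    by move: din; rewrite /= inE => /orP[/eqP e|//]; case: bd.
  by move/iso/negbTE ->.
have [] := pc (b.1.1%:~R, b.1.2%:~R) (c.1.1%:~R, c.1.2%:~R).
- by exists b => //; apply: corner; exact: pos.
- by exists c => //; apply: corner; exact: pos.
move=> g [[cg gU] g0 g1]; have [N0 HN] := grid_steps cg.
pose N := N0.+1; have NN : (N0 <= N)%N by exact: leqnSn.
have all_b k : (k <= N)%N -> bar_set b (g (grid_point N k)).
  elim: k => [_|k IH kN].
    by rewrite /grid_point mul0r g0; apply: corner; exact: pos.
  apply: close (IH (ltnW kN)) _ (HN _ _ NN kN).
  by apply: gU; exists (grid_point N k.+1) => //; rewrite /= in_itv /= grid_point01.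
have := all_b N (leqnn _); rewrite /grid_point divff ?pnatr_eq0 // g1 => cb.
have bc : b <> c by move=> e; move: nb; rewrite e inE eqxx.
have := bars_meet_touch (ap _ _ bb cc bc) cb (corner _ (pos _ cc)).
by apply/negP/iso; rewrite inE eqxx.
Qed.

End Bars.

(** * Cocycles modulo 2 along sampled paths *)

Section Cocycle.
Variable R : realType.
Notation plane := (R * R)%type.
Variables (U : set plane) (w : plane -> plane -> bool).

Hypothesis wD : forall p q r, U p -> U q -> U r -> `|p - q| < 2^-1 -> `|q - r| < 2^-1 ->
  `|p - r| < 2^-1 -> w p q (+) w q r = w p r.

(** By [wD] the function [w] is a cocycle modulo 2 on points closer than 1/2; this is its integral
    along a path sampled at [N] steps. *)
Definition path_sum (g : R -> plane) (N : nat) : bool :=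
  \big[addb/false]_(k < N) w (g (grid_point R N k)) (g (grid_point R N k.+1)).

Lemma cocycle_refl p : U p -> w p p = false.
Proof.
move=> Up; have h : `|p - p| < 2^-1 by rewrite subrr normr0 invr_gt0.
by have := wD Up Up Up h h h; case: (w p p).
Qed.

(** Every quadrilateral between the two polygons is cut by its diagonal into two triangles, on each
    of which [w] is additive; the inner vertical edges cancel in pairs. *)
Lemma strip_sum (a b : nat -> plane) n :
  (forall k, (k <= n)%N -> U (a k) /\ U (b k)) ->
  (forall k, (k <= n)%N -> `|a k - b k| < 2^-1) ->
  (forall k, (k < n)%N -> [/\ `|a k - a k.+1| < 2^-1, `|b k - b k.+1| < 2^-1 & `|a k - b k.+1| < 2^-1]) ->
  \big[addb/false]_(k < n) w (a k) (a k.+1) (+) \big[addb/false]_(k < n) w (b k) (b k.+1) =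
  w (a 0%N) (b 0%N) (+) w (a n) (b n).
Proof.
elim: n => [|n IH] HU Hv Hs; first by rewrite !big_ord0 !addbb.
rewrite !big_ord_recr /=.
have := IH (fun k kn => HU k (leqW kn)) (fun k kn => Hv k (leqW kn)) (fun k kn => Hs k (leqW kn)).
have [h1 h2 h3] := Hs n (leqnn _).
have [[Ua Ub] [Ua' Ub']] := (HU n (leqnSn _), HU n.+1 (leqnn _)).
have e1 := wD Ua Ua' Ub' h1 (Hv n.+1 (leqnn _)) h3.
have e2 := wD Ua Ub Ub' (Hv n (leqnSn _)) h2 h3.
move: e1 e2.
by do 2!case: (\big[addb/false]_(i < n) _); do 2!case: (w (a n) _); case: (w (a n) _);
   case: (w (b n) _); case: (w _ _); case: (w _ _).
Qed.

(** In a fine grid on the homotopy square all rows have the same sum by [strip_sum], because the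
    vertical edges at both ends are constant, and the last row is a constant path. *)
Lemma null_homotopic_sum (g : R -> plane) : null_homotopic_in U g ->
  exists N0, forall N, (N0 <= N)%N -> path_sum g N = false.
Proof.
move=> [H [/contP cH HU H0 H1 Hs]].
have cK : compact (`[0 : R, 1]%classic `*` `[0 : R, 1]%classic).
  by apply: compact_setX; exact: segment_compact.
have [|d d0 Hd] := cont_uniform cK cH (e := 2^-1); first by rewrite invr_gt0.
have [N0 HN] := grid_fine d0; exists N0 => N /HN[N1 Nd].
pose a i k := H (grid_point R N i, grid_point R N k).
have inK i k : (i <= N)%N -> (k <= N)%N ->
    (`[0 : R, 1]%classic `*` `[0 : R, 1]%classic) (grid_point R N i, grid_point R N k).
  by move=> iN kN; split; rewrite /= in_itv /= grid_point01.
have Ua i k : (i <= N)%N -> (k <= N)%N -> U (a i k).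
  by move=> iN kN; apply: HU; eexists; [exact: inK iN kN|].
have Ninv : `|N%:R^-1 : R| < d by rewrite ger0_norm // invr_ge0 ler0n.
have {HN} near i k i' k' : (i <= i' <= i.+1)%N -> (k <= k' <= k.+1)%N -> (i' <= N)%N -> (k' <= N)%N ->
    `|a i k - a i' k'| < 2^-1.
  move=> ii kk iN kN; apply: Hd; [apply: inK; lia|exact: inK|].
  have gd l l' : (l <= l' <= l.+1)%N -> `|grid_point R N l - grid_point R N l'| < d.
    move=> ll; have [->|->] : l' = l \/ l' = l.+1 by lia.
      by rewrite subrr normr0.
    by rewrite grid_pointS opprD addNKr normrN.
  by rewrite norm_pair_lt /= !gd.
have i01 : (0 : R) \in `[0, 1] by rewrite in_itv /= lexx ler01.
have row i : (i <= N)%N -> \big[addb/false]_(k < N) w (a i k) (a i k.+1) = path_sum g N.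
  elim: i => [_|i IH iN].
    apply: eq_bigr => k _; rewrite /a /grid_point mul0r -/(grid_point R N k) -/(grid_point R N k.+1).
    by rewrite !H0 // in_itv /= grid_point01 // ltnW.
  rewrite -IH; last exact: ltnW.
  have := @strip_sum (a i) (a i.+1) N _ _ _.
  have -> : a i 0%N = a i.+1 0%N.
    have e l : (l <= N)%N -> a l 0%N = g 0.
      by move=> lN; rewrite /a {2}/grid_point mul0r; have [] := Hs (grid_point R N l) _; rewrite ?in_itv /= ?grid_point01.
    by rewrite !e // ltnW.
  have -> : a i N = a i.+1 N.
    have e l : (l <= N)%N -> a l N = g 0.
      move=> lN; rewrite /a {2}/grid_point divff ?pnatr_eq0 -?lt0n //.
      by have [] := Hs (grid_point R N l) _; rewrite ?in_itv /= ?grid_point01.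
    by rewrite !e // ltnW.
  rewrite !cocycle_refl; [|exact: Ua|exact: Ua].
  move=> h; suff : \big[addb/false]_(k < N) w (a i k) (a i k.+1) (+)
    \big[addb/false]_(k < N) w (a i.+1 k) (a i.+1 k.+1) = false.
    by do 2!case: (\big[addb/false]_(_ < N) _).
  apply: h => k kN.
  - by split; apply: Ua; lia.
  - by apply: near; lia.
  - by split; apply: near; lia.
rewrite -(row N (leqnn _)) big1 // => k _.
have e l : (l <= N)%N -> a N l = g 0.
  move=> lN; rewrite /a {1}/grid_point divff ?pnatr_eq0 -?lt0n //.
  by rewrite H1 // in_itv /= grid_point01.
by rewrite !e // -?(e 0%N) // ?cocycle_refl //; [exact: Ua|exact: ltnW].
Qed.

(** Only dyadic subdivisions are considered: a concatenation sampled at [2 ^ k.+1] steps is then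
    exactly its two halves sampled at [2 ^ k] steps, so that sums add in [conn_trans]. *)
Definition conn p q (v : bool) : Prop := exists g : R -> plane,
  [/\ path_in U g, g 0 = p, g 1 = q & exists K, forall k, (K <= k)%N -> path_sum g (2 ^ k) = v].

Lemma conn_trans p q r v v' : conn p q v -> conn q r v' -> conn p r (v (+) v').
Proof.
move=> [g [[/contP cg gU] g0 g1 [K HK]]] [g' [[/contP cg' gU'] g0' g1' [K' HK']]].
have gUt t : 0 <= t <= 1 -> U (g t) by move=> t01; apply: gU; exists t => //; exact/I01P.
have gUt' t : 0 <= t <= 1 -> U (g' t) by move=> t01; apply: gU'; exists t => //; exact/I01P.
have h2 : 2 * 2^-1 = 1 :> R by rewrite mulfV.
pose f (t : R) := if t <= 2^-1 then g (2 * t) else g' (2 * t - 1).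
have fr t : 2^-1 <= t -> f t = g' (2 * t - 1).
  rewrite /f le_eqVlt => /orP[/eqP <-|]; last by case: ltgtP.
  by rewrite lexx h2 subrr g1 g0'.
exists f; split.
- split.
    apply/contP; apply: (@cont_split _ _ _ _ id 2^-1); first exact: cont_id.
      apply: (@cont_eq _ _ _ _ (g \o (fun t => 2 * t))); first by move=> t [_ /= th]; rewrite /f th.
      apply: (cont_comp _ _ cg); last by apply: cont_M; [exact: cont_cst|exact: cont_id].
      by move=> t [/I01P/andP[t0 t1] /= th]; apply/I01P; lra.
    apply: (@cont_eq _ _ _ _ (g' \o (fun t => 2 * t - 1))); first by move=> t [_ /= th]; rewrite fr.
    apply: (cont_comp _ _ cg').
      by move=> t [/I01P/andP[t0 t1] /= th]; apply/I01P; lra.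
    by apply: cont_B; [apply: cont_M; [exact: cont_cst|exact: cont_id]|exact: cont_cst].
  move=> _ [t /I01P/andP[t0 t1] <-]; rewrite /f; case: ifP => th.
    by apply: gUt; lra.
  by move/negbT: th; rewrite -ltNge => th; apply: gUt'; lra.
- by rewrite /f invr_ge0 ler0n mulr0.
- by rewrite fr ?mulr1; [rewrite (_ : 2 - 1 = 1 :> R) //; lra|lra].
exists (K + K').+1 => -[//|k] hk; rewrite -(HK k) -?(HK' k); [|lia|lia].
have P0 : (0 < 2 ^ k)%N by rewrite expn_gt0.
have e2 : (2 ^ k.+1 = 2 ^ k + 2 ^ k)%N by rewrite expnS mul2n addnn.
have P0' : (2 ^ k)%:R != 0 :> R by rewrite pnatr_eq0 -lt0n.
have gl i : (i <= 2 ^ k)%N -> f (grid_point R (2 ^ k.+1) i) = g (grid_point R (2 ^ k) i).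
  move=> ik; have ge : grid_point R (2 ^ k.+1) i = 2^-1 * grid_point R (2 ^ k) i.
    by rewrite /grid_point expnS natrM invfM; ring.
  rewrite ge /f; have /andP[_ b1] := grid_point01 R P0 ik.
  rewrite (_ : _ <= _ = true); last by lra.
  by rewrite mulrA h2 mul1r.
have gr i : (i <= 2 ^ k)%N -> f (grid_point R (2 ^ k.+1) (2 ^ k + i)) = g' (grid_point R (2 ^ k) i).
  move=> ik; have ge : grid_point R (2 ^ k.+1) (2 ^ k + i) = 2^-1 + 2^-1 * grid_point R (2 ^ k) i.
    by rewrite /grid_point expnS natrM invfM natrD mulrDl mulrCA mulfV //; ring.
  have /andP[b0 _] := grid_point01 R P0 ik.
  rewrite ge fr; last by lra.
  by congr (g' _); lra.
rewrite /path_sum e2 big_split_ord /=; congr (_ (+) _); apply: eq_bigr => i _.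
  by rewrite -e2 !gl // ltnW.
by rewrite -e2 -addnS !gr // ltnW.
Qed.

Lemma conn_convex (C : set plane) p q v : C `<=` U ->
  (forall x y s, C x -> C y -> 0 <= s <= 1 -> C ((1 - s) *: x + s *: y)) -> C p -> C q ->
  (forall a : nat -> plane, forall n, (forall k, (k <= n)%N -> C (a k)) ->
    (forall k, (k < n)%N -> `|a k - a k.+1| < 2^-1) -> a 0%N = p -> a n = q ->
    \big[addb/false]_(k < n) w (a k) (a k.+1) = v) -> conn p q v.
Proof.
move=> CU Cc Cp Cq Hw; pose g (t : R) := (1 - t) *: p + t *: q.
have gC t : 0 <= t <= 1 -> C (g t) by move=> t01; apply: Cc.
have cg : {within `[0, 1], continuous g}.
  by apply/contP; apply: cont_D; apply: cont_Z; rewrite //; do ?[exact: cont_cst|exact: cont_id|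
    apply: cont_B; [exact: cont_cst|exact: cont_id]].
have g0 : g 0 = p by rewrite /g subr0 scale1r scale0r addr0.
have g1 : g 1 = q by rewrite /g subrr scale1r scale0r add0r.
exists g; split=> //.
  by split; [|move=> _ [t /I01P t01 <-]; exact/CU/gC].
have [N0 HN] := grid_steps cg; exists N0 => k hk.
have P0 : (0 < 2 ^ k)%N by rewrite expn_gt0.
have N2 : (N0 <= 2 ^ k)%N by apply: leq_trans hk _; apply: ltnW; exact: ltn_expl.
apply: (Hw (fun i => g (grid_point R (2 ^ k) i))).
- by move=> i ik; apply: gC; exact: grid_point01.
- by move=> i ik; exact: HN.
- by rewrite /grid_point mul0r.
- by rewrite /grid_point divff // pnatr_eq0 -lt0n.
Qed.

Lemma simply_connected_conn p v : simply_connected R U -> conn p p v -> v = false.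
Proof.
move=> [_ _ hU] [g [gU g0 g1 [K HK]]].
have [|N0 HN] := null_homotopic_sum (hU g gU _); first by rewrite g0 g1.
rewrite -(HK (maxn K N0)) ?leq_maxl // HN //.
by apply: leq_trans (leq_maxr K N0) _; apply: ltnW; exact: ltn_expl.
Qed.

End Cocycle.

(** * Cycles of bars carry loops that are not null-homotopic *)

Section Cycle.
Variable R : realType.
Notation plane := (R * R)%type.
Variable bs : seq bar.
Hypothesis val : bars_valid bs.
Notation U := (@bars_set R bs).
Notation bset := (@bar_set R).

Section Edge.
Variables A B : bar.
Hypotheses (Abs : A \in bs) (Bbs : B \in bs) (AB : touch A B).

(* Detects the passages of a fine polygonal path through the contact of [A] and [B]. *)
Definition crossing (p q : plane) : bool :=
  [&& `[< bset A p >], ~~ `[< bset B p >] & `[< bset B q >]] (+)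
  [&& `[< bset A q >], ~~ `[< bset B q >] & `[< bset B p >]].

Lemma near_touch_in b c p q : b \in bs -> c \in bs -> b <> c -> bset b p -> bset c q ->
  `|p - q| < 2^-1 -> touch b c.
Proof. by move=> bi ci bc; apply: near_touch; case: val => _ _; apply. Qed.

Lemma crossing_in p q : bset A p \/ bset B p -> bset A q \/ bset B q ->
  crossing p q = `[< bset B p >] (+) `[< bset B q >].
Proof.
rewrite /crossing => hp hq.
have : `[< bset A p >] || `[< bset B p >] by apply/orP; case: hp => h; [left|right]; apply/asboolP.
have : `[< bset A q >] || `[< bset B q >] by apply/orP; case: hq => h; [left|right]; apply/asboolP.
by case: `[< bset A p >]; case: `[< bset B p >]; case: `[< bset A q >]; case: `[< bset B q >].
Qed.

Lemma crossing_third c p q r : c \in bs -> c <> A -> c <> B -> bset c r ->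
  `|p - r| < 2^-1 -> `|q - r| < 2^-1 -> bset A p -> bset B q -> False.
Proof.
move=> ci cA cB cr pr qr Ap Bq.
have tA : touch A c by apply: (near_touch_in Abs ci _ Ap cr pr) => e; exact: cA.
have tB : touch B c by apply: (near_touch_in Bbs ci _ Bq cr qr) => e; exact: cB.
exact: no_triangle AB tB tA.
Qed.

Lemma crossing_out c p q r : c \in bs -> c <> A -> c <> B -> bset c r ->
  `|p - r| < 2^-1 -> `|q - r| < 2^-1 -> crossing p q = false.
Proof.
move=> ci cA cB cr pr qr; rewrite /crossing.
have -> : [&& `[< bset A p >], ~~ `[< bset B p >] & `[< bset B q >]] = false.
  by apply/negP => /and3P[/asboolP Ap _ /asboolP Bq]; exact: crossing_third ci cA cB cr pr qr Ap Bq.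
apply/negP => /and3P[/asboolP Aq _ /asboolP Bp]; exact: crossing_third ci cA cB cr qr pr Aq Bp.
Qed.

(** On points of [A] and [B] the crossing is the coboundary of the indicator of [B]. If one of the
    three points lies in a third bar then all terms vanish: a crossing so near to it would make that
    bar touch both [A] and [B], against [no_triangle]. *)
Lemma crossingD p q r : U p -> U q -> U r -> `|p - q| < 2^-1 -> `|q - r| < 2^-1 ->
  `|p - r| < 2^-1 -> crossing p q (+) crossing q r = crossing p r.
Proof.
move=> [a /= ai ap] [b /= bi bq] [c /= ci cr] pq qr pr.
have z x : `|x - x : plane| < 2^-1 by rewrite subrr normr0 invr_gt0.
have in_or d x : bset d x -> d = A \/ d = B -> bset A x \/ bset B x.
  by move=> dx [<-|<-]; [left|right].
have dec d : (d = A \/ d = B) \/ (d <> A /\ d <> B).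
  by case: (pselect (d = A)); case: (pselect (d = B)); tauto.
have [ha|[a1 a2]] := dec a; last first.
  rewrite (crossing_out ai a1 a2 ap) ?z // 1?distrC // (crossing_out ai a1 a2 ap) 1?distrC //.
  by rewrite (crossing_out ai a1 a2 ap) ?z // 1?distrC.
have [hb|[b1 b2]] := dec b; last first.
  rewrite (crossing_out bi b1 b2 bq) // (crossing_out bi b1 b2 bq) // 1?distrC //.
  by rewrite (crossing_out bi b1 b2 bq) // distrC.
have [hc|[c1 c2]] := dec c; last first.
  by rewrite (crossing_out ci c1 c2 cr) // (crossing_out ci c1 c2 cr) // (crossing_out ci c1 c2 cr).
rewrite !crossing_in; do ?[exact: (in_or a)|exact: (in_or b)|exact: (in_or c)].
by do 3!case: `[< bset B _ >].
Qed.

Lemma conn_bar c p q : c \in bs -> c <> A -> bset c p -> bset c q -> conn U crossing p q false.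
Proof.
move=> ci cA cp cq; apply: (@conn_convex _ _ _ (bset c)) => //.
- by move=> x cx; exists c.
- exact: bar_convex.
move=> a n Ca da _ _; rewrite big1 // => k _.
have [kn kn'] := (ltn_ord k, ltnW (ltn_ord k)).
case: (pselect (c = B)) => [cB|cB]; last first.
  by apply: (crossing_out ci cA cB (Ca _ kn)); [exact: da|rewrite subrr normr0 invr_gt0].
have hB i : (i <= n)%N -> `[< bset B (a i) >] by move=> /Ca; rewrite cB => /asboolP.
by rewrite /crossing !hB //= !andbF.
Qed.

Lemma conn_bar_A p q : bset A p -> bset A q -> conn U crossing p q (`[< bset B p >] (+) `[< bset B q >]).
Proof.
move=> Ap Aq; apply: (@conn_convex _ _ _ (bset A)) => //.
- by move=> x cx; exists A.
- exact: bar_convex.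
move=> a n Ca _ <- <-; elim: n Ca => [|n IH] Ca; first by rewrite big_ord0 addbb.
rewrite big_ord_recr /= IH; last by move=> k kn; apply: Ca; exact: leqW.
rewrite crossing_in; [|by left; apply: Ca|by left; apply: Ca].
by do 3!case: `[< bset B _ >].
Qed.

Lemma conn_chain b s p q : path touch b s -> all (mem bs) (b :: s) -> A \notin b :: s ->
  bset b p -> bset (last b s) q -> conn U crossing p q false.
Proof.
elim: s b p => [|c s IH] b p /=.
  move=> _ /andP[bi _]; rewrite inE => bA pb qb.
  by apply: (conn_bar bi) => // e; rewrite e eqxx in bA.
move=> /andP[bc pth] /andP[bi al]; rewrite inE negb_or => /andP[bA nA] pb qb.
have [e [eb ec]] := touch_meet R bc.
rewrite -[false]/(false (+) false); apply: (conn_trans (q := e)).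
  by apply: (conn_bar bi) => // e'; rewrite e' eqxx in bA.
exact: (IH c e pth al nA ec qb).
Qed.

(* Closing up the chain [B :: s] through [A] gives a loop crossing the contact once. *)
Lemma chain_cycle s : path touch B s -> all (mem bs) (B :: s) -> A \notin B :: s ->
  touch (last B s) A -> last B s <> B -> ~ simply_connected R U.
Proof.
move=> pth al nA tl lB sc; have [e [eA eB]] := touch_meet R AB.
have [f [fl fA]] := touch_meet R tl.
have c1 := conn_chain pth al nA eB fl.
have c2 := conn_bar_A fA eA.
(* The loop goes from [e] to [f] along the chain with sum 0 and returns inside [A], where the sum
   compares membership of [f] and [e] in [B]. As [e] is in [B], a zero sum puts [f] in [B] too, and
   then [A], [B] and the last bar form a triangle. *)
have := simply_connected_conn crossingD sc (conn_trans c1 c2).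
have -> : `[< bset B e >] = true by exact/asboolP.
rewrite /= addbT => /negbFE/asboolP fB.
have li : last B s \in bs by have := allP al _ (mem_last B s).
have tlB : touch (last B s) B.
  by apply: (near_touch_in li Bbs lB fl fB); rewrite subrr normr0 invr_gt0.
by apply: (no_triangle AB (b := B) (c := last B s)); rewrite touch_sym.
Qed.

End Edge.

(** Take a longest simple path [x], [h], ... of touching bars. A neighbour [y] of [x] other than [h]
    lies on the path, which could be extended otherwise; the part from [h] to [y] is closed up
    through [x]. *)
Lemma cyclic_not_simply_connected : bs <> [::] ->
  (forall b, b \in bs -> (1 < count (touch b) bs)%N) -> ~ simply_connected R U.
Proof.
have [ubs _ _] := val => nz nb2.
have ex2 b h : b \in bs -> exists2 c, c \in bs & touch b c && (c != h).
  move=> /nb2 h2; apply/hasP; rewrite has_count.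
  have : count (touch b) bs = (count (fun c => touch b c && (c != h)) bs + count (fun c => touch b c && (c == h)) bs)%N.
    by elim: (bs) => //= c l ->; case: (touch b c); case: (c == h); rewrite /=; lia.
  have : (count (fun c => touch b c && (c == h)) bs <= 1)%N.
    apply: leq_trans (sub_count _ bs) _; first by move=> c /andP[_]; exact: id.
    by rewrite count_uniq_mem // leq_b1.
  move=> h1 h3; rewrite lt0n; apply/negP => /eqP z; move: h2.
  by rewrite h3 z add0n ltnNge h1.
pose P n := `[< exists s, [/\ size s = n, uniq s, all (mem bs) s & sorted touch s] >].
have P0 : exists n, P n by exists 0%N; apply/asboolP; exists [::].
have Pb n : P n -> (n <= size bs)%N.
  by move=> /asboolP[s [<- us al _]]; apply: uniq_leq_size us _; exact/allP.
have [n /asboolP[s [sn us al st]] mx] := ex_maxnP P0 Pb.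
have mxs s' : uniq s' -> all (mem bs) s' -> sorted touch s' -> (size s' <= n)%N.
  by move=> u' a' t'; apply: mx; apply/asboolP; exists s'.
have [b0 b0i] : exists b, b \in bs by case: bs nz => // b l _; exists b; rewrite inE eqxx.
case: s sn us al st => [|x s] sn us al st.
  by have := mxs [:: b0]; rewrite -sn /= b0i => /(_ isT isT isT).
have xi : x \in bs by case/andP: al.
case: s sn us al st => [|h s] sn us al st.
  have [c ci /andP[xc _]] := ex2 x x xi.
  have := mxs [:: c; x]; rewrite -sn /= inE ci xi touch_sym xc.
  have -> : c != x by apply/eqP => e; rewrite e touch_irr in xc.
  by move=> /(_ isT isT isT).
have [y yi /andP[xy yh]] := ex2 x h xi.
have yx : y != x by apply/eqP => e; rewrite e touch_irr in xy.
have ys : y \in h :: s.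
  apply: contraT => ny; have := mxs [:: y, x, h & s]; rewrite -sn [sorted _ _]/= [all _ _]/= yi touch_sym xy.
  rewrite cons_uniq us andbT inE negb_or yx ny /= -/(all (mem bs) (x :: h :: s)).
  by move: al st => /= -> -> /(_ isT isT isT); rewrite ltnn.
have ys' : y \in s by move: ys; rewrite inE (negbTE yh).
case/splitPr: ys' us al st => s1 s2 us al st {sn}.
have hi : h \in bs by case/and3P: al.
have xh : touch x h by case/andP: st.
apply: (@chain_cycle x h xi hi xh (rcons s1 y)).
- by move: st => /= /andP[_]; rewrite -cat_rcons cat_path => /andP[].
- move: al => /= /and3P[_ -> ]; rewrite all_cat all_rcons /= => /and3P[-> -> _].
  by [].
- move: us => /= /andP[nx _]; apply: contra nx; rewrite !inE mem_cat mem_rcons !inE.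
  by case/orP => [->//|/orP[->|->]]; rewrite ?orbT.
- by rewrite last_rcons touch_sym.
- by rewrite last_rcons; exact/eqP.
Qed.

End Cycle.

(** * Pruning leaves decides simple connectedness *)

Definition prune (bs : seq bar) : seq bar :=
  if [seq b <- bs | count (touch b) bs == 1%N] is b :: _ then [seq c <- bs | c != b] else bs.

Section Prune.
Variable R : realType.

Lemma bars_valid_perm bs cs : perm_eq bs cs -> bars_valid bs -> bars_valid cs.
Proof.
move=> e [ub pos ap]; split; first by rewrite -(perm_uniq e).
  by move=> b; rewrite -(perm_mem e); exact: pos.
by move=> b c; rewrite -!(perm_mem e); exact: ap.
Qed.

Lemma pruneP bs : bars_valid bs ->
  (exists b a, [/\ b \in bs, prune bs = rem b bs & leaf b a (rem b bs)]) \/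
  (prune bs = bs /\ forall b, b \in bs -> count (touch b) bs != 1%N).
Proof.
move=> val; have [ub _ _] := val; rewrite /prune.
case E : [seq b <- bs | count (touch b) bs == 1%N] => [|b l].
  right; split=> // b bi; apply/negP => c1.
  have : b \in [seq b <- bs | count (touch b) bs == 1%N] by rewrite mem_filter c1.
  by rewrite E.
left; have : b \in [seq b <- bs | count (touch b) bs == 1%N] by rewrite E inE eqxx.
rewrite mem_filter => /andP[/eqP c1 bi]; rewrite -rem_filter //.
have c1' : count (touch b) (rem b bs) = 1%N.
  by rewrite -c1 (permP (perm_to_rem bi)) /= touch_irr.
move: c1'; rewrite -size_filter; case F : [seq _ <- _ | _] => [|a [|]] // _.
have aF : a \in [seq c <- rem b bs | touch b c] by rewrite F inE eqxx.
move: aF; rewrite mem_filter => /andP[ba ai].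
exists b, a; split=> //; split=> //.
  by apply: bars_valid_perm val; exact: perm_to_rem.
move=> c ci bc; have : c \in [seq c <- rem b bs | touch b c] by rewrite mem_filter bc.
by rewrite F inE => /eqP.
Qed.

Lemma bars_valid_prune bs : bars_valid bs -> bars_valid (prune bs).
Proof.
move=> val; case: (pruneP val) => [[b [a [bi -> [v _ _ _]]]]|[-> //]].
by have [] := bars_valid_cons v.
Qed.

Lemma bars_set_rem b bs : b \in bs -> @bars_set R bs = @bars_set R (b :: rem b bs).
Proof. by move=> bi; apply: eq_bars_set => c; rewrite (perm_mem (perm_to_rem bi)). Qed.

Lemma prune_contractible bs : bars_valid bs ->
  contractible (@bars_set R (prune bs)) -> contractible (@bars_set R bs).
Proof.
move=> val; case: (pruneP val) => [[b [a [bi -> lf]]]|[-> //]].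
by rewrite (bars_set_rem bi); exact: leaf_contractible lf.
Qed.

Lemma prune_simply_connected bs : bars_valid bs ->
  simply_connected R (@bars_set R bs) -> simply_connected R (@bars_set R (prune bs)).
Proof.
move=> val; case: (pruneP val) => [[b [a [bi -> lf]]]|[-> //]].
by rewrite {1}(bars_set_rem bi); exact: leaf_simply_connected lf.
Qed.

(** Without leaves, either some bar is isolated and path connectedness makes it the only one, or
    every bar has two contacts and the bars contain a cycle. *)
Lemma simply_connected_leafless bs : bars_valid bs ->
  (forall b, b \in bs -> count (touch b) bs != 1%N) ->
  simply_connected R (@bars_set R bs) -> size bs = 1%N.
Proof.
move=> val nl sc; have [p0 [b0 /= b0i _]] : @bars_set R bs !=set0 by case: sc.
case: (pselect (exists2 b, b \in bs & count (touch b) bs = 0%N)) => [[b bi c0]|no]; last first.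
  exfalso; apply: (@cyclic_not_simply_connected R bs val) sc.
    by move=> e; rewrite e in b0i.
  move=> b bi; have := nl b bi; case E : (count (touch b) bs) => [|[|k]] // _.
  by case: no; exists b.
have val' := bars_valid_perm (perm_to_rem bi) val.
move: sc; rewrite (bars_set_rem bi) (perm_size (perm_to_rem bi)) /=.
case E : (rem b bs) => [|c l] // sc; exfalso; rewrite E in val'.
apply: isolated_not_path_connected val' _ sc => d di; apply/negP => bd.
have : d \in bs by apply: (@mem_rem _ b); rewrite E.
by move=> din; have : has (touch b) bs; [apply/hasP; exists d|rewrite has_count c0].
Qed.

Lemma prune1_contractible n bs : bars_valid bs -> size (iter n prune bs) = 1%N ->
  contractible (@bars_set R bs).
Proof.
elim: n bs => [|n IH] bs val.
  by case: bs val => [|b [|]] //= [_ pos _] _; apply: contractible_bars1; apply: pos; rewrite inE eqxx.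
rewrite iterSr => h; apply: (prune_contractible val); apply: IH h; exact: bars_valid_prune.
Qed.

Lemma simply_connected_prune1 n bs : (size bs <= n)%N -> bars_valid bs ->
  simply_connected R (@bars_set R bs) -> size (iter n prune bs) = 1%N.
Proof.
elim: n bs => [|n IH] bs hn val sc.
  have [p [b /= bi _]] : @bars_set R bs !=set0 by case: sc.
  by move: hn bi; rewrite leqn0 size_eq0 => /eqP ->.
rewrite iterSr; case: (pruneP val) => [[b [a [bi pe lf]]]|[pe nl]].
  apply: IH; [|exact: bars_valid_prune|exact: prune_simply_connected].
  by rewrite pe size_rem //; case: (size bs) hn.
have -> : iter n prune (prune bs) = bs by elim: {IH hn} n => [|n IHn] /=; rewrite ?IHn pe.
exact: simply_connected_leafless nl sc.
Qed.

Lemma simply_connected_bars bs : bars_valid bs ->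
  simply_connected R (@bars_set R bs) <-> size (iter (size bs) prune bs) = 1%N.
Proof.
move=> val; split=> h; first exact: simply_connected_prune1.
exact/contractible_simply_connected/(prune1_contractible val h).
Qed.

End Prune.

(** * Connectedness of the interior *)

Definition overlap (b c : bar) : bool :=
  [&& (b.1.2 == c.1.2 + 1) || (c.1.2 == b.1.2 + 1),
      b.1.1 < c.1.1 + c.2%:Z & c.1.1 < b.1.1 + b.2%:Z].

Lemma overlap_sym b c : overlap b c = overlap c b.
Proof.
by rewrite /overlap; lia.
Qed.

Lemma overlap_window b c : overlap b c -> (0 < b.2)%N -> (0 < c.2)%N ->
  [/\ Num.max b.1.1 c.1.1 < Num.min (b.1.1 + b.2%:Z) (c.1.1 + c.2%:Z),
      b.1.1 <= Num.max b.1.1 c.1.1, c.1.1 <= Num.max b.1.1 c.1.1,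
      Num.min (b.1.1 + b.2%:Z) (c.1.1 + c.2%:Z) <= b.1.1 + b.2%:Z &
      Num.min (b.1.1 + b.2%:Z) (c.1.1 + c.2%:Z) <= c.1.1 + c.2%:Z].
Proof.
by rewrite /overlap => h h1 h2; split; lia.
Qed.

Lemma overlap_rows b c : overlap b c -> c.1.2 = b.1.2 + 1 \/ b.1.2 = c.1.2 + 1.
Proof.
by rewrite /overlap; lia.
Qed.

Lemma touch_corner b c : touch b c -> ~~ overlap b c ->
  b.1.1 = c.1.1 + c.2%:Z \/ c.1.1 = b.1.1 + b.2%:Z.
Proof.
by rewrite /touch /overlap; lia.
Qed.

Lemma touch_same_row b c : touch b c -> c.1.2 <= b.1.2 -> b.1.2 <= c.1.2 -> False.
Proof.
by rewrite /touch; lia.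
Qed.

Section Interior.
Variable R : realType.
Notation plane := (R * R)%type.
Definition open_box (x x' y y' : R) : set plane := [set p | x < p.1 < x' /\ y < p.2 < y'].

Lemma open_open_box x x' y y' : open (open_box x x' y y').
Proof.
have -> : open_box x x' y y' = (fst @^-1` `]x, x'[) `&` (snd @^-1` `]y, y'[).
by apply/seteqP; split=> p; rewrite /open_box /= !in_itv.
apply: openI; apply: open_comp (interval_open _ _) => // z _.
exact: cvg_fst.
exact: cvg_snd.
Qed.

Lemma convex_gt (a u v t : R) : a < u -> a < v -> 0 <= t <= 1 -> a < (1 - t) * u + t * v.
Proof.
by move=> au av t01; case: (leP u v) => uv; nra.
Qed.

Lemma convex_lt (a u v t : R) : u < a -> v < a -> 0 <= t <= 1 -> (1 - t) * u + t * v < a.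
Proof.
by move=> au av t01; case: (leP u v) => uv; nra.
Qed.

Lemma open_box_connected x x' y y' : connected (open_box x x' y y').
Proof.
have [->|/set0P[p0 B0]] := eqVneq (open_box x x' y y') set0; first exact: connected0.
pose seg (p : plane) := (fun t : R => (1 - t) *: p0 + t *: p) @` `[0, 1].
have segB p : open_box x x' y y' p -> seg p `<=` open_box x x' y y'.
move: B0 => [/andP[b1 b2] /andP[b3 b4]] [/andP[c1 c2] /andP[c3 c4]] _ [t /I01P t01 <-].
by split; apply/andP; split; rewrite /= /GRing.scale /=; first [exact: convex_gt|exact: convex_lt].
have -> : open_box x x' y y' = \bigcup_(p in open_box x x' y y') seg p.
apply/seteqP; split=> [p Bp|q [p Bp pq]]; last exact: segB pq.
exists p => //; exists 1; first by apply/I01P; rewrite ler01 lexx.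
by rewrite subrr scale0r add0r scale1r.
apply: bigcup_connected.
exists p0 => p Bp; exists 0; first by apply/I01P; rewrite ler01 lexx.
by rewrite subr0 scale1r scale0r addr0.
move=> p Bp; apply: connected_continuous_connected; first exact: segment_connected.
apply/contP; apply: cont_D; apply: cont_Z; do ?[exact: cont_cst|exact: cont_id].
by apply: cont_B; [exact: cont_cst|exact: cont_id].
Qed.

Definition bar_inner (b : bar) : set plane :=
  open_box b.1.1%:~R (b.1.1%:~R + b.2%:R) b.1.2%:~R (b.1.2%:~R + 1).

Lemma bar_inner_sub b : bar_inner b `<=` @bar_set R b.
Proof.
by move=> p [p1 p2]; apply/bar_setE; lra.
Qed.

Lemma bar_sub_closure b : (0 < b.2)%N -> @bar_set R b `<=` closure (bar_inner b).
Proof.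
move=> b0 p /bar_setE[p1 p2] B /nbhs_ballP[e /= e0 He].
have n0 : 0 < b.2%:R :> R by rewrite ltr0n.
set n : R := b.2%:R in p1 n0.
pose c : plane := (b.1.1%:~R + n / 2, b.1.2%:~R + 1 / 2).
pose s : R := Num.min (1 / 2) (e / (2 * (n + 1))).
have n1 : 0 < 2 * (n + 1) by lra.
have s0 : 0 < s by rewrite lt_min divr_gt0 ?divr_gt0.
have s1 : s <= 1 / 2 by rewrite ge_min lexx.
have s2 : s * (2 * (n + 1)) <= e by rewrite -ler_pdivlMr // ge_min lexx orbT.
have sn : 0 < s * n by rewrite mulr_gt0.
pose q : plane := ((1 - s) * p.1 + s * c.1, (1 - s) * p.2 + s * c.2).
have t0 : 0 <= 1 - s by lra.
move/andP: p1 => [p1 p1']; move/andP: p2 => [p2 p2'].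
have m1 : 0 <= (1 - s) * (p.1 - b.1.1%:~R) by apply: mulr_ge0; lra.
have m2 : 0 <= (1 - s) * (b.1.1%:~R + n - p.1) by apply: mulr_ge0; lra.
have m3 : 0 <= (1 - s) * (p.2 - b.1.2%:~R) by apply: mulr_ge0; lra.
have m4 : 0 <= (1 - s) * (b.1.2%:~R + 1 - p.2) by apply: mulr_ge0; lra.
have k1 : 0 <= s * (p.1 - b.1.1%:~R) by apply: mulr_ge0; lra.
have k2 : 0 <= s * (b.1.1%:~R + n - p.1) by apply: mulr_ge0; lra.
have k3 : 0 <= s * (p.2 - b.1.2%:~R) by apply: mulr_ge0; lra.
have k4 : 0 <= s * (b.1.2%:~R + 1 - p.2) by apply: mulr_ge0; lra.
exists q; split.
by rewrite /bar_inner /open_box /q /c /= -/n; split; lra.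
apply: He; rewrite -ball_normE /= norm_pair_lt !ltr_norml /q /c /=.
by apply/andP; split; lra.
Qed.

Definition bars_inner (bs : seq bar) : set plane := \bigcup_(b in [set` bs]) bar_inner b.

Lemma connected_between (A B : set plane) : connected A -> A `<=` B -> B `<=` closure A -> connected B.
Proof.
move=> cA AB BA; apply/connectedP => E [Ene EB sep].
have [[e1 n1] [e2 n2]] := (Ene false, Ene true).
have [s1 s2] := sep.
have part (i : bool) : A `<=` E i -> False.
move=> AE; have [x Ex] := Ene (~~ i).
have Bx : B x by rewrite EB; case: i {AE} Ex => /= Ex; [left|right].
have := closureS AE (BA _ Bx) => cl.
have : (closure (E i) `&` E (~~ i)) x by [].
case: i {AE} Ex cl => /= Ex cl _.
by have : (E false `&` closure (E true)) x by []; rewrite s2.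
by have : (closure (E false) `&` E true) x by []; rewrite s1.
move/connectedP: cA => /(_ (fun i => A `&` E i)); apply; split.
move=> i; apply/set0P/negP => /eqP A0; apply: (part (~~ i)) => x Ax.
have := AB _ Ax; rewrite EB => -[] Ex; case: i A0 => A0 //=; exfalso.
by have : (A `&` E false) x by []; rewrite ?A0.
by have : (A `&` E true) x by []; rewrite ?A0.
by rewrite -setIUr -EB; apply/esym/setIidl.
rewrite /separated; split; apply/seteqP; split=> // x [h1 h2].
by rewrite -s1; split; [apply: closureS h1 => y []|case: h2].
by rewrite -s2; split; [case: h1|apply: closureS h2 => y []].
Qed.

Lemma interior_bars_sub bs : bars_inner bs `<=` (@bars_set R bs)^°.
Proof.
move=> p [b bi bp]; rewrite /interior; apply: (@filterS _ _ _ (bar_inner b)).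
by move=> q bq; exists b => //; exact: bar_inner_sub.
by apply: open_nbhs_nbhs; split=> //; exact: open_open_box.
Qed.

(** The interior of the union lies in the closure of the open bars. Once [S] contains all bars, the
    connected set [A] is thus dense in the interior, and [connected_between] applies. *)
Definition joined (bs S : seq bar) : Prop :=
  exists A : set plane, [/\ connected A, A `<=` (@bars_set R bs)^° & bars_inner S `<=` A].

Lemma joined1 bs b : b \in bs -> joined bs [:: b].
Proof.
move=> bi; exists (bar_inner b); split; first exact: open_box_connected.
by apply: subset_trans (@interior_bars_sub bs) => p bp; exists b.
by move=> p [c /=]; rewrite inE => /eqP ->.
Qed.

(** An open box two rows high, standing over the common segment, meets both open bars and stays
    within the two closed ones. *)
Lemma overlap_bridge bs b c : b \in bs -> c \in bs -> (0 < b.2)%N -> (0 < c.2)%N -> overlap b c ->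
  exists A : set plane, [/\ connected A, A `<=` (@bars_set R bs)^°, bar_inner b `<=` A & bar_inner c `<=` A].
Proof.
wlog yy : b c / c.1.2 = b.1.2 + 1.
move=> W bi ci b0 c0 ov; have [yy|yy] := overlap_rows ov; first exact: W.
have ov' : overlap c b by rewrite overlap_sym.
have [A [A1 A2 A3 A4]] := W c b yy ci bi c0 b0 ov'.
by exists A.
move=> bi ci b0 c0 ov.
have [] := overlap_window ov b0 c0.
set l : int := Num.max _ _; set u : int := Num.min _ _.
rewrite -(ltr_int R) -!(ler_int R) !intrD -!pmulrn.
have yR : c.1.2%:~R = b.1.2%:~R + 1 :> R by rewrite yy intrD.
set L : R := l%:~R; set V : R := u%:~R.
move: yR; rewrite /bar_inner; set xb : R := b.1.1%:~R; set xc : R := c.1.1%:~R.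
set yb : R := b.1.2%:~R; set yc : R := c.1.2%:~R; set nb : R := b.2%:R; set nc : R := c.2%:R.
move=> yR ez m1 m2 m3 m4.
pose E := open_box L V yb (yb + 2).
have Esub : E `<=` (@bars_set R bs)^°.
move=> p Ep; rewrite /interior; apply: (@filterS _ _ _ E); last first.
by apply: open_nbhs_nbhs; split=> //; exact: open_open_box.
move=> q [q1 q2]; case: (leP q.2 (yb + 1)) => qy.
by exists b => //; apply/bar_setE; rewrite -/xb -/yb -/nb; lra.
by exists c => //; apply/bar_setE; rewrite -/xc -/yc -/nc; lra.
pose m : R := (L + V) / 2.
exists (bar_inner b `|` E `|` bar_inner c); split.
apply: connectedU.
by exists (m, yb + 3 / 2); split; [right|]; rewrite /E /bar_inner /open_box /m /= -/xc -/yc -/nc; lra.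
apply: connectedU; do ?exact: open_box_connected.
by exists (m, yb + 1 / 2); split; rewrite /E /bar_inner /open_box /m /= -?/xb -?/yb -?/nb; lra.
exact: open_box_connected.
move=> p [[pb|pE]|pc]; [|exact: Esub|]; apply: interior_bars_sub.
by exists b.
by exists c.
by move=> p pb; left; left.
by move=> p pc; right.
Qed.

Lemma joined_grow bs S S' : bars_valid bs -> (forall b, b \in S -> b \in bs) -> S <> [::] ->
  (forall b, b \in S' -> b \in S \/ (b \in bs /\ has (overlap b) S)) -> joined bs S -> joined bs S'.
Proof.
move=> [_ pos _] Sbs S0 H [A [cA Asub SA]].
have [b0 b0S] : exists b, b \in S by case: S S0 {Sbs H SA} => // b l _; exists b; rewrite inE eqxx.
have inner_ne b : b \in bs -> bar_inner b !=set0.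
move=> /pos; rewrite -(ltr0n R) => h; exists (b.1.1%:~R + b.2%:R / 2, b.1.2%:~R + 1 / 2).
by rewrite /bar_inner /open_box /=; lra.
have [x0 x0A] : A !=set0.
by have [x xb] := inner_ne _ (Sbs _ b0S); exists x; apply: SA; exists b0.
have ex b : exists B : set plane, [/\ connected B, B `<=` (@bars_set R bs)^°, B x0 & b \in S' -> bar_inner b `<=` B].
case: (boolP (b \in S')) => [bS'|_]; last by exists A.
have [bS|[bi /hasP[c cS ov]]] := H b bS'.
by exists A; split=> // _ p bp; apply: SA; exists b.
have [B [cB Bs bB cB']] := overlap_bridge bi (Sbs _ cS) (pos _ bi) (pos _ (Sbs _ cS)) ov.
exists (A `|` B); split.
apply: connectedU => //; have [x xc] := inner_ne _ (Sbs _ cS).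
by exists x; split; [apply: SA; exists c|exact: cB'].
by move=> p [/Asub|/Bs].
by left.
by move=> _ p bp; right; exact: bB.
have [F HF] := choice ex.
exists (\bigcup_(b in setT) F b); split.
by apply: bigcup_connected; [exists x0 => b _; have [] := HF b|move=> b _; have [] := HF b].
by move=> p [b _ Fp]; have [_ Fs _ _] := HF b; exact: Fs.
by move=> p [b /= bS' bp]; exists b => //; have [_ _ _ Fb] := HF b; exact: (Fb bS').
Qed.

Lemma joined_connected bs : bars_valid bs -> joined bs bs -> connected (@bars_set R bs)^°.
Proof.
move=> [_ pos _] [A [cA As Ab]]; apply: connected_between cA As _.
move=> p /interior_subset[b /= bi pb].
by apply: closureS (bar_sub_closure (pos _ bi) pb) => q qb; apply: Ab; exists b.
Qed.

(** Touching without overlap means a common corner. Moving diagonally from it into the row of the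
    lower bar, but away from that bar, leads to points that no bar covers. *)
Lemma corner_not_interior bs b c p : bars_valid bs -> b \in bs -> c \in bs -> b <> c -> ~~ overlap b c ->
  @bar_set R b p -> @bar_set R c p -> ~ (@bars_set R bs)^° p.
Proof.
move=> val bi ci bc nov pb pc; have [_ pos ap] := val.
have tbc := bars_meet_touch (ap _ _ bi ci bc) pb pc.
wlog yy : b c bi ci bc nov pb pc tbc / c.1.2 = b.1.2 + 1.
move=> W; have [[_ yy]|[_ yy]] := touch_level tbc; last exact: (W b c).
by apply: (W c b) => //; [move=> e; exact: bc|rewrite overlap_sym|rewrite touch_sym].
have xx := touch_corner tbc nov.
have b0 : 1 <= b.2%:R :> R by rewrite ler1n; exact: pos.
have c0 : 1 <= c.2%:R :> R by rewrite ler1n; exact: pos.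
have yR : c.1.2%:~R = b.1.2%:~R + 1 :> R by rewrite yy intrD.
move/bar_setE: (pb) => [p1 p2]; move/bar_setE: (pc) => [q1 q2].
move=> /nbhs_ballP[e /= e0 He].
(* With a shift of at most 1/4, a bar covering the shifted point would be within 1/2 of [b] and so
   touch [b], although it lies in the same row. *)
pose s : R := Num.min (1 / 4) (e / 2).
have s0 : 0 < s by rewrite lt_min; apply/andP; split; lra.
have s1 : s <= 1 / 4 by rewrite ge_min lexx.
have se : s < e by rewrite gt_min; apply/orP; right; lra.
have no_cover (q : plane) : `|p.1 - q.1| = s -> `|p.2 - q.2| = s -> b.1.2%:~R < q.2 < b.1.2%:~R + 1 ->
   ~ @bar_set R b q -> False.
move=> d1 d2 qy nb; have [] : @bars_set R bs q.
by apply: He; rewrite -ball_normE /= norm_pair_lt /= d1 d2 se.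
move=> d /= di qd; have db : b <> d by move=> e'; apply: nb; rewrite e'.
have t : touch b d by apply: (near_touch (ap _ _ bi di db) pb qd); rewrite norm_pair_lt /= d1 d2; lra.
move/bar_setE: qd => [_ qd2].
have h1 : d.1.2%:~R < b.1.2%:~R + 1 :> R by lra.
have h2 : b.1.2%:~R < d.1.2%:~R + 1 :> R by lra.
exact: touch_same_row t (lez_intr h1) (lez_intr h2).
have py : p.2 = b.1.2%:~R + 1 by lra.
case: xx => xx.
have xR : b.1.1%:~R = c.1.1%:~R + c.2%:R :> R by rewrite xx intrD -pmulrn.
apply: (no_cover (p.1 - s, p.2 - s)) => /=; rewrite ?subKr ?gtr0_norm //; first by lra.
move=> /bar_setE[/andP[h _] _]; have {}h : b.1.1%:~R <= p.1 - s := h.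
have pl : p.1 <= b.1.1%:~R by rewrite xR; case/andP: q1.
by move: h; rewrite lerBrDr => h; have := le_trans h pl; rewrite gerDl leNgt s0.
have xR : c.1.1%:~R = b.1.1%:~R + b.2%:R :> R by rewrite xx intrD -pmulrn.
apply: (no_cover (p.1 + s, p.2 - s)) => /=; rewrite ?subKr ?opprD ?addNKr ?normrN ?gtr0_norm //; first by lra.
move=> /bar_setE[/andP[_ h] _]; have {}h : p.1 + s <= b.1.1%:~R + b.2%:R := h.
have pl : b.1.1%:~R + b.2%:R <= p.1 by rewrite -xR; case/andP: q1.
by have := le_trans h pl; rewrite gerDl leNgt s0.
Qed.

(** The two families cut the interior into relatively closed parts, disjoint because a common point
    would be a corner as in [corner_not_interior]. *)
Lemma split_not_connected bs (P : pred bar) : bars_valid bs ->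
  (forall b c, b \in bs -> c \in bs -> P b -> ~~ P c -> ~~ overlap b c) ->
  has P bs -> has (predC P) bs -> ~ connected (@bars_set R bs)^°.
Proof.
move=> val nov hP hN; have [_ pos _] := val.
pose E (i : bool) := (@bars_set R bs)^° `&` @bars_set R [seq b <- bs | P b == i].
have cover p : @bars_set R bs p -> @bars_set R [seq b <- bs | P b == false] p \/ @bars_set R [seq b <- bs | P b == true] p.
by move=> [b /= bi pb]; case Pb : (P b); [right|left]; exists b; rewrite //= mem_filter Pb.
have disj p : (@bars_set R bs)^° p -> @bars_set R [seq b <- bs | P b == false] p ->
    @bars_set R [seq b <- bs | P b == true] p -> False.
move=> ip [b /=]; rewrite mem_filter => /andP[/eqP Pb bi] pb [c /=].
rewrite mem_filter => /andP[/eqP Pc ci] pc.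
apply: (@corner_not_interior bs c b p) ip => //; first by move=> e; rewrite e Pb in Pc.
by apply: nov; rewrite ?Pb ?Pc.
have clE i : closure (E i) `<=` @bars_set R [seq b <- bs | P b == i].
apply: subset_trans (closureS (@subIsetr _ _ _)) _.
by have /closure_id {2}-> := @closed_bars R [seq b <- bs | P b == i].
move=> /connectedP/(_ E); apply; split.
have inner b : b \in bs -> exists p, bar_inner b p.
move=> /pos; rewrite -(ltr0n R) => h; exists (b.1.1%:~R + b.2%:R / 2, b.1.2%:~R + 1 / 2).
by rewrite /bar_inner /open_box /=; lra.
case.
have /hasP[b bi Pb] := hP; have [p pb] := inner b bi; exists p; split.
by apply: interior_bars_sub; exists b.
by exists b; [rewrite /= mem_filter Pb|exact: bar_inner_sub].
have /hasP[b bi /= /negbTE Pb] := hN; have [p pb] := inner b bi; exists p; split.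
by apply: interior_bars_sub; exists b.
by exists b; [rewrite /= mem_filter Pb|exact: bar_inner_sub].
apply/seteqP; split=> [p ip|p [[]|[]] //].
by case: (cover p (interior_subset ip)) => h; [left|right].
rewrite /separated; split; apply/seteqP; split=> // p [].
by move=> /clE h [ip h']; exact: disj ip h h'.
by move=> [ip h'] /clE h; exact: disj ip h' h.
Qed.

Definition grow (bs S : seq bar) : seq bar := [seq b <- bs | (b \in S) || has (overlap b) S].
Definition overlap_connected (bs : seq bar) : bool :=
  size (iter (size bs) (grow bs) (take 1 bs)) == size bs.

Lemma interior_connected_bars bs : bs <> [::] -> bars_valid bs ->
  connected (@bars_set R bs)^° <-> overlap_connected bs.
Proof.
move=> nz val; have [ubs pos _] := val; rewrite /overlap_connected.
pose S n := iter n (grow bs) (take 1 bs).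
have sub n : (forall b, b \in S n -> b \in bs) by case: n => [|n] b /=; [exact: mem_take|rewrite mem_filter => /andP[]].
have memS n b : (b \in S n.+1) = ((b \in S n) || has (overlap b) (S n)) && (b \in bs).
by rewrite /= mem_filter.
have mono n b : b \in S n -> b \in S n.+1 by move=> bS; rewrite /= mem_filter bS (sub n).
have [b0 b0S] : exists b, b \in S 0%N by rewrite /S /=; case: (bs) nz => // b l _; exists b; rewrite /= take0 inE eqxx.
have b0n n : b0 \in S n by elim: n => // n; exact: mono.
have uS n : uniq (S n) by case: n => [|n] /=; [exact: take_uniq|exact: filter_uniq].
have jn n : joined bs (S n).
elim: n => [|n IH].
rewrite /S /=; case: (bs) nz (@joined1 bs) => // b l _ /=; rewrite take0; apply; exact: mem_head.
apply: (joined_grow val (sub n) _ _ IH); first by move=> e; have := b0n n; rewrite e.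
move=> b; rewrite /= mem_filter => /andP[/orP[bS|ov] bi]; [by left|by right].
split=> [cn|/eqP sz]; last first.
apply: (joined_connected val); have [A [cA As Ab]] := jn (size bs); exists A; split=> //.
move=> p [b /= bi pb]; apply: Ab; exists b => //=.
have := uniq_min_size (uS (size bs)) (fun b h => sub _ b h); rewrite sz leqnn => /(_ isT)[_ ->] //.
(* Every round gains a bar until the search is stable, so after [size bs] rounds it must be
   stable. *)
have fix_or n : (n < size (S n))%N \/ S n.+1 =i S n.
elim: n => [|n [IH|IH]].
by left; rewrite /S /=; case: (bs) nz.
have [e|ne] := eqVneq (size (S n.+1)) (size (S n)).
right; have e1 : S n.+1 =i S n.
have := uniq_min_size (uS n) (@mono n); rewrite e leqnn => /(_ isT)[_ h] b; exact/esym/h.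
by move=> b; rewrite [RHS]memS [LHS]memS e1 (eq_has_r e1).
left; apply: leq_ltn_trans IH _; rewrite ltn_neqAle eq_sym ne.
by apply: uniq_leq_size (uS n) _; exact: mono.
by right=> b; rewrite [RHS]memS [LHS]memS IH (eq_has_r IH).
have {}fix_or : S (size bs).+1 =i S (size bs).
case: (fix_or (size bs)) => // h; exfalso; move: h; rewrite ltnNge => /negP; apply.
by apply: uniq_leq_size (uS _) _; exact: sub.
rewrite eqn_leq; apply/andP; split; first by apply: uniq_leq_size (uS _) _; exact: sub.
apply: uniq_leq_size ubs _ => b bi; apply: contraT => bN; exfalso.
apply: (@split_not_connected bs (mem (S (size bs))) val) cn => /=.
move=> c d ci di cS; apply: contra => ov; rewrite -fix_or /= mem_filter di andbT.
by apply/orP; right; apply/hasP; exists c => //; rewrite overlap_sym.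
by apply/hasP; exists b0; [exact: (sub 0%N)|exact: b0n].
by apply/hasP; exists b.
Qed.

End Interior.

(** * Tilings and cells *)

Definition tile_cells (u : square * tile) : seq square :=
  [seq (u.1.1 + i%:Z, u.1.2 + j%:Z) | i <- iota 0 u.2.1, j <- iota 0 u.2.2].

Lemma mem_tile_cells u c : (c \in tile_cells u) =
  [&& u.1.1 <= c.1, c.1 < u.1.1 + u.2.1%:Z, u.1.2 <= c.2 & c.2 < u.1.2 + u.2.2%:Z].
Proof.
apply/allpairsP/idP => [[[i j] /= [iw jh ->]] /=|].
  by move: iw jh; rewrite !mem_iota; lia.
case: u c => [[a b] [w h]] [x y] /= H; exists (`|x - a|%N, `|y - b|%N); rewrite /= !mem_iota.
by split; [lia|lia|congr pair; lia].
Qed.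

Lemma uniq_tile_cells u : uniq (tile_cells u).
Proof. by apply: allpairs_uniq; rewrite ?iota_uniq // => -[i j] [i' j'] _ _ [? ?]; congr pair; lia. Qed.

Section Cells.
Variable R : realType.
Notation plane := (R * R)%type.

Definition center (c : square) : plane := (c.1%:~R + 1 / 2, c.2%:~R + 1 / 2).

Lemma center_in (a x : int) (w : nat) :
  (a%:~R <= x%:~R + (1 / 2 : R) <= a%:~R + w%:R) = (a <= x) && (x < a + w%:Z).
Proof.
apply/idP/idP => [/andP[h1 h2]|/andP[]].
  have h3 : a%:~R < x%:~R + 1 :> R by lra.
  have h4 : x%:~R < (a + w%:Z)%:~R :> R by rewrite intrD -pmulrn; lra.
  by rewrite (lez_intr h3) /=; move: h4; rewrite ltr_int.
rewrite -(ler_int R) -lezD1 -(ler_int R) !intrD -pmulrn => h1 h2; lra.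
Qed.

Lemma center_rectangle c u : (0 < u.2.1)%N -> (0 < u.2.2)%N ->
  @rectangle R u.1 u.2 (center c) <-> c \in tile_cells u.
Proof.
move=> _ _; rewrite mem_tile_cells /rectangle /= !in_itv /= !center_in.
by split=> [[/andP[-> ->] /andP[-> ->]]|/and4P[-> -> -> ->]].
Qed.

Lemma center_square c d : @unit_square R d (center c) <-> c = d.
Proof.
rewrite /unit_square (@center_rectangle c (d, (1, 1)%N)) // mem_tile_cells /=.
by case: c d => [x y] [x' y'] /=; split=> [h|[-> ->]]; [congr pair; lia|lia].
Qed.

Lemma center_union s c : @union_of_squares R s (center c) <-> c \in s.
Proof.
split=> [[d /= ds /center_square -> //]|cs].
by exists c => //; exact/center_square.
Qed.

(** The bounds are half-open so that the floors of the two coordinates name a cell of the rectangle;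
    two tiles with a common interior point then share a cell. *)
Lemma interior_rectangle (u : square * tile) p : (@rectangle R u.1 u.2)^° p ->
  (u.1.1%:~R <= p.1 < u.1.1%:~R + u.2.1%:R) /\ (u.1.2%:~R <= p.2 < u.1.2%:~R + u.2.2%:R).
Proof.
move=> /nbhs_ballP[e /= e0 He].
have e2 : 0 < e / 2 by rewrite divr_gt0.
have se : `|e / 2| < e by rewrite gtr0_norm //; lra.
have [h1 h2] : @rectangle R u.1 u.2 (p.1 + e / 2, p.2 + e / 2).
  by apply: He; rewrite -ball_normE /= norm_pair_lt /= !opprD !addNKr !normrN se.
have [h3 h4] : @rectangle R u.1 u.2 p by apply: He; exact: ballxx.
move: h1 h2 h3 h4; rewrite /= !in_itv /= => /andP[_ h1] /andP[_ h2] /andP[h3 _] /andP[h4 _].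
by rewrite h3 h4 /=; split; [apply: lt_le_trans h1|apply: lt_le_trans h2]; rewrite ltrDl.
Qed.

Lemma center_interior c u : c \in tile_cells u -> (@rectangle R u.1 u.2)^° (center c).
Proof.
rewrite mem_tile_cells => /and4P[h1 h2 h3 h4].
move: h1 h2 h3 h4; rewrite -!lezD1 -!(ler_int R) !intrD -!pmulrn => h1 h2 h3 h4.
apply: (@filterS _ _ _ (open_box c.1%:~R (c.1%:~R + 1) c.2%:~R (c.2%:~R + 1))).
  by move=> q [q1 q2]; split; rewrite /= in_itv /=; lra.
apply: open_nbhs_nbhs; split; first exact: open_open_box.
by rewrite /open_box /center /=; lra.
Qed.

Lemma floor_cell (x : R) (a : int) (w : nat) : a%:~R <= x < a%:~R + w%:R ->
  a <= Num.floor x < a + w%:Z.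
Proof.
move=> /andP[h1 h2]; rewrite -(ler_int R) floor_ge_int in_itv ?h1 // || idtac.
have f1 := floor_le x; have f2 := lt_succ_floor x.
have h3 : a%:~R < (Num.floor x)%:~R + 1 :> R by apply: le_lt_trans h1 _; rewrite -intrD1.
rewrite (lez_intr h3) /= -(ltr_int R) intrD -pmulrn.
exact: le_lt_trans f1 h2.
Qed.

Lemma rectangle_cells (u : square * tile) p : (0 < u.2.1)%N -> (0 < u.2.2)%N ->
  @rectangle R u.1 u.2 p <-> exists2 c, c \in tile_cells u & @unit_square R c p.
Proof.
move=> w0 h0; split=> [|[c]]; last first.
  rewrite mem_tile_cells => /and4P[h1 h2 h3 h4] [].
  move: h1 h2 h3 h4; rewrite -!lezD1 -!(ler_int R) !intrD -!pmulrn /= !in_itv /= => h1 h2 h3 h4 c1 c2.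
  by split; rewrite /= in_itv /=; lra.
have coord (x : R) (a : int) (w : nat) : (0 < w)%N -> a%:~R <= x <= a%:~R + w%:R ->
    exists2 z : int, a <= z < a + w%:Z & z%:~R <= x <= z%:~R + 1.
  move=> wp /andP[h1]; rewrite le_eqVlt => /orP[/eqP h2|h2].
    exists (a + w%:Z - 1); first by lia.
    rewrite intrB intrD -pmulrn h2; apply/andP; split; lra.
  have fc : a <= Num.floor x < a + w%:Z by apply: floor_cell; rewrite h1.
  exists (Num.floor x) => //; rewrite floor_le /=; apply: ltW.
  by have := lt_succ_floor x; rewrite intrD.
case=> /=; rewrite !in_itv /= => /(coord _ _ _ w0)[x xw xp] /(coord _ _ _ h0)[y yh yp].
exists (x, y); first by rewrite mem_tile_cells /=; move/andP: xw => [-> ->].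
by split; rewrite /= in_itv.
Qed.

(** Centres of cells test which rectangles cover a cell, and floors of interior points produce a
    common cell of overlapping rectangles; this leaves a purely combinatorial notion. *)
Lemma is_tilingP (T : {fset tile}) s (P : {fset square * tile}) :
  (forall t : tile, t \in T -> is_tile t) ->
  is_tiling T (@union_of_squares R s) P <->
  [/\ forall u, u \in P -> u.2 \in T,
      forall u v c, u \in P -> v \in P -> c \in tile_cells u -> c \in tile_cells v -> u = v &
      forall c, c \in s <-> exists2 u, u \in P & c \in tile_cells u].
Proof.
move=> posT; split=> -[PT dis cov]; split=> //.
- move=> u v c uP vP cu cv; apply: contrapT => uv.
  have : (interior (@rectangle R u.1 u.2) `&` interior (@rectangle R v.1 v.2)) (center c).
    by split; exact: center_interior.
  by rewrite dis.
- move=> c; rewrite -center_union -cov; split=> [[u /= uP]|[u uP cu]].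
    by have [? ?] := posT _ (PT _ uP); move/center_rectangle => h; exists u => //; exact: h.
  by exists u => //; have [? ?] := posT _ (PT _ uP); exact/center_rectangle.
- move=> u v uP vP uv; apply/seteqP; split=> // p [/interior_rectangle[u1 u2] /interior_rectangle[v1 v2]].
  apply: uv; apply: (dis u v (Num.floor p.1, Num.floor p.2)) => //; rewrite mem_tile_cells /=.
    by move/floor_cell: u1; move/floor_cell: u2 => -> /andP[-> ->].
  by move/floor_cell: v1; move/floor_cell: v2 => -> /andP[-> ->].
- apply/seteqP; split=> p.
    move=> [u /= uP]; have [w0 h0] := posT _ (PT _ uP).
    move/(rectangle_cells _ w0 h0) => [c cu cp]; exists c => //=.
    by apply/cov; exists u.
  move=> [c /= /cov[u uP cu] cp]; exists u => //.
  by have [w0 h0] := posT _ (PT _ uP); apply/(rectangle_cells _ w0 h0); exists c.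
Qed.

Lemma nb_tilings_card (T : {fset tile}) s (D : finType) (A : pred D) (F : D -> {fset square * tile}) :
  {in A &, injective F} -> (forall a, A a -> is_tiling T (@union_of_squares R s) (F a)) ->
  (forall P, is_tiling T (@union_of_squares R s) P -> exists2 a, A a & F a = P) ->
  nb_tilings R T s = #|A|.
Proof.
move=> injF FA AF; rewrite /nb_tilings.
have -> : fset_set [set P | is_tiling T (@union_of_squares R s) P] = [fset F a | a in A]%fset.
  apply/fsetP => P; rewrite in_fset_set; last exact: finite_tilings.
  apply/idP/imfsetP => [|[a /= aA ->]].
    by rewrite inE => /AF[a aA <-]; exists a.
  by rewrite inE; exact: FA.
by rewrite card_in_imfset /= ?cardE // => a b aA bA; exact: injF.
Qed.

End Cells.

(** * Cutting a list of squares into maximal bars *)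

Definition run_length (s : seq square) (c : square) : nat :=
  find (fun i : nat => (c.1 + i%:Z, c.2) \notin s) (iota 0 (size s).+1).

Definition run_starts (s : seq square) : seq square :=
  [seq c <- s | ~~ has (fun d : square => (d.1 + 1 == c.1) && (d.2 == c.2)) s].

Definition bars_of (s : seq square) : seq bar := [seq (c, run_length s c) | c <- run_starts s].

Lemma run_startE s (c : square) : (c \in run_starts s) = (c \in s) && ((c.1 - 1, c.2) \notin s).
Proof.
rewrite mem_filter andbC; congr (_ && ~~ _); apply/hasP/idP => [[[x y] ds /= /andP[/eqP h1 /eqP h2]]|cs].
  by rewrite (_ : (c.1 - 1, c.2) = (x, y)) //; congr pair; lia.
by exists (c.1 - 1, c.2) => //=; rewrite subrK !eqxx.
Qed.

Lemma row_pigeonhole (s : seq square) (f : nat -> square) : injective f ->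
  exists2 i, (i <= size s)%N & f i \notin s.
Proof.
move=> injf; apply: contrapT => no.
have : (size (map f (iota 0 (size s).+1)) <= size s)%N.
  apply: uniq_leq_size; first by rewrite map_inj_uniq ?iota_uniq.
  move=> c /mapP[i]; rewrite mem_iota /= add0n ltnS => ile ->; apply: contraT => ni.
  by case: no; exists i.
by rewrite size_map size_iota ltnn.
Qed.

(** Among [(size s).+1] consecutive positions one is missing from [s], so the search of [run_length]
    succeeds within its range. *)
Lemma run_lengthP s c : (c.1 + (run_length s c)%:Z, c.2) \notin s /\
  forall i, (i < run_length s c)%N -> (c.1 + i%:Z, c.2) \in s.
Proof.
have [|i0 ile ni] := @row_pigeonhole s (fun i => (c.1 + i%:Z, c.2)).
  by move=> i j [?]; lia.
have hs : has (fun i : nat => (c.1 + i%:Z, c.2) \notin s) (iota 0 (size s).+1).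
  by apply/hasP; exists i0; rewrite ?mem_iota.
have lt : (run_length s c < (size s).+1)%N by move: hs; rewrite has_find size_iota.
split; first by have := nth_find 0%N hs; rewrite nth_iota.
move=> i il; have := before_find 0%N il; rewrite nth_iota; last exact: ltn_trans il lt.
by rewrite add0n => /negbFE.
Qed.

Lemma in_run s (c : square) (x : int) : c.1 <= x -> x < c.1 + (run_length s c)%:Z -> (x, c.2) \in s.
Proof.
have [_ rc] := run_lengthP s c; case: c rc => a b /= rc h1 h2.
have e : a + `|x - a|%N%:Z = x by lia.
by rewrite -e; apply: rc; lia.
Qed.

Lemma run_apart s (c d : square) : (d.1 - 1, d.2) \notin s -> c.2 = d.2 -> c.1 < d.1 ->
  c.1 + (run_length s c)%:Z < d.1.
Proof.
move=> dn yy lt; rewrite ltNge; apply/negP => le; move/negP: dn; apply.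
by rewrite -yy; apply: in_run; lia.
Qed.

Lemma bars_of_valid s : uniq s -> bars_valid (bars_of s).
Proof.
move=> us; split.
- by rewrite map_inj_uniq ?filter_uniq // => c d [].
- move=> b /mapP[c]; rewrite run_startE => /andP[cs _] -> /=.
  have [nr _] := run_lengthP s c; case: (run_length s c) nr => //.
  by rewrite addr0 -surjective_pairing cs.
move=> b b' /mapP[c]; rewrite run_startE => /andP[cs cn] -> /mapP[d]; rewrite run_startE => /andP[ds dn] -> bc.
have {}bc : c <> d by move=> e; apply: bc; rewrite e.
rewrite /bar_apart /= => yy.
have neq : c.1 != d.1.
  by apply/eqP => xx; apply: bc; rewrite (surjective_pairing c) xx yy -surjective_pairing.
have [lt|lt] := orP (lt_total neq); [left|right]; exact: run_apart.
Qed.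

Lemma bars_of_cells s (c : square) : (c \in s) <-> exists2 b, b \in bars_of s & c \in tile_cells (b.1, (b.2, 1%N)).
Proof.
split=> [cs|[b /mapP[d _ ->]]]; last first.
  rewrite mem_tile_cells /= => /and4P[h1 h2 h3 h4]; have := in_run h1 h2.
  by case: d c {h1 h2} h3 h4 => [dx dy] [cx cy] /= h3 h4; rewrite (_ : dy = cy) //; lia.
have [|i0 ile ni] := @row_pigeonhole s (fun i => (c.1 - i%:Z, c.2)).
  by move=> i j [?]; lia.
have ex : exists i, (c.1 - i%:Z, c.2) \notin s by exists i0.
(* [k] is the distance to the first missing square on the left of [c], so the run containing [c]
   starts at distance [k.-1]. *)
have [k nk mink] := ex_minnP ex.
have k0 : (0 < k)%N by case: k nk {mink} => //; rewrite subr0 -surjective_pairing cs.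
have ins i : (i < k)%N -> (c.1 - i%:Z, c.2) \in s.
  by move=> ik; apply: contraT => /mink; rewrite leqNgt ik.
pose d : square := (c.1 - (k.-1)%:Z, c.2).
have dst : d \in run_starts s.
  rewrite run_startE ins /=; last by lia.
  by rewrite (_ : c.1 - _ - 1 = c.1 - k%:Z) //; lia.
exists (d, run_length s d); first exact: map_f.
have [nr _] := run_lengthP s d; rewrite mem_tile_cells /=.
have kr : (k.-1 < run_length s d)%N.
  rewrite ltnNge; apply/negP => le; move/negP: nr; apply.
  rewrite (_ : d.1 + _ = c.1 - (k.-1 - run_length s d)%N%:Z); last by rewrite /=; lia.
  by apply: ins; lia.
by lia.
Qed.

(** A successful pruning removes one bar, so [size] rounds exhaust all leaves. The empty list is
    rejected because no bar remains. *)
Definition region_test (s : seq square) : bool :=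
  [&& uniq s, size (iter (size (bars_of s)) prune (bars_of s)) == 1%N & overlap_connected (bars_of s)].

Section RegionTest.
Variable R : realType.

Lemma bars_of_union s : uniq s -> @union_of_squares R s = @bars_set R (bars_of s).
Proof.
move=> us; have [_ pos _] := bars_of_valid us.
apply/seteqP; split=> p.
  move=> [c /= /bars_of_cells[b bi cb] cp]; exists b => //.
  by apply: (proj2 (@rectangle_cells R (b.1, (b.2, 1%N)) p (pos b bi) isT)); exists c.
move=> [b /= bi bp]; have b0 := pos b bi.
have [c cb cp] := proj1 (@rectangle_cells R (b.1, (b.2, 1%N)) p b0 isT) bp.
by exists c => //=; apply/bars_of_cells; exists b.
Qed.

Lemma region_testP s : simply_connected_region R s <-> region_test s.
Proof.
rewrite /simply_connected_region /is_region /region_test; split.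
  move=> [[us cn] sc]; have val := bars_of_valid us; move: cn sc; rewrite bars_of_union // => cn sc.
  rewrite us; have /eqP h := proj1 (simply_connected_bars R val) sc; rewrite h /=.
  apply/(interior_connected_bars R _ val) => // e; move: h; rewrite e.
  by [].
move=> /and3P[us /eqP h oc]; have val := bars_of_valid us; rewrite bars_of_union //; split; last first.
  exact/simply_connected_bars.
split=> //; apply/(interior_connected_bars R _ val) => // e; move: h; rewrite e.
by [].
Qed.

End RegionTest.

Local Close Scope ring_scope.
Local Close Scope classical_set_scope.

(** * Arithmetic and parsing in polynomial time *)

Definition bits_value (w : seq bool) : nat := foldr (fun (b : bool) n => b + n.*2) 0 w.

Definition canonical_bits (w : seq bool) : bool := last true w.

Lemma bits_of_positiveP p : bits_value (bits_of_positive p) = nat_of_pos p /\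
  canonical_bits (bits_of_positive p) /\ bits_of_positive p != [::].
Proof.
rewrite /canonical_bits; elim: p => [p [h1 [h2 h3]]|p [h1 [h2 h3]]|] //=; rewrite h1 NatTrec.doubleE ?add1n ?add0n.
  by split=> //; split=> //; case: (bits_of_positive p) h2.
by split=> //; split=> //; case: (bits_of_positive p) h2 h3.
Qed.

Lemma bits_valueK n : bits_value (bits n) = n.
Proof.
rewrite -{2}(bin_of_natK n) /bits; case: (bin_of_nat n) => [|p] //=.
by have [] := bits_of_positiveP p.
Qed.

Lemma canonical_bits_bits n : canonical_bits (bits n).
Proof. by rewrite /bits; case: (bin_of_nat n) => [|p] //=; have [_ []] := bits_of_positiveP p. Qed.

Lemma bits_value_canonical w : canonical_bits w -> bits (bits_value w) = w.
Proof.
move=> cw; have [->//|nz] := eqVneq w [::].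
have [p <-] : exists p, bits_of_positive p = w.
  elim: w cw nz => // b [|c w] IH cw _.
    by exists BinNums.xH; case: b cw.
  have [p <-] := IH cw isT.
  by exists (if b then BinNums.xI p else BinNums.xO p); case: b {cw}.
have [-> _] := bits_of_positiveP p.
by rewrite /bits -[nat_of_pos p]/(nat_of_bin (BinNums.Npos p)) nat_of_binK.
Qed.

(** Addition of a carry [c] for [k = true] and subtraction of a borrow [c] for [k = false]; both
    travel past the bits equal to [k], the least significant bit being first. *)
Fixpoint ripple (k c : bool) (w : seq bool) : seq bool :=
  if w is b :: w' then (c (+) b) :: ripple k (c && (b == k)) w' else if c && k then [:: true] else [::].

Lemma ripple_inc c w : bits_value (ripple true c w) = bits_value w + c /\
  (canonical_bits w -> canonical_bits (ripple true c w)).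
Proof.
rewrite /canonical_bits; elim: w c => [|b w IH] [] //=.
- have [h1 h2] := IH (true && (b == true)); rewrite h1; split; first by case: b {IH h1 h2} => /=; lia.
  case: w IH h1 h2 => [|b' w] IH h1 h2 //=; first by case: b {IH h1 h2}.
- have [h1 h2] := IH false; rewrite h1; split; first by lia.
  case: w IH h1 h2 => [|b' w] IH h1 h2 //=.
Qed.

Definition strip_false (w : seq bool) : seq bool := if head true w then w else behead w.

(** Decrementing a canonical word leaves at most one zero at the most significant end, so stripping
    a single one restores canonicity. *)
Definition decr (w : seq bool) : seq bool := rev (strip_false (rev (ripple false true w))).

Lemma ripple_false0 w : ripple false false w = w.
Proof. by elim: w => //= b w ->; case: b. Qed.

Lemma rev_strip w : rev (strip_false (rev w)) = if last true w then w else take (size w).-1 w.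
Proof.
elim/last_ind: w => [|w b _] //; rewrite rev_rcons last_rcons /strip_false /=.
by case: b; [rewrite rev_cons revK|rewrite revK size_rcons /= -cats1 take_size_cat].
Qed.

Lemma decrP w : canonical_bits w -> w != [::] ->
  bits_value (decr w) = (bits_value w).-1 /\ canonical_bits (decr w).
Proof.
rewrite /decr rev_strip /canonical_bits.
elim: w => // b [|c w] IH cw _; first by case: b cw.
have [h1 h2] := IH cw isT; case: b {cw} (cw : is_true (last true (c :: w))) => cw.
  have -> : ripple false true [:: true, c & w] = [:: false, c & w].
    by rewrite -[in RHS](ripple_false0 (c :: w)).
  have -> : last true [:: false, c & w] = true by exact: cw.
  by split.
have -> : ripple false true [:: false, c & w] = true :: ripple false true (c :: w) by [].
set r := ripple false true (c :: w) in h1 h2 *.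
have tk : take (size (true :: r)).-1 (true :: r) = true :: take (size r).-1 r by [].
rewrite tk.
have -> : last true (true :: r) = last true r by [].
have V : bits_value (false :: c :: w) = (bits_value (c :: w)).*2 by [].
have Vp : 0 < bits_value (c :: w).
  rewrite lt0n; apply/negP => /eqP z; have := bits_value_canonical (cw : canonical_bits (c :: w)).
  by rewrite z.
have V2 u : bits_value (true :: u) = (bits_value u).*2.+1 by [].
by rewrite V; case: (last true r) h1 h2 => h1 h2; rewrite V2 h1; split=> //; lia.
Qed.

(** Sign and binary magnitude, since coordinates in the input can be exponential in its length. *)
Canonical int_encType := EncType (fun z : int => encode (Order.lt z 0%R, bits (absz z))).

Lemma encode_int_tree_inj : injective (@encode int_encType).
Proof.
move=> z z' /(encode_pair_inj encode_bool_inj (encode_seq_inj encode_bool_inj)) [sz /bits_inj az].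
by rewrite (intEsign z) (intEsign z') sz az.
Qed.

Section Linear.
Variables (A X S : encType).

Lemma csize_foldl (f : S -> X -> S) c z l :
  (forall s x, csize (f s x) <= csize s + c * csize x + c) ->
  csize (foldl f z l) <= csize z + 2 * c * csize l.
Proof.
move=> Hf; elim: l z => [|x l IH] z /=; first by rewrite leq_addr.
apply: leq_trans (IH _) _; have := Hf z x; rewrite csize_cons; lia.
Qed.

(** A step that adds to the state at most a linear function of the list item keeps all partial
    results linear in the code of the list, as [ptime_foldl] demands. *)
Lemma ptime_foldl_add (f : A -> S -> X -> S) (z : A -> S) (l : A -> seq X) c :
  ptime (fun p : A * S * X => f p.1.1 p.1.2 p.2) -> ptime z -> ptime l ->
  (forall a s x, csize (f a s x) <= csize s + c * csize x + c) ->
  ptime (fun a => foldl (f a) (z a) (l a)).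
Proof.
move=> Pf Pz Pl Hf; have [hz [pz mz Hz]] := ptime_growth Pz; have [hl [pl ml Hl]] := ptime_growth Pl.
apply: (ptime_foldl (b := fun n => hz n + 2 * c * hl n)) => //.
  by apply: poly_boundedD => //; apply: poly_boundedM => //; exact: poly_boundedC.
move=> a i; apply: leq_trans (csize_foldl _ _ (Hf a)) _.
by apply: leq_add => //; rewrite leq_mul2l (leq_trans (csize_take _ _)) ?orbT.
Qed.

Lemma ptime_iter_add (f : A -> S -> S) (n : A -> nat) (z : A -> S) c :
  ptime (fun p : A * S => f p.1 p.2) -> ptime n -> ptime z ->
  (forall a s, csize (f a s) <= csize s + c) -> ptime (fun a => iter (n a) (f a) (z a)).
Proof.
move=> Pf Pn Pz Hf; have [hz [pz mz Hz]] := ptime_growth Pz; have [hn [pn mn Hn]] := ptime_growth Pn.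
apply: (ptime_iter (b := fun m => hz m + hn m * c)) => //.
  by apply: poly_boundedD => //; apply: poly_boundedM => //; exact: poly_boundedC.
move=> a i ile; apply: (@leq_trans (csize (z a) + i * c)).
  elim: i {ile} => [|i IH] /=; first by rewrite leq_addr.
  by have := Hf a (iter i (f a) (z a)); lia.
apply: leq_add => //; rewrite leq_mul2r; apply/orP; right; apply: leq_trans ile _.
by apply: leq_trans (Hn a); rewrite csize_nat; lia.
Qed.

End Linear.

Section Find.
Variables (A X : encType).

Lemma ptime_find (f : A -> X -> bool) (l : A -> seq X) :
  ptime (fun p : A * X => f p.1 p.2) -> ptime l -> ptime (fun a => find (f a) (l a)).
Proof.
move=> Pf Pl.
pose st a (s : bool * nat) x := if s.1 then s else if f a x then (true, s.2) else (false, s.2.+1).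
have E a s m : foldl (st a) (s, m) (l a) = if s then (true, m) else (has (f a) (l a), m + find (f a) (l a)).
  elim: (l a) s m => [|x r IH] s m /=; first by case: s; rewrite ?addn0.
  by rewrite /st /= -/(st a); case: s => /=; rewrite ?IH //; case: (f a x); rewrite /= ?IH ?addn0 ?addnS.
apply: (ptime_ext (f := fun a => (foldl (st a) (false, 0) (l a)).2)); first by move=> a; rewrite E.
apply: ptime1 ptime_snd _; apply: (ptime_foldl_add (f := st) (z := fun=> (false, 0)) (c := 3)) => //.
- have P1 : ptime (fun p : A * (bool * nat) * X => p.1.2) by exact: ptime1 ptime_snd ptime_fst.
  have P2 : ptime (fun p : A * (bool * nat) * X => p.1.2.1) by exact: ptime1 ptime_fst P1.
  have P3 : ptime (fun p : A * (bool * nat) * X => p.1.2.2) by exact: ptime1 ptime_snd P1.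
  apply: (ptime_if P2 P1); apply: ptime_if.
  + by apply: (ptime2 Pf _ ptime_snd); exact: ptime1 ptime_fst ptime_fst.
  + by apply: ptime_pair P3; exact: ptime_const.
  + by apply: ptime_pair; [exact: ptime_const|exact: ptime1 ptime_succ P3].
- exact: ptime_const.
- move=> a [s m] x; rewrite /st /=; have := csize_gt0 x; have := csize_bool s; have := csize_gt0 s.
  by case: s => /=; [lia|case: (f a x); rewrite !csize_pair !csize_nat => ? ? ?; have := csize_bool true; lia].
Qed.

Lemma csize_filter (p : X -> bool) (l : seq X) : csize [seq x <- l | p x] <= csize l.
Proof. by elim: l => //= x l IH; case: ifP => _; rewrite !csize_cons; lia. Qed.

End Find.

Lemma ptime_ripple k : ptime (fun p : bool * seq bool => ripple k p.1 p.2).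
Proof.
pose st (s : bool * seq bool) b := (s.1 && (b == k), (s.1 (+) b) :: s.2).
pose fin (s : bool * seq bool) := rev (if s.1 && k then true :: s.2 else s.2).
have E c w acc : fin (foldl st (c, acc) w) = rev acc ++ ripple k c w.
  elim: w c acc => [|b w IH] c acc /=; first by rewrite /fin /=; case: ifP; rewrite ?cats0 // rev_cons cats1.
  by rewrite IH rev_cons cat_rcons.
apply: (ptime_ext (f := fun p => fin (foldl st (p.1, [::]) p.2))); first by move=> p; rewrite E.
have bb : ptime (fun p : bool * bool => p.1 (+) p.2).
  apply: (ptime_ext (f := fun p => if p.1 then ~~ p.2 else p.2)); first by case=> -[] [].
  by apply: (ptime_if ptime_fst _ ptime_snd); exact: ptime1 ptime_negb ptime_snd.
have bk : ptime (fun b : bool => b == k).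
  case: k {st fin E}.
    by apply: (ptime_ext (f := id)); [case|exact: ptime_id].
  by apply: (ptime_ext (f := negb)); [case|exact: ptime_negb].
apply: ptime1.
  apply: ptime1 (@ptime_rev _) _; apply: ptime_if.
  - by apply: (ptime2 ptime_and ptime_fst); exact: ptime_const.
  - by apply: (ptime2 (@ptime_cons _) _ ptime_snd); exact: ptime_const.
  - exact: ptime_snd.
apply: (ptime_foldl_add (f := fun=> st) (c := 4)).
- have P1 : ptime (fun p : (bool * seq bool) * (bool * seq bool) * bool => p.1.2) by exact: ptime1 ptime_snd ptime_fst.
  apply: ptime_pair.
    by apply: (ptime2 ptime_and); [exact: ptime1 ptime_fst P1|exact: ptime1 bk ptime_snd].
  apply: (ptime2 (@ptime_cons _)); last exact: ptime1 ptime_snd P1.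
  by apply: (ptime2 bb _ ptime_snd); exact: ptime1 ptime_fst P1.
- by apply: ptime_pair ptime_fst _; exact: ptime_const.
- exact: ptime_snd.
- move=> _ [c w] b; rewrite /st !csize_pair csize_cons /=.
  have := csize_bool (c && (b == k)); have := csize_bool (c (+) b); have := csize_gt0 b.
  have := csize_gt0 c; lia.
Qed.

Lemma ptime_decr : ptime decr.
Proof.
apply: ptime1 (@ptime_rev _) _.
have P : ptime (fun w => rev (ripple false true w)).
  by apply: ptime1 (@ptime_rev _) _; apply: (ptime2 (ptime_ripple false) _ ptime_id); exact: ptime_const.
apply: (ptime1 _ P).
by apply: ptime_if; [exact: ptime_head|exact: ptime_id|exact: ptime_behead].
Qed.

Lemma ptime_isnil (X : encType) : ptime (fun l : seq X => nilp l).
Proof.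
apply: (ptime_ext (f := fun l => size l == 0)); first by case.
by apply: (ptime2 ptime_eqn); [exact: ptime_size|exact: ptime_const].
Qed.

Lemma ptime_int_next : ptime (fun z : int => (z + 1)%R).
Proof.
pose g (r : bool * seq bool) : bool * seq bool :=
  if r.1 then (~~ nilp (decr r.2), decr r.2) else (false, ripple true true r.2).
have Pg : ptime g.
  apply: (ptime_if ptime_fst); apply: ptime_pair.
  - by apply: ptime1 ptime_negb _; apply: ptime1 (@ptime_isnil _) _; exact: ptime1 ptime_decr ptime_snd.
  - exact: ptime1 ptime_decr ptime_snd.
  - exact: ptime_const.
  - by apply: (ptime2 (ptime_ripple true) _ ptime_snd); exact: ptime_const.
have Pr : ptime (fun z : int => (Order.lt z 0%R, bits (absz z))) by exact: ptime_recode_id.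
apply: (ptime_recode _ (ptime1 Pg Pr)) => z.
change (encode (g (Order.lt z 0%R, bits (absz z))) = encode (Order.lt (z + 1)%R 0%R, bits (absz (z + 1)%R))).
congr (encode _).
rewrite /g /=; case: (ltrP z 0%R) => z0 /=.
  have nz : bits (absz z) != [::] by apply/eqP => e; have := bits_valueK (absz z); rewrite e /=; lia.
  have [h1 h2] := decrP (canonical_bits_bits (absz z)) nz.
  have e : decr (bits (absz z)) = bits (absz (z + 1)%R).
    by rewrite -(bits_value_canonical h2) h1 bits_valueK; congr bits; lia.
  rewrite e; congr pair; apply/idP/idP => [h|h].
    rewrite ltNge; apply/negP => h0; move/negP: h; apply.
    by rewrite (_ : absz (z + 1)%R = 0) //; lia.
  by apply/negP => /nilP e0; have := bits_valueK (absz (z + 1)%R); rewrite e0 /=; lia.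
have [h1 h2] := ripple_inc true (bits (absz z)).
have -> : Order.lt (z + 1)%R 0%R = false by lia.
congr pair; rewrite -(bits_value_canonical (h2 (canonical_bits_bits _))) h1 bits_valueK.
by congr bits; lia.
Qed.

Lemma size_bits_next (z : int) : size (bits (absz (z + 1)%R)) <= (size (bits (absz z))).+1.
Proof.
have sr k c w : size (ripple k c w) <= (size w).+1.
  by elim: w c => [|b w IH] c /=; [case: ifP|rewrite ltnS].
have sd w : size (decr w) <= (size w).+1.
  rewrite /decr size_rev (leq_trans _ (sr false true w)) // -[size (ripple _ _ _)]size_rev.
  by rewrite /strip_false; case: ifP => // _; rewrite size_behead leq_pred.
case: (ltrP z 0%R) => z0.
  have nz : bits (absz z) != [::] by apply/eqP => e; have := bits_valueK (absz z); rewrite e /=; lia.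
  have [h1 h2] := decrP (canonical_bits_bits (absz z)) nz.
  have -> : absz (z + 1)%R = bits_value (decr (bits (absz z))) by rewrite h1 bits_valueK; lia.
  by rewrite bits_value_canonical.
have [h1 h2] := ripple_inc true (bits (absz z)).
have -> : absz (z + 1)%R = bits_value (ripple true true (bits (absz z))).
  by rewrite h1 bits_valueK; lia.
by rewrite bits_value_canonical //; apply: h2; exact: canonical_bits_bits.
Qed.

Lemma csize_int (z : int) : size (bits (absz z)) <= csize z <= 4 * size (bits (absz z)) + 5.
Proof.
have -> : csize z = csize (Order.lt z 0%R, bits (absz z)) by [].
have h (w : seq bool) : size w < csize w <= 4 * size w + 1.
  by rewrite size_le_csize /=; elim: w => // b w IH; rewrite csize_cons /=; have := csize_bool b; lia.
rewrite csize_pair; have := h (bits (absz z)); have := csize_bool (Order.lt z 0%R).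
by move: (csize (Order.lt z 0%R)) (csize (bits _)) (size _) => a b n; lia.
Qed.

Lemma int_iter (z : int) i : iter i (fun z : int => (z + 1)%R) z = (z + Posz i)%R.
Proof. by elim: i => [|i IH] /=; rewrite ?addr0 // IH; lia. Qed.

(** The second summand is in unary, so repeated increments are affordable. *)
Lemma ptime_int_add : ptime (fun p : int * nat => (p.1 + Posz p.2)%R).
Proof.
apply: (ptime_ext (f := fun p => iter p.2 (fun z : int => (z + 1)%R) p.1)).
  by move=> p; rewrite int_iter.
apply: (ptime_iter (S := int_encType) (f := fun _ (z : int) => (z + 1)%R) (n := snd) (z := fst) (b := fun n => 8 * n + 5)).
- exact: ptime1 ptime_int_next ptime_snd.
- exact: ptime_snd.
- exact: ptime_fst.
- by pb.
move=> [z n] i /= ile; have sz : size (bits (absz (iter i (fun z : int => (z + 1)%R) z))) <= size (bits (absz z)) + i.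
  elim: i {ile} => [|i IH] /=; first by rewrite addn0.
  by apply: leq_trans (size_bits_next _) _; rewrite addnS ltnS.
have /andP[_ h] := csize_int (iter i (fun z : int => (z + 1)%R) z).
have /andP[h' _] := csize_int z.
by rewrite csize_pair csize_nat; lia.
Qed.

Lemma ptime_eqb (A : encType) (E : eqType) (u : A -> E) : injective u -> injective (@encode A) ->
  ptime (fun p : A * A => u p.1 == u p.2).
Proof.
move=> iu ie; apply: (ptime_ext (f := fun p : A * A => `[< p.1 = p.2 >])); last exact: ptime_eq.
by move=> [a b] /=; apply/asboolP/eqP => [->|/iu].
Qed.

Lemma encode_square_inj : injective (@encode (int * int)%type).
Proof. exact: encode_pair_inj encode_int_tree_inj encode_int_tree_inj. Qed.

Lemma ptime_int_eq : ptime (fun p : int * int => p.1 == p.2).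
Proof. by apply: (ptime_eqb (u := fun z : int => z)) => //; exact: encode_int_tree_inj. Qed.

Lemma ptime_square_eq : ptime (fun p : (int * int) * (int * int) => p.1 == p.2).
Proof. by apply: (ptime_eqb (u := fun z : int * int => z)) => //; exact: encode_square_inj. Qed.

Lemma ptime_string_eq : ptime (fun p : seq bool * seq bool => p.1 == p.2).
Proof.
by apply: (ptime_eqb (u := fun z : seq bool => z)) => //; exact: encode_seq_inj encode_bool_inj.
Qed.

Lemma ptime_delimited : ptime delimited.
Proof.
apply: (ptime2 (@ptime_cat _)); last exact: ptime_const.
apply: ptime1 (@ptime_flatten _) _; apply: (ptime_map (f := fun _ b => [:: b; b]) _ ptime_id).
have c1 : ptime (fun p : seq bool * bool => [:: p.2]).
  by apply: (ptime2 (@ptime_cons _) ptime_snd); exact: ptime_const.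
exact: ptime2 (@ptime_cons _) ptime_snd c1.
Qed.

Lemma ptime_encode_int : ptime encode_int.
Proof.
apply: (ptime1 ptime_delimited).
have P : ptime (fun z : int => (Order.lt z 0%R, bits (absz z))) by exact: ptime_recode_id.
exact: ptime2 (@ptime_cons _) (ptime1 ptime_fst P) (ptime1 ptime_snd P).
Qed.

Lemma ptime_encode_squares : ptime encode_squares.
Proof.
apply: ptime1 (@ptime_flatten _) _.
apply: (ptime_map (f := fun _ (c : int * int) => encode_int c.1 ++ encode_int c.2) _ ptime_id).
apply: (ptime2 (@ptime_cat _)); apply: (ptime1 ptime_encode_int).
  exact: ptime1 ptime_fst ptime_snd.
exact: ptime1 ptime_snd ptime_snd.
Qed.

(* [[:: a]] is a pending first half of a doubled bit, [cur] and [done] are read backwards. *)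
Definition parse_step (s : seq bool * (seq bool * seq (seq bool))) (b : bool) :
    seq bool * (seq bool * seq (seq bool)) :=
  let: (pending, (cur, done)) := s in
  if pending is a :: _ then
    if a == b then ([::], (a :: cur, done)) else ([::], ([::], rev cur :: done))
  else ([:: b], (cur, done)).

Definition parse_words (w : seq bool) : seq (seq bool) :=
  rev (foldl parse_step ([::], ([::], [::])) w).2.2.

Lemma parse_wordsK ws : parse_words (flatten (map delimited ws)) = ws.
Proof.
have P w cur done r : foldl parse_step ([::], (cur, done)) (delimited w ++ r) =
    foldl parse_step ([::], ([::], rev (rev w ++ cur) :: done)) r.
  rewrite /delimited; elim: w cur => [|b w IH] cur /=; first by [].
  by rewrite eqxx IH rev_cons cat_rcons.
suff H done : foldl parse_step ([::], ([::], done)) (flatten (map delimited ws)) = ([::], ([::], rev ws ++ done)).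
  by rewrite /parse_words H cats0 revK.
elim: ws done => //= w ws IH done.
by rewrite P IH cats0 revK rev_cons cat_rcons.
Qed.

Definition split_step (s : seq bool * (seq bool * (bool * seq bool))) (b : bool) :
    seq bool * (seq bool * (bool * seq bool)) :=
  let: (pending, (cur, (over, rest))) := s in
  if over then (pending, (cur, (over, b :: rest))) else
  if pending is a :: _ then
    if a == b then ([::], (a :: cur, (false, rest))) else ([::], (cur, (true, rest)))
  else ([:: b], (cur, (false, rest))).

Definition split_pair (w : seq bool) : seq bool * seq bool :=
  let s := foldl split_step ([::], ([::], (false, [::]))) w in (rev s.2.1, rev s.2.2.2).

Lemma split_pairK x y : split_pair (string_pair x y) = (x, y).
Proof.
have Q p c r w : foldl split_step (p, (c, (true, r))) w = (p, (c, (true, rev w ++ r))).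
  by elim: w r => //= b w IH r; rewrite IH rev_cons cat_rcons.
have P cur : foldl split_step ([::], (cur, (false, [::]))) (string_pair x y) =
    ([::], (rev x ++ cur, (true, rev y))).
  rewrite /string_pair /delimited; elim: x cur => [|b x IH] cur /=; first by rewrite Q cats0.
  by rewrite eqxx IH rev_cons cat_rcons.
by rewrite /split_pair P /= cats0 !revK.
Qed.

Lemma ptime_parse_words : ptime parse_words.
Proof.
apply: ptime1 (@ptime_rev _) _; apply: ptime1 ptime_snd _; apply: ptime1 ptime_snd _.
pose ST := (seq bool * (seq bool * seq (seq bool)))%type.
have Ps : ptime (fun p : ST * bool => p.1) by exact: ptime_fst.
have Pp : ptime (fun p : ST * bool => p.1.1) by exact: ptime1 ptime_fst ptime_fst.
have Pc : ptime (fun p : ST * bool => p.1.2.1) by exact: ptime1 ptime_fst (ptime1 ptime_snd ptime_fst).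
have Pd : ptime (fun p : ST * bool => p.1.2.2) by exact: ptime1 ptime_snd (ptime1 ptime_snd ptime_fst).
have Ph : ptime (fun p : ST * bool => head true p.1.1) by exact: ptime1 (ptime_head true) Pp.
have Nn (X : encType) : ptime (fun p : ST * bool => [::] : seq X) by exact: ptime_const.
have Pb : ptime (fun p : ST * bool => p.2) by exact: ptime_snd.
have eqb2 : ptime (fun p : ST * bool => head true p.1.1 == p.2).
  apply: (ptime2 (g := fun a b : bool => a == b) _ Ph Pb).
  by apply: (ptime_eqb (u := fun z : bool => z)) => //; exact: encode_bool_inj.
pose stp (p : ST * bool) : ST := if nilp p.1.1 then ([:: p.2], (p.1.2.1, p.1.2.2)) else
  if head true p.1.1 == p.2 then ([::], (head true p.1.1 :: p.1.2.1, p.1.2.2))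
  else ([::], ([::], rev p.1.2.1 :: p.1.2.2)).
have Pst : ptime stp.
  apply: ptime_if; first exact: ptime1 (@ptime_isnil _) Pp.
    by apply: ptime_pair; [exact: ptime2 (@ptime_cons _) Pb (Nn _)|exact: ptime_pair].
  apply: (ptime_if eqb2); apply: ptime_pair => //; apply: ptime_pair => //.
    exact: ptime2 (@ptime_cons _) Ph Pc.
  exact: ptime2 (@ptime_cons _) (ptime1 (@ptime_rev _) Pc) Pd.
have stE s b : parse_step s b = stp (s, b) by case: s => -[|a ?] [cur dn].
apply: (ptime_ext (f := fun w => foldl (fun s b => stp (s, b)) ([::], ([::], [::])) w)).
  by move=> w; congr foldl; apply: boolp.funext => s; apply: boolp.funext => b; rewrite stE.
apply: (ptime_foldl_add (f := fun (_ : seq bool) s b => stp (s, b)) (c := 10)).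
- apply: (ptime1 Pst); apply: ptime_pair ptime_snd; exact: ptime1 ptime_snd ptime_fst.
- exact: ptime_const.
- exact: ptime_id.
move=> _ [p [c dn] ] b; rewrite /stp /=; have := csize_gt0 b; have := csize_bool b.
have := csize_gt0 p; case: p => [|a p] /=.
  by rewrite !csize_pair csize_cons !csize_nil; lia.
have := csize_bool a; rewrite !csize_pair csize_cons.
by case: ifP => _; rewrite !csize_pair !csize_cons ?csize_nil ?csize_rev; lia.
Qed.

Lemma ptime_split_pair : ptime split_pair.
Proof.
pose ST := (seq bool * (seq bool * (bool * seq bool)))%type.
have Pp : ptime (fun p : ST * bool => p.1.1) by exact: ptime1 ptime_fst ptime_fst.
have Pc : ptime (fun p : ST * bool => p.1.2.1) by exact: ptime1 ptime_fst (ptime1 ptime_snd ptime_fst).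
have Pd : ptime (fun p : ST * bool => p.1.2.2) by exact: ptime1 ptime_snd (ptime1 ptime_snd ptime_fst).
have Po : ptime (fun p : ST * bool => p.1.2.2.1) by exact: ptime1 ptime_fst Pd.
have Pr : ptime (fun p : ST * bool => p.1.2.2.2) by exact: ptime1 ptime_snd Pd.
have Ph : ptime (fun p : ST * bool => head true p.1.1) by exact: ptime1 (ptime_head true) Pp.
have Nn (X : encType) : ptime (fun p : ST * bool => [::] : seq X) by exact: ptime_const.
have Pb : ptime (fun p : ST * bool => p.2) by exact: ptime_snd.
have eqb2 : ptime (fun p : ST * bool => head true p.1.1 == p.2).
  apply: (ptime2 (g := fun a b : bool => a == b) _ Ph Pb).
  by apply: (ptime_eqb (u := fun z : bool => z)) => //; exact: encode_bool_inj.
pose stp (p : ST * bool) : ST :=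
  if p.1.2.2.1 then (p.1.1, (p.1.2.1, (true, p.2 :: p.1.2.2.2))) else
  if nilp p.1.1 then ([:: p.2], (p.1.2.1, (false, p.1.2.2.2))) else
  if head true p.1.1 == p.2 then ([::], (head true p.1.1 :: p.1.2.1, (false, p.1.2.2.2)))
  else ([::], (p.1.2.1, (true, p.1.2.2.2))).
have Pst : ptime stp.
  have cb (b : bool) : ptime (fun p : ST * bool => b) by exact: ptime_const.
  have cr (b : bool) : ptime (fun p : ST * bool => (b, p.1.2.2.2)) by exact: ptime_pair (cb b) Pr.
  apply: (ptime_if Po).
    apply: (ptime_pair Pp); apply: (ptime_pair Pc); apply: (ptime_pair (cb true)).
    exact: ptime2 (@ptime_cons _) Pb Pr.
  apply: ptime_if; first exact: ptime1 (@ptime_isnil _) Pp.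
    by apply: ptime_pair; [exact: ptime2 (@ptime_cons _) Pb (Nn _)|exact: ptime_pair Pc (cr false)].
  apply: (ptime_if eqb2); apply: (ptime_pair (Nn _)); last exact: ptime_pair Pc (cr true).
  by apply: ptime_pair (cr false); exact: ptime2 (@ptime_cons _) Ph Pc.
have stE s b : split_step s b = stp (s, b) by case: s => -[|a ?] [cur [[] dn]].
have PF : ptime (fun w => foldl (fun s b => stp (s, b)) ([::], ([::], (false, [::]))) w).
  apply: (ptime_foldl_add (f := fun (_ : seq bool) s b => stp (s, b)) (c := 12)).
  - apply: (ptime1 Pst); apply: ptime_pair ptime_snd; exact: ptime1 ptime_snd ptime_fst.
  - exact: ptime_const.
  - exact: ptime_id.
  move=> _ [p [c [ov dn]]] b; rewrite /stp /=; have := csize_gt0 b; have := csize_bool b.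
  have := csize_bool true; have := csize_bool false; have := csize_gt0 ov; have := csize_gt0 p.
  case: ov => /=; first by rewrite !csize_pair csize_cons; lia.
  case: p => [|a p] /=; first by rewrite !csize_pair csize_cons !csize_nil; lia.
  have := csize_bool a; rewrite !csize_pair csize_cons.
  by case: ifP => _; rewrite !csize_pair ?csize_cons ?csize_nil; lia.
apply: (ptime_ext (f := fun w => let s := foldl (fun s b => stp (s, b)) ([::], ([::], (false, [::]))) w in (rev s.2.1, rev s.2.2.2))).
  have E l st : foldl (fun s b => stp (s, b)) st l = foldl split_step st l.
    by elim: l st => // b l IH st; rewrite [LHS]/= IH [RHS]/= stE.
  by move=> w; rewrite /split_pair /= E.
apply: ptime_pair; apply: ptime1 (@ptime_rev _) _.
  exact: ptime1 ptime_fst (ptime1 ptime_snd PF).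
exact: ptime1 ptime_snd (ptime1 ptime_snd (ptime1 ptime_snd PF)).
Qed.

(** Words that represent no integer must get a value as well: a magnitude that is not canonical
    counts as 0, and zero never gets a sign. The code of the result can then be read off the
    word. *)
Definition int_of_word (w : seq bool) : int :=
  let bs := if canonical_bits (behead w) && ~~ nilp (behead w) then behead w else [::] in
  if head false w && ~~ nilp bs then (- Posz (bits_value bs))%R else Posz (bits_value bs).

Lemma int_of_wordK z : int_of_word (Order.lt z 0%R :: bits (absz z)) = z.
Proof.
rewrite /int_of_word /= canonical_bits_bits /=.
have e : (if ~~ nilp (bits (absz z)) then bits (absz z) else [::]) = bits (absz z).
  by case: (bits (absz z)).
rewrite e bits_valueK; case: (ltrP z 0%R) => z0 /=; last by lia.
case: nilP => [n0|_]; last by rewrite /=; lia.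
by have := bits_valueK (absz z); rewrite n0 /=; lia.
Qed.

Lemma ptime_int_of_word : ptime int_of_word.
Proof.
pose bs (w : seq bool) := if canonical_bits (behead w) && ~~ nilp (behead w) then behead w else [::].
have Pl : ptime canonical_bits.
  apply: (ptime_ext (f := fun w => head true (rev w))).
    by move=> w; rewrite /canonical_bits; elim/last_ind: w => // w b _; rewrite rev_rcons last_rcons.
  exact: ptime1 (ptime_head true) (@ptime_rev _).
have Pn : ptime (fun w : seq bool => ~~ nilp w) by exact: ptime1 ptime_negb (@ptime_isnil _).
have Pb : ptime bs.
  apply: ptime_if; last exact: ptime_const.
    exact: ptime2 ptime_and (ptime1 Pl (@ptime_behead _)) (ptime1 Pn (@ptime_behead _)).
  exact: ptime_behead.
apply: (ptime_recode (f := fun w => (head false w && ~~ nilp (bs w), bs w))); last first.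
  by apply: (ptime_pair _ Pb); apply: (ptime2 ptime_and (ptime_head false)); exact: ptime1 Pn Pb.
move=> w; have cb : canonical_bits (bs w) by rewrite /bs; case: ifP => // /andP[].
change (encode (head false w && ~~ nilp (bs w), bs w) =
  encode (Order.lt (int_of_word w) 0%R, bits (absz (int_of_word w)))).
congr (encode _); rewrite /int_of_word -/(bs w); case: ifP => h; last first.
  by rewrite [absz _]/= bits_value_canonical //; congr pair; lia.
have nz : bits_value (bs w) <> 0.
  by move=> z; have := bits_value_canonical cb; rewrite z => e; move: h; rewrite -e andbF.
rewrite (_ : absz _ = bits_value (bs w)); last by lia.
by rewrite bits_value_canonical //; congr pair; lia.
Qed.

Section Pointwise.
Variable A : encType.

Lemma ptime_addz (f : A -> int) (n : A -> nat) : ptime f -> ptime n -> ptime (fun a => (f a + Posz (n a))%R).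
Proof. by move=> Pf Pn; exact: (ptime2 (g := fun (z : int) (k : nat) => (z + Posz k)%R) ptime_int_add Pf Pn). Qed.

End Pointwise.

(** * Tilings are counted in #P *)

Lemma eq_ptime (A B : encType) (f g : A -> B) : ptime f -> f =1 g -> ptime g.
Proof. by move=> Pf fg; exact: ptime_ext fg Pf. Qed.

Lemma hasMem (E : eqType) (c : E) s : has (fun d => d == c) s = (c \in s).
Proof. by apply/hasP/idP => [[d ds /eqP <-]|cs] //; exists c. Qed.

Section Uniq.
Variables (A : encType) (E : eqType).

Lemma uniq_count (s : seq E) : uniq s = all (fun c => size [seq d <- s | d == c] <= 1) s.
Proof.
apply/idP/allP => [us c cs|H]; first by rewrite size_filter count_uniq_mem ?cs.
apply: count_mem_uniq => c; case: (boolP (c \in s)) => cs; last exact/count_memPn.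
apply/eqP; rewrite eqn_leq -size_filter H //= size_filter -has_count hasMem.
exact: cs.
Qed.

End Uniq.

Lemma ptime_mem_square : ptime (fun p : (int * int) * seq (int * int) => p.1 \in p.2).
Proof.
apply: eq_ptime; last by move=> p; exact: hasMem.
apply: (ptime_has (f := fun (p : (int * int) * seq (int * int)) (d : int * int) => d == p.1) _ ptime_snd).
exact: ptime2 ptime_square_eq ptime_snd (ptime1 ptime_fst ptime_fst).
Qed.

Lemma ptime_in_squares (A : encType) (f : A -> int * int) (s : A -> seq (int * int)) :
  ptime f -> ptime s -> ptime (fun a => f a \in s a).
Proof. by move=> Pf Ps; exact: (ptime2 (g := fun (c : int * int) (l : seq (int * int)) => c \in l) ptime_mem_square Pf Ps). Qed.

Lemma ptime_uniq_square : ptime (fun s : seq (int * int) => uniq s).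
Proof.
apply: eq_ptime; last by move=> s; rewrite uniq_count.
apply: (ptime_all (f := fun (s : seq (int * int)) (c : int * int) => size [seq d <- s | d == c] <= 1) _ ptime_id).
apply: (ptime2 ptime_leq); last exact: ptime_const.
apply: ptime1 (@ptime_size _) _.
apply: (ptime_filter (f := fun (p : seq (int * int) * (int * int)) (d : int * int) => d == p.2) _ ptime_fst).
exact: ptime2 ptime_square_eq ptime_snd (ptime1 ptime_snd ptime_fst).
Qed.

Lemma ptime_run_length : ptime (fun p : seq (int * int) * (int * int) => run_length p.1 p.2).
Proof.
pose AA := (seq (int * int) * (int * int))%type.
apply: (ptime_find (f := fun (p : AA) (i : nat) => ((p.2.1 + Posz i)%R, p.2.2) \notin p.1)
  (l := fun p => iota 0 (size p.1).+1)).
  apply: ptime1 ptime_negb _; apply: ptime_in_squares; last exact: ptime1 ptime_fst ptime_fst.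
  have P2 : ptime (fun p : AA * nat => p.1.2) by exact: ptime1 ptime_snd ptime_fst.
  apply: ptime_pair; last exact: ptime1 ptime_snd P2.
  exact: ptime_addz (ptime1 ptime_fst P2) ptime_snd.
apply: (ptime2 ptime_iota); first exact: ptime_const.
exact: ptime1 ptime_succ (ptime1 (@ptime_size _) ptime_fst).
Qed.

Lemma ptime_bars_of : ptime (fun s : seq (int * int) => bars_of s).
Proof.
apply: (ptime_map (f := fun s c => (c, run_length s c)) (l := run_starts)).
  exact: ptime_pair ptime_snd ptime_run_length.
apply: (ptime_filter (f := fun s (c : int * int) => ~~ has (fun d : int * int => ((d.1 + 1)%R == c.1) && (d.2 == c.2)) s) _ ptime_id).
apply: ptime1 ptime_negb _.
apply: (ptime_has (f := fun (p : seq (int * int) * (int * int)) (d : int * int) =>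
  ((d.1 + 1)%R == p.2.1) && (d.2 == p.2.2)) _ ptime_fst).
have P2 : ptime (fun p : seq (int * int) * (int * int) * (int * int) => p.1.2) by exact: ptime1 ptime_snd ptime_fst.
apply: (ptime2 ptime_and).
  exact: ptime2 ptime_int_eq (ptime1 ptime_int_next (ptime1 ptime_fst ptime_snd)) (ptime1 ptime_fst P2).
exact: ptime2 ptime_int_eq (ptime1 ptime_snd ptime_snd) (ptime1 ptime_snd P2).
Qed.

Notation eBar := ((int * int) * nat)%type.

Lemma has_offset (x y : int) n : has (fun i => (y + Posz i)%R == x) (iota 0 n) =
  Order.le y x && Order.lt x (y + Posz n)%R.
Proof.
apply/hasP/idP => [[i]|h]; first by rewrite mem_iota => h /eqP <-; lia.
by exists (absz (x - y)%R); rewrite ?mem_iota; lia.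
Qed.

Definition adjacent_rows (b c : eBar) : bool :=
  (b.1.2 == (c.1.2 + 1)%R) || (c.1.2 == (b.1.2 + 1)%R).

Lemma ptime_adjacent_rows : ptime (fun p : eBar * eBar => adjacent_rows p.1 p.2).
Proof.
have Y1 : ptime (fun p : eBar * eBar => p.1.1.2) by exact: ptime1 ptime_snd (ptime1 ptime_fst ptime_fst).
have Y2 : ptime (fun p : eBar * eBar => p.2.1.2) by exact: ptime1 ptime_snd (ptime1 ptime_fst ptime_snd).
apply: (ptime2 ptime_or); apply: (ptime2 ptime_int_eq) => //; exact: ptime1 ptime_int_next _.
Qed.

Lemma ptime_has_offset : ptime (fun p : (int * int) * nat =>
  has (fun i => (p.1.2 + Posz i)%R == p.1.1) (iota 0 p.2)).
Proof.
apply: (ptime_has (f := fun (p : (int * int) * nat) (i : nat) => (p.1.2 + Posz i)%R == p.1.1)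
   (l := fun p => iota 0 p.2)); last first.
  by apply: (ptime2 ptime_iota) ptime_snd; exact: ptime_const.
have P1 : ptime (fun p : ((int * int) * nat) * nat => p.1.1) by exact: ptime1 ptime_fst ptime_fst.
apply: (ptime2 ptime_int_eq); last exact: ptime1 ptime_fst P1.
exact: ptime_addz (ptime1 ptime_snd P1) ptime_snd.
Qed.

(** Inequalities between binary integers are replaced by searching an equality over offsets bounded
    by a bar length, which is in unary. The value of [k] selects closed intervals for [touch] or
    half-open ones for [overlap]; the side conditions settle bars of length 0. *)
Lemma ptime_bar_relation (k : bool) : ptime (fun p : eBar * eBar =>
  adjacent_rows p.1 p.2 &&
  (has (fun i => (p.2.1.1 + Posz i)%R == p.1.1.1) (iota 0 (p.2.2 + k)) && ((0 < p.1.2 + k) || (p.1.1.1 != p.2.1.1)) ||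
   has (fun i => (p.1.1.1 + Posz i)%R == p.2.1.1) (iota 0 (p.1.2 + k)) && ((0 < p.2.2 + k) || (p.1.1.1 != p.2.1.1)))).
Proof.
have X1 : ptime (fun p : eBar * eBar => p.1.1.1) by exact: ptime1 ptime_fst (ptime1 ptime_fst ptime_fst).
have X2 : ptime (fun p : eBar * eBar => p.2.1.1) by exact: ptime1 ptime_fst (ptime1 ptime_fst ptime_snd).
have N1 : ptime (fun p : eBar * eBar => p.1.2 + k).
  by apply: (ptime2 ptime_add); [exact: ptime1 ptime_snd ptime_fst|exact: ptime_const].
have N2 : ptime (fun p : eBar * eBar => p.2.2 + k).
  by apply: (ptime2 ptime_add); [exact: ptime1 ptime_snd ptime_snd|exact: ptime_const].
have pos f : ptime f -> ptime (fun p : eBar * eBar => (0 < f p) || (p.1.1.1 != p.2.1.1)).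
  move=> Pf; apply: (ptime2 ptime_or); last exact: ptime1 ptime_negb (ptime2 ptime_int_eq X1 X2).
  by apply: (ptime2 ptime_leq) Pf; exact: ptime_const.
apply: (ptime2 ptime_and ptime_adjacent_rows); apply: (ptime2 ptime_or); apply: (ptime2 ptime_and).
- exact: ptime1 ptime_has_offset (ptime_pair (ptime_pair X1 X2) N2).
- exact: pos.
- exact: ptime1 ptime_has_offset (ptime_pair (ptime_pair X2 X1) N1).
- exact: pos.
Qed.

Lemma ptime_touch : ptime (fun p : eBar * eBar => touch p.1 p.2).
Proof.
apply: eq_ptime (ptime_bar_relation true) _ => -[[[x y] n] [[x' y'] n']] /=.
rewrite /touch /adjacent_rows /= !has_offset; lia.
Qed.

Lemma ptime_overlap : ptime (fun p : eBar * eBar => overlap p.1 p.2).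
Proof.
apply: eq_ptime (ptime_bar_relation false) _ => -[[[x y] n] [[x' y'] n']] /=.
rewrite /overlap /adjacent_rows /= !has_offset; lia.
Qed.

Lemma encode_bar_inj : injective (@encode eBar).
Proof. exact: encode_pair_inj encode_square_inj encode_nat_inj. Qed.

Lemma ptime_bar_eq : ptime (fun p : eBar * eBar => p.1 == p.2).
Proof. by apply: (ptime_eqb (u := fun z : eBar => z)) => //; exact: encode_bar_inj. Qed.

Lemma ptime_prune : ptime (fun bs : seq eBar => prune bs).
Proof.
apply: (ptime_list_case (l := fun bs : seq eBar => [seq b <- bs | count (touch b) bs == 1])
  (f := fun t : seq eBar * (eBar * seq eBar) => [seq c <- t.1 | c != t.2.1]) (g := id)).
- apply: (ptime_filter (f := fun (bs : seq eBar) (b : eBar) => count (touch b) bs == 1) _ ptime_id).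
  apply: (ptime2 ptime_eqn); last exact: ptime_const.
  apply: (ptime_ext (f := fun p : seq eBar * eBar => size [seq c <- p.1 | touch p.2 c])).
    by move=> p; rewrite size_filter.
  apply: ptime1 (@ptime_size _) _.
  apply: (ptime_filter (f := fun (p : seq eBar * eBar) (c : eBar) => touch p.2 c) _ ptime_fst).
  exact: ptime2 ptime_touch (ptime1 ptime_snd ptime_fst) ptime_snd.
- apply: (ptime_filter (f := fun (t : seq eBar * (eBar * seq eBar)) (c : eBar) => c != t.2.1) _ ptime_fst).
  apply: ptime1 ptime_negb _.
  exact: ptime2 ptime_bar_eq ptime_snd (ptime1 ptime_fst (ptime1 ptime_snd ptime_fst)).
- exact: ptime_id.
Qed.

Lemma csize_prune (bs : seq eBar) : csize (prune bs) <= csize bs.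
Proof. by rewrite /prune; case: [seq _ <- _ | _] => // b l; exact: csize_filter. Qed.

Lemma ptime_pruned : ptime (fun bs : seq eBar => iter (size bs) prune bs).
Proof.
apply: (ptime_iter (S := seq_encType (prod_encType _ _)) (f := fun _ => prune) (n := size) (z := id) (b := id)).
- exact: ptime1 ptime_prune ptime_snd.
- exact: ptime_size.
- exact: ptime_id.
- exact: poly_bounded_id.
move=> bs i _; elim: i => //= i IH; exact: leq_trans (csize_prune _) IH.
Qed.

Lemma ptime_overlap_connected : ptime (fun bs : seq eBar => overlap_connected bs).
Proof.
apply: (ptime2 ptime_eqn); last exact: ptime_size.
apply: ptime1 (@ptime_size _) _.
apply: (ptime_iter (S := seq_encType (prod_encType (prod_encType int_encType int_encType) nat_encType))
  (f := grow) (n := size) (z := take 1) (b := id)).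
- apply: (ptime_filter (f := fun (p : seq eBar * seq eBar) (b : eBar) => (b \in p.2) || has (overlap b) p.2) _ ptime_fst).
  have P2 : ptime (fun p : seq eBar * seq eBar * eBar => p.1.2) by exact: ptime1 ptime_snd ptime_fst.
  apply: (ptime2 ptime_or).
    apply: eq_ptime; last by move=> p; exact: hasMem.
    apply: (ptime_has (f := fun (p : seq eBar * seq eBar * eBar) (d : eBar) => d == p.2) _ P2).
    exact: ptime2 ptime_bar_eq ptime_snd (ptime1 ptime_snd ptime_fst).
  apply: (ptime_has (f := fun (p : seq eBar * seq eBar * eBar) (d : eBar) => overlap p.2 d) _ P2).
  exact: ptime2 ptime_overlap (ptime1 ptime_snd ptime_fst) ptime_snd.
- exact: ptime_size.
- apply: (ptime_ext (f := fun bs : seq eBar => if bs is b :: _ then [:: b] else [::])).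
    by case=> //= b l; rewrite take0.
  apply: (ptime_list_case (l := id) (f := fun t : seq eBar * (eBar * seq eBar) => [:: t.2.1]) (g := fun=> [::])).
  + exact: ptime_id.
  + by apply: (ptime2 (@ptime_cons _)); [exact: ptime1 ptime_fst ptime_snd|exact: ptime_const].
  + exact: ptime_const.
- exact: poly_bounded_id.
by move=> bs [|i] _ /=; [exact: csize_take|exact: csize_filter].
Qed.

Lemma ptime_region_test : ptime (fun s : seq (int * int) => region_test s).
Proof.
apply: (ptime2 ptime_and ptime_uniq_square); apply: (ptime2 ptime_and).
  apply: (ptime2 ptime_eqn); last exact: ptime_const.
  exact: ptime1 (@ptime_size _) (ptime1 ptime_pruned ptime_bars_of).
exact: ptime1 ptime_overlap_connected ptime_bars_of.
Qed.

(** * Checking a tiling given as a bit mask *)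

Section Verifier.
Variable T : seq tile.

Definition candidates (s : seq square) : seq (square * tile) := [seq (c, t) | c <- s, t <- T].

(** Distinct cells that lie in [s] and are as many as those of [s] fill it exactly. Asking the
    surplus bits of [y] to be zero gives each tiling a single witness of the prescribed length. *)
Definition cover_test (s : seq square) (y : seq bool) : bool :=
  let cells := flatten [seq tile_cells u | u <- mask y (candidates s)] in
  [&& uniq cells, all (fun c => c \in s) cells, size cells == size s & all negb (drop (size (candidates s)) y)].

Definition squares_of_word (x : seq bool) : seq square :=
  (foldl (fun (st : seq int * seq square) w => if st.1 is a :: _ then ([::], (a, int_of_word w) :: st.2)
     else ([:: int_of_word w], st.2)) ([::], [::]) (parse_words x)).2.

Definition decode_squares (x : seq bool) : seq square := rev (squares_of_word x).

(** Decoding accepts any word; the comparison with the re-encoded list rejects words that are not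
    the encoding of what they decode to. *)
Definition verifier (w : seq bool) : bool :=
  let: (x, y) := split_pair w in
  let s := decode_squares x in
  [&& encode_squares s == x, region_test s & cover_test s y].

Lemma decode_squaresK s : decode_squares (encode_squares s) = s.
Proof.
rewrite /decode_squares /squares_of_word.
have -> : encode_squares s = flatten (map delimited (flatten [seq [:: (Order.lt c.1 0%R) :: bits (absz c.1); (Order.lt c.2 0%R) :: bits (absz c.2)] | c : square <- s])).
  by rewrite /encode_squares; elim: s => //= c s ->; rewrite -catA.
rewrite parse_wordsK; set f := (fun _ _ => _).
suff H acc : foldl f ([::], acc) (flatten [seq [:: (Order.lt c.1 0%R) :: bits (absz c.1); (Order.lt c.2 0%R) :: bits (absz c.2)] | c : square <- s]) = ([::], rev s ++ acc).
  by rewrite H cats0 revK.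
have F2 acc' (a b : int) l : foldl f ([::], acc') (((Order.lt a 0%R) :: bits (absz a)) :: ((Order.lt b 0%R) :: bits (absz b)) :: l) =
    foldl f ([::], (a, b) :: acc') l.
  by rewrite /= {2}/f /= {1}/f /= !int_of_wordK.
by elim: s acc => // -[a b] s IH acc; rewrite [flatten _]/= F2 IH rev_cons cat_rcons.
Qed.

Lemma ptime_decode_squares : ptime decode_squares.
Proof.
apply: ptime1 (@ptime_rev _) _; apply: ptime1 ptime_snd _.
pose ST := (seq int * seq (int * int))%type.
apply: (ptime_ext (f := fun x => foldl (fun (st : ST) z => if st.1 is a :: _ then ([::], (a, z) :: st.2)
     else ([:: z], st.2)) ([::], [::]) (map int_of_word (parse_words x)))).
  by move=> x; elim: (parse_words x) ([::], [::]) => // w l IH st; rewrite [LHS]/= IH.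
apply: (ptime_foldl_add (A := seq_encType bool_encType) (X := int_encType)
   (f := fun _ (st : ST) z => if st.1 is a :: _ then ([::], (a, z) :: st.2) else ([:: z], st.2)) (c := 6)).
- have P1 : ptime (fun p : seq bool * ST * int => p.1.2.1) by exact: ptime1 ptime_fst (ptime1 ptime_snd ptime_fst).
  have P2 : ptime (fun p : seq bool * ST * int => p.1.2.2) by exact: ptime1 ptime_snd (ptime1 ptime_snd ptime_fst).
  apply: (ptime_list_case (l := fun p : seq bool * ST * int => p.1.2.1)
     (f := fun t => ([::], (t.2.1, t.1.2) :: t.1.1.2.2)) (g := fun p => ([:: p.2], p.1.2.2)) P1).
    apply: ptime_pair; first exact: ptime_const.
    apply: (ptime2 (@ptime_cons _)); last exact: ptime1 P2 ptime_fst.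
    exact: ptime_pair (ptime1 ptime_fst ptime_snd) (ptime1 ptime_snd ptime_fst).
  by apply: ptime_pair P2; apply: (ptime2 (@ptime_cons _) ptime_snd); exact: ptime_const.
- exact: ptime_const.
- apply: (ptime_map (f := fun _ w => int_of_word w) _ ptime_parse_words); exact: ptime1 ptime_int_of_word ptime_snd.
move=> _ [p l] z /=; have := csize_gt0 z; case: p => [|a p] /=.
  by rewrite !csize_pair csize_cons !csize_nil; lia.
by have := csize_gt0 p; rewrite !csize_pair !csize_cons csize_pair csize_nil; lia.
Qed.

Lemma mask_zip (E : Type) m (l : seq E) : mask m l = [seq p.2 | p <- [seq p <- zip m l | p.1]].
Proof. by elim: m l => [|b m IH] [|x l] //=; case: b; rewrite /= IH. Qed.

Lemma ptime_tile_cells : ptime (fun u : (int * int) * (nat * nat) => tile_cells u).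
Proof.
pose UU := ((int * int) * (nat * nat))%type.
apply: ptime1 (@ptime_flatten _) _.
apply: (ptime_map (f := fun (u : UU) (i : nat) => [seq ((u.1.1 + Posz i)%R, (u.1.2 + Posz j)%R) | j <- iota 0 u.2.2])
  (l := fun u => iota 0 u.2.1)); last first.
  by apply: (ptime2 ptime_iota); [exact: ptime_const|exact: ptime1 ptime_fst ptime_snd].
apply: (ptime_map (f := fun (p : UU * nat) (j : nat) => ((p.1.1.1 + Posz p.2)%R, (p.1.1.2 + Posz j)%R))
  (l := fun p => iota 0 p.1.2.2)); last first.
  by apply: (ptime2 ptime_iota); [exact: ptime_const|exact: ptime1 ptime_snd (ptime1 ptime_snd ptime_fst)].
have P1 : ptime (fun p : UU * nat * nat => p.1.1.1) by exact: ptime1 ptime_fst (ptime1 ptime_fst ptime_fst).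
apply: ptime_pair.
  exact: ptime_addz (ptime1 ptime_fst P1) (ptime1 ptime_snd ptime_fst).
exact: ptime_addz (ptime1 ptime_snd P1) ptime_snd.
Qed.

Lemma ptime_candidates : ptime (fun s : seq (int * int) => candidates s).
Proof.
apply: ptime1 (@ptime_flatten _) _.
apply: (ptime_map (f := fun (s : seq (int * int)) (c : int * int) => [seq (c, t) | t <- T]) _ ptime_id).
apply: (ptime_map (f := fun (p : seq (int * int) * (int * int)) (t : nat * nat) => (p.2, t)) (l := fun=> T)).
  exact: ptime_pair (ptime1 ptime_snd ptime_fst) ptime_snd.
exact: ptime_const.
Qed.

Lemma ptime_cover_test : ptime (fun p : seq (int * int) * seq bool => cover_test p.1 p.2).
Proof.
pose AA := (seq (int * int) * seq bool)%type.
have Pc : ptime (fun p : AA => candidates p.1) by exact: ptime1 ptime_candidates ptime_fst.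
have Pm : ptime (fun p : AA => mask p.2 (candidates p.1)).
  apply: eq_ptime; last by move=> p; rewrite mask_zip.
  apply: (ptime_map (f := fun (p : AA) (q : bool * (square * tile)) => q.2)
    (l := fun p => [seq q <- zip p.2 (candidates p.1) | q.1])); first exact: ptime1 ptime_snd ptime_snd.
  apply: (ptime_filter (f := fun (p : AA) (q : bool * (square * tile)) => q.1)
    (l := fun p => zip p.2 (candidates p.1))); first exact: ptime1 ptime_fst ptime_snd.
  exact: ptime2 (@ptime_zip _ _) ptime_snd Pc.
have Pf : ptime (fun p : AA => flatten [seq tile_cells u | u <- mask p.2 (candidates p.1)]).
  apply: ptime1 (@ptime_flatten _) _.
  apply: (ptime_map (f := fun (p : AA) (u : square * tile) => tile_cells u) _ Pm).
  exact: ptime1 ptime_tile_cells ptime_snd.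
apply: (ptime2 ptime_and); first exact: ptime1 ptime_uniq_square Pf.
apply: (ptime2 ptime_and).
  apply: (ptime_all (f := fun (p : AA) (c : square) => c \in p.1) _ Pf).
  exact: ptime_in_squares ptime_snd (ptime1 ptime_fst ptime_fst).
apply: (ptime2 ptime_and).
  exact: ptime2 ptime_eqn (ptime1 (@ptime_size _) Pf) (ptime1 (@ptime_size _) ptime_fst).
apply: (ptime_all (f := fun (p : AA) => negb)); first exact: ptime1 ptime_negb ptime_snd.
exact: ptime2 (@ptime_drop _) (ptime1 (@ptime_size _) Pc) ptime_snd.
Qed.

Lemma polytime_verifier : polytime (fun w => [:: verifier w]).
Proof.
apply: PF_polytime; apply: ptime_PF.
apply: (ptime2 (@ptime_cons _)); last exact: ptime_const.
apply: (ptime_ext (f := fun w => let s := decode_squares (split_pair w).1 in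
   [&& encode_squares s == (split_pair w).1, region_test s & cover_test s (split_pair w).2])).
  by move=> w; rewrite /verifier; case: (split_pair w).
have Px : ptime (fun w => (split_pair w).1) by exact: ptime1 ptime_fst ptime_split_pair.
have Ps : ptime (fun w => decode_squares (split_pair w).1) by exact: ptime1 ptime_decode_squares Px.
apply: (ptime2 ptime_and).
  exact: ptime2 ptime_string_eq (ptime1 ptime_encode_squares Ps) Px.
apply: (ptime2 ptime_and); first exact: ptime1 ptime_region_test Ps.
exact: ptime2 ptime_cover_test Ps (ptime1 ptime_snd ptime_split_pair).
Qed.

End Verifier.

Section FlattenMap.
Variables (E F : eqType) (f : E -> seq F).

Lemma uniq_flatten_map l : uniq l -> (forall u, u \in l -> uniq (f u)) ->
  (forall u v c, u \in l -> v \in l -> c \in f u -> c \in f v -> u = v) -> uniq (flatten (map f l)).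
Proof.
elim: l => //= u l IH /andP[ul ll] uf dis; rewrite cat_uniq uf ?mem_head //= IH //.
- rewrite andbT; apply/hasPn => c /flattenP[_ /mapP[v vl ->] cv]; apply/negP => cu.
  have e := dis u v c (mem_head _ _) (@mem_behead _ (u :: l) v vl) cu cv.
  by move: ul; rewrite e vl.
- by move=> v vl; apply: uf; rewrite inE vl orbT.
- by move=> v w c vl wl; apply: dis; rewrite inE ?vl ?wl orbT.
Qed.

Lemma flatten_map_disjoint l u v c : uniq (flatten (map f l)) -> u \in l -> v \in l ->
  c \in f u -> c \in f v -> u = v.
Proof.
elim: l => //= w l IH; rewrite cat_uniq => /and3P[_ /hasPn dis ul].
have no x : x \in l -> c \in f x -> c \in f w -> False.
  move=> xl cx cw; have /negP : c \notin f w; last exact.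
  by apply: dis; apply/flattenP; exists (f x) => //; exact: map_f.
rewrite !inE => /orP[/eqP ->|ul'] /orP[/eqP ->|vl'] //.
- by move=> cw cv; case: (no v).
- by move=> cu cw; case: (no u).
- exact: IH.
Qed.

Lemma mem_flatten_map l c : (c \in flatten (map f l)) <-> exists2 u, u \in l & c \in f u.
Proof.
split=> [/flattenP[_ /mapP[u ul ->] cu]|[u ul cu]]; first by exists u.
by apply/flattenP; exists (f u) => //; exact: map_f.
Qed.

End FlattenMap.

Lemma size_encode_squares s : size s <= size (encode_squares s).
Proof.
have pos z : 0 < size (encode_int z) by rewrite /encode_int /delimited size_cat addn2.
elim: s => // c s IH.
have -> : encode_squares (c :: s) = (encode_int c.1 ++ encode_int c.2) ++ encode_squares s by [].
by rewrite !size_cat; have := pos c.1; rewrite /=; lia.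
Qed.

Section Membership.
Variables (R : realType) (T : {fset tile}).
Hypothesis T_pos : forall t : tile, t \in T -> is_tile t.
Local Notation TT := (enum_fset T).

Lemma uniq_candidates s : uniq s -> uniq (candidates TT s).
Proof. by move=> us; apply: allpairs_uniq => //; [exact: fset_uniq|move=> [a b] [c d] _ _ [-> ->]]. Qed.

Lemma mem_candidates s u : (u \in candidates TT s) = (u.1 \in s) && (u.2 \in T).
Proof.
apply/allpairsP/andP => [[[c t] /= [cs tT ->]]|[cs tT]] //.
by exists u; split=> //; exact: surjective_pairing.
Qed.

Lemma size_candidates s : size (candidates TT s) = size TT * size s.
Proof. by rewrite size_allpairs mulnC. Qed.

Lemma cover_test_tiling s y : uniq s -> cover_test TT s y ->
  is_tiling T (@union_of_squares R s) [fset u in mask y (candidates TT s)]%fset.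
Proof.
move=> us /and4P[uc alls /eqP sz _]; apply/(is_tilingP R _ _ T_pos); split.
- by move=> u; rewrite inE => /mem_mask; rewrite mem_candidates => /andP[].
- by move=> u v c; rewrite !inE => um vm; exact: flatten_map_disjoint uc um vm.
move=> c; have [_ e] := uniq_min_size uc (allP alls) (eq_leq (esym sz)).
rewrite -e mem_flatten_map; split=> -[u um cu]; exists u => //; first by rewrite inE.
by move: um; rewrite inE.
Qed.

Lemma tiling_cover_test s P : uniq s -> is_tiling T (@union_of_squares R s) P ->
  forall k, let y := [seq u \in P | u <- candidates TT s] ++ nseq k false in
  cover_test TT s y /\ [fset u in mask y (candidates TT s)]%fset = P.
Proof.
move=> us /(is_tilingP R _ _ T_pos)[PT dis cov] k y.
have my : mask y (candidates TT s) = [seq u <- candidates TT s | u \in P].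
  rewrite /y filter_mask; elim: (candidates TT s) => [|u l IH] /=; first by rewrite mask0.
  by rewrite IH; case: (u \in P).
have Pc u : u \in P -> u \in candidates TT s.
  move=> uP; rewrite mem_candidates PT // andbT; apply/cov; exists u => //.
  by have [] := T_pos (PT _ uP); case: u {uP} => [[a b] [w h]] /= w0 h0; rewrite mem_tile_cells /=; lia.
have mP u : (u \in [seq u <- candidates TT s | u \in P]) = (u \in P).
  by rewrite mem_filter; case: (boolP (u \in P)) => //= /Pc.
split; last by apply/fsetP => u; rewrite inE my mP.
rewrite /cover_test my.
have uc : uniq (flatten [seq tile_cells u | u <- [seq u <- candidates TT s | u \in P]]).
  apply: uniq_flatten_map; first by apply: filter_uniq; exact: uniq_candidates.
    by move=> u _; exact: uniq_tile_cells.
  by move=> u v c; rewrite !mP; exact: dis.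
have ec : flatten [seq tile_cells u | u <- [seq u <- candidates TT s | u \in P]] =i s.
  move=> c; apply/idP/idP; first by move/mem_flatten_map => [u]; rewrite mP => uP cu; apply/cov; exists u.
  by move/cov => [u uP cu]; apply/mem_flatten_map; exists u; rewrite ?mP.
apply/and4P; split=> //.
- by apply/allP => c; rewrite ec.
- by apply/eqP/perm_size/uniq_perm.
- by rewrite /y drop_size_cat ?size_map // all_nseq orbT.
Qed.

Lemma cover_test_inj s y y' : uniq s -> size y = size y' -> cover_test TT s y -> cover_test TT s y' ->
  [fset u in mask y (candidates TT s)]%fset = [fset u in mask y' (candidates TT s)]%fset -> y = y'.
Proof.
move=> us sy /and4P[_ _ _ r] /and4P[_ _ _ r'] e; have uc := uniq_candidates us.
apply: (@eq_from_nth _ false) => // i _.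
have zero z : all negb (drop (size (candidates TT s)) z) -> size (candidates TT s) <= i -> nth false z i = false.
  move=> /all_nthP a h; case: (ltnP i (size z)) => hi; last by rewrite nth_default.
  have := a false (i - size (candidates TT s)); rewrite size_drop nth_drop subnKC // => /(_ _)/negbTE.
  by apply; lia.
case: (ltnP i (size (candidates TT s))) => hi; last by rewrite !zero.
have [u0 _] : exists u, u \in candidates TT s by exists (nth ((0%R, 0%R), (0, 0)) (candidates TT s) i); exact: mem_nth.
have m z : nth false z i = (nth u0 (candidates TT s) i \in mask z (candidates TT s)).
  by rewrite in_mask // mem_nth //= index_uniq.
by rewrite !m; move/fsetP/(_ (nth u0 (candidates TT s) i)): e; rewrite !inE.
Qed.

Theorem tiling_sharpP : sharpP (tiling_problem R T).
Proof.
(* There are [size TT * size s] candidates, and an encoding is at least as long as the list of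
   squares. *)
pose p : {poly nat} := (size TT *: 'X)%R.
have pE n : (p.[n])%R = size TT * n by rewrite /p hornerZ hornerX.
exists p, (verifier TT); split; first exact: polytime_verifier.
move=> x; rewrite /tiling_problem /counting_problem.
have vE (y : seq bool) : verifier TT (string_pair x y) =
    [&& encode_squares (decode_squares x) == x, region_test (decode_squares x) & cover_test TT (decode_squares x) y].
  by rewrite /verifier split_pairK.
case: pselect => [ex|nex]; last first.
  apply/esym/eq_card0 => y; rewrite !inE vE; apply/negP => /and3P[/eqP e rt _]; apply: nex.
  by exists (decode_squares x); split=> //; exact/region_testP.
case: (cid ex) => s [sc e] /=; rewrite -e in vE *.
have us : uniq s by case: sc => -[].
have rt : region_test s by exact/(region_testP R).
have {}vE (y : seq bool) : verifier TT (string_pair (encode_squares s) y) = cover_test TT s y.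
  by rewrite vE decode_squaresK eqxx rt.
set N := (p.[_])%R.
have hN : size (candidates TT s) <= N.
  by rewrite /N pE size_candidates leq_mul2l size_encode_squares orbT.
apply: (nb_tilings_card (F := fun y : N.-tuple bool => [fset u in mask y (candidates TT s)]%fset)).
- move=> y y'; rewrite !inE !vE => cy cy' e'; apply/val_inj.
  by apply: cover_test_inj us _ cy cy' e'; rewrite !size_tuple.
- by move=> y; rewrite inE vE => cy; exact: cover_test_tiling.
- move=> P /(tiling_cover_test us)/(_ (N - size (candidates TT s)))[c1 c2].
  have sz : size ([seq u \in P | u <- candidates TT s] ++ nseq (N - size (candidates TT s)) false) == N.
    by rewrite size_cat size_map size_nseq subnKC.
  by exists (Tuple sz); rewrite ?inE ?vE.
Qed.

End Membership.

(** * Brick gadgets *)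

Lemma digits_uniq n (f g : nat -> nat) : (forall k, f k < 4) -> (forall k, g k < 4) ->
  \sum_(k < n) f k * 4 ^ k = \sum_(k < n) g k * 4 ^ k -> forall k, k < n -> f k = g k.
Proof.
elim: n f g => // n IH f g f4 g4; rewrite !big_ord_recl /= expn0 !muln1.
have E h : \sum_(i < n) h (bump 0 i) * 4 ^ bump 0 i = 4 * \sum_(i < n) h i.+1 * 4 ^ i.
  by rewrite big_distrr /=; apply: eq_bigr => i _; rewrite /bump /= add1n expnS mulnCA.
rewrite !E => e; have f0 := f4 0; have g0 := g4 0.
case=> [|k] kn; first by lia.
apply: (IH (fun k => f k.+1) (fun k => g k.+1)) => //; lia.
Qed.

(** With fewer than four summands each multiplicity is a single digit in base 4, and digits are
    unique. *)
Lemma pow4_sum_perm (s t : seq nat) : size s < 4 -> size t < 4 ->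
  \sum_(k <- s) 4 ^ k = \sum_(k <- t) 4 ^ k -> perm_eq s t.
Proof.
move=> s4 t4; pose n := (\max_(k <- s ++ t) k).+1.
have an a : a \in s ++ t -> a < n.
  by move=> ast; rewrite ltnS; apply: (@leq_bigmax_seq _ (s ++ t) xpredT id a).
have E (r : seq nat) : {subset r <= s ++ t} ->
    \sum_(k <- r) 4 ^ k = \sum_(k < n) count_mem (k : nat) r * 4 ^ k.
  elim: r => [|a r IH] sub; first by rewrite big_nil big1.
  rewrite big_cons IH; last by move=> x xr; apply: sub; rewrite inE xr orbT.
  have {}an := an a (sub _ (mem_head _ _)).
  rewrite [X in _ + X](bigD1 (Ordinal an)) //= [RHS](bigD1 (Ordinal an)) //= eqxx.
  rewrite mulnDl mul1n addnA; congr (_ + _); apply: eq_bigr => k ka.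
  suff -> : (a == k) = false by [].
  by apply: contraNF ka => /eqP e; apply/eqP/val_inj.
rewrite (E s) ?(E t); [|by move=> x; rewrite mem_cat => ->; rewrite ?orbT..].
have cl (r : seq nat) k : size r < 4 -> count_mem k r < 4.
  by apply: leq_ltn_trans; exact: count_size.
move=> /(digits_uniq (fun k => cl s k s4) (fun k => cl t k t4)) H.
apply/allP => k /an kn /=; exact/eqP/H.
Qed.

Lemma pow4_inj a b : 4 ^ a = 4 ^ b -> a = b.
Proof. by move/eqP; rewrite eqn_exp2l // => /eqP. Qed.

Lemma pow4_mem3 a1 a2 a3 b1 b2 b3 :
  4 ^ a1 + 4 ^ a2 + 4 ^ a3 = 4 ^ b1 + 4 ^ b2 + 4 ^ b3 -> b3 \in [:: a1; a2; a3].
Proof.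
move=> e; have /perm_mem -> : perm_eq [:: a1; a2; a3] [:: b1; b2; b3].
  by apply: pow4_sum_perm => //; rewrite !big_cons !big_nil; lia.
by rewrite !inE eqxx !orbT.
Qed.

Lemma pow4_mem2 a1 a2 b1 b2 : 4 ^ a1 + 4 ^ a2 = 4 ^ b1 + 4 ^ b2 -> a1 \in [:: b1; b2].
Proof.
move=> e; have /perm_mem <- : perm_eq [:: a1; a2] [:: b1; b2].
  by apply: pow4_sum_perm => //; rewrite !big_cons !big_nil; lia.
by rewrite mem_head.
Qed.

(* Placed tiles, with lower left corner, width and height; cells are named by
   their lower left corners. *)
Notation placed := ((nat * nat) * (nat * nat))%type.

Definition in_placed (u : placed) (x y : nat) : bool :=
  [&& u.1.1 <= x, x < u.1.1 + u.2.1, u.1.2 <= y & y < u.1.2 + u.2.2].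

Definition tiles_region (T : nat * nat -> Prop) (Reg : nat -> nat -> Prop)
    (P : placed -> Prop) : Prop :=
  [/\ forall u, P u -> T u.2,
      forall u v x y, P u -> P v -> in_placed u x y -> in_placed v x y -> u = v &
      forall x y, Reg x y <-> exists2 u, P u & in_placed u x y].

Section Floors.
Variables (T : nat * nat -> Prop) (Reg : nat -> nat -> Prop) (P : placed -> Prop).
Hypothesis tP : tiles_region T Reg P.
Hypothesis T_pos : forall t, T t -> 0 < t.1 /\ 0 < t.2.

(** Prevents any tile from containing both cells: the first is outside the region, or belongs to a
    known tile that ends before the second. *)
Definition wall x y x' y' : Prop :=
  ~ Reg x y \/ exists2 v, P v & in_placed v x y && ~~ in_placed v x' y'.

Lemma wall_sep x y x' y' u : wall x y x' y' -> P u -> in_placed u x y -> ~~ in_placed u x' y'.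
Proof.
have [_ uniqP regP] := tP.
move=> [nR|[v Pv /andP[vx vx']]] Pu ux; last by rewrite (uniqP u v x y).
by case: nR; apply/regP; exists u.
Qed.

(** Exactly what is needed to place tiles from the left: the tile at [x0] must have lower left
    corner [(x0, y)], it cannot pass [x1], and the rest beyond it is again a floor. *)
Definition floor x0 x1 y : Prop :=
  [/\ forall x, x0 <= x < x1 -> Reg x y,
      forall u, P u -> in_placed u x0 y -> u.1.1 = x0,
      forall u x, P u -> x0 <= x < x1 -> in_placed u x y -> u.1.2 = y &
      forall u x, P u -> x0 <= x < x1 -> in_placed u x y -> u.1.1 + u.2.1 <= x1].

Lemma floorI x0 x1 y : 0 < x0 < x1 -> 0 < y ->
  (forall x, x0 <= x < x1 -> Reg x y) -> wall x0.-1 y x0 y ->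
  (forall x, x0 <= x < x1 -> wall x y.-1 x y) -> wall x1 y x1.-1 y -> floor x0 x1 y.
Proof.
move=> x01 y0 HR Hl Hb Hr; split=> //.
- move=> u Pu ux; apply/eqP; move: (ux) => /and4P[? ? ? ?]; rewrite eqn_leq; apply/andP; split=> //.
  rewrite leqNgt; apply/negP => lt; have := wall_sep Hl Pu; rewrite ux => /(_ _)/negP; apply=> //.
  by apply/and4P; split=> //; lia.
- move=> u x Pu xx ux; apply/eqP; move: (ux) => /and4P[? ? ? ?]; rewrite eqn_leq; apply/andP; split=> //.
  rewrite leqNgt; apply/negP => lt; have := wall_sep (Hb x xx) Pu; rewrite ux => /(_ _)/negP; apply=> //.
  by apply/and4P; split=> //; lia.
- move=> u x Pu xx ux; rewrite leqNgt; apply/negP => lt; move: (ux) => /and4P[? ? ? ?].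
  have := wall_sep Hr Pu => /(_ _)/negP; apply; apply/and4P; split=> //; lia.
Qed.

Lemma floor_step x0 x1 y : x0 < x1 -> floor x0 x1 y ->
  exists u, [/\ P u, u.1 = (x0, y), x0 + u.2.1 <= x1 &
    x0 + u.2.1 < x1 -> floor (x0 + u.2.1) x1 y].
Proof.
move=> x01 [HR Hl Hb Hr]; have [TP uniqP regP] := tP.
have x0i : x0 <= x0 < x1 by rewrite leqnn.
have /regP[u Pu ux] := HR x0 x0i.
have e1 := Hl u Pu ux; have e2 := Hb u x0 Pu x0i ux; have e3 := Hr u x0 Pu x0i ux.
exists u; split=> //; [by case: (u.1) e1 e2 => a b /= -> ->|by lia|move=> lt].
have [w0 h0] := T_pos (TP u Pu).
split; [by move=> x xx; apply: HR; lia| |by move=> v x Pv xx; apply: Hb => //; lia|by move=> v x Pv xx; apply: (Hr v x Pv); lia].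
move=> v Pv vx; apply/eqP; move: (vx) => /and4P[? ? ? ?]; rewrite eqn_leq; apply/andP; split=> //.
rewrite leqNgt; apply/negP => vlt.
have vu : v = u.
  apply: (uniqP v u (x0 + u.2.1).-1 y) => //; apply/and4P; split=> //; lia.
by move: vx; rewrite vu => /and4P[]; lia.
Qed.

End Floors.

Section Gadget.
Variables (L : finType) (EB EF : rel L).

(** Including the parities of row and column makes the codes of neighbouring cuts come from disjoint
    sets. *)
Definition label_rank (pi pj : bool) (c : L) : nat := enum_rank (pi, pj, c).

Definition label_code pi pj c : nat := 4 ^ label_rank pi pj c.

(** The three surplus powers of 4 keep every code below [U / 64], so that labels change the width of
    a tile by less than [U / 32]. *)
Definition unit_length : nat := 4 ^ #|{: bool * bool * L}|.+3.

Local Notation Q := label_code.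
Local Notation U := unit_length.

Lemma label_code_lt pi pj c : 64 * Q pi pj c < U.
Proof.
rewrite /label_code /unit_length -[64]/(4 ^ 3) -expnD ltn_exp2l // add3n !ltnS.
exact: (ltn_ord (enum_rank (pi, pj, c))).
Qed.

Lemma label_code_gt0 pi pj c : 0 < Q pi pj c.
Proof. by rewrite expn_gt0. Qed.

Lemma label_rank_inj pi pj c pi' pj' c' :
  label_rank pi pj c = label_rank pi' pj' c' -> [/\ pi = pi', pj = pj' & c = c'].
Proof. by move=> /val_inj/enum_rank_inj[-> -> ->]. Qed.

(** The height of a filler reveals the parity of its column. Both values are below the height 4 of a
    brick, and two stacked fillers exceed 3, so a wrong tile always overshoots its step. *)
Definition filler_height (pj : bool) : nat := if pj then 3 else 2.

(** A brick runs from the cut labelled [l] to the cut labelled [r] of the next column. A filler runs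
    from the cut labelled [d] of its own row to the cut labelled [c] of the row below, which lies to
    the right because the wall leans left; hence the signs. *)
Definition brick_tile pi pj l r : nat * nat := (3 * U + Q pi (~~ pj) r - Q pi pj l, 4).

Definition filler_tile pi pj c d : nat * nat :=
  (2 * U + Q pi pj c - Q (~~ pi) pj d, filler_height pj).

Definition gadget_tile (t : nat * nat) : Prop :=
  (exists pi pj l r, EB l r /\ t = brick_tile pi pj l r) \/
  (exists pi pj c d, EF c d /\ t = filler_tile pi pj c d).

Lemma gadget_tile_pos t : gadget_tile t -> 0 < t.1 /\ 0 < t.2.
Proof.
move=> [[pi [pj [l [r [_ ->]]]]]|[pi [pj [c [d [_ ->]]]]]] /=.
  by have := label_code_lt pi pj l; lia.
by have := label_code_lt (~~ pi) pj d; case: pj; rewrite /filler_height; lia.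
Qed.

Lemma gadget_tile_cases t : gadget_tile t ->
  [/\ 32 * t.1 < 97 * U, 95 * U < 32 * t.1, t.2 = 4 &
     exists pi pj l r, EB l r /\ t = brick_tile pi pj l r] \/
  [/\ 32 * t.1 < 65 * U, 63 * U < 32 * t.1 &
     exists pi pj c d, [/\ EF c d, t.2 = filler_height pj & t = filler_tile pi pj c d]].
Proof.
move=> [[pi [pj [l [r [E ->]]]]]|[pi [pj [c [d [E ->]]]]]]; [left|right].
  split=> //; last by exists pi, pj, l, r.
  - by rewrite /brick_tile /=; have := label_code_lt pi pj l; have := label_code_lt pi (~~ pj) r; lia.
  - by rewrite /brick_tile /=; have := label_code_lt pi pj l; have := label_code_lt pi (~~ pj) r; lia.
split=> //; last by exists pi, pj, c, d.
- by rewrite /filler_tile /=; have := label_code_lt (~~ pi) pj d; have := label_code_lt pi pj c; lia.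
- by rewrite /filler_tile /=; have := label_code_lt (~~ pi) pj d; have := label_code_lt pi pj c; lia.
Qed.

Fixpoint stair j : nat := if j is k.+1 then stair k + filler_height (odd j) else 0.

Arguments stair : simpl never.

Lemma stair0 : stair 0 = 0.
Proof. by []. Qed.

Lemma filler_height_bounds b : 2 <= filler_height b <= 3.
Proof. by case: b. Qed.

Lemma stairS j : stair j.+1 = stair j + filler_height (odd j.+1).
Proof. by []. Qed.

Lemma stair_step j : stair j + 2 <= stair j.+1 <= stair j + 3.
Proof. by rewrite stairS; have := filler_height_bounds (odd j.+1); lia. Qed.

Lemma stair_le j j' : j <= j' -> stair j <= stair j'.
Proof.
elim: j' => [|j' IH]; first by rewrite leqn0 => /eqP ->.
by rewrite leq_eqVlt ltnS => /orP[/eqP -> //|/IH]; have := stair_step j'; lia.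
Qed.

Variables (M W : nat) (bd : nat -> nat -> L).
Hypotheses (M_gt0 : 0 < M) (W_gt0 : 0 < W).

(** One row up shifts the cuts left by two units, one column on shifts them right by three. Away
    from the border, a brick thus rests on a filler of two units and on the first unit of the brick
    below it, and the next filler rests on the other two. *)
Definition coarse i j : nat := 2 * U * (M.+1 - i) + 3 * U * j.

Definition code_at (q : nat -> nat -> L) i j : nat := Q (odd i) (odd j) (q i j).

Definition cut q i j : nat := coarse i j + code_at q i j.

Definition brick q i j : placed :=
  ((cut q i j, 4 * i + stair j), (3 * U + code_at q i j.+1 - code_at q i j, 4)).

Definition filler q i j : placed :=
  ((cut q i j, 4 * i + stair j.-1),
   (2 * U + code_at q i.-1 j - code_at q i j, filler_height (odd j))).

Lemma coarseS i j : coarse i j.+1 = coarse i j + 3 * U.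
Proof. by rewrite /coarse; lia. Qed.

Lemma coarse_pred i j : i <= M -> coarse i j = coarse i.+1 j + 2 * U.
Proof. by move=> iM; rewrite /coarse subSS subSn // mulnS; lia. Qed.

Lemma coarse_le i j i' j' : i <= i' <= M.+1 -> j' <= j -> coarse i' j' <= coarse i j.
Proof.
move=> ii jj; rewrite /coarse leq_add // leq_mul2l; apply/orP; right; lia.
Qed.

Lemma coarse_lt i j i' j' : i <= i' <= M.+1 -> j' <= j -> (i != i') || (j' != j) ->
  coarse i' j' + 2 * U <= coarse i j.
Proof.
move=> ii jj ne; have [e|/eqP ne'] := eqVneq i i'.
  move: ne; rewrite e eqxx /= => ne; have jj' : j'.+1 <= j by lia.
  by have := @coarse_le i j i j'.+1 _ jj'; rewrite coarseS -e; lia.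
have iM : i <= M by lia.
by rewrite (coarse_pred j iM); have := @coarse_le i.+1 j i' j' _ jj; lia.
Qed.

Lemma code_at_lt q i j : 0 < code_at q i j /\ 64 * code_at q i j < U.
Proof. by rewrite /code_at label_code_lt label_code_gt0. Qed.

(** Codes are small against the unit, so cuts are ordered by their coarse positions alone, even
    across two different labellings. *)
Lemma cut_lt q q' i j i' j' : i <= i' <= M.+1 -> j' <= j -> (i != i') || (j' != j) ->
  cut q' i' j' + U < cut q i j.
Proof.
move=> h1 h2 h3; have := coarse_lt h1 h2 h3; rewrite /cut.
have := code_at_lt q i j; have := code_at_lt q' i' j'; lia.
Qed.

Lemma cut_le q q' i j i' j' : i <= i' <= M.+1 -> j' <= j ->
  (i = i' -> j = j' -> q i j = q' i j) -> cut q' i' j' <= cut q i j.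
Proof.
move=> h1 h2 h3; have [/andP[/eqP e1 /eqP e2]|ne] := boolP ((i == i') && (j' == j)).
  by rewrite /cut /code_at -e1 e2 h3.
have {}ne : (i != i') || (j' != j) by rewrite -negb_and.
by have := @cut_lt q q' _ _ _ _ h1 h2 ne; lia.
Qed.

(** The left border follows the left ends of the rows and then the steps on top of row [M]; the
    right border, below, follows the steps under row 1 and then the right ends of the rows. All of
    these are cuts of [bd]. *)
Definition left_out x y : Prop :=
  (exists i, [/\ 1 <= i <= M, 4 * i <= y < 4 * i + 4 & x < cut bd i 0]) \/
  (exists j, [/\ 1 <= j < W, 4 * M.+1 + stair j.-1 <= y < 4 * M.+1 + stair j & x < cut bd M j]).

Definition right_out x y : Prop :=
  (exists j, [/\ 1 <= j <= W, 4 + stair j.-1 <= y < 4 + stair j & cut bd 0 j <= x]) \/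
  (exists i, [/\ 1 <= i <= M, 4 * i + stair W <= y < 4 * i + 4 + stair W & cut bd i W <= x]).

Definition region x y : Prop :=
  [/\ 4 <= y < 4 * M.+1 + stair W.-1, ~ left_out x y & ~ right_out x y].

(* Labellings of the vertical segments, [q i j] being that between the bricks
   [j - 1] and [j] of row [i]; row 0 lies below the region. *)
Definition labelling (q : nat -> nat -> L) : Prop :=
  [/\ forall i j, i <= M -> j <= W -> [|| i == 0, i == M, j == 0 | j == W] -> q i j = bd i j,
      forall i j, 1 <= i <= M -> j < W -> EB (q i j) (q i j.+1) &
      forall i j, 1 <= i <= M -> 1 <= j <= W -> EF (q i.-1 j) (q i j)].

Definition placed_in (q : nat -> nat -> L) (u : placed) : Prop :=
  (exists i j, [/\ 1 <= i <= M, j < W & u = brick q i j]) \/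
  (exists i j, [/\ 1 <= i <= M, 1 <= j <= W & u = filler q i j]).

Lemma in_brick q i j x y : i <= M -> in_placed (brick q i j) x y =
  (cut q i j <= x < cut q i j.+1) && (4 * i + stair j <= y < 4 * i + stair j + 4).
Proof.
move=> iM; rewrite /in_placed /brick /= andbA.
suff -> : cut q i j + (3 * U + code_at q i j.+1 - code_at q i j) = cut q i j.+1 by [].
by rewrite /cut coarseS; have := code_at_lt q i j; lia.
Qed.

Lemma in_filler q i j x y : 0 < i <= M -> 0 < j -> in_placed (filler q i j) x y =
  (cut q i j <= x < cut q i.-1 j) && (4 * i + stair j.-1 <= y < 4 * i + stair j).
Proof.
case: i => // i iM; case: j => // j _; rewrite /in_placed /filler /= andbA -addnA -stairS.
suff -> : cut q i.+1 j.+1 + (2 * U + code_at q i j.+1 - code_at q i.+1 j.+1) = cut q i j.+1 by [].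
by rewrite /cut [coarse i _]coarse_pred; have := code_at_lt q i.+1 j.+1; lia.
Qed.

(** * Every tiling comes from a labelling *)

Section Forced.
Variable P : placed -> Prop.
Hypothesis tP : tiles_region gadget_tile region P.

Let regP x y : region x y <-> exists2 u, P u & in_placed u x y.
Proof. by have [_ _] := tP. Qed.

Let floorS x0 x1 y := @floor_step _ _ _ tP gadget_tile_pos x0 x1 y.
Let tileP u : P u -> gadget_tile u.2.
Proof. by have [H _ _] := tP; exact: H. Qed.

Lemma floor_small x0 x1 y : x0 < x1 -> floor region P x0 x1 y -> U <= x1 - x0.
Proof.
move=> x01 /(floorS x01)[u [Pu _ ux _]].
case: (gadget_tile_cases (tileP Pu)) => [[? ? _ _]|[? ? _]]; lia.
Qed.

(** A brick is too wide, and behind one filler the gap is narrower than any tile. *)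
Lemma floor_filler x0 x1 y : x0 < x1 -> x1 - x0 < 3 * U - U %/ 2 -> floor region P x0 x1 y ->
  exists u pi pj c d, [/\ P u, u.1 = (x0, y), x0 + u.2.1 = x1, EF c d & u.2 = filler_tile pi pj c d].
Proof.
move=> x01 lt F; have [u [Pu u1 ux F']] := floorS x01 F.
case: (gadget_tile_cases (tileP Pu)) => [[l1 l2 _ _]|[l1 l2 [pi [pj [c [d [E _ e]]]]]]]; first lia.
exists u, pi, pj, c, d; split=> //; apply/eqP; rewrite eqn_leq ux leqNgt; apply/negP => lt'.
by have := floor_small lt' (F' lt'); lia.
Qed.

(** Starting with a filler would leave a nonempty gap narrower than any tile. *)
Lemma floor_brick x0 x1 y : x0 < x1 -> 2 * U + U %/ 2 < x1 - x0 -> x1 - x0 < 3 * U + U %/ 2 ->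
  floor region P x0 x1 y ->
  exists u pi pj l r, [/\ P u, u.1 = (x0, y), x0 + u.2.1 = x1, EB l r & u.2 = brick_tile pi pj l r].
Proof.
move=> x01 lt lt2 F; have [u [Pu u1 ux F']] := floorS x01 F.
case: (gadget_tile_cases (tileP Pu)) => [[l1 l2 _ [pi [pj [l [r [E e]]]]]]|[l1 l2 _]].
  exists u, pi, pj, l, r; split=> //; apply/eqP; rewrite eqn_leq ux leqNgt; apply/negP => lt'.
  by have := floor_small lt' (F' lt'); lia.
have lt' : x0 + u.2.1 < x1 by lia.
have [v [Pv _ vx _]] := floorS lt' (F' lt').
by case: (gadget_tile_cases (tileP Pv)) => [[? ? _ _]|[? ? _]]; lia.
Qed.

Section Row.
Variables (q : nat -> nat -> L) (i : nat).
Hypotheses (i_bounds : 1 <= i <= M)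
  (q0 : forall j, j <= W -> q 0 j = bd 0 j)
  (q_left : forall i, i <= M -> q i 0 = bd i 0)
  (q_right : forall i', i' < i -> q i' W = bd i' W)
  (q_bricks : forall i' j, 1 <= i' < i -> j < W -> P (brick q i' j)).

(** The cell lies in the upper layers of brick [(i.-1, j)], those above the step to its left, or in
    the border that replaces this brick under row 1 and in column [W]. This closes row [i] from
    below and from the right. *)
Lemma side_wall j x y x' y' : j <= W -> cut q i.-1 j <= x ->
  (j < W -> x < cut q i.-1 j.+1) ->
  (if j is k.+1 then 4 * i + stair k <= y < 4 * i + stair j else y = 4 * i - 1) ->
  (x' < cut q i.-1 j) || (4 * i + stair j <= y') ->
  wall region P x y x' y'.
Proof.
case: i i_bounds q_right q_bricks => // k kM qr qb jW cx cx' hy sep /=.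
have [y3 y4] : 4 * k.+1 + stair j <= y + 3 /\ y < 4 * k.+1 + stair j.
  by move: hy; case: (j) => [|j']; [rewrite stair0; lia|have := stair_step j'; lia].
have [k0|k0] := posnP k.
  left=> -[/andP[y0 _] _ ro]; case: j jW cx cx' hy sep y3 y4 => [|j] jW cx cx' hy sep y3 y4.
    by move: hy; rewrite k0; lia.
  apply: ro; left; exists j.+1; split=> //; first by move: hy; rewrite k0 /=; lia.
  by move: cx; rewrite k0 /cut /code_at q0.
have [jW'|jW'] := ltnP j W; last first.
  have {}jW' : j = W by apply/eqP; rewrite eqn_leq jW.
  left=> -[_ _ []]; right; exists k; split; [by lia|by rewrite -jW'; lia|].
  by move: cx; rewrite jW' /cut /code_at /= qr.
right; exists (brick q k j); first by apply: qb => //; lia.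
have kM' : k <= M by lia.
by rewrite !in_brick //; have := cx' jW'; move: cx sep; rewrite ?stair0 /=; lia.
Qed.

Lemma row_region j x y : j < W -> cut q i j <= x < cut q i.-1 j.+1 ->
  4 * i + stair j <= y < 4 * i + stair j.+1 ->
  (y < 4 * i + 4 + stair j.-1) || (cut q i j + U <= x) -> region x y.
Proof.
move=> jW xx yy ytop.
split.
- by have := @stair_le j W.-1; have := stair_step W.-1; have := @stair_le j.+1 W.-1.+1; have := stair_step j; lia.
- case=> [[i' [iM' y' x']]|[j' [jM' y' x']]].
    have ii : i <= i' by lia.
    have : cut bd i' 0 <= cut q i j by apply: cut_le; [lia|lia|move=> _ ->; rewrite q_left //; lia].
    lia.
  have jj : j' <= j.
    by rewrite leqNgt; apply/negP => lt; have := @stair_le j j'.-1; have := stair_step j; lia.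
  have [e|ne] := boolP ((i == M) && (j' == j)).
    case/andP: e => /eqP e /eqP e'; move: ytop y'; rewrite e' e => /orP[|]; first by lia.
    move=> xU _; have := code_at_lt bd M j; have := code_at_lt q M j.
    by move: xU x'; rewrite e' /cut; lia.
  have := @cut_lt q bd i j M j' _ jj _; rewrite negb_and in ne; rewrite ne; lia.
- case=> [[j' [jM' y' x']]|[i' [iM' y' x']]].
    have jj : j.+1 <= j'.
      by rewrite leqNgt; apply/negP => lt; have := @stair_le j' j; lia.
    have : cut q i.-1 j.+1 <= cut bd 0 j' by apply: cut_le; [lia|lia|move=> _ ->; rewrite q0 //; lia].
    lia.
  have ii : i' < i.
    by have := @stair_le j.+1 W jW; lia.
  have : cut q i.-1 j.+1 <= cut bd i' W by apply: cut_le; [lia|lia|move=> e _; rewrite q_right //; lia].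
  lia.
Qed.

(* A tile reaching above the wall on its right isolates the top of the brick to
   the right of it, which must then carry a brick of its own; this repeats up
   to the right end of the row, where such a brick leaves the region. *)
Lemma no_defect j v : 1 <= j <= W -> P v -> in_placed v (cut q i.-1 j).-1 (4 * i + stair j) ->
  ~~ in_placed v (cut q i.-1 j) (4 * i + stair j) -> False.
Proof.
move: {2}(W - j) (leqnn (W - j)) => n; elim: n j v => [|n IH] j v Wn jW Pv vin vout.
  have jE : j = W by lia.
  have /regP[_ _ []] : exists2 u, P u & in_placed u (cut q i.-1 j).-1 (4 * i + stair j) by exists v.
  right; exists i; split=> //; first by rewrite jE; lia.
  by have := @cut_lt q bd i.-1 W i W _ (leqnn _) _; rewrite jE; lia.
have [jE|jne] := eqVneq j W; first by apply: (IH j v) => //; lia.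
have jW' : j < W by lia.
have x01 : cut q i.-1 j < cut q i.-1 j.+1.
  by have := @cut_lt q q i.-1 j.+1 i.-1 j _ (leqnSn j) _; lia.
have xpos : 0 < cut q i.-1 j by have := code_at_lt q i.-1 j; rewrite /cut; lia.
have F : floor region P (cut q i.-1 j) (cut q i.-1 j.+1) (4 * i + stair j).
  apply: (floorI tP) => //; first by rewrite xpos.
  - by lia.
  - move=> x xx; have := stair_step j; move=> st; apply: (@row_region j) => //.
    + have := @cut_lt q q i.-1 j i j _ (leqnn j) _; lia.
    + by lia.
    + apply/orP; right; have := @cut_lt q q i.-1 j i j _ (leqnn j) _; lia.
  - by right; exists v => //; rewrite vin.
  - move=> x xx; apply: (@side_wall j); [by lia|by lia|by lia| |by rewrite leqnn orbT].
    by case: (j) => [|k]; [rewrite ?stair0 /=; lia|have := stair_step k; lia].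
  - have st := stair_step j.
    apply: (@side_wall j.+1); [by lia|by lia| |by lia|by apply/orP; left; lia].
    by move=> jW2; have := @cut_lt q q i.-1 j.+2 i.-1 j.+1 _ (leqnSn _) _; lia.
have c1 := code_at_lt q i.-1 j; have c2 := code_at_lt q i.-1 j.+1.
have len : cut q i.-1 j.+1 - cut q i.-1 j + code_at q i.-1 j = 3 * U + code_at q i.-1 j.+1.
  by rewrite /cut coarseS; lia.
have [||u [pi [pj [l [r [Pu u1 ux _ ut]]]]]] := floor_brick x01 _ _ F; [by lia|by lia|].
have st := stair_step j.
apply: (IH j.+1 u) => //; first by lia.
- have uh : u.2.2 = 4 by rewrite ut.
  by rewrite /in_placed u1 /= ux uh; lia.
- by rewrite /in_placed u1 /= ux; lia.
Qed.

Lemma code_equation j pi pj l r pi' c d :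
  3 * U + Q pi (~~ pj) r - Q pi pj l + (2 * U + Q pi' (odd j.+1) c - Q (~~ pi') (odd j.+1) d) +
    code_at q i j = 5 * U + code_at q i.-1 j.+1 ->
  [/\ pi = odd i, pj = odd j, l = q i j, pi' = odd i.-1 & c = q i.-1 j.+1] /\ r = d.
Proof.
move=> e; have l1 := label_code_lt pi pj l; have l2 := label_code_lt (~~ pi') (odd j.+1) d.
have oi : odd i.-1 = ~~ odd i by case: (i) i_bounds => // k _ /=; rewrite negbK.
have oj : odd j.+1 = ~~ odd j by [].
have e1 : code_at q i.-1 j.+1 + Q (~~ pi') (odd j.+1) d + Q pi pj l =
          Q pi' (odd j.+1) c + Q pi (~~ pj) r + code_at q i j by lia.
have := pow4_mem3 e1; rewrite !inE => /or3P[]/eqP/label_rank_inj[].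
- by rewrite oj; case: (odd j).
- by rewrite oj; case: (odd j).
move=> h1 h2 h3; have {h1 h2 h3} [h1 h2 h3] : [/\ pi = odd i, pj = odd j & l = q i j] by [].
have e2 : code_at q i.-1 j.+1 + Q (~~ pi') (odd j.+1) d = Q pi' (odd j.+1) c + Q pi (~~ pj) r.
  by move: e1; rewrite -[code_at q i j]/(Q (odd i) (odd j) (q i j)) h1 h2 h3; lia.
have := pow4_mem2 e2; rewrite !inE => /orP[]/eqP/label_rank_inj[h4 h5 h6]; last first.
  by move: h4; rewrite oi -h1; case: (pi).
split; first by rewrite h4 h6.
have : Q (~~ pi') (odd j.+1) d = Q pi (~~ pj) r.
  by move: e2; rewrite /code_at h4 h6; lia.
by move/pow4_inj/label_rank_inj => [].
Qed.

(** If the last cut lay right of the border, the brick would stick out of the region; if it lay left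
    of it, a floor narrower than any tile would remain above the filler. *)
Lemma row_end j r : j.+1 = W ->
  P ((cut q i j, 4 * i + stair j), (3 * U + Q (odd i) (odd j.+1) r - code_at q i j, 4)) ->
  P ((coarse i j.+1 + Q (odd i) (odd j.+1) r, 4 * i + stair j),
     (2 * U + code_at q i.-1 j.+1 - Q (odd i) (odd j.+1) r, filler_height (odd j.+1))) ->
  r = bd i W.
Proof.
move=> jE; set u := (_, _); set v := (X in P u -> P X -> _) => Pu Pv.
pose xm := coarse i W + Q (odd i) (odd W) r; pose x1 := cut q i.-1 W.
have cb := code_at_lt bd i W; have cr := label_code_lt (odd i) (odd W) r.
have sj : stair j + 2 <= stair W <= stair j + 3 by rewrite -jE; exact: stair_step.
have u1 : u.1.1 + u.2.1 = xm.
  by rewrite /u [LHS]/= -/(odd j.+1) /xm -jE /cut coarseS; have := code_at_lt q i j; rewrite /=; lia.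
have uin x y : in_placed u x y = (cut q i j <= x < xm) && (4 * i + stair j <= y < 4 * i + stair j + 4).
  by rewrite /in_placed andbA u1.
have iE : i.-1.+1 = i by lia.
have v0 : v.1.1 = xm by rewrite /v /xm -jE.
have v1 : v.1.1 + v.2.1 = x1.
  have c1 := code_at_lt q i.-1 W; rewrite v0 /v [_.2.1]/= jE /xm /x1 /cut [coarse i.-1 W]coarse_pred ?iE; last by lia.
  by move: cr; rewrite -jE /=; lia.
have v2 : v.1.2 + v.2.2 = 4 * i + stair W by rewrite -jE stairS addnA.
have vin x y : in_placed v x y = (xm <= x < x1) && (4 * i + stair j <= y < 4 * i + stair W).
  by rewrite /in_placed andbA v1 v2 v0.
have x0m : cut q i j < xm by rewrite /xm -jE /cut coarseS; have := code_at_lt q i j; lia.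
have xm1 : xm < x1.
  by rewrite /xm /x1 /cut [coarse i.-1 W]coarse_pred ?iE; lia.
have [//|ne] := eqVneq r (bd i W).
have ne' : xm <> cut bd i W.
  rewrite /xm /cut /code_at => /addnI/pow4_inj/label_rank_inj[_ _ er].
  by rewrite er eqxx in ne.
clear u1 v0 v1 v2 iE; clearbody u v.
have [lt'|ge'] := ltnP xm (cut bd i W); last first.
  have /regP[_ _ []] : exists2 u, P u & in_placed u xm.-1 (4 * i + stair W).
    by exists u => //; rewrite uin; clear -sj x0m i_bounds; lia.
  by right; exists i; split=> //; clear -ge' ne' i_bounds; lia.
suff F3 : floor region P xm (cut bd i W) (4 * i + stair W).
  by have := floor_small lt' F3; rewrite /xm /cut; clear -cb cr; lia.
have xx1 : cut bd i W < x1.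
  by rewrite /x1; have := @cut_lt q bd i.-1 W i W; clear -i_bounds; lia.
apply: (floorI tP) => //; [by rewrite lt' andbT; clear -x0m; lia|by clear -sj; lia| | | |].
- move=> x xx; split.
  + have : stair W.-1 + 2 <= stair W <= stair W.-1 + 3 by rewrite -jE; exact: stair_step.
    by clear -i_bounds; lia.
  + case=> [[i' [iM' y' x']]|[j' [jM' y' x']]].
      have ii : i <= i' by move: iM' y'; clear; lia.
      have : cut bd i' 0 <= cut q i j.
        by apply: cut_le; [clear -ii iM'; lia|by []|move=> _ ->; rewrite q_left //; clear -i_bounds; lia].
      by clear -x' xx x0m; lia.
    have jj : j' <= j by clear -jM' jE; lia.
    have h : cut bd M j' + U < cut q i W.
      by apply: cut_lt; [clear -i_bounds; lia|clear -jj jE; lia|apply/orP; right; clear -jj jE; lia].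
    have : cut q i W <= xm + U by rewrite /xm /cut; have := code_at_lt q i W; clear; lia.
    by clear -h xx x'; lia.
  + case=> [[j' [jM' y' x']]|[i' [iM' y' x']]].
      by have := @stair_le j' W; clear -jM' y' i_bounds; lia.
    have ii : i' = i by clear -y'; lia.
    by move: x'; rewrite ii; clear -xx; lia.
- by right; exists u => //; rewrite !uin; clear -sj x0m; lia.
- by move=> x xx; right; exists v => //; rewrite !vin; clear -sj xx xx1; lia.
- by left=> -[_ _ []]; right; exists i; split=> //; clear; lia.
Qed.

(** The free stretch, about [5 * U] long, must take one brick and one filler. Order and filler
    height are forced because every alternative rises above the step at the right end, contrary to
    [no_defect]; the widths then determine the labels by [code_equation]. *)
Lemma row_step j : j < W -> (forall j', j' < j -> P (brick q i j')) ->
  (0 < j -> P (filler q i j)) ->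
  exists r, [/\ EB (q i j) r, EF (q i.-1 j.+1) r, j.+1 = W -> r = bd i W,
    P ((cut q i j, 4 * i + stair j), (3 * U + Q (odd i) (odd j.+1) r - code_at q i j, 4)) &
    P ((coarse i j.+1 + Q (odd i) (odd j.+1) r, 4 * i + stair j),
       (2 * U + code_at q i.-1 j.+1 - Q (odd i) (odd j.+1) r, filler_height (odd j.+1)))].
Proof.
move=> jW Hb Hf; pose x0 := cut q i j; pose x1 := cut q i.-1 j.+1; pose y := 4 * i + stair j.
have iE : i.-1.+1 = i by lia.
have st := stair_step j.
have c0 := code_at_lt q i j; have c1 := code_at_lt q i.-1 j.+1.
have len : x1 + code_at q i j = x0 + 5 * U + code_at q i.-1 j.+1.
  by rewrite /x1 /x0 /cut coarseS [coarse i.-1 j]coarse_pred ?iE; lia.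
have wr y' : y <= y' < 4 * i + stair j.+1 -> wall region P x1 y' x1.-1 y'.
  move=> yy; apply: (@side_wall j.+1) => //.
    by move=> jW2; have := @cut_lt q q i.-1 j.+2 i.-1 j.+1 _ (leqnSn _) _; rewrite /x1; lia.
  by apply/orP; left; rewrite /x1; lia.
have F : floor region P x0 x1 y.
  apply: (floorI tP); [by move: len; rewrite /x0 /cut; lia|by rewrite /y; lia| | | |by apply: wr; rewrite /y; lia].
  - move=> x xx; apply: (@row_region j) => //; rewrite /y; first by lia.
    by apply/orP; left; case: (j) => [|k]; [rewrite ?stair0 /=; lia|have := stair_step k; rewrite -[k.+1.-1]/k; lia].
  - have [j0|j0] := posnP j.
      left=> -[_ lo _]; apply: lo; left; exists i; split=> //; first by rewrite /y j0 ?stair0 /=; lia.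
      by rewrite /x0 j0 /cut /code_at q_left; have := code_at_lt bd i 0; rewrite /code_at; lia.
    right; exists (brick q i j.-1); first by apply: Hb; lia.
    have st' := stair_step j.-1; rewrite prednK // in st'.
    have iM : i <= M by lia.
    have jE : j.-1.+1 = j by lia.
    rewrite !in_brick // jE.
    have := @cut_lt q q i j i j.-1; rewrite /x0 /y; lia.
  - move=> x xx; have [lt|ge] := ltnP x (cut q i.-1 j); last first.
      apply: (@side_wall j) => //; [by lia|by rewrite -/x1; lia| |by rewrite leqnn orbT].
      by rewrite /y; case: (j) => [|k]; [rewrite ?stair0 /=; lia|have := stair_step k; lia].
    have [j0|j0] := posnP j.
      left=> -[/andP[y4 _] lo _]; apply: lo; left; exists i.-1; split.
      + by move: y4; rewrite /y j0 ?stair0 /=; lia.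
      + by move: y4; rewrite /y j0 ?stair0 /=; lia.
      + by move: lt; rewrite j0 /cut /code_at q_left //; lia.
    right; exists (filler q i j); first exact: Hf.
    have st' := stair_step j.-1; rewrite prednK // in st'.
    rewrite !in_filler //; rewrite /y -/x0; lia.
have x01 : x0 < x1 by lia.
have [u [Pu u1 ux Fu]] := floorS x01 F.
have nodef v : P v -> in_placed v x1.-1 (4 * i + stair j.+1) ->
    ~~ in_placed v x1 (4 * i + stair j.+1) -> False.
  by move=> Pv; apply: no_defect.
(* If a filler came first, the brick of height 4 would end at [x1], where the step is at most 3
   high. *)
case: (gadget_tile_cases (tileP Pu)) => [[l1 l2 uh [pi [pj [l [r [E e]]]]]]|[l1 l2 _]]; last first.
  have lt : x0 + u.2.1 < x1 by lia.
  have [||v [pi [pj [l [r [Pv v1 vx _ vt]]]]]] := floor_brick lt _ _ (Fu lt); [by lia|by lia|].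
  by case: (nodef v) => //; rewrite /in_placed v1 vx vt /= /y; rewrite vt /= in vx; rewrite ?vx; lia.
have lt : x0 + u.2.1 < x1 by lia.
have [|v [pi' [pj' [c [d [Pv v1 vx E' vt]]]]]] := floor_filler lt _ (Fu lt); first by lia.
set xm := x0 + u.2.1 in lt vx v1.
have pjE : pj' = odd j.+1.
  have vh : v.2.2 = filler_height pj' by rewrite vt.
  apply/eqP; apply: contraT => ne; exfalso.
  have [h|h] := ltnP (filler_height (odd j.+1)) (filler_height pj').
    apply: (nodef v) => //; rewrite /in_placed v1 /= vx vh /y stairS; lia.
  have {}h : filler_height pj' = 2 /\ filler_height (odd j.+1) = 3.
    by move: h ne; case: (pj'); case: (odd j.+1).
  (* A filler of height 2 in a step of height 3 leaves a strip of height 1, closed on both sides,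
     which can only take another filler and overshoots. *)
  have F2 : floor region P xm x1 (y + 2).
    apply: (floorI tP); [by rewrite lt andbT /xm; lia|by lia| | | |].
    - move=> x xx; apply: (@row_region j) => //; rewrite -/x0 -/x1.
      + by rewrite /xm in xx; lia.
      + by rewrite stairS /y; lia.
      + by apply/orP; right; rewrite /xm in xx; lia.
    - by right; exists u => //; rewrite /in_placed u1 /= uh /xm; lia.
    - by move=> x xx; right; exists v => //; rewrite /in_placed v1 /= vx vh; lia.
    - by apply: wr; rewrite stairS /y; lia.
  have [|v' [p1 [p2 [c' [d' [Pv' v1' vx' _ vt']]]]]] := floor_filler lt _ F2; first by lia.
  have vh' : v'.2.2 = filler_height p2 by rewrite vt'.
  have fb := filler_height_bounds p2.
  apply: (nodef v') => //; rewrite /in_placed v1' /= vx' vh' /y stairS; lia.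
have uw : u.2.1 = 3 * U + Q pi (~~ pj) r - Q pi pj l by rewrite e.
have vw : v.2.1 = 2 * U + Q pi' pj' c - Q (~~ pi') pj' d by rewrite vt.
have eq : u.2.1 + v.2.1 + code_at q i j = 5 * U + code_at q i.-1 j.+1.
  by rewrite /xm in vx; lia.
rewrite uw vw pjE in eq; have [[? ? ? ? ?] ?] := code_equation eq; subst pi pj l pi' c d.
have oj : odd j.+1 = ~~ odd j by [].
have oi : ~~ odd i.-1 = odd i by rewrite -[in RHS]iE.
have uE : u = ((x0, y), (3 * U + Q (odd i) (odd j.+1) r - code_at q i j, 4)).
  by case: u u1 e {Pu ux Fu l1 l2 uh uw vw lt vx v1 xm eq} => [a b] /= -> ->.
have xmE : xm = coarse i j.+1 + Q (odd i) (odd j.+1) r.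
  by rewrite /xm uw -/(code_at q i j) /x0 /cut coarseS oj; lia.
have vE : v = ((coarse i j.+1 + Q (odd i) (odd j.+1) r, y),
    (2 * U + code_at q i.-1 j.+1 - Q (odd i) (odd j.+1) r, filler_height (odd j.+1))).
  by case: v v1 vt {Pv vx vw eq} => [a b] /= -> ->; rewrite -xmE pjE /filler_tile oi.
exists r; split=> //; [|by rewrite -/y -/x0 -uE|by rewrite -/y -vE].
by move=> jE; apply: (@row_end j r) => //; [rewrite -/y -/x0 -uE|rewrite -/y -vE].
Qed.

End Row.

Definition upd_label (q : nat -> nat -> L) i j c : nat -> nat -> L :=
  fun i' j' => if (i' == i) && (j' == j) then c else q i' j'.

Lemma upd_label_ne q i j c i' j' : (i' != i) || (j' != j) -> upd_label q i j c i' j' = q i' j'.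
Proof. by rewrite /upd_label -negb_and => /negbTE ->. Qed.

(** The invariant of the forcing, row by row and from left to right. Agreement with the right border
    is recorded only for finished rows, and agreement with the top border only at the very end. *)
Definition partial_labelling (q : nat -> nat -> L) i j : Prop :=
  [/\ forall j, j <= W -> q 0 j = bd 0 j, forall i, i <= M -> q i 0 = bd i 0,
      forall i', i' < i -> q i' W = bd i' W,
      forall i' j', 1 <= i' <= M -> j' < W -> (i' < i) || ((i' == i) && (j' < j)) ->
        P (brick q i' j') /\ EB (q i' j') (q i' j'.+1) &
      forall i' j', 1 <= i' <= M -> 1 <= j' <= W -> (i' < i) || ((i' == i) && (j' <= j)) ->
        P (filler q i' j') /\ EF (q i'.-1 j') (q i' j')].

Lemma partial_labelling_step q i j : 1 <= i <= M -> j < W ->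
  partial_labelling q i j ->
  exists2 q', partial_labelling q' i j.+1 & j.+1 = W -> q' i W = bd i W.
Proof.
move=> iM jW [h0 hl hr hb hf].
have [|||r [E1 E2 rW Pb Pf]] := @row_step q i iM h0 hl hr _ j jW.
- by move=> i' j' ii jj; apply: (proj1 (hb i' j' _ jj _)); lia.
- by move=> j' jj; apply: (proj1 (hb i j' iM _ _)); lia.
- by move=> j0; apply: (proj1 (hf i j iM _ _)); lia.
exists (upd_label q i j.+1 r); last first.
  by move=> jE; rewrite /upd_label -jE !eqxx /= rW // jE.
have bE i' j' : 1 <= i' -> (i' < i) || ((i' == i) && (j' < j)) ->
    brick (upd_label q i j.+1 r) i' j' = brick q i' j'.
  by move=> i0 lt; rewrite /brick /cut /code_at !upd_label_ne //; lia.
have fE i' j' : 1 <= i' -> (i' < i) || ((i' == i) && (j' <= j)) ->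
    filler (upd_label q i j.+1 r) i' j' = filler q i' j'.
  by move=> i0 lt; rewrite /filler /cut /code_at !upd_label_ne //; lia.
split.
- by move=> j' jj; rewrite upd_label_ne ?h0 //; lia.
- by move=> i' ii; rewrite upd_label_ne ?hl // orbT.
- by move=> i' ii; rewrite upd_label_ne ?hr //; lia.
- move=> i' j' ii jj lt.
  have [lt'|ge] := boolP ((i' < i) || ((i' == i) && (j' < j))).
    have [? ?] := hb i' j' ii jj lt'.
    by rewrite bE //; last lia; rewrite !upd_label_ne //; lia.
  have -> : i' = i by lia. have -> : j' = j by lia.
  rewrite /brick /cut /code_at upd_label_ne; last by lia.
  by rewrite /upd_label !eqxx.
- move=> i' j' ii jj lt.
  have [lt'|ge] := boolP ((i' < i) || ((i' == i) && (j' <= j))).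
    have [? ?] := hf i' j' ii jj lt'.
    by rewrite fE //; last lia; rewrite !upd_label_ne //; lia.
  have -> : i' = i by lia. have -> : j' = j.+1 by lia.
  rewrite /filler /cut /code_at [upd_label _ _ _ _ i.-1 _]upd_label_ne; last by lia.
  by rewrite /upd_label !eqxx.
Qed.

Lemma partial_labelling_row q i : 1 <= i <= M -> partial_labelling q i 0 ->
  exists q', partial_labelling q' i.+1 0.
Proof.
move=> iM H0.
have [q' [h0 hl hr hb hf] hW] : exists2 q', partial_labelling q' i W & q' i W = bd i W.
  have K j : j <= W -> exists2 q', partial_labelling q' i j & j = W -> q' i W = bd i W.
    elim: j => [|j IH] jW; first by exists q => // jW'; move: W_gt0; rewrite -jW'.
    have [|q1 H1 _] := IH; first exact: ltnW.
    exact: (partial_labelling_step iM jW H1).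
  by have [q' H' /(_ erefl) e] := K W (leqnn _); exists q'.
exists q'; split=> //.
- by move=> i' ii; have [->//|ne] := eqVneq i' i; apply: hr; lia.
- by move=> i' j' ii jj lt; apply: hb => //; lia.
- by move=> i' j' ii jj lt; apply: hf => //; lia.
Qed.

Lemma forced_labelling : exists q, labelling q /\ forall u, placed_in q u -> P u.
Proof.
have [q [h0 hl hr hb hf]] : exists q, partial_labelling q M.+1 0.
  have K i : i <= M -> exists q, partial_labelling q i.+1 0.
    elim: i => [|i IH] iM; last first.
      have [|q Hq] := IH; first exact: ltnW.
      by apply: (partial_labelling_row _ Hq).
    exists bd; split=> //; move=> i' j' ii jj lt; exfalso; lia.
  exact: K.
exists q; split; last first.
  move=> u [[i [j [ii jj ->]]]|[i [j [ii jj ->]]]].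
    by have [|//] := hb i j ii jj; lia.
  by have [|//] := hf i j ii jj; lia.
split; [|by move=> i j ii jj; have [|//] := hb i j ii jj; lia|by move=> i j ii jj; have [|//] := hf i j ii jj; lia].
move=> i j iM jW; have [->|i0] := posnP i; first by rewrite h0.
have [->|j0] := posnP j; first by rewrite hl.
have [->|jW'] := eqVneq j W; first by rewrite hr.
have [/eqP iE _|] := boolP (i == M); last by [].
rewrite iE {i iM i0 iE}.
have jlt : j < W by lia.
have [Pb _] : P (brick q M j) /\ EB (q M j) (q M j.+1) by apply: hb => //; lia.
have [Pb' _] : P (brick q M j.-1) /\ EB (q M j.-1) (q M j.-1.+1) by apply: hb => //; lia.
have st := stair_step j.-1; rewrite prednK // in st.
(* Nothing rests on row [M], so its labels are compared with the upper border: a cut left of the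
   border makes the brick cover a cell outside, and a cut right of it leaves a floor too narrow for
   any tile. *)
pose y := 4 * M.+1 + stair j.-1.
have R : region (cut q M j) y.
  apply/regP; exists (brick q M j) => //; rewrite in_brick // leqnn /=.
  have := @cut_lt q q M j.+1 M j; rewrite /y; lia.
have c1 := code_at_lt q M j; have c2 := code_at_lt bd M j.
have [//|ne] := eqVneq (q M j) (bd M j).
have ne' : cut q M j <> cut bd M j.
  by rewrite /cut /code_at => /addnI/pow4_inj/label_rank_inj[_ _ er]; rewrite er eqxx in ne.
exfalso; have [lt|ge] := ltnP (cut q M j) (cut bd M j).
  by case: R => _ lo _; apply: lo; right; exists j; split=> //; rewrite /y; lia.
have lt : cut bd M j < cut q M j by lia.
have xpos : 0 < cut bd M j by rewrite /cut; lia.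
suff F : floor region P (cut bd M j) (cut q M j) y.
  by have := floor_small lt F; rewrite /cut; lia.
apply: (floorI tP); [by rewrite xpos|by rewrite /y; lia| | | |].
- move=> x xx; case: R => yR lo ro; split=> //.
    case=> [[i' [iM' y' x']]|[j' [jM' y' x']]]; first by move: y'; rewrite /y; lia.
    have jj : j' = j.
      have := @stair_le j j'.-1; have := @stair_le j' j.-1; move: y'; rewrite /y; lia.
    by move: x'; rewrite jj; lia.
  move=> ro'; apply: ro; case: ro' => [[j' [h1 h2 h3]]|[i' [h1 h2 h3]]]; [left; exists j'|right; exists i']; split=> //; lia.
- left=> -[_ lo _]; apply: lo; right; exists j; split; [by lia|by rewrite /y; lia|by lia].
- move=> x xx; right; exists (brick q M j.-1) => //.
  have := @cut_lt bd q M j M j.-1.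
  rewrite !in_brick ?prednK // /y; lia.
- right; exists (brick q M j) => //; rewrite !in_brick // leqnn /=.
  have := @cut_lt q q M j.+1 M j; rewrite /y; lia.
Qed.

End Forced.

(** * Every labelling gives a tiling *)

Lemma labelling_region q u x y : labelling q -> placed_in q u -> in_placed u x y -> region x y.
Proof.
move=> [hbd hB hF].
have bdl i : i <= M -> q i 0 = bd i 0 by move=> iM; rewrite hbd ?eqxx ?orbT.
have bdr i : i <= M -> q i W = bd i W by move=> iM; rewrite hbd ?eqxx ?orbT.
have bdb j : j <= W -> q 0 j = bd 0 j by move=> jW; rewrite hbd ?eqxx ?orbT.
have bdt j : j <= W -> q M j = bd M j by move=> jW; rewrite hbd ?eqxx ?orbT.
have stW : stair W.-1 + 2 <= stair W <= stair W.-1 + 3.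
  by have := stair_step W.-1; rewrite prednK.
case=> [[i [j [iM jW ->]]]|[i [j [iM jW ->]]]].
  rewrite in_brick; last by lia.
  case/andP=> xx yy; split.
  - by have := @stair_le j W.-1; lia.
  - case=> [[i' [iM' y' x']]|[j' [jM' y' x']]].
      have : cut bd i' 0 <= cut q i j by apply: cut_le; [lia|lia|move=> _ ->; rewrite bdl //; lia].
      by lia.
    have jj : j' <= j by rewrite leqNgt; apply/negP => lt; have := @stair_le j j'.-1; lia.
    have : cut bd M j' <= cut q i j by apply: cut_le; [lia|lia|move=> -> ->; rewrite bdt //; lia].
      by lia.
  - case=> [[j' [jM' y' x']]|[i' [iM' y' x']]].
      have jj : j < j' by rewrite ltnNge; apply/negP => le; have := @stair_le j' j; lia.
      have : cut q i j.+1 <= cut bd 0 j' by apply: cut_le; lia.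
      by lia.
    have ii : i' <= i by have := @stair_le j W; lia.
    have : cut q i j.+1 <= cut bd i' W by apply: cut_le; [lia|lia|move=> _ _; rewrite bdr //; lia].
      by lia.
rewrite in_filler; [|by lia..].
have stj := stair_step j.-1; rewrite prednK in stj; last by lia.
case/andP=> xx yy; split.
- by have := @stair_le j.-1 W.-1; have := @stair_le j W; lia.
- case=> [[i' [iM' y' x']]|[j' [jM' y' x']]].
    have : cut bd i' 0 <= cut q i j by apply: cut_le; lia.
      by lia.
  have jj : j' <= j by rewrite leqNgt; apply/negP => lt; have := @stair_le j j'.-1; lia.
  have : cut bd M j' <= cut q i j by apply: cut_le; [lia|lia|move=> -> ->; rewrite bdt //; lia].
      by lia.
- case=> [[j' [jM' y' x']]|[i' [iM' y' x']]].
    have jj : j <= j' by rewrite leqNgt; apply/negP => lt; have := @stair_le j' j.-1; lia.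
    have : cut q i.-1 j <= cut bd 0 j' by apply: cut_le; [lia|lia|move=> _ _; rewrite bdb //; lia].
      by lia.
  have ii : i' <= i.-1 by have := @stair_le j W; lia.
  have : cut q i.-1 j <= cut bd i' W by apply: cut_le; [lia|lia|move=> _ _; rewrite bdr //; lia].
      by lia.
Qed.

Lemma placed_in_uniq q u v x y : placed_in q u -> placed_in q v ->
  in_placed u x y -> in_placed v x y -> u = v.
Proof.
have BB i j i' j' : 1 <= i <= M -> 1 <= i' <= M -> in_placed (brick q i j) x y ->
    in_placed (brick q i' j') x y -> j < j' -> False.
  move=> iM iM'; rewrite !in_brick; [|lia..].
  move=> /andP[xx yy] /andP[xx' yy'] jj; have sl := @stair_le j j' (ltnW jj).
  have : cut q i j.+1 <= cut q i' j' by apply: cut_le; [lia|lia|].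
  by lia.
have BF i j i' j' : 1 <= i <= M -> 1 <= i' <= M -> 0 < j' -> in_placed (brick q i j) x y ->
    in_placed (filler q i' j') x y -> False.
  move=> iM iM' j0; rewrite in_brick ?in_filler; [|lia..].
  move=> /andP[xx yy] /andP[xx' yy'].
  have [jj|jj] := ltnP j j'.
    have sl := @stair_le j j'.-1; have : cut q i j.+1 <= cut q i' j' by apply: cut_le; [lia|lia|].
  by lia.
  have sl := @stair_le j' j jj.
  have : cut q i'.-1 j' <= cut q i j by apply: cut_le; [lia|lia|].
  by lia.
have FF i j i' j' : 1 <= i <= M -> 1 <= i' <= M -> 0 < j -> 0 < j' -> in_placed (filler q i j) x y ->
    in_placed (filler q i' j') x y -> j < j' -> False.
  move=> iM iM' j0 j0'; rewrite !in_filler; [|lia..].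
  move=> /andP[xx yy] /andP[xx' yy'] jj.
  have sl := @stair_le j j'.-1.
  have : cut q i.-1 j <= cut q i' j' by apply: cut_le; [lia|lia|].
  by lia.
case=> [[i [j [iM jW ->]]]|[i [j [iM jW ->]]]]; case=> [[i' [j' [iM' jW' ->]]]|[i' [j' [iM' jW' ->]]]] h h'.
- have [lt|lt|e] := ltngtP j j'; [by case: (BB i j i' j')|by case: (BB i' j' i j)|].
  move: h h'; rewrite e !in_brick; [|lia..] => /andP[_ y1] /andP[_ y2].
  by have -> : i = i' by lia.
- by case: (BF i j i' j') => //; lia.
- by case: (BF i' j' i j) => //; lia.
- have [lt|lt|e] := ltngtP j j'; [by case: (FF i j i' j') => //; lia|by case: (FF i' j' i j) => //; lia|].
  have st := stair_step j'.-1; rewrite prednK in st; last by lia.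
  move: h h'; rewrite e !in_filler; [|lia..] => /andP[_ y1] /andP[_ y2].
  by have -> : i = i' by lia.
Qed.

Lemma labelling_covers q x y : labelling q -> region x y ->
  exists2 u, placed_in q u & in_placed u x y.
Proof.
move=> [hbd hB hF] [yr lo ro].
have bdl i : i <= M -> q i 0 = bd i 0 by move=> iM; rewrite hbd ?eqxx ?orbT.
have bdr i : i <= M -> q i W = bd i W by move=> iM; rewrite hbd ?eqxx ?orbT.
have bdb j : j <= W -> q 0 j = bd 0 j by move=> jW; rewrite hbd ?eqxx ?orbT.
have bdt j : j <= W -> q M j = bd M j by move=> jW; rewrite hbd ?eqxx ?orbT.
pose row j := (y - stair j) %/ 4.
have rowP j : 4 + stair j <= y -> 1 <= row j /\ 4 * row j + stair j <= y < 4 * row j + stair j + 4.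
  by rewrite /row; lia.
(* the last column whose brick at this height starts at or before [x] *)
pose ok j := [&& j < W, 4 + stair j <= y, row j <= M & cut q (row j) j <= x].
have ok_ex : exists j, ok j.
  have [lt|ge] := ltnP y (4 * M.+1).
    exists 0; have [|r1 r2] := rowP 0; first by rewrite ?stair0 /=; lia.
    rewrite stair0 in r2; apply/and4P; split=> //; rewrite ?stair0; [by lia|by lia|].
    rewrite leqNgt; apply/negP => xlt; apply: lo; left; exists (row 0); split; [by lia|by lia|].
    by move: xlt; rewrite /cut /code_at bdl //; lia.
  have [j [jW yj]] : exists j, 1 <= j < W /\ 4 * M.+1 + stair j.-1 <= y < 4 * M.+1 + stair j.
    have exj : exists j, y < 4 * M.+1 + stair j by exists W.-1; lia.
    case: (ex_minnP exj) => j yj jmin; exists j.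
    have j0 : 0 < j by case: j yj {jmin} => //; rewrite stair0; lia.
    have jW : j <= W.-1 by apply: jmin; lia.
    split; first by lia.
    by rewrite yj andbT leqNgt; apply/negP => /jmin; lia.
  have stj := stair_step j.-1; rewrite prednK in stj; last by lia.
  exists j; have [|r1 r2] := rowP j; first by lia.
  have rM : row j = M by lia.
  apply/and4P; split; [by lia|by lia|by lia|].
  rewrite leqNgt; apply/negP => xlt; apply: lo; right; exists j; split=> //.
  by move: xlt; rewrite rM /cut /code_at bdt //; lia.
have ok_le j : ok j -> j <= W by case/and4P => /ltnW.
case: (ex_maxnP ok_ex ok_le) => j /and4P[jW yj rM xj] jmax.
have [r1 r2] := rowP j yj; set i := row j in rM xj r1 r2.
have st := stair_step j.
have [lt|ge] := ltnP x (cut q i j.+1).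
  exists (brick q i j); first by left; exists i, j; split=> //; lia.
  by rewrite in_brick // xj lt r2.
exists (filler q i j.+1); first by right; exists i, j.+1; split=> //; lia.
rewrite in_filler //; last by lia.
rewrite ge /=; have [yS|yS] := ltnP y (4 + stair j.+1).
  have i1 : i = 1 by lia.
  have -> : x < cut q i.-1 j.+1.
    rewrite i1 /= ltnNge; apply/negP => xge; apply: ro; left; exists j.+1; split=> //; first by rewrite -[j.+1.-1]/j; lia.
    by move: xge; rewrite /cut /code_at bdb.
  by rewrite i1 /=; lia.
have [jE|jne] := eqVneq j.+1 W.
  pose i' := (y - stair W) %/ 4.
  have [i'1 i'2] : 1 <= i' /\ 4 * i' + stair W <= y < 4 * i' + stair W + 4 by rewrite /i' -jE; lia.
  have i'M : i' <= M by have := @stair_le W.-1 W (leq_pred _); lia.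
  have xlt : x < cut bd i' W.
    rewrite ltnNge; apply/negP => xge; apply: ro; right; exists i'; split=> //; lia.
  have ii : i' = i \/ i' = i.-1 by move: r2 st i'2; rewrite jE; lia.
  case: ii => ii; first by move: xlt ge; rewrite ii jE /cut /code_at bdr //; lia.
  have -> : x < cut q i.-1 j.+1 by rewrite jE -ii /cut /code_at bdr.
  by move: i'2; rewrite ii -jE /=; lia.
have [|s1 s2] := rowP j.+1; first by [].
have jW' : j.+1 < W by lia.
have iM : row j.+1 <= M by lia.
have xlt : x < cut q (row j.+1) j.+1.
  rewrite ltnNge; apply/negP => xge.
  have : ok j.+1 by apply/and4P; split.
  by move/jmax; rewrite ltnn.
have ii : row j.+1 = i \/ row j.+1 = i.-1 by lia.
case: ii => ii; first by move: xlt; rewrite ii; lia.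
by rewrite -ii xlt /=; lia.
Qed.

Theorem gadget_tiling q : labelling q -> tiles_region gadget_tile region (placed_in q).
Proof.
move=> lq; have [hbd hB hF] := lq; split.
- move=> u [[i [j [iM jW ->]]]|[i [j [iM jW ->]]]].
    by left; exists (odd i), (odd j), (q i j), (q i j.+1); split; [exact: hB|].
  right; exists (odd i.-1), (odd j), (q i.-1 j), (q i j); split; first exact: hF.
  by rewrite /filler_tile /filler /code_at; case: (i) iM => // k _ /=.
- by move=> u v x y; exact: placed_in_uniq.
- move=> x y; split; first exact: labelling_covers.
  by move=> [u uq ux]; exact: labelling_region uq ux.
Qed.

Theorem gadget_forced P : tiles_region gadget_tile region P ->
  exists q, labelling q /\ forall u, P u <-> placed_in q u.
Proof.
move=> tP; have [q [lq sub]] := forced_labelling tP; exists q; split=> // u; split; last exact: sub.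
move=> Pu; have [TP uniqP regP] := tP.
have [w0 h0] := gadget_tile_pos (TP u Pu).
have uin : in_placed u u.1.1 u.1.2 by rewrite /in_placed !leqnn /=; lia.
have /(labelling_covers lq)[v vq vin] : region u.1.1 u.1.2 by apply/regP; exists u.
by rewrite (uniqP u v _ _ Pu (sub _ vq) uin vin).
Qed.

(** The corner of a brick reveals its place: at equal height a larger column means a lower row,
    hence a cut further to the right. What remains of its abscissa is the code of the label. Fillers
    differ from bricks in height. *)
Theorem gadget_labels_inj q q' : labelling q -> labelling q' ->
  (forall u, placed_in q u -> placed_in q' u) ->
  forall i j, i <= M -> j <= W -> q i j = q' i j.
Proof.
move=> [hbd _ _] [hbd' _ _] sub i j iM jW.
have [b|/norP[i0 /norP[_ /norP[j0 jW']]]] := boolP [|| i == 0, i == M, j == 0 | j == W].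
  by rewrite hbd // hbd'.
have : placed_in q' (brick q i j).
  by apply: sub; left; exists i, j; split=> //; lia.
case=> [[i' [j' [ii jj [e1 e2 _]]]]|[i' [j' [_ _ [_ _ _]]]]]; last by case: (odd j').
have c1 := code_at_lt q i j; have c2 := code_at_lt q' i' j'.
suff [ei ej] : i' = i /\ j' = j.
  by move: e1; rewrite ei ej /cut /code_at => /addnI/pow4_inj/label_rank_inj[].
have [lt|lt|e] := ltngtP j j'.
- have := @stair_le j.+1 j' lt; have := stair_step j => s1 s2.
  by have := @cut_lt q q' i j i' j'; have := @cut_lt q' q i' j' i j; lia.
- have := @stair_le j'.+1 j lt; have := stair_step j' => s1 s2.
  by have := @cut_lt q q' i j i' j'; have := @cut_lt q' q i' j' i j; lia.
- by split=> //; move: e2; rewrite e; lia.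
Qed.

End Gadget.

(** * Formulas as labelled grids *)

(** The accumulator tells whether the current clause is already satisfied, and a marker selects the
    current variable. Moving the marker one cell at a time keeps all rules local, so a fixed number
    of labels suffices. *)
Inductive instr := Guess | Reset | Step | Pos | Neg | Assert | Clear | Nop.

Inductive mode := Start of instr | Guessing | Marking | Unmarking | Seeking | Dropping
  | Test0 | Test1 | Clearing.

Definition mode_code (m : mode) : nat :=
  match m with
  | Start Guess => 0 | Start Reset => 1 | Start Step => 2 | Start Pos => 3 | Start Neg => 4
  | Start Assert => 5 | Start Clear => 6 | Start Nop => 7 | Guessing => 8 | Marking => 9
  | Unmarking => 10 | Seeking => 11 | Dropping => 12 | Test0 => 13 | Test1 => 14 | Clearing => 15
  end.

Definition mode_of_code (n : nat) : mode :=
  nth Clearing [:: Start Guess; Start Reset; Start Step; Start Pos; Start Neg; Start Assert; Start Clear;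
    Start Nop; Guessing; Marking; Unmarking; Seeking; Dropping; Test0; Test1; Clearing] n.

Definition mode_ord (m : mode) : 'I_16 := inord (mode_code m).

Lemma mode_ordK : cancel mode_ord (fun i => mode_of_code i).
Proof. by rewrite /mode_ord; case=> [[]| | | | | | | |]; rewrite inordK. Qed.

HB.instance Definition _ := Finite.copy mode (can_type mode_ordK).

Lemma card_mode : #|{: mode}| <= 16.
Proof. by rewrite -[16]card_ord; apply: leq_card (can_inj mode_ordK). Qed.

(** [inl] is the accumulator in the first cell of a row, [inr (x, m)] a bit [x] of the assignment
    with marker flag [m]. *)
Notation sym := (bool + bool * bool)%type.

(** A row is read from the accumulator towards the variables, so the value of a literal is guessed
    first; the mode carries the guess to the marker, where it is checked. *)
Definition test_mode (c : bool) : mode := if c then Test1 else Test0.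

(* The mode [Start Nop] also serves as the idle mode of the rest of a row. *)
Definition transition (l : mode) (b : sym) (c : bool) : option (mode * sym) :=
  match l, b with
  | Start Guess, inl a => if c then None else Some (Guessing, inl false)
  | Start Reset, inl a => if c then None else Some (Marking, inl a)
  | Start Step, inl a => if c then None else Some (Seeking, inl a)
  | Start Pos, inl a =>
      if a then if c then None else Some (Start Nop, inl true) else Some (test_mode c, inl c)
  | Start Neg, inl a =>
      if a then if c then None else Some (Start Nop, inl true) else Some (test_mode (~~ c), inl c)
  | Start Assert, inl a => if c || ~~ a then None else Some (Start Nop, inl false)
  | Start Clear, inl a => if c then None else Some (Clearing, inl false)
  | Start Nop, _ => if c then None else Some (Start Nop, b)
  | Guessing, inr (x, m) => Some (Guessing, inr (c, m))
  | Marking, inr (x, m) => if c then None else Some (Unmarking, inr (x, true))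
  | Unmarking, inr (x, m) => if c then None else Some (Unmarking, inr (x, false))
  | Seeking, inr (x, m) => if c then None else Some (if m then Dropping else Seeking, inr (x, false))
  | Dropping, inr (x, m) => if c then None else Some (Seeking, inr (x, true))
  | Test0, inr (x, m) => if c || (m && x) then None else Some (if m then Start Nop else Test0, b)
  | Test1, inr (x, m) => if c || (m && ~~ x) then None else Some (if m then Start Nop else Test1, b)
  | Clearing, inr _ => if c then None else Some (Clearing, inr (false, false))
  | _, _ => None
  end.

(** Prescribing the mode at the right end ensures that the marker has been found, and put down again
    when it is moved. *)
Definition final_mode (I : instr) : mode :=
  match I with
  | Guess => Guessing | Reset => Unmarking | Step => Seeking | Clear => Clearing | _ => Start Nop
  end.

(** [inl] labels belong to the two sides of the grid. In [inr (l, b, c)] the mode [l] arrives from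
    the left, the symbol [b] from below, and [c] is a choice bit. *)
Notation label := (mode + mode * sym * bool)%type.

Definition label_out (x : label) : option mode :=
  match x with inl s => Some s | inr (l, b, c) => omap fst (transition l b c) end.

Definition label_in (x : label) : mode := match x with inl s => s | inr (l, _, _) => l end.

Definition label_up (x : label) : option sym :=
  match x with inl s => None | inr (l, b, c) => omap snd (transition l b c) end.

Definition label_down (x : label) : option sym :=
  match x with inl s => None | inr (_, b, _) => Some b end.

Definition row_rel (x y : label) : bool := label_out x == Some (label_in y).

Definition col_rel (x y : label) : bool := label_up x == label_down y.

(** 16 modes for the sides and 16 modes, 6 symbols and 2 choices inside give [16 * 13]. *)
Lemma card_label : #|{: label}| <= 208.
Proof.
rewrite card_sum !card_prod card_sum card_prod !card_bool.
by have := card_mode; set m := #|_|; move=> h; rewrite (leq_trans (n := m * 13)) //; lia.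
Qed.

(** * Rows as runs of instructions *)

Fixpoint run (l : mode) (s : seq sym) (cs : seq bool) : option (mode * seq sym) :=
  match s, cs with
  | b :: s', c :: cs' =>
      if transition l b c is Some (l', t) then
        if run l' s' cs' is Some (e, ts) then Some (e, t :: ts) else None
      else None
  | _, _ => Some (l, [::])
  end.

Definition run_row (I : instr) (s : seq sym) (cs : seq bool) : option (seq sym) :=
  if run (Start I) s cs is Some (e, t) then if e == final_mode I then Some t else None else None.

(** An [m] out of range means that there is no marker, which is why the cells after the marker are
    built with [size a']. *)
Fixpoint cells (m : nat) (a : seq bool) : seq sym :=
  if a is x :: a' then inr (x, m == 0) :: (if m is m'.+1 then cells m' a' else cells (size a') a')
  else [::].

Definition plain (a : seq bool) : seq sym := [seq inr (x, false) | x <- a].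

Lemma cells_plain m a : size a <= m -> cells m a = plain a.
Proof. by elim: a m => //= x a IH [|m] //= h; rewrite IH. Qed.

Lemma size_cells m a : size (cells m a) = size a.
Proof. by elim: a m => //= x a IH [|m] /=; rewrite IH. Qed.

Section Cells.
Variables (n : nat).

Definition allF (cs : seq bool) : bool := ~~ has id cs.

Lemma run_unmark m a cs : size cs = size a ->
  run Unmarking (cells m a) cs = if allF cs then Some (Unmarking, plain a) else None.
Proof.
rewrite /allF; elim: a m cs => [|x a IH] m [|[] cs] //= [] h.
by have {}IH k := IH k cs h; case: m => [|m]; rewrite IH; case: (has id cs).
Qed.

Lemma run_clear m a cs : size cs = size a ->
  run Clearing (cells m a) cs = if allF cs then Some (Clearing, plain (nseq (size a) false)) else None.
Proof.
rewrite /allF; elim: a m cs => [|x a IH] m [|[] cs] //= [] h.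
by have {}IH k := IH k cs h; case: m => [|m]; rewrite IH; case: (has id cs).
Qed.

Lemma run_idle s cs : size cs = size s ->
  run (Start Nop) s cs = if allF cs then Some (Start Nop, s) else None.
Proof.
rewrite /allF; elim: s cs => [|x a IH] [|c cs] //= [] h.
by case: x => [?|[? ?]]; case: c; rewrite //= (IH cs h); case: (has id cs).
Qed.

Lemma run_guess a cs : size cs = size a -> run Guessing (plain a) cs = Some (Guessing, plain cs).
Proof. by elim: a cs => [|x a IH] [|c cs] //= [] h; rewrite IH. Qed.

Lemma run_seek_plain a cs : size cs = size a ->
  run Seeking (plain a) cs = if allF cs then Some (Seeking, plain a) else None.
Proof.
rewrite /allF; elim: a cs => [|x a IH] [|c cs] //= [] h.
by case: c; rewrite //= (IH cs h); case: (has id cs).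
Qed.

Lemma run_seek m a cs : size cs = size a -> m.+1 < size a ->
  run Seeking (cells m a) cs = if allF cs then Some (Seeking, cells m.+1 a) else None.
Proof.
elim: a m cs => [|x a IH] m [|c cs] //= [] h hm; case: m hm => [|m] hm.
  case: a IH h hm => [//|y a] IH h _; case: cs h => [//|c' cs] /= [] h.
  rewrite !cells_plain // /allF; case: c => //; case: c' => //=.
  by rewrite run_seek_plain // /allF; case: (has id cs).
by case: c; rewrite //= (IH m cs h hm) /allF /=; case: (has id cs).
Qed.

Lemma run_test k m a cs : size cs = size a -> m < size a ->
  run (test_mode k) (cells m a) cs =
  if allF cs && (nth false a m == k) then Some (Start Nop, cells m a) else None.
Proof.
elim: a m cs => [|x a IH] m [|c cs] //= [] h hm; case: m hm => [|m] hm.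
  rewrite cells_plain // /= /allF /=; have := @run_idle (plain a) cs; rewrite size_map => /(_ h) E.
  by clear IH; case: k; case: c; case: x; rewrite //= ?E /allF; case: (has id cs).
have := IH m cs h hm; clear IH; rewrite /allF /=; case: k => /= E; case: c => //=; rewrite E.
  by case: (has id cs) => //=; case: ifP.
by case: (has id cs) => //=; case: ifP.
Qed.

End Cells.

Definition acc_cells (A : bool) m a : seq sym := inl A :: cells m a.

Definition memory := (bool * nat * seq bool)%type.

Definition sem (I : instr) (c : memory) : option memory :=
  let: (A, m, a) := c in
  match I with
  | Reset => Some (A, 0, a)
  | Step => Some (A, m.+1, a)
  | Pos => Some (A || nth false a m, m, a)
  | Neg => Some (A || ~~ nth false a m, m, a)
  | Assert => if A then Some (false, m, a) else None
  | Clear => Some (false, size a, nseq (size a) false)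
  | _ => None
  end.

(** The only choice bits with which a row succeeds. For a literal the guess must be its value,
    except that it must be [false] when the accumulator is already set; without this rule
    assignments would be counted several times. *)
Definition sem_choice (I : instr) (c : memory) : seq bool :=
  let: (A, m, a) := c in
  match I with
  | Pos => ~~ A && nth false a m | Neg => ~~ A && ~~ nth false a m | _ => false
  end :: nseq (size a) false.

Definition applicable (I : instr) (c : memory) : bool :=
  let: (A, m, a) := c in
  match I with
  | Reset => 0 < size a | Step => m.+1 < size a | Pos | Neg => m < size a | Assert | Clear => true
  | _ => false
  end.

Lemma eq_nseq cs k : size cs = k -> (cs == nseq k false) = allF cs.
Proof.
rewrite /allF => <-; elim: cs => //= c cs IH; rewrite eqseq_cons IH.
by case: c.
Qed.

Lemma run_row_sem I c cs : applicable I c -> size cs = (size c.2).+1 ->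
  run_row I (acc_cells c.1.1 c.1.2 c.2) cs =
  if cs == sem_choice I c then omap (fun d : memory => acc_cells d.1.1 d.1.2 d.2) (sem I c) else None.
Proof.
case: c => -[A m] a /=; case: cs => [//|c cs] ap [] h; rewrite /run_row /acc_cells.
case: I ap => //= ap; rewrite eqseq_cons (eq_nseq h).
- case: a ap h => [//|x a] _ h; case: cs h => [//|c' cs] [] h; case: c => //=.
  have := @run_unmark m.-1 a cs h; have := @run_unmark (size a) a cs h; rewrite /allF => E1 E2 /=.
  case: c' => /=; first by case: m {E2}.
  by case: m E2 => [|m] E2 /=; rewrite ?E1 ?E2; case: (has id cs); rewrite //= eqxx cells_plain.
- by case: c => //=; rewrite run_seek //; case: allF; rewrite //= eqxx.
- case: A => /=; first by case: c => //=; rewrite run_idle ?size_cells //; case: allF; rewrite //= eqxx.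
  rewrite run_test //; case: allF; rewrite ?andbF ?andbT //=.
  by case: c; case: (nth false a m); rewrite //= eqxx.
- case: A => /=; first by case: c => //=; rewrite run_idle ?size_cells //; case: allF; rewrite //= eqxx.
  rewrite run_test //; case: allF; rewrite ?andbF ?andbT //=.
  by case: c; case: (nth false a m); rewrite //= eqxx.
- by case: c => //=; case: A => /=; rewrite ?run_idle ?size_cells //; case: allF; rewrite //= ?eqxx.
- case: c => //=; rewrite run_clear //; case: allF => //=.
  by rewrite eqxx cells_plain // size_nseq.
Qed.

Lemma run_row_guess n cs : size cs = n.+1 ->
  run_row Guess (acc_cells false n (nseq n false)) cs =
  if head false cs then None else Some (acc_cells false n (behead cs)).
Proof.
case: cs => [//|c cs] [] h; rewrite /run_row /acc_cells /=; case: c => //=.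
have e : cells n (nseq n false) = plain (nseq n false) by rewrite cells_plain // size_nseq.
by rewrite e run_guess ?size_nseq // eqxx cells_plain // h.
Qed.

Fixpoint run_rows (s : seq sym) (Is : seq instr) (css : seq (seq bool)) : option (seq sym) :=
  match Is, css with
  | op :: Is', cs :: css' => if run_row op s cs is Some t then run_rows t Is' css' else None
  | _, _ => Some s
  end.

Fixpoint sems (c : memory) (Is : seq instr) : option memory :=
  if Is is op :: Is' then
    if applicable op c then if sem op c is Some d then sems d Is' else None else None
  else Some c.

Fixpoint choices (c : memory) (Is : seq instr) : seq (seq bool) :=
  if Is is op :: Is' then sem_choice op c :: (if sem op c is Some d then choices d Is' else [::]) else [::].

Fixpoint applicable_all (c : memory) (Is : seq instr) : bool :=
  if Is is op :: Is' then applicable op c && (if sem op c is Some d then applicable_all d Is' else true)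
  else true.

Definition config_syms (c : memory) : seq sym := acc_cells c.1.1 c.1.2 c.2.

Lemma sem_size I c d : sem I c = Some d -> size d.2 = size c.2.
Proof. by case: c d => -[A m] a [[A' m'] a']; case: I => //=; [..|case: A => //|] => -[_ _ <-] //; rewrite size_nseq. Qed.

Lemma run_rows_sems c Is css : applicable_all c Is -> size css = size Is ->
  all (fun cs => size cs == (size c.2).+1) css ->
  forall s, run_rows (config_syms c) Is css = Some s <->
    css = choices c Is /\ exists2 d, sems c Is = Some d & s = config_syms d.
Proof.
elim: Is c css => [|I Is IH] c [|cs css] //=.
  by move=> _ _ _ s; split=> [[<-]|[_ [d [<-] ->]]] //; split=> //; exists c.
move=> /andP[ap apa] [] sz /andP[/eqP scs al] s; rewrite /config_syms run_row_sem // ap.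
case: eqP => [->|ne]; last by split=> // -[[e _]]; case: ne.
case E : (sem I c) apa => [d|] apa /=; last by split=> // -[_ [d]].
have sd := sem_size E.
have := IH d css apa sz; rewrite sd => /(_ al s) H; split.
  by move/H => [-> [d' e1 e2]]; split=> //; exists d'.
by move=> [[e] h]; apply/H.
Qed.

Notation literal := (nat * bool)%type.
Notation cnf := (seq (seq literal)).

Definition literal_program (l : literal) : seq instr :=
  Reset :: nseq l.1 Step ++ [:: if l.2 then Pos else Neg].

Definition clause_program (cl : seq literal) : seq instr :=
  flatten [seq literal_program l | l <- cl] ++ [:: Assert].

(** The final [Clear] erases the assignment, so that the top border is the same for all of them. *)
Definition cnf_program (f : cnf) : seq instr :=
  flatten [seq clause_program cl | cl <- f] ++ [:: Clear].

Arguments literal_program : simpl never.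
Arguments clause_program : simpl never.

Definition lit_holds (a : seq bool) (l : literal) : bool := nth false a l.1 == l.2.
Definition cnf_holds (a : seq bool) (f : cnf) : bool := all (has (lit_holds a)) f.
Definition cnf_bounded (n : nat) (f : cnf) : bool := all (all (fun l : literal => l.1 < n)) f.

Lemma sems_cat c Is Js : sems c (Is ++ Js) = obind (fun d => sems d Js) (sems c Is).
Proof. by elim: Is c => //= I Is IH c; case: applicable => //; case: sem. Qed.

Lemma applicable_all_cat c Is Js : applicable_all c (Is ++ Js) =
  applicable_all c Is && (if sems c Is is Some d then applicable_all d Js else true).
Proof.
elim: Is c => //= I Is IH c; case: applicable => //=; case: sem => //= d.
Qed.

Lemma sems_steps A m a k : m + k < size a -> applicable_all (A, m, a) (nseq k Step) /\
  sems (A, m, a) (nseq k Step) = Some (A, m + k, a).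
Proof.
elim: k m => [|k IH] m h; first by rewrite addn0.
have hk : m.+1 < size a by lia.
by rewrite /= hk; have [|-> ->] := IH m.+1; rewrite addSnnS.
Qed.

Lemma sems_literal A m a l : l.1 < size a -> applicable_all (A, m, a) (literal_program l) /\
  sems (A, m, a) (literal_program l) = Some (A || lit_holds a l, l.1, a).
Proof.
move=> h; rewrite /literal_program /= (leq_ltn_trans (leq0n _) h) /=.
have [|h1 h2] := @sems_steps A 0 a l.1; first by [].
rewrite applicable_all_cat sems_cat h1 h2 add0n /= /lit_holds.
by case: l.2 => /=; rewrite h //=; case: nth.
Qed.

Lemma sems_clause A m a cl : all (fun l : literal => l.1 < size a) cl ->
  exists m', applicable_all (A, m, a) (clause_program cl) /\
  sems (A, m, a) (clause_program cl) = if A || has (lit_holds a) cl then Some (false, m', a) else None.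
Proof.
rewrite /clause_program; elim: cl A m => [|l cl IH] A m.
  by exists m; rewrite /= orbF; case: A.
rewrite [all _ _]/= => /andP[hl hcl]; have [h1 h2] := sems_literal A m hl.
have [m' [h3 h4]] := IH (A || lit_holds a l) l.1 hcl.
have -> : flatten [seq literal_program l | l <- l :: cl] ++ [:: Assert] =
    literal_program l ++ (flatten [seq literal_program l | l <- cl] ++ [:: Assert]) by rewrite catA.
exists m'; rewrite applicable_all_cat sems_cat h1 h2 /= h3 h4.
by rewrite orbA.
Qed.

Lemma sems_cnf m a f : cnf_bounded (size a) f -> applicable_all (false, m, a) (cnf_program f) /\
  sems (false, m, a) (cnf_program f) =
    if cnf_holds a f then Some (false, size a, nseq (size a) false) else None.
Proof.
rewrite /cnf_program /cnf_holds; elim: f m => [|cl f IH] m //= /andP[hc hf].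
have [m' [h1 h2]] := sems_clause false m hc.
rewrite -catA applicable_all_cat sems_cat h1 h2 /=; case: (has _ cl) => //=; exact: IH.
Qed.

(** * Labellings of the grid and accepting runs *)

Section Rows.
Variables (n : nat) (f : cnf).
Hypotheses (n_gt0 : 0 < n) (f_n : cnf_bounded n f).

Definition program : seq instr := Guess :: cnf_program f.

Definition blank_syms : seq sym := acc_cells false n (nseq n false).

Definition assignment_choices (a : seq bool) : seq (seq bool) :=
  (false :: a) :: choices (false, n, a) (cnf_program f).

Lemma accepted_rows css : size css = size program -> all (fun cs => size cs == n.+1) css ->
  run_rows blank_syms program css = Some blank_syms <->
  exists a, [/\ size a = n, cnf_holds a f & css = assignment_choices a].
Proof.
case: css => [//|cs css] [] sz /= /andP[/eqP scs al]; rewrite run_row_guess //.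
case: cs scs => [//|c a] [] sa; case: c => /=.
  by split=> // -[a' [_ _ []]].
have ba : cnf_bounded (size a) f by rewrite sa.
have [ap se] := sems_cnf n ba.
have := run_rows_sems ap sz; rewrite /= sa => /(_ al blank_syms); rewrite /config_syms /= => H.
split.
  by move/H => [-> [d]]; rewrite se; case: ifP => // ha _ _; exists a.
by move=> [a' [sa' ha [ea ec]]]; subst a'; apply/H; split=> //; rewrite se ha sa; eexists.
Qed.

Definition width : nat := n.+2.
(** One row more than the program has instructions: the last is a [Nop] row, by the default of [nth]
    in [row_instr], whose labels are prescribed. *)
Definition height : nat := (size program).+1.

Definition row_instr (i : nat) : instr := nth Nop program i.-1.

(** Rows 0 and [height] are idle rows over blank cells: the former hands the blank contents to the
    program, the latter demands them back. *)
Definition border (i j : nat) : label :=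
  if j == 0 then inl (Start (if i == 0 then Nop else row_instr i))
  else if j == width then inl (if i == 0 then Start Nop else final_mode (row_instr i))
  else inr (Start Nop, nth (inl false) blank_syms j.-1, false).

Definition is_labelling (q : nat -> nat -> label) : Prop :=
  [/\ forall i j, i <= height -> j <= width -> [|| i == 0, i == height, j == 0 | j == width] -> q i j = border i j,
      forall i j, 1 <= i <= height -> j < width -> row_rel (q i j) (q i j.+1) &
      forall i j, 1 <= i <= height -> 1 <= j <= width -> col_rel (q i.-1 j) (q i j)].

Fixpoint row_labels (l : mode) (s : seq sym) (cs : seq bool) : seq label :=
  match s, cs with
  | b :: s', c :: cs' =>
     inr (l, b, c) :: row_labels (if transition l b c is Some (l', _) then l' else l) s' cs'
  | _, _ => [::]
  end.

Fixpoint syms_at (i : nat) (s : seq sym) (Is : seq instr) (css : seq (seq bool)) : seq sym :=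
  match i, Is, css with
  | i'.+1, op :: Is', cs :: css' => if run_row op s cs is Some t then syms_at i' t Is' css' else s
  | _, _, _ => s
  end.

Definition labels_of (css : seq (seq bool)) (i j : nat) : label :=
  if [|| i == 0, i == height, j == 0 | j == width] then border i j
  else nth (inl (Start Nop)) (row_labels (Start (row_instr i)) (syms_at i.-1 blank_syms program css)
         (nth [::] css i.-1)) j.-1.

Lemma run_labels l s cs e t : size cs = size s -> run l s cs = Some (e, t) ->
  [/\ size t = size s, size (row_labels l s cs) = size s &
   forall y0, (forall j, j < size s ->
       label_up (nth y0 (row_labels l s cs) j) = Some (nth (inl false) t j) /\
       label_down (nth y0 (row_labels l s cs) j) = Some (nth (inl false) s j)) /\
     (forall j, j <= size s -> label_out (nth y0 (inl l :: row_labels l s cs) j) =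
       Some (label_in (nth y0 (rcons (row_labels l s cs) (inl e)) j)))].
Proof.
elim: s l cs e t => [|b s IH] l [|c cs] e t //=.
  by move=> _ [<- <-]; split=> // y0; split=> // -[].
move=> [] sz; case E : (transition l b c) => [[l' t0]|//].
case F : (run l' s cs) => [[e' ts]|//] [<- <-].
have [h1 h2 h3] := IH _ _ _ _ sz F; split; [by rewrite /= h1|by rewrite /= h2|].
move=> y0; have [h4 h5] := h3 y0; split.
  by case=> [_|j hj] /=; [rewrite E|exact: h4].
case=> [_ //|j hj]; have := h5 j hj; rewrite /= -/(row_labels l' s cs).
by case: j hj => [|j] hj //= <-; rewrite E.
Qed.

Lemma labels_run l s cs e (x : nat -> label) : size cs = size s ->
  label_out (x 0) = Some l -> (forall j, j < size s -> x j.+1 = inr (label_in (x j.+1), nth (inl false) s j, nth false cs j)) ->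
  (forall j, j <= size s -> label_out (x j) = Some (label_in (x j.+1))) -> label_in (x (size s).+1) = e ->
  exists t, [/\ run l s cs = Some (e, t), forall y0 j, j < size s -> x j.+1 = nth y0 (row_labels l s cs) j &
    forall j, j < size s -> label_up (x j.+1) = Some (nth (inl false) t j)].
Proof.
elim: s l cs x => [|b s IH] l [|c cs] x //=.
  by move=> _ x0 _ Ho <-; exists [::]; split=> //; have := Ho 0 isT; rewrite x0 => -[->].
move=> [] sz x0 Hx Ho He.
have x1 : x 1 = inr (l, b, c).
  by have := Hx 0 isT; have := Ho 0 isT; rewrite x0 => -[<-].
have := Ho 1 isT; rewrite x1 /=; case E : (transition l b c) => [[l' t0]|//] /= [el'].
have [||||t [h1 h2 h3]] := IH l' cs (fun j => x j.+1) sz.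
- by rewrite x1 /= E.
- by move=> j hj; exact: (Hx j.+1).
- by move=> j hj; exact: (Ho j.+1).
- exact: He.
exists (t0 :: t); rewrite h1; split=> //.
  by move=> y0 [_|j hj] //=; exact: h2.
by case=> [_|j hj] /=; [rewrite x1 /= E|exact: h3].
Qed.

Lemma size_blank : size blank_syms = n.+1.
Proof. by rewrite /= size_cells size_nseq. Qed.

Lemma size_run l s cs e t : size cs = size s -> run l s cs = Some (e, t) -> size t = size s.
Proof. by move=> h /(run_labels h)[]. Qed.

Lemma size_run_row I s cs t : size cs = size s -> run_row I s cs = Some t -> size t = size s.
Proof.
move=> h; rewrite /run_row; case E : (run _ _ _) => [[e t']|//]; case: eqP => // _ [<-].
exact: size_run h E.
Qed.

Lemma syms_atS s Is css i k : size css = size Is -> all (fun cs => size cs == k) css -> size s = k ->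
  run_rows s Is css <> None -> i < size Is ->
  [/\ size (syms_at i s Is css) = k &
   run_row (nth Nop Is i) (syms_at i s Is css) (nth [::] css i) = Some (syms_at i.+1 s Is css)].
Proof.
elim: Is s css i => [|I Is IH] s [|cs css] i //= [] sz /andP[/eqP scs al] ss.
case E : (run_row I s cs) => [t|//] nn; case: i => [_|i hi] //=.
rewrite E; have st : size t = k by rewrite -ss; apply: size_run_row E; rewrite scs ss.
exact: IH.
Qed.

Lemma syms_at_last s Is css : size css = size Is ->
  forall t, run_rows s Is css = Some t -> syms_at (size Is) s Is css = t.
Proof.
elim: Is s css => [|I Is IH] s [|cs css] //= sz t; first by case.
by case: sz => sz; case: run_row => // u; exact: IH.
Qed.

Lemma run_rows_cons s op Is cs css t : run_row op s cs = Some t ->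
  run_rows s (op :: Is) (cs :: css) = run_rows t Is css.
Proof. by rewrite /= => ->. Qed.

Lemma syms_at_cons s op Is cs css t i : run_row op s cs = Some t ->
  syms_at i.+1 s (op :: Is) (cs :: css) = syms_at i t Is css.
Proof. by rewrite /= => ->. Qed.

Lemma border_mid i j : 0 < j < width -> border i j = inr (Start Nop, nth (inl false) blank_syms j.-1, false).
Proof. by move=> /andP[j0 jw]; rewrite /border; case: eqP => [?|_]; [lia|case: eqP => [?|//]; lia]. Qed.

Lemma labels_of_labelling css : size css = size program -> all (fun cs => size cs == n.+1) css ->
  run_rows blank_syms program css = Some blank_syms -> is_labelling (labels_of css).
Proof.
move=> sz al acc.
have nn : run_rows blank_syms program css <> None by rewrite acc.
have sa i : i < size program -> [/\ size (syms_at i blank_syms program css) = n.+1 &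
   run_row (nth Nop program i) (syms_at i blank_syms program css) (nth [::] css i) =
     Some (syms_at i.+1 blank_syms program css)].
  by apply: syms_atS => //; exact: size_blank.
have sc i : i < size program -> size (nth [::] css i) = n.+1.
  by move=> hi; apply/eqP; apply: (allP al); apply: mem_nth; rewrite sz.
have row i : 0 < i < height -> exists e, [/\ run (Start (row_instr i)) (syms_at i.-1 blank_syms program css)
     (nth [::] css i.-1) = Some (e, syms_at i blank_syms program css),
     e = final_mode (row_instr i), size (syms_at i.-1 blank_syms program css) = n.+1 & size (nth [::] css i.-1) = n.+1].
  case: i => [//|i] /= hi; have [s1] := sa i hi; rewrite /run_row /row_instr /=.
  case E : (run _ _ _) => [[e t]|//]; case: eqP => // ee [<-].
  by exists e; split=> //; exact: sc.
have lab i j : 0 < i < height -> 0 < j < width -> labels_of css i j =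
   nth (inl (Start Nop)) (row_labels (Start (row_instr i)) (syms_at i.-1 blank_syms program css) (nth [::] css i.-1)) j.-1.
  move=> hi hj; rewrite /labels_of; case: ifP => // /or4P[] /eqP; lia.
have labb i j : [|| i == 0, i == height, j == 0 | j == width] -> labels_of css i j = border i j.
  by rewrite /labels_of => ->.
have up i j : i <= size program -> 0 < j < width ->
   label_up (labels_of css i j) = Some (nth (inl false) (syms_at i blank_syms program css) j.-1).
  move=> hi hj; case: i hi => [|i] hi; first by rewrite labb // border_mid //.
  have hi' : 0 < i.+1 < height by rewrite /height; lia.
  have [e [E1 _ s1 s2]] := row _ hi'; have [_ _ /(_ (inl (Start Nop)))[H _]] := run_labels (etrans s2 (esym s1)) E1.
  rewrite lab //; have [|-> _] := H j.-1; last by [].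
  by rewrite s1; move: hj; rewrite /width; lia.
split.
- by move=> i j _ _ h; exact: labb.
- move=> i j hi hj; have [iM|iM] := eqVneq i height.
    rewrite !labb; [|by rewrite iM eqxx orbT|by rewrite iM eqxx orbT].
    have rN : row_instr height = Nop by rewrite /row_instr /height /= nth_default.
    rewrite /row_rel iM /border rN; case: (eqVneq j 0) => [->|j0] /=.
      by [].
    by rewrite (ltn_eqF hj); case: ifP.
  have hi' : 0 < i < height by lia.
  have [e [E1 ee s1 s2]] := row i hi'; have [_ h2 /(_ (inl (Start Nop)))[_ H]] := run_labels (etrans s2 (esym s1)) E1.
  have jn : j <= n.+1 by move: hj; rewrite /width.
  have := H j; rewrite s1 => /(_ jn); rewrite /row_rel => H'.
  set rl := row_labels _ _ _ in h2 H' *; apply/eqP.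
  have -> : labels_of css i j = nth (inl (Start Nop)) (inl (Start (row_instr i)) :: rl) j.
    case: j hj jn {H'} => [|j] hj jn; last by rewrite lab //; rewrite /width; lia.
    by rewrite labb ?orbT // /border /=; case: eqP => // i0; lia.
  have -> : labels_of css i j.+1 = nth (inl (Start Nop)) (rcons rl (inl e)) j.
    rewrite nth_rcons h2 s1; case: (ltnP j n.+1) => jl; first by rewrite lab //; rewrite /width; lia.
    have -> : j = n.+1 by lia.
    rewrite eqxx labb; last by rewrite /width eqxx !orbT.
    by rewrite /border /= /width eqxx ee; case: eqP => // i0; lia.
  exact: H'.
- move=> i j hi hj; have [jW|jW] := eqVneq j width.
    rewrite !labb; [|by rewrite jW eqxx !orbT|by rewrite jW eqxx !orbT].
    by rewrite /col_rel /border jW /= eqxx.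
  have hj' : 0 < j < width by lia.
  rewrite /col_rel up //; last by move: hi; rewrite /height; lia.
  have [iM|iM] := eqVneq i height.
    by rewrite iM labb ?eqxx ?orbT // border_mid // [height.-1]/(size program) (syms_at_last sz acc).
  have hi' : 0 < i < height by lia.
  have [e [E1 _ s1 s2]] := row _ hi'; have [_ _ /(_ (inl (Start Nop)))[H _]] := run_labels (etrans s2 (esym s1)) E1.
  rewrite lab //; have [|_ ->] := H j.-1; last by rewrite eqxx.
  by rewrite s1; move: hj'; rewrite /width; lia.
Qed.

Lemma labelling_labels_of q : is_labelling q -> exists css,
  [/\ size css = size program, all (fun cs => size cs == n.+1) css,
      run_rows blank_syms program css = Some blank_syms &
      forall i j, i <= height -> j <= width -> q i j = labels_of css i j].
Proof.
move=> [Hb HB HF].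
pose ch (x : label) : bool := if x is inr (_, _, c) then c else false.
pose css := [seq [seq ch (q i.+1 j.+1) | j <- iota 0 n.+1] | i <- iota 0 (size program)].
pose sy i := [seq odflt (inl false) (label_up (q i j.+1)) | j <- iota 0 n.+1].
have ssy i : size (sy i) = n.+1 by rewrite size_map size_iota.
have scss : size css = size program by rewrite size_map size_iota.
have ncss i : i < size program -> nth [::] css i = [seq ch (q i.+1 j.+1) | j <- iota 0 n.+1].
  by move=> hi; rewrite (nth_map 0) ?size_iota // nth_iota.
have nsy i j : j < n.+1 -> nth (inl false) (sy i) j = odflt (inl false) (label_up (q i j.+1)).
  by move=> hj; rewrite (nth_map 0) ?size_iota // nth_iota.
have q0 j : 0 < j < width -> q 0 j = border 0 j by move=> hj; apply: Hb => //; lia.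
(* A label of a side cannot occur inside the grid: each label passes a symbol upwards, so by
   [col_rel] the label above it receives one, and by [row_rel] it has a transition. *)
have mid0 i j : i <= height -> 0 < j < width -> exists l b c, q i j = inr (l, b, c) /\ (exists t, label_up (q i j) = Some t).
  move=> hi hj; elim: i hi => [_|i IH hi].
    by rewrite q0 // border_mid //; do 3!eexists; split; [reflexivity|eexists].
  have [l [b [c [e [t et]]]]] := IH (ltnW hi).
  have [hj1 hj2] : 0 < j <= width /\ j < width by lia.
  have := HF i.+1 j hi hj1; rewrite /col_rel /= et; case E : (q i.+1 j) => [s|[[l' b'] c']] //= _.
  exists l', b', c'; split=> //.
  have := HB i.+1 j hi hj2; rewrite /row_rel E /=.
  by case: (transition l' b' c') => [[l2 t2]|] //= _; exists t2.
have row i : i < size program -> run (Start (nth Nop program i)) (sy i) (nth [::] css i) =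
    Some (final_mode (nth Nop program i), sy i.+1) /\
    forall y0 j, j < n.+1 -> q i.+1 j.+1 = nth y0 (row_labels (Start (nth Nop program i)) (sy i) (nth [::] css i)) j.
  move=> hi; have hi1 : 1 <= i.+1 <= height by rewrite /height; lia.
  have [||||| t [h1 h2 h3]] := @labels_run (Start (nth Nop program i)) (sy i) (nth [::] css i)
     (final_mode (nth Nop program i)) (q i.+1).
  - by rewrite ncss // size_map size_iota ssy.
  - by rewrite Hb // ?orbT //; lia.
  - move=> j; rewrite ssy => hj; rewrite nsy // ncss // (nth_map 0) ?size_iota // nth_iota // add0n.
    have [l [b [c [e _]]]] := @mid0 i.+1 j.+1 ltac:(lia) ltac:(rewrite /width; lia).
    have := HF i.+1 j.+1 hi1 ltac:(rewrite /width; lia); rewrite /col_rel /= e /= => /eqP ->.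
    by [].
  - by move=> j; rewrite ssy => hj; apply/eqP; apply: HB => //; rewrite /width; lia.
  - rewrite ssy Hb; [|by move: hi1; lia|by []|by rewrite /width eqxx !orbT].
    by rewrite /border /width /= eqxx.
  have st : t = sy i.+1.
    apply: (@eq_from_nth _ (inl false)).
      by rewrite ssy (size_run _ h1) ?ssy // ncss // size_map size_iota.
    move=> j; rewrite (size_run _ h1) ?ssy; last by rewrite ncss // size_map size_iota.
    by move=> hj; rewrite nsy // h3 // ssy.
  by rewrite h1 st; split=> // y0 j hj; apply: h2; rewrite ssy.
have sy0 : sy 0 = blank_syms.
  apply: (@eq_from_nth _ (inl false)); first by rewrite ssy size_blank.
  by move=> j; rewrite ssy => hj; rewrite nsy // q0 ?border_mid //; rewrite /width; lia.
have syM : sy (size program) = blank_syms.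
  apply: (@eq_from_nth _ (inl false)); first by rewrite ssy size_blank.
  move=> j; rewrite ssy => hj; rewrite nsy //.
  have hM : 1 <= height <= height by rewrite /height; lia.
  have := HF height j.+1 hM ltac:(rewrite /width; lia); rewrite /col_rel /= => /eqP ->.
  rewrite Hb //; [|by rewrite /width; lia|by rewrite eqxx orbT].
  by rewrite border_mid //; rewrite /width; lia.
(* Induction from the end of the program: [k] counts the instructions still to be executed. *)
have runs k : k <= size program -> run_rows (sy (size program - k)) (drop (size program - k) program)
    (drop (size program - k) css) = Some blank_syms /\
    forall i, i <= k -> syms_at i (sy (size program - k)) (drop (size program - k) program) (drop (size program - k) css) =
       sy (size program - k + i).
  elim: k => [|k IH] hk.
    rewrite subn0 !drop_oversize ?scss // syM; split=> // i; rewrite leqn0 => /eqP ->.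
    by rewrite addn0 syM.
  have [IH1 IH2] := IH (ltnW hk); set i := size program - k.+1.
  have ei : size program - k = i.+1 by rewrite /i; lia.
  have hi : i < size program by rewrite /i; lia.
  have R1 : run_row (nth Nop program i) (sy i) (nth [::] css i) = Some (sy i.+1).
    by rewrite /run_row; have [-> _] := row i hi; rewrite eqxx.
  rewrite ei in IH1 IH2; rewrite (drop_nth Nop hi) (drop_nth [::]) ?scss // (run_rows_cons _ _ R1).
  split=> // -[_|i' hi']; first by rewrite addn0.
  by rewrite (syms_at_cons _ _ _ R1) IH2 // addnS.
have [r1 r2] := runs _ (leqnn _); rewrite subnn !drop0 sy0 in r1 r2.
exists css; split=> //.
  by apply/allP => _ /mapP[i _ ->]; rewrite size_map size_iota.
move=> i j hi hj; rewrite /labels_of; case: ifP => hb; first exact: Hb.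
have hi' : i.-1 < size program by move: hi hb; rewrite /height; lia.
have [_ h] := row i.-1 hi'; rewrite r2; last by lia.
have ei : i.-1.+1 = i by move: hb; lia.
have ej : j.-1.+1 = j by move: hb; lia.
rewrite add0n /row_instr; have := h (inl (Start Nop)) j.-1; rewrite ei ej; apply.
by move: hj hb; rewrite /width; lia.
Qed.

Theorem labelling_assignment q : is_labelling q -> exists a,
  [/\ size a = n, cnf_holds a f & forall i j, i <= height -> j <= width -> q i j = labels_of (assignment_choices a) i j].
Proof.
move=> /labelling_labels_of[css [h1 h2 h3 h4]].
by have [a [s1 s2 e]] := proj1 (accepted_rows h1 h2) h3; exists a; rewrite -e.
Qed.

Lemma size_choices c Is d : sems c Is = Some d -> size (choices c Is) = size Is.
Proof.
elim: Is c => //= I Is IH c; case: applicable => //; case: sem => // e /IH ->.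
by [].
Qed.

Lemma all_size_choices c Is : all (fun cs => size cs == (size c.2).+1) (choices c Is).
Proof.
elim: Is c => //= I Is IH c; apply/andP; split; first by case: c => -[A m] a; rewrite /= size_nseq.
by case E : (sem I c) => [d|] //; rewrite -(sem_size E).
Qed.

Theorem assignment_labelling a : size a = n -> cnf_holds a f -> is_labelling (labels_of (assignment_choices a)).
Proof.
move=> sa ha.
have ba : cnf_bounded (size a) f by rewrite sa.
have [ap se] := sems_cnf n ba; rewrite ha in se.
have h1 : size (assignment_choices a) = size program by rewrite /= (size_choices se).
have h2 : all (fun cs => size cs == n.+1) (assignment_choices a).
  by rewrite /= sa eqxx /=; have := all_size_choices (false, n, a) (cnf_program f); rewrite /= sa.
by apply: labels_of_labelling => //; apply/(accepted_rows h1 h2); exists a.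
Qed.

(** The choice bits of the [Guess] row, from its second cell on, spell out the assignment. *)
Theorem labels_of_inj a b : size a = n -> size b = n ->
  (forall i j, i <= height -> j <= width ->
     labels_of (assignment_choices a) i j = labels_of (assignment_choices b) i j) -> a = b.
Proof.
move=> sa sb H; apply: (@eq_from_nth _ false); first by rewrite sa sb.
move=> k; rewrite sa => kn.
have rl c l : size c = n -> forall m j, j < n -> nth l (row_labels Guessing (cells m (nseq n false)) c) j =
    inr (Guessing, nth (inl false) (cells m (nseq n false)) j, nth false c j).
  move: kn => _; elim: (n) c => [|k' IH] [|x c] //= [] sc m [|j] //= hj; case: m => [|m]; rewrite ?IH //.
have E c : size c = n -> labels_of (assignment_choices c) 1 k.+2 =
    inr (Guessing, nth (inl false) (cells n (nseq n false)) k, nth false c k).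
  move=> sc; rewrite /labels_of /=; case: ifP => [|_]; first by rewrite /width /height /=; lia.
  by rewrite /row_instr /= rl.
have kw : k.+2 <= width by rewrite /width; lia.
by have := H 1 k.+2 isT kw; rewrite !E // => -[].
Qed.

End Rows.

(** * Machines as formulas *)

Arguments tape_move : simpl never.

Section TapeCells.
Variables (S : Type).

Definition tape_small (l r : nat) (t : tape S) : Prop := size (tape_left t) <= l /\ size (tape_right t) <= r.

Lemma tape_small_step l r s d t : 0 < r -> tape_small l r t -> tape_small l.+1 r.+1 (tape_move d (tape_write s t)).
Proof.
move=> r0 [h1 h2]; case: t h1 h2 => tl tr /= h1 h2; have := size_behead tr; have := size_behead tl.
by rewrite /tape_move; case: d => /=; split=> /=; lia.
Qed.

Variable c : nat.

(* Cell [j] of a window in which the head stands over cell [c]. *)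
Definition tape_cell (t : tape S) (j : nat) : option S :=
  if c <= j then nth None (tape_right t) (j - c) else nth None (tape_left t) (c.-1 - j).

Lemma tape_cell_read t : tape_cell t c = tape_read t.
Proof. by rewrite /tape_cell leqnn subnn nth0. Qed.

Lemma tape_cell_write s t j : tape_cell (tape_write s t) j = if j == c then s else tape_cell t j.
Proof.
rewrite /tape_cell /=; case: (ltngtP c j) => // [h|->]; last by rewrite subnn.
have -> : j - c = (j - c).-1.+1 by lia.
by rewrite /= nth_behead.
Qed.

Lemma tape_cell_move d t j : 0 < c -> 0 < j -> tape_cell (tape_move d t) j =
  match d with Left => tape_cell t j.-1 | Stay => tape_cell t j | Right => tape_cell t j.+1 end.
Proof.
move=> c0 j0; rewrite /tape_cell /tape_move; case: t => l r; case: d => //=.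
- case: (ltngtP c j) => h.
  + have -> : (c <= j.-1) = true by lia.
    by have -> : j - c = (j.-1 - c).+1 by lia.
  + have -> : (c <= j.-1) = false by lia.
    by rewrite nth_behead; congr nth; lia.
  + rewrite -h subnn /=; have -> : (c <= c.-1) = false by lia.
    by rewrite subnn nth0.
- case: (ltngtP c j) => h.
  + have -> : (c <= j.+1) = true by lia.
    by rewrite nth_behead; congr nth; lia.
  + case: (ltngtP c j.+1) => h'; [lia| |].
      by have -> : c.-1 - j = (c.-1 - j.+1).+1 by lia.
    by rewrite h' subnn /= subnn nth0.
  + rewrite -h subnn; have -> : (c <= c.+1) = true by lia.
    by rewrite nth_behead; congr nth; lia.
Qed.

Lemma tape_cell_low l r t j : tape_small l r t -> j + l < c -> tape_cell t j = None.
Proof.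
move=> [h1 h2] h; rewrite /tape_cell; have -> : (c <= j) = false by lia.
by rewrite nth_default //; lia.
Qed.

Lemma tape_cell_high l r t j : tape_small l r t -> c + r <= j -> tape_cell t j = None.
Proof.
move=> [h1 h2] h; rewrite /tape_cell; have -> : (c <= j) = true by lia.
by rewrite nth_default //; lia.
Qed.

End TapeCells.

Definition column (M : machine) : finType :=
  (tm_state M * {ffun 'I_(tm_work M).+2 -> option (bool + tm_extra M)})%type.

Section Columns.
Variables (M : machine) (c N : nat).
Notation column := (column M).

(** The heads stay over column [c] and the tapes move instead. All heads are thereby aligned, one
    column can serve all tapes, and no head position has to be coded; the state is copied into every
    column. *)
Definition config_column (k : config M) (j : nat) : column := (k.1, [ffun i => tape_cell c (k.2 i) j]).

(* [k] tells which of the three neighbours is the column under the heads. *)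
Definition next_column (k : nat) (h l m r : column) : column :=
  if tm_halt h.1 then m else
  let: (q, act) := tm_step h.1 h.2 in
  (q, [ffun i => match (act i).2 with
       | Left => if k == 0 then (act i).1 else l.2 i
       | Stay => if k == 1 then (act i).1 else m.2 i
       | Right => if k == 2 then (act i).1 else r.2 i end]).

(** The cell just written is found at [c.+1] after a move to the left, at [c] without a move, and at
    [c.-1] after a move to the right. *)
Definition column_kind (j : nat) : nat := if j == c.+1 then 0 else if j == c then 1 else if j.+1 == c then 2 else 3.

(** At the two ends of the window a column serves as its own missing neighbour, which is harmless as
    long as the tapes are blank there. *)
Definition left_column (j : nat) : nat := j.-1.
Definition right_column (j : nat) : nat := if j.+1 == N then j else j.+1.

Definition small_config (l r : nat) (k : config M) : Prop := forall i, tape_small l r (k.2 i).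

Lemma small_step l r k : oracle_free M -> 0 < r -> small_config l r k -> small_config l.+1 r.+1 (step (fun=> [::]) k).
Proof.
case: k => q ts M_free r0 h i; rewrite /step; have [h1 h2] := h i; case: ifP => _.
  by split; apply: leqW.
rewrite M_free; case: (tm_step _ _) => q' act /=; exact: tape_small_step.
Qed.

Lemma config_column_step l r k j : oracle_free M -> 0 < r -> l.+1 < c -> c + r.+1 < N -> small_config l r k -> j < N ->
  config_column (step (fun=> [::]) k) j =
  next_column (column_kind j) (config_column k c) (config_column k (left_column j)) (config_column k j)
    (config_column k (right_column j)).
Proof.
move=> M_free r0 lc rN sm jN; have sm' := small_step M_free r0 sm.
case: k sm sm' => q ts sm sm'.
have -> : step (fun=> [::]) (q, ts) = if tm_halt q then (q, ts) else
   let: (q', act) := tm_step q [ffun i => tape_read (ts i)] in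
   (q', fun i => tape_move (act i).2 (tape_write (act i).1 (ts i))) by rewrite /step M_free.
rewrite /next_column /=; case: ifP => hq //.
have -> : [ffun i => tape_cell c (ts i) c] = [ffun i => tape_read (ts i)] :> {ffun _ -> _}.
  by apply/ffunP => i; rewrite !ffunE tape_cell_read.
move: sm'; rewrite /step hq M_free; case E : (tm_step q _) => [q' act] sm' /=.
rewrite /config_column /=; congr pair; apply/ffunP => i; rewrite !ffunE.
have smi := sm i; have smi' := sm' i.
have [j0|j0] := posnP j.
  have lo' : tape_cell c (tape_move (act i).2 (tape_write (act i).1 (ts i))) j = None.
    by apply: (tape_cell_low smi'); lia.
  rewrite lo'.
  have lo k : k + l < c -> tape_cell c (ts i) k = None by move=> h; exact: tape_cell_low smi h.
  have ck : column_kind j = 3.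
    by rewrite /column_kind j0; case: eqP => [?|_]; [lia|case: eqP => [?|_]; [lia|case: eqP => [?|//]; lia]].
  have rc : right_column j = 1 by rewrite /right_column j0; case: eqP => // ?; lia.
  have l0 : tape_cell c (ts i) 0 = None by apply: lo; lia.
  have l1 : tape_cell c (ts i) 1 = None by apply: lo; lia.
  by rewrite ck rc /left_column j0 /= l0 l1; case: (act i).2.
rewrite tape_cell_move //; last by lia.
rewrite !tape_cell_write /column_kind /left_column /right_column.
case: (act i).2.
- have -> : (j.-1 == c) = (j == c.+1) by lia.
  by case: (j == c.+1) => //; case: (j == c) => //; case: (j.+1 == c).
- case: (boolP (j == c.+1)) => [jc|_]; last by case: (j == c) => //; case: (j.+1 == c).
  by have -> : (j == c) = false by lia.
- case: (eqVneq j.+1 c) => [jc|ne].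
    have -> : (j == c.+1) = false by lia.
    by have -> : (j == c) = false by lia.
  have -> : (if j == c.+1 then 0 else if j == c then 1 else 3) == 2 = false by case: ifP => // _; case: ifP.
  case: (eqVneq j.+1 N) => [jN'|//].
  by rewrite !(tape_cell_high smi) //; lia.
Qed.

End Columns.

(** * Clauses about cells in unary code *)

Section Codes.
Variable C : finType.

(** The one-hot code. *)
Definition code_bits (x : C) : seq bool := [seq i == nat_of_ord (enum_rank x) | i <- iota 0 #|C|].

Lemma size_code_bits x : size (code_bits x) = #|C|.
Proof. by rewrite size_map size_iota. Qed.

Lemma code_bits_inj : injective code_bits.
Proof.
move=> x y e; have : nth false (code_bits x) (enum_rank x) = nth false (code_bits y) (enum_rank x) by rewrite e.
rewrite !(nth_map 0) ?size_iota ?ltn_ord // nth_iota ?ltn_ord // add0n eqxx.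
by move/esym/eqP/val_inj/enum_rank_inj.
Qed.

Definition block (a : seq bool) (v : nat) : seq bool := [seq nth false a i | i <- iota (v * #|C|) #|C|].

Definition words (k : nat) : seq (seq bool) := map val (enum {: k.-tuple bool}).

Lemma mem_words k w : (w \in words k) = (size w == k).
Proof.
apply/mapP/eqP => [[t _ ->]|h]; first exact: size_tuple.
by exists (Tuple (introT eqP h)); rewrite ?mem_enum.
Qed.

(** Each bad word is excluded by one clause. Words that code no columns are bad too, so a solution
    determines its cells. The list is huge but depends only on [C], [r] and [Q], and a finite number
    of triples occurs for a given machine. *)
Definition bad_words (r : nat) (Q : pred (seq C)) : seq (seq bool) :=
  [seq w <- words (r * #|C|) | ~~ [exists t : r.-tuple C, (w == flatten (map code_bits t)) && Q t]].

Definition var_bits (vs : seq nat) : seq nat := flatten [seq iota (v * #|C|) #|C| | v <- vs].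

Definition bad_clauses (vs : seq nat) (ws : seq (seq bool)) : cnf :=
  [seq zip (var_bits vs) (map negb w) | w <- ws].

Lemma size_var_bits vs : size (var_bits vs) = size vs * #|C|.
Proof.
rewrite /var_bits size_flatten /shape -map_comp (eq_map (g := fun=> #|C|)); last by move=> v /=; rewrite size_iota.
by elim: vs => //= v vs ->; rewrite mulSn.
Qed.

Lemma clause_holds a ads w : size ads = size w ->
  has (lit_holds a) (zip ads (map negb w)) = ([seq nth false a i | i <- ads] != w).
Proof.
elim: ads w => [|x ads IH] [|b w] //= [] h; rewrite eqseq_cons negb_and -IH // /lit_holds /=.
by case: nth; case: b.
Qed.

Lemma bad_clausesP a vs Q : cnf_holds a (bad_clauses vs (bad_words (size vs) Q)) <->
  exists2 t, map (block a) vs = map code_bits t & Q t.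
Proof.
have vE : [seq nth false a i | i <- var_bits vs] = flatten (map (block a) vs).
  by rewrite /var_bits map_flatten -map_comp.
have szb : size (flatten (map (block a) vs)) = size vs * #|C| by rewrite -vE size_map size_var_bits.
have flat_inj (s t : seq (seq bool)) : size s = size t -> all (fun x => size x == #|C|) s ->
    all (fun x => size x == #|C|) t -> flatten s = flatten t -> s = t.
  elim: s t => [|x s IH] [|y t] //= [] h /andP[/eqP sx hs] /andP[/eqP sy ht] e.
  have /eqP := e; rewrite eqseq_cat ?sx ?sy // => /andP[/eqP -> /eqP e'].
  by rewrite (IH t).
split.
  move=> H; have : flatten (map (block a) vs) \notin bad_words (size vs) Q.
    apply/negP => b; have := allP H (zip (var_bits vs) (map negb (flatten (map (block a) vs)))).
    have -> : zip (var_bits vs) (map negb (flatten (map (block a) vs))) \in bad_clauses vs (bad_words (size vs) Q).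
      by apply/mapP; exists (flatten (map (block a) vs)).
    by rewrite clause_holds ?vE ?eqxx ?size_var_bits // => /(_ isT).
  rewrite mem_filter mem_words szb eqxx andbT negbK => /existsP[t /andP[/eqP e Qt]].
  exists t => //; apply: flat_inj e; rewrite ?size_map ?size_tuple //.
    by apply/allP => _ /mapP[v _ ->]; rewrite size_map size_iota.
  by apply/allP => _ /mapP[v _ ->]; rewrite size_code_bits.
move=> [t e Qt]; apply/allP => _ /mapP[w wb ->].
move: wb; rewrite mem_filter mem_words => /andP[nb /eqP sw].
rewrite clause_holds ?size_var_bits // vE; apply: contra nb => /eqP <-.
have st : size t == size vs by have := congr1 size e; rewrite !size_map => ->.
by apply/existsP; exists (Tuple st); rewrite /= e eqxx.
Qed.

Lemma bad_clauses_bounded n vs ws : all (fun v => v < n) vs -> cnf_bounded (n * #|C|) (bad_clauses vs ws).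
Proof.
move=> hv; apply/allP => _ /mapP[w _ ->]; apply/allP => l /= hl.
have zip1 (s : seq nat) (t : seq bool) : l \in zip s t -> l.1 \in s.
  by elim: s t => [|x s IH] [|b t] //=; rewrite !inE => /orP[/eqP -> /=|/IH ->]; rewrite ?eqxx ?orbT.
have : l.1 \in var_bits vs by exact: zip1 hl.
move=> /flattenP[_ /mapP[v /(allP hv) vn ->]]; rewrite mem_iota => /andP[_ h].
by apply: leq_trans h _; rewrite -mulSnr leq_mul2r vn orbT.
Qed.

End Codes.

Lemma blocks_eq (C : finType) n a b : size a = n * #|C| -> size b = n * #|C| ->
  (forall v, v < n -> block C a v = block C b v) -> a = b.
Proof.
move=> sa sb H; apply: (@eq_from_nth _ false); first by rewrite sa sb.
move=> u; rewrite sa => hu; have C0 : 0 < #|C| by case: #|C| hu; rewrite ?muln0.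
have hv : u %/ #|C| < n by rewrite ltn_divLR.
have := congr1 (fun s => nth false s (u %% #|C|)) (H _ hv).
by rewrite /block !(nth_map 0) ?size_iota ?ltn_mod // !nth_iota ?ltn_mod // -divn_eq.
Qed.

Lemma block_flatten (C : finType) (ws : seq (seq bool)) v : all (fun w => size w == #|C|) ws -> v < size ws ->
  block C (flatten ws) v = nth [::] ws v.
Proof.
elim: ws v => [|w ws IH] v //= /andP[/eqP sw al]; case: v => [_|v hv].
  rewrite /block mul0n; apply: (@eq_from_nth _ false); first by rewrite size_map size_iota sw.
  move=> i; rewrite size_map size_iota => hi; rewrite (nth_map 0) ?size_iota // nth_iota // nth_cat.
  by rewrite add0n sw hi.
rewrite [RHS]/= -(IH v al hv) /block mulSn; apply: (@eq_from_nth _ false); first by rewrite !size_map !size_iota.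
move=> i; rewrite size_map size_iota => hi; rewrite !(nth_map 0) ?size_iota // !nth_iota // nth_cat sw.
by rewrite ltnNge -addnA leq_addr /= addKn.
Qed.

Lemma cnf_bounded_cat k f g : cnf_bounded k (f ++ g) = cnf_bounded k f && cnf_bounded k g.
Proof. exact: all_cat. Qed.

Lemma cnf_bounded_flatten k fs : cnf_bounded k (flatten fs) = all (cnf_bounded k) fs.
Proof. by elim: fs => //= f fs <-; rewrite cnf_bounded_cat. Qed.

Lemma cnf_holds_cat a f g : cnf_holds a (f ++ g) = cnf_holds a f && cnf_holds a g.
Proof. exact: all_cat. Qed.

Lemma cnf_holds_flatten a fs : cnf_holds a (flatten fs) = all (cnf_holds a) fs.
Proof. by elim: fs => //= f fs <-; rewrite cnf_holds_cat. Qed.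

(** * The tableau of a verification *)

Section Tableau.
Variables (M : machine) (V : pred (seq bool)) (steps c N : nat) (x : seq bool) (m : nat).
Hypotheses (M_free : oracle_free M) (cE : c = steps.+2) (NE : N = c + (size (delimited x) + m + steps).+4).
Hypothesis run_V : forall y, size y = m -> computes_within M (fun=> [::]) (string_pair x y) [:: V (string_pair x y)] steps.
Notation C := (column M).

Definition input_column (s : option bool) : C :=
  (tm_start M, [ffun i => if i == ord0 then omap inl s else None]).

(* [None] stands for a blank, [Some None] for a free bit. *)
Definition initial_test (s : option (option bool)) : pred (seq C) := fun l =>
  match s with
  | None => l == [:: input_column None]
  | Some (Some b) => l == [:: input_column (Some b)]
  | Some None => (l == [:: input_column (Some true)]) || (l == [:: input_column (Some false)])
  end.

(** The blank margins, [steps.+2] cells on the left and [steps.+4] on the right, exceed what the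
    heads can reach in [steps] steps. *)
Definition initial_kinds : seq (option (option bool)) :=
  nseq c None ++ [seq Some (Some b) | b <- delimited x] ++ nseq m (Some None) ++ nseq (steps.+4) None.

Definition step_test (k : nat) : pred (seq C) := fun l =>
  if l is [:: n; h; a; b; d] then n == next_column k h a b d else false.

Definition accept_test : pred (seq C) := fun l =>
  if l is [:: h] then h.2 ord0 == Some (inl true) else false.

Definition clauses_at (vs : seq nat) (Q : pred (seq C)) : cnf := bad_clauses C vs (bad_words (size vs) Q).

Definition cell_var (t j : nat) : nat := t * N + j.

Definition initial_clauses : cnf :=
  flatten [seq clauses_at [:: p.1] (initial_test p.2) | p <- zip (iota 0 N) initial_kinds].

Definition step_vars (t j : nat) : seq nat :=
  [:: cell_var t.+1 j; cell_var t c; cell_var t (left_column j); cell_var t j; cell_var t (right_column N j)].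

Definition step_clauses : cnf :=
  flatten [seq flatten [seq clauses_at (step_vars t j) (step_test (column_kind c j)) | j <- iota 0 N] | t <- iota 0 steps].

Definition tableau_cnf : cnf := initial_clauses ++ step_clauses ++ clauses_at [:: cell_var steps c] accept_test.

Definition tableau_vars : nat := (steps.+1 * N) * #|C|.

Lemma size_initial_kinds : size initial_kinds = N.
Proof. by rewrite /initial_kinds !size_cat !size_nseq size_map; lia. Qed.

Lemma cell_var_lt t j : t <= steps -> j < N -> cell_var t j < steps.+1 * N.
Proof. by move=> ht hj; rewrite /cell_var; nia. Qed.

Lemma mem_initial p : p \in zip (iota 0 N) initial_kinds -> exists2 i, i < N & p = (i, nth None initial_kinds i).
Proof.
move=> /(nthP (0, None))[i]; rewrite size_zip size_iota size_initial_kinds minnn => hi <-.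
by exists i => //; rewrite nth_zip ?size_iota ?size_initial_kinds // nth_iota.
Qed.

Lemma neighbour_lt j : j < N -> left_column j < N /\ right_column N j < N.
Proof. by rewrite /left_column /right_column => hj; split; [lia|case: eqP => h; lia]. Qed.

Lemma tableau_bounded : cnf_bounded tableau_vars tableau_cnf.
Proof.
have cN : c < N by lia.
rewrite /tableau_cnf !cnf_bounded_cat; apply/andP; split; last (apply/andP; split).
- rewrite cnf_bounded_flatten; apply/allP => _ /mapP[p /mem_initial[i hi ->] ->].
  apply: bad_clauses_bounded; rewrite /= andbT.
  by have := @cell_var_lt 0 i (leq0n _) hi; rewrite /cell_var mul0n.
- rewrite cnf_bounded_flatten; apply/allP => _ /mapP[t ht ->].
  rewrite cnf_bounded_flatten; apply/allP => _ /mapP[j hj ->].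
  apply: bad_clauses_bounded; move: ht hj; rewrite !mem_iota !add0n => /andP[_ ht] /andP[_ hj].
  have [h1 h2] := neighbour_lt hj.
  by rewrite /step_vars /= !cell_var_lt // ltnW.
- by apply: bad_clauses_bounded; rewrite /= cell_var_lt.
Qed.

Definition tableau_config (y : seq bool) (t : nat) : config M := iter t (step (fun=> [::])) (init M (string_pair x y)).

Definition tableau_column (y : seq bool) (t j : nat) : C := config_column c (tableau_config y t) j.

Definition tableau_word (y : seq bool) : seq bool :=
  flatten [seq code_bits (tableau_column y (v %/ N) (v %% N)) | v <- iota 0 (steps.+1 * N)].

Lemma size_tableau_word y : size (tableau_word y) = tableau_vars.
Proof.
rewrite /tableau_word size_flatten /shape -map_comp (eq_map (g := fun=> #|C|)); last first.
  by move=> v /=; rewrite size_code_bits.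
rewrite /tableau_vars -[in RHS](size_iota 0 (steps.+1 * N)).
by elim: (iota 0 _) => //= v vs ->; rewrite mulSn.
Qed.

Lemma block_tableau y t j : t <= steps -> j < N ->
  block C (tableau_word y) (cell_var t j) = code_bits (tableau_column y t j).
Proof.
move=> ht hj; have hv := cell_var_lt ht hj.
rewrite /tableau_word block_flatten ?size_map ?size_iota //; last first.
  by apply/allP => _ /mapP[v _ ->]; rewrite size_code_bits.
rewrite (nth_map 0) ?size_iota // nth_iota // add0n /cell_var divnMDl ?modnMDl; last by lia.
by rewrite divn_small // modn_small // addn0.
Qed.

Lemma small_tableau y t : size y = m -> small_config t (size (delimited x) + m + t).+1 (tableau_config y t).
Proof.
move=> sy; elim: t => [|t IH].
  move=> i; rewrite /tableau_config /init /=; split; case: ifP => //= _.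
  by rewrite size_map size_cat sy; lia.
by rewrite /tableau_config iterS addnS; apply: small_step.
Qed.

Lemma tableau_columnS y t j : size y = m -> t < steps -> j < N ->
  tableau_column y t.+1 j = next_column (column_kind c j) (tableau_column y t c)
    (tableau_column y t (left_column j)) (tableau_column y t j) (tableau_column y t (right_column N j)).
Proof.
move=> sy ht hj; rewrite /tableau_column /tableau_config iterS.
apply: (@config_column_step M c N t (size (delimited x) + m + t).+1) => //; try lia.
exact: small_tableau.
Qed.

Definition input_bits (y : seq bool) : seq (option bool) := nseq c None ++ [seq Some b | b <- string_pair x y].

Lemma tableau_column0 y j : tableau_column y 0 j = input_column (nth None (input_bits y) j).
Proof.
rewrite /tableau_column /tableau_config /= /config_column /init /=; congr pair.
apply/ffunP => i; rewrite !ffunE /tape_cell /input_bits nth_cat size_nseq; case: (eqVneq i ord0) => [_|ne]; last first.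
  by rewrite /= !nth_nil; case: ifP.
rewrite ltnNge; case: leqP => h /=; last by rewrite nth_nseq h nth_nil.
case: (ltnP (j - c) (size (string_pair x y))) => h2; last by rewrite !nth_default // size_map.
by rewrite !(nth_map false).
Qed.

(** A halted configuration no longer changes, so the last row of the tableau shows the output, a
    single bit under the head of tape 0. *)
Lemma accept_tableau y : size y = m -> accept_test [:: tableau_column y steps c] = V (string_pair x y).
Proof.
move=> sy; have [t tn [hh bt]] := run_V sy.
have st : iter steps (step (fun=> [::])) (init M (string_pair x y)) = iter t (step (fun=> [::])) (init M (string_pair x y)).
  rewrite -(subnK tn) iterD; elim: (steps - t) => //= k ->.
  by move: hh; case: (iter t _ _) => q ts /= ->.
rewrite /accept_test /= ffunE tape_cell_read /tableau_config st /tape_read.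
move: bt; rewrite /bits_of_tape; case: (tape_right _) => [|[[b|z]|] r] //= [<- _].
by case: b.
Qed.

Lemma initial_testP s b : initial_test s [:: b] <->
  match s with
  | None => b = input_column None
  | Some (Some e) => b = input_column (Some e)
  | Some None => exists e, b = input_column (Some e)
  end.
Proof.
case: s => [[e|]|] /=; rewrite ?eqseq_cons ?andbT.
- by split=> [/eqP|->].
- split=> [/orP[/eqP ->|/eqP ->]|[[] ->]]; [by exists true|by exists false|by rewrite eqxx|].
  by rewrite eqxx orbT.
- by split=> [/eqP|->].
Qed.

Lemma input_column_inj : injective input_column.
Proof.
move=> s t e; have := congr1 (fun z : C => z.2 ord0) e; rewrite /= !ffunE eqxx.
by case: s t {e} => [a|] [b|] //= [->].
Qed.

Lemma initial_kind_value y j : size y = m ->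
  match nth None initial_kinds j with
  | None => nth None (input_bits y) j = None
  | Some (Some e) => nth None (input_bits y) j = Some e
  | Some None => c + size (delimited x) <= j /\ j - c - size (delimited x) < m /\
                 nth None (input_bits y) j = Some (nth false y (j - c - size (delimited x)))
  end.
Proof.
move=> sy; rewrite /initial_kinds /input_bits /string_pair map_cat !nth_cat !size_nseq !size_map.
case: ifP => h1; first by rewrite !nth_nseq h1.
case: ifP => h2; first by rewrite !(nth_map false).
case: ifP => h3.
  rewrite nth_nseq h3; split; first by lia.
  by split=> //; rewrite (nth_map false) // sy.
by rewrite nth_nseq if_same nth_default // size_map sy leqNgt h3.
Qed.

Lemma tableau_holds y : size y = m -> V (string_pair x y) -> cnf_holds (tableau_word y) tableau_cnf.
Proof.
move=> sy Vy; have cN : c < N by lia.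
rewrite /tableau_cnf !cnf_holds_cat; apply/andP; split; last (apply/andP; split).
- rewrite cnf_holds_flatten; apply/allP => _ /mapP[p /mem_initial[i hi ->] ->].
  apply/(@bad_clausesP C); exists [:: tableau_column y 0 i].
    by rewrite /= -(block_tableau y) // /cell_var mul0n.
  apply/initial_testP; rewrite tableau_column0; have := initial_kind_value i sy.
  by case: (nth None initial_kinds i) => [[e|]|] => [->|[_ [_ ->]]|->] //; eexists.
- rewrite cnf_holds_flatten; apply/allP => _ /mapP[t ht ->].
  rewrite cnf_holds_flatten; apply/allP => _ /mapP[j hj ->].
  move: ht hj; rewrite !mem_iota !add0n => /andP[_ ht] /andP[_ hj]; have [h1 h2] := neighbour_lt hj.
  apply/(@bad_clausesP C); exists [:: tableau_column y t.+1 j; tableau_column y t c;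
    tableau_column y t (left_column j); tableau_column y t j; tableau_column y t (right_column N j)].
    by rewrite /step_vars /= !block_tableau // ltnW.
  by rewrite /step_test tableau_columnS.
- apply/(@bad_clausesP C); exists [:: tableau_column y steps c]; last by rewrite accept_tableau.
  by rewrite /= block_tableau.
Qed.

(** The free cells of the first row define [y]. Each later row is a function of the one before it,
    so the whole assignment is the tableau of [y]; this makes the reduction preserve the count. *)
Lemma holds_tableau a : size a = tableau_vars -> cnf_holds a tableau_cnf ->
  exists y, [/\ size y = m, V (string_pair x y) & a = tableau_word y].
Proof.
move=> sa; have cN : c < N by lia.
rewrite /tableau_cnf !cnf_holds_cat => /andP[H0 /andP[H1 H2]].
rewrite cnf_holds_flatten in H0; rewrite cnf_holds_flatten in H1.
have init j : j < N -> exists2 b, block C a j = code_bits b & initial_test (nth None initial_kinds j) [:: b].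
  move=> hj; have /(@bad_clausesP C)[[|b [|]] //= [e] t] : cnf_holds a (clauses_at [:: j] (initial_test (nth None initial_kinds j))).
    apply: (allP H0); apply/mapP; exists (j, nth None initial_kinds j) => //.
    apply/(nthP (0, None)); exists j; first by rewrite size_zip size_iota size_initial_kinds minnn.
    by rewrite nth_zip ?size_iota ?size_initial_kinds // nth_iota.
  by exists b.
pose yb i := `[< block C a (c + size (delimited x) + i) = code_bits (input_column (Some true)) >].
pose y := [seq yb i | i <- iota 0 m].
have sy : size y = m by rewrite size_map size_iota.
have row0 j : j < N -> block C a (cell_var 0 j) = code_bits (tableau_column y 0 j).
  move=> hj; rewrite /cell_var mul0n; have [b eb /initial_testP ib] := init j hj.
  rewrite eb; congr code_bits; rewrite tableau_column0; move: ib (initial_kind_value j sy).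
  case: (nth None initial_kinds j) => [[e|]|]; [by move=> -> ->| |by move=> -> ->].
  move=> [e be] [h1 [h2 ->]]; rewrite be; congr (input_column (Some _)).
  rewrite /y (nth_map 0) ?size_iota // nth_iota // add0n /yb.
  have -> : c + size (delimited x) + (j - c - size (delimited x)) = j by lia.
  rewrite eb be; apply/idP/asboolP => [->//|/code_bits_inj/input_column_inj [->]//].
have rows t j : t <= steps -> j < N -> block C a (cell_var t j) = code_bits (tableau_column y t j).
  elim: t j => [|t IH] j ht hj; first exact: row0.
  have [h1 h2] := neighbour_lt hj; have lt := ltnW ht.
  have : cnf_holds a (clauses_at (step_vars t j) (step_test (column_kind c j))).
    have := allP H1 (flatten [seq clauses_at (step_vars t j) (step_test (column_kind c j)) | j <- iota 0 N]).
    rewrite cnf_holds_flatten => /(_ _)/allP; apply; last by apply/mapP; exists j; rewrite ?mem_iota.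
    by apply/mapP; exists t; rewrite ?mem_iota.
  move=> /(@bad_clausesP C)[l]; rewrite /step_vars /= !IH //.
  case: l => [|n [|h [|u [|v [|w [|]]]]]] //= [-> /code_bits_inj <- /code_bits_inj <- /code_bits_inj <- /code_bits_inj <-].
  by rewrite /step_test => /eqP ->; rewrite tableau_columnS.
exists y; split=> //.
  rewrite -accept_tableau //; move: H2 => /(@bad_clausesP C)[[|b [|]] //= []].
  by rewrite rows // => /code_bits_inj <-.
apply: (blocks_eq sa (size_tableau_word y)) => v hv.
have N0 : 0 < N by lia.
have -> : v = cell_var (v %/ N) (v %% N) by rewrite /cell_var -divn_eq.
have h1 : v %/ N <= steps by rewrite -ltnS ltn_divLR.
have h2 : v %% N < N by rewrite ltn_mod.
by rewrite rows // block_tableau.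
Qed.

Lemma tableau_word_inj y z : size y = m -> size z = m -> tableau_word y = tableau_word z -> y = z.
Proof.
move=> sy sz e; apply: (@eq_from_nth _ false); first by rewrite sy sz.
move=> i; rewrite sy => hi; have hj : c + size (delimited x) + i < N by lia.
have : tableau_column y 0 (c + size (delimited x) + i) = tableau_column z 0 (c + size (delimited x) + i).
  by apply: code_bits_inj; rewrite -!block_tableau // e.
rewrite !tableau_column0 => /input_column_inj.
rewrite /input_bits /string_pair (map_cat _ (delimited x) y) (map_cat _ (delimited x) z) !nth_cat !size_nseq !size_map.
have -> : (c + size (delimited x) + i < c) = false by lia.
have -> : (c + size (delimited x) + i - c < size (delimited x)) = false by lia.
have -> : c + size (delimited x) + i - c - size (delimited x) = i by lia.
by rewrite !(nth_map false) ?sy ?sz // => -[].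
Qed.

Theorem count_tableau : #|[pred y : m.-tuple bool | V (string_pair x y)]| =
  #|[pred a : tableau_vars.-tuple bool | cnf_holds a tableau_cnf]|.
Proof.
have szE (y : m.-tuple bool) : size (tableau_word y) == tableau_vars by rewrite size_tableau_word.
pose F (y : m.-tuple bool) : tableau_vars.-tuple bool := Tuple (szE y).
have injF : injective F.
  by move=> y z /(congr1 val) /= e; apply/val_inj/tableau_word_inj; rewrite ?size_tuple.
have -> : #|[pred y : m.-tuple bool | V (string_pair x y)]| = #|[set y : m.-tuple bool | V (string_pair x y)]%SET|.
  by apply: eq_card => y; rewrite !inE.
rewrite -(card_imset _ injF); apply: eq_card => a; rewrite [RHS]inE; apply/imsetP/idP => [[y]|ha].
  by rewrite inE => Vy ->; apply: tableau_holds; rewrite ?size_tuple.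
have sa : size a = tableau_vars by rewrite size_tuple.
have [y [sy Vy e]] := holds_tableau sa ha.
have sy' : size y == m by rewrite sy.
by exists (Tuple sy'); [rewrite inE|apply/val_inj].
Qed.

End Tableau.

(** * The region of a formula *)

Section Chain.
Variables (R : realType) (lo hi : nat -> nat) (y0 H : nat).
Hypothesis lo_hi : forall y y', y0 <= y < y0 + H -> y0 <= y' < y0 + H -> y <= y'.+1 -> y' <= y.+1 -> lo y < hi y'.

Definition row_bar (y : nat) : bar := ((Posz (lo y), Posz y), hi y - lo y).

Fixpoint chain (k : nat) : seq bar := if k is k'.+1 then row_bar (y0 + k') :: chain k' else [::].

Lemma mem_chain k b : reflect (exists2 i, i < k & b = row_bar (y0 + i)) (b \in chain k).
Proof.
elim: k => [|k IH] /=; first by apply: (iffP idP) => // -[].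
rewrite inE; apply: (iffP orP) => [[/eqP ->|/IH[i ik ->]]|[i]].
- by exists k.
- by exists i => //; exact: leqW.
by rewrite ltnS leq_eqVlt => /orP[/eqP ei e|ik e]; [left; rewrite e ei|right; apply/IH; exists i].
Qed.

Lemma chain_valid k : k <= H -> bars_valid (chain k).
Proof.
move=> kH; split.
- elim: k kH => //= k IH kH; rewrite IH; last exact: ltnW.
  by rewrite andbT; apply/mem_chain => -[i ik [_ e _]]; lia.
- move=> b /mem_chain[i ik ->] /=; have := @lo_hi (y0 + i) (y0 + i); lia.
- move=> b c /mem_chain[i ik ->] /mem_chain[j jk ->] ne; rewrite /bar_apart /= => -[e].
  by case: ne; rewrite e.
Qed.

Lemma chain_overlap i j : i < H -> j < H -> overlap (row_bar (y0 + i)) (row_bar (y0 + j)) = (i == j.+1) || (j == i.+1).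
Proof.
move=> iH jH; rewrite /overlap /=.
have := @lo_hi (y0 + i) (y0 + i); have := @lo_hi (y0 + j) (y0 + j).
by have := @lo_hi (y0 + i) (y0 + j); have := @lo_hi (y0 + j) (y0 + i); lia.
Qed.

Lemma chain_touch i j : i < H -> j < H -> touch (row_bar (y0 + i)) (row_bar (y0 + j)) = (i == j.+1) || (j == i.+1).
Proof.
move=> iH jH; rewrite /touch /=.
have := @lo_hi (y0 + i) (y0 + i); have := @lo_hi (y0 + j) (y0 + j).
by have := @lo_hi (y0 + i) (y0 + j); have := @lo_hi (y0 + j) (y0 + i); lia.
Qed.

(** Each row of the region is one bar that meets only the bars of the adjacent rows, so the topmost
    bar is a leaf. *)
Lemma chain_contractible k : 0 < k <= H -> contractible (@bars_set R (chain k)).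
Proof.
elim: k => // -[|k] IH kH.
  apply: contractible_bars1; have [_ pos _] := @chain_valid 1 kH; apply: pos; exact: mem_head.
apply: (@leaf_contractible R _ (row_bar (y0 + k)) (chain k.+1)); last by apply: IH; lia.
split; [exact: (@chain_valid k.+2)|exact: mem_head|by rewrite chain_touch ?eqxx //; lia|].
move=> c /mem_chain[i ik ->]; rewrite chain_touch; [|lia|lia].
by move=> /orP[/eqP [->]|/eqP e]; [|lia].
Qed.

Lemma chain_interior : 0 < H -> connected ((@bars_set R (chain H))^°)%classic.
Proof.
move=> H0; have val := chain_valid (leqnn H).
apply: (joined_connected val); suff J k : 0 < k <= H -> joined R (chain H) (chain k) by apply: J; rewrite H0 leqnn.
elim: k => // -[|k] IH kH.
  by apply: joined1; apply/mem_chain; exists 0; rewrite ?addn0.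
apply: (joined_grow val (S := chain k.+1)) => //.
- by move=> b /mem_chain[i ik ->]; apply/mem_chain; exists i => //; lia.
- move=> b /mem_chain[i]; rewrite ltnS leq_eqVlt => /orP[/eqP -> ->|ik ->]; last first.
    by left; apply/mem_chain; exists i.
  right; split; first by apply/mem_chain; exists k.+1.
  by apply/hasP; exists (row_bar (y0 + k)); [exact: mem_head|rewrite chain_overlap ?eqxx //; lia].
- by apply: IH; lia.
Qed.

Lemma chain_union s : (forall c : square, c \in s <-> exists2 y, y0 <= y < y0 + H &
    c.2 = Posz y /\ (Order.le (Posz (lo y)) c.1 /\ Order.lt c.1 (Posz (hi y)))) ->
  @union_of_squares R s = @bars_set R (chain H).
Proof.
move=> Hs; have [_ pos _] := chain_valid (leqnn H).
have cellsE y c : y0 <= y < y0 + H -> (c \in tile_cells ((row_bar y).1, ((row_bar y).2, 1))) =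
    [&& Order.le (Posz (lo y)) c.1, Order.lt c.1 (Posz (hi y)) & c.2 == Posz y].
  by move=> hy; rewrite mem_tile_cells /=; have := @lo_hi y y; lia.
apply/seteqP; split=> p.
  move=> [c /= /Hs[y hy [e [h1 h2]]] cp].
  have yc : row_bar y \in chain H by apply/mem_chain; exists (y - y0); [lia|congr row_bar; lia].
  exists (row_bar y) => //.
  apply: (proj2 (@rectangle_cells R ((row_bar y).1, ((row_bar y).2, 1)) p (pos _ yc) isT)).
  by exists c => //; rewrite cellsE // h1 h2 e eqxx.
move=> [b /= bc bp].
have [c cb cp] := proj1 (@rectangle_cells R (b.1, (b.2, 1)) p (pos _ bc) isT) bp.
have [i iH e] := mem_chain _ _ bc; exists c => //=; apply/Hs; exists (y0 + i); first by lia.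
by move: cb; rewrite e cellsE; [move=> /and3P[-> -> /eqP ->]|lia].
Qed.

Lemma chain_region s : 0 < H -> uniq s -> (forall c : square, c \in s <-> exists2 y, y0 <= y < y0 + H &
    c.2 = Posz y /\ (Order.le (Posz (lo y)) c.1 /\ Order.lt c.1 (Posz (hi y)))) ->
  simply_connected_region R s.
Proof.
move=> H0 us /chain_union e; rewrite /simply_connected_region /is_region e; split.
  by split=> //; exact: chain_interior.
by apply: contractible_simply_connected; apply: chain_contractible; rewrite H0 leqnn.
Qed.

End Chain.

Section RowSquares.

Definition row_squares (y0 : nat) (rows : seq (nat * nat)) : seq square :=
  flatten [seq [seq (Posz x, Posz p.1) | x <- iota p.2.1 (p.2.2 - p.2.1)]
          | p <- zip (iota y0 (size rows)) rows].

Lemma mem_row_squares y0 rows (c : square) : c \in row_squares y0 rows <->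
  exists2 y, y0 <= y < y0 + size rows & c.2 = Posz y /\
    (Order.le (Posz (nth (0, 0) rows (y - y0)).1) c.1 /\ Order.lt c.1 (Posz (nth (0, 0) rows (y - y0)).2)).
Proof.
have nthz i : i < size rows -> nth (0, (0, 0)) (zip (iota y0 (size rows)) rows) i = (y0 + i, nth (0, 0) rows i).
  by move=> hi; rewrite nth_zip ?size_iota // nth_iota.
have sz : size (zip (iota y0 (size rows)) rows) = size rows by rewrite size_zip size_iota minnn.
split.
  move=> /flattenP[l /mapP[p /(nthP (0, (0, 0)))[i]]]; rewrite sz => hi; rewrite nthz // => <- ->.
  move=> /mapP[x]; rewrite mem_iota /= => hx ->; exists (y0 + i); first by lia.
  by rewrite /= addKn; split=> //; lia.
move=> [y hy [e [h1 h2]]]; apply/flattenP.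
exists [seq (Posz x, Posz y) | x <- iota (nth (0, 0) rows (y - y0)).1 ((nth (0, 0) rows (y - y0)).2 - (nth (0, 0) rows (y - y0)).1)].
  apply/mapP; exists (y, nth (0, 0) rows (y - y0)) => //.
  apply/(nthP (0, (0, 0))); exists (y - y0); rewrite ?sz ?nthz //; try lia.
  by congr pair; lia.
apply/mapP; exists (absz c.1); first by rewrite mem_iota; lia.
by case: c e h1 h2 => a b /= -> h1 h2; congr pair; lia.
Qed.

Lemma uniq_row_squares y0 rows : uniq (row_squares y0 rows).
Proof.
rewrite /row_squares; elim: rows y0 => [|r rows IH] y0 //=.
rewrite cat_uniq IH andbT map_inj_uniq ?iota_uniq; last by move=> x x' [].
apply/hasPn => c /mem_row_squares[y hy [e _]]; apply/mapP => -[x _ ec].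
by move: e; rewrite ec /= => -[?]; lia.
Qed.

End RowSquares.

Section Blocks.
Variables (h f : nat -> nat).

Fixpoint height_sum (n : nat) : nat := if n is k.+1 then height_sum k + h n else 0.

Definition blocks (n : nat) : seq nat := flatten [seq nseq (h j) (f j) | j <- iota 1 n].

Lemma blocksS n : blocks n.+1 = blocks n ++ nseq (h n.+1) (f n.+1).
Proof. by rewrite /blocks -(addn1 n) iotaD map_cat flatten_cat /= cats0 add1n addn1. Qed.

Lemma size_blocks n : size (blocks n) = height_sum n.
Proof. by elim: n => // n IH; rewrite blocksS size_cat size_nseq IH. Qed.

Lemma height_sum_le m n : m <= n -> height_sum m <= height_sum n.
Proof. by move=> mn; rewrite -(subnKC mn); elim: (n - m) => [|k IH]; rewrite ?addn0 // addnS /=; lia. Qed.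

Lemma nth_blocks n j k : 1 <= j <= n -> height_sum j.-1 <= k < height_sum j -> nth 0 (blocks n) k = f j.
Proof.
elim: n => [|n IH] hj hk; first by lia.
rewrite blocksS nth_cat size_blocks; have [e|lt] : j = n.+1 \/ j <= n by lia.
  rewrite e in hk *; have -> : (k < height_sum n) = false by move: hk => /=; lia.
  by rewrite nth_nseq; case: ifP => //; move: hk => /=; lia.
have le := height_sum_le lt; have -> : k < height_sum n by lia.
by apply: IH => //; lia.
Qed.

Lemma blocks_index n k : k < height_sum n -> exists2 j, 1 <= j <= n & height_sum j.-1 <= k < height_sum j.
Proof.
elim: n => // n IH hk; case: (ltnP k (height_sum n)) => [/IH[j hj hk']|le].
  by exists j => //; lia.
by exists n.+1; rewrite ?ltnS ?leqnn //= le.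
Qed.

End Blocks.

(** * The region of the wall as a list of rows *)

Section GadgetRows.
Variables (L : finType) (M W : nat) (bd : nat -> nat -> L).
Hypotheses (M_gt0 : 0 < M) (W_gt0 : 0 < W).

Notation step_height := (fun j => filler_height (odd j)).

Definition left_ends : seq nat :=
  blocks (fun=> 4) (fun i => cut M bd i 0) M ++ blocks step_height (fun j => cut M bd M j) W.-1.

Definition right_ends : seq nat :=
  blocks step_height (fun j => cut M bd 0 j) W ++ blocks (fun=> 4) (fun i => cut M bd i W) M.

Lemma height_sum4 n : height_sum (fun=> 4) n = 4 * n.
Proof. by elim: n => //= n ->; lia. Qed.

Lemma height_sum_stair n : height_sum step_height n = stair n.
Proof. by elim: n => //= n ->; rewrite stairS. Qed.

Lemma size_left_ends : size left_ends = 4 * M + stair W.-1.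
Proof. by rewrite size_cat !size_blocks height_sum4 height_sum_stair. Qed.

Lemma size_right_ends : size right_ends = stair W + 4 * M.
Proof. by rewrite size_cat !size_blocks height_sum4 height_sum_stair. Qed.

Lemma left_endP y : 4 <= y < 4 * M.+1 + stair W.-1 ->
  (exists i, [/\ 1 <= i <= M, 4 * i <= y < 4 * i + 4 & nth 0 left_ends (y - 4) = cut M bd i 0]) \/
  (exists j, [/\ 1 <= j < W, 4 * M.+1 + stair j.-1 <= y < 4 * M.+1 + stair j & nth 0 left_ends (y - 4) = cut M bd M j]).
Proof.
move=> hy; rewrite /left_ends nth_cat size_blocks height_sum4; case: ltnP => h; [left|right].
  have [|i hi hk] := @blocks_index (fun=> 4) M (y - 4); first by rewrite height_sum4.
  exists i; rewrite (nth_blocks _ hi hk); rewrite !height_sum4 in hk; split=> //; lia.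
have [|j hj hk] := @blocks_index step_height W.-1 (y - 4 - 4 * M); first by rewrite height_sum_stair; lia.
by exists j; rewrite (nth_blocks _ hj hk); rewrite !height_sum_stair in hk; split=> //; lia.
Qed.

Lemma right_endP y : 4 <= y < 4 * M.+1 + stair W ->
  (exists j, [/\ 1 <= j <= W, 4 + stair j.-1 <= y < 4 + stair j & nth 0 right_ends (y - 4) = cut M bd 0 j]) \/
  (exists i, [/\ 1 <= i <= M, 4 * i + stair W <= y < 4 * i + 4 + stair W & nth 0 right_ends (y - 4) = cut M bd i W]).
Proof.
move=> hy; rewrite /right_ends nth_cat size_blocks height_sum_stair; case: ltnP => h; [left|right].
  have [|j hj hk] := @blocks_index step_height W (y - 4); first by rewrite height_sum_stair.
  by exists j; rewrite (nth_blocks _ hj hk); rewrite !height_sum_stair in hk; split=> //; lia.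
have [|i hi hk] := @blocks_index (fun=> 4) M (y - 4 - stair W); first by rewrite height_sum4; lia.
by exists i; rewrite (nth_blocks _ hi hk); rewrite !height_sum4 in hk; split=> //; lia.
Qed.

Lemma stair_mono j j' : stair j' < stair j -> j' < j.
Proof. by move=> h; rewrite ltnNge; apply/negP => /stair_le; lia. Qed.

Lemma stair_interval j j' y : 0 < j -> 0 < j' -> stair j.-1 <= y < stair j -> stair j'.-1 <= y < stair j' -> j = j'.
Proof.
move=> j0 j0' h h'; have h1 : stair j.-1 < stair j' by lia.
have h2 : stair j'.-1 < stair j by lia.
by have := stair_mono h1; have := stair_mono h2; lia.
Qed.

Lemma left_outP x y : 4 <= y < 4 * M.+1 + stair W.-1 -> left_out M W bd x y <-> x < nth 0 left_ends (y - 4).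
Proof.
move=> hy; have [[i [iM yi ->]]|[j [jW yj ->]]] := left_endP hy; split.
- case=> [[i' [iM' yi' h]]|[j' [jW' yj' h]]]; last by lia.
  by have -> : i = i' by lia.
- by move=> h; left; exists i.
- case=> [[i' [iM' yi' h]]|[j' [jW' yj' h]]]; first by lia.
  by have -> : j = j' by apply: (@stair_interval _ _ (y - 4 * M.+1)); lia.
- by move=> h; right; exists j.
Qed.

Lemma right_outP x y : 4 <= y < 4 * M.+1 + stair W -> right_out M W bd x y <-> nth 0 right_ends (y - 4) <= x.
Proof.
have st j : j <= W -> stair j <= stair W by exact: stair_le.
move=> hy; have [[j [jW yj ->]]|[i [iM yi ->]]] := right_endP hy; split.
- case=> [[j' [jW' yj' h]]|[i' [iM' yi' h]]].
    by have -> : j = j' by apply: (@stair_interval _ _ (y - 4)); lia.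
  by have := st j; lia.
- by move=> h; left; exists j.
- case=> [[j' [jW' yj' h]]|[i' [iM' yi' h]]]; first by have := st j'; lia.
  by have -> : i = i' by lia.
- by move=> h; right; exists i.
Qed.

Lemma region_rows x y : region M W bd x y <->
  4 <= y < 4 + size left_ends /\ nth 0 left_ends (y - 4) <= x < nth 0 right_ends (y - 4).
Proof.
have s1 := @stair_le W.-1 W (leq_pred W); rewrite size_left_ends; split.
  move=> [hy nl nr]; have hy' : 4 <= y < 4 * M.+1 + stair W by lia.
  split; first by lia.
  apply/andP; split; first by rewrite leqNgt; apply/negP => h; apply: nl; exact/left_outP.
  by rewrite ltnNge; apply/negP => h; apply: nr; exact/right_outP.
move=> [hy hx]; have hy1 : 4 <= y < 4 * M.+1 + stair W.-1 by lia.
have hy' : 4 <= y < 4 * M.+1 + stair W by lia.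
split=> //; first by move/left_outP => /(_ hy1); lia.
by move/right_outP => /(_ hy'); lia.
Qed.

(** At nearby heights, left ends are cuts with larger row and smaller column index than right ends,
    so the order of the cuts applies. This is the overlap of consecutive rows that [chain_region]
    asks for. *)
Lemma row_ends_lt y y' : 4 <= y < 4 + size left_ends -> 4 <= y' < 4 + size left_ends ->
  y <= y'.+1 -> y' <= y.+1 -> nth 0 left_ends (y - 4) < nth 0 right_ends (y' - 4).
Proof.
have s1 := @stair_le W.-1 W (leq_pred W); rewrite size_left_ends => hy hy' h1 h2.
have hy1 : 4 <= y < 4 * M.+1 + stair W.-1 by lia.
have hy2 : 4 <= y' < 4 * M.+1 + stair W by lia.
have st1 : 3 <= stair W by have := @stair_le 1 W W_gt0.
have lt i j i' j' : i' <= i <= M.+1 -> j <= j' -> (i' != i) || (j != j') -> cut M bd i j < cut M bd i' j'.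
  by move=> a b c; have := cut_lt M_gt0 W_gt0 bd bd a b c; lia.
have [[i [iM yi ->]]|[j [jW yj ->]]] := left_endP hy1; have [[j' [jW' yj' ->]]|[i' [iM' yi' ->]]] := right_endP hy2;
  apply: lt => //; try lia.
by have := @stair_mono j' j.-1; lia.
Qed.

(** The right border is described up to a greater height than the region has; [zip] drops the
    surplus. *)
Definition gadget_rows : seq (nat * nat) := zip left_ends right_ends.
Definition gadget_squares : seq square := row_squares 4 gadget_rows.

Lemma size_gadget_rows : size gadget_rows = size left_ends.
Proof.
rewrite size_zip; apply/minn_idPl; rewrite size_left_ends size_right_ends.
by have := @stair_le W.-1 W (leq_pred W); lia.
Qed.

Lemma nth_gadget_rows k : k < size left_ends -> nth (0, 0) gadget_rows k = (nth 0 left_ends k, nth 0 right_ends k).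
Proof.
move=> hk; rewrite -size_gadget_rows in hk.
by rewrite -[LHS]/(nth (0, 0) (zip left_ends right_ends) k) nth_zip_cond hk.
Qed.

Lemma gadget_squares_rows (c : square) : c \in gadget_squares <-> exists2 y, 4 <= y < 4 + size left_ends &
    c.2 = Posz y /\ (Order.le (Posz (nth 0 left_ends (y - 4))) c.1 /\ Order.lt c.1 (Posz (nth 0 right_ends (y - 4)))).
Proof.
rewrite /gadget_squares mem_row_squares size_gadget_rows.
by split=> -[y hy]; [rewrite nth_gadget_rows; [exists y|lia]|exists y => //; rewrite nth_gadget_rows //; lia].
Qed.

Lemma mem_gadget_squares (c : square) : c \in gadget_squares <->
  exists x y, c = (Posz x, Posz y) /\ region M W bd x y.
Proof.
rewrite gadget_squares_rows; split.
  move=> [y hy [e [h1 h2]]]; exists (absz c.1), y; split; last by apply/region_rows; lia.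
  by case: c e h1 h2 => a b /= -> h1 h2; congr pair; lia.
by move=> [x [y [-> /region_rows[hy hx]]]]; exists y => //=; lia.
Qed.

Lemma gadget_squares_region (R : realType) : simply_connected_region R gadget_squares.
Proof.
apply: (@chain_region R (fun y => nth 0 left_ends (y - 4)) (fun y => nth 0 right_ends (y - 4)) 4 (size left_ends)).
- exact: row_ends_lt.
- by rewrite size_left_ends; lia.
- exact: uniq_row_squares.
- exact: gadget_squares_rows.
Qed.

End GadgetRows.

(** * Tilings of the region and labellings of the grid *)

Section GadgetCount.
Variables (R : realType) (L : finType) (EB EF : rel L) (T : {fset tile}).
Hypothesis T_gadget : forall t, t \in T <-> gadget_tile EB EF t.
Variables (M W : nat) (bd : nat -> nat -> L).
Hypotheses (M_gt0 : 0 < M) (W_gt0 : 0 < W).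

Let mem_gs := @mem_gadget_squares L M W bd M_gt0 W_gt0.

Definition placed_z (u : placed) : square * tile := ((Posz u.1.1, Posz u.1.2), u.2).

Lemma placed_z_inj : injective placed_z.
Proof. by move=> [[a b] [w h]] [[a' b'] [w' h']] [-> -> -> ->]. Qed.

Lemma mem_placed_z u x y : ((Posz x, Posz y) \in tile_cells (placed_z u)) = in_placed u x y.
Proof. by rewrite mem_tile_cells /in_placed /=; lia. Qed.

Lemma placed_z_cells u c : c \in tile_cells (placed_z u) -> exists x y, c = (Posz x, Posz y) /\ in_placed u x y.
Proof.
move=> cu; exists (absz c.1), (absz c.2).
have e : c = (Posz (absz c.1), Posz (absz c.2)).
  by move: cu; rewrite mem_tile_cells; case: c => a b /=; lia || (move=> h; congr pair; lia).
by rewrite -mem_placed_z -e.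
Qed.

Lemma T_pos t : t \in T -> is_tile t.
Proof. by move/T_gadget/gadget_tile_pos. Qed.

(** Placed tiles have natural coordinates because the lower left cell of a tile belongs to the
    region. *)
Lemma tiles_region_tiling (P : {fset square * tile}) : is_tiling T (@union_of_squares R (gadget_squares M W bd)) P <->
  (forall v, v \in P -> exists u, v = placed_z u) /\
  tiles_region (gadget_tile EB EF) (region M W bd) (fun u => placed_z u \in P).
Proof.
rewrite (is_tilingP R _ _ T_pos); split.
  move=> [PT dis cov].
  have Pz v : v \in P -> exists u, v = placed_z u.
    move=> vP; have [w0 h0] := T_pos (PT _ vP).
    have : v.1 \in gadget_squares M W bd.
      by apply/cov; exists v => //; rewrite mem_tile_cells; case: v {vP} w0 h0 => [[a b] [w h]] /=; lia.
    move/mem_gs => [x [y [e _]]]; exists ((x, y), v.2).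
    by case: v e {vP w0 h0} => c t /= ->.
  split=> //; split.
  - by move=> u /PT/T_gadget.
  - move=> u v x y uP vP ux vx; apply: placed_z_inj.
    by apply: (dis _ _ (Posz x, Posz y)); rewrite ?mem_placed_z.
  - move=> x y; split.
      move=> rxy; have /cov[v vP] : (Posz x, Posz y) \in gadget_squares M W bd.
        by apply/mem_gs; exists x, y.
      by have [u e] := Pz v vP; rewrite e mem_placed_z => h; exists u; rewrite -?e.
    move=> [u uP ux]; have /mem_gs[x' [y' [[<- <-] //]]] : (Posz x, Posz y) \in gadget_squares M W bd.
    by apply/cov; exists (placed_z u); rewrite ?mem_placed_z.
move=> [Pz [PT dis cov]]; split.
- by move=> v vP; have [u e] := Pz v vP; apply/T_gadget; rewrite e; apply: PT; rewrite -e.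
- move=> v w c vP wP; have [u e] := Pz v vP; have [u' e'] := Pz w wP; rewrite e e'.
  move=> /placed_z_cells[x [y [-> ux]]]; rewrite mem_placed_z => u'x.
  by rewrite (dis u u' x y) // -?e -?e'.
- move=> c; rewrite mem_gs; split.
    by move=> [x [y [-> /cov[u uP ux]]]]; exists (placed_z u); rewrite ?mem_placed_z.
  move=> [v vP cv]; have [u e] := Pz v vP; move: cv; rewrite e => /placed_z_cells[x [y [-> ux]]].
  by exists x, y; split=> //; apply/cov; exists u; rewrite -?e.
Qed.

Definition placed_list (q : nat -> nat -> L) : seq placed :=
  [seq brick M q i j | i <- iota 1 M, j <- iota 0 W] ++ [seq filler M q i j | i <- iota 1 M, j <- iota 1 W].

Lemma mem_placed_list q u : u \in placed_list q <-> placed_in M W q u.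
Proof.
rewrite mem_cat; split.
  move=> /orP[/allpairsP[[i j] /= [hi hj ->]]|/allpairsP[[i j] /= [hi hj ->]]]; [left|right];
    by exists i, j; move: hi hj; rewrite !mem_iota; split=> //; lia.
by move=> [[i [j [hi hj ->]]]|[i [j [hi hj ->]]]]; apply/orP; [left|right];
  apply/allpairsP; exists (i, j); rewrite /= !mem_iota; split=> //; lia.
Qed.

Definition labelling_tiling (q : nat -> nat -> L) : {fset square * tile} :=
  [fset placed_z u | u in placed_list q]%fset.

Lemma mem_labelling_tiling q u : placed_z u \in labelling_tiling q <-> placed_in M W q u.
Proof.
rewrite -mem_placed_list; split=> [/imfsetP[v /= vq /placed_z_inj ->] //|uq].
by apply/imfsetP; exists u.
Qed.

Lemma tiles_region_iff (P Q : placed -> Prop) : (forall u, P u <-> Q u) ->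
  tiles_region (gadget_tile EB EF) (region M W bd) P -> tiles_region (gadget_tile EB EF) (region M W bd) Q.
Proof. by move=> e; have -> : P = Q by apply: boolp.funext => u; apply: boolp.propext. Qed.

Lemma labelling_is_tiling q : labelling EB EF M W bd q ->
  is_tiling T (@union_of_squares R (gadget_squares M W bd)) (labelling_tiling q).
Proof.
move=> lq; apply/tiles_region_tiling; split; first by move=> v /imfsetP[u _ ->]; exists u.
by apply: tiles_region_iff (gadget_tiling M_gt0 W_gt0 lq) => u; rewrite mem_labelling_tiling.
Qed.

Lemma tiling_is_labelling P : is_tiling T (@union_of_squares R (gadget_squares M W bd)) P ->
  exists2 q, labelling EB EF M W bd q & labelling_tiling q = P.
Proof.
move=> /tiles_region_tiling[Pz /(gadget_forced M_gt0 W_gt0)[q [lq e]]]; exists q => //.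
apply/fsetP => v; apply/idP/idP.
  by move=> /imfsetP[u /= /mem_placed_list/e uP ->].
by move=> vP; have [u ev] := Pz v vP; rewrite ev; apply/mem_labelling_tiling/e; rewrite -ev.
Qed.

Lemma labelling_tiling_eq q q' : labelling_tiling q = labelling_tiling q' ->
  forall u, placed_in M W q u -> placed_in M W q' u.
Proof. by move=> e u /mem_labelling_tiling; rewrite e => /mem_labelling_tiling. Qed.

End GadgetCount.

Lemma labelling_tiling_ext (L : finType) (M W : nat) (q q' : nat -> nat -> L) :
  (forall i j, i <= M -> j <= W -> q i j = q' i j) ->
  labelling_tiling M W q = labelling_tiling M W q'.
Proof.
move=> e; rewrite /labelling_tiling; suff -> : placed_list M W q = placed_list M W q' by [].
rewrite /placed_list; congr (_ ++ _); apply/eq_in_allpairs => i j; rewrite !mem_iota => hi hj.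
  by rewrite /brick /cut /code_at !e //; lia.
by rewrite /filler /cut /code_at !e //; lia.
Qed.

Definition brick_tiles : seq tile :=
  [seq brick_tile p.1.1.1 p.1.1.2 p.1.2 p.2 | p <- enum {: bool * bool * label * label} & row_rel p.1.2 p.2].

Definition filler_tiles : seq tile :=
  [seq filler_tile p.1.1.1 p.1.1.2 p.1.2 p.2 | p <- enum {: bool * bool * label * label} & col_rel p.1.2 p.2].

Definition gadget_tiles : {fset tile} := [fset t in brick_tiles ++ filler_tiles]%fset.

Lemma mem_gadget_tiles t : t \in gadget_tiles <-> gadget_tile row_rel col_rel t.
Proof.
have -> : (t \in gadget_tiles) = (t \in brick_tiles ++ filler_tiles) 
  by apply/imfsetP/idP => [[x h ->] //|h]; exists t.
rewrite mem_cat; split.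
  move=> /orP[/mapP[[[[pi pj] l] r]]|/mapP[[[[pi pj] l] r]]]; rewrite mem_filter => /andP[/= h _] ->.
    by left; exists pi, pj, l, r.
  by right; exists pi, pj, l, r.
move=> [[pi [pj [l [r [h ->]]]]]|[pi [pj [l [r [h ->]]]]]]; apply/orP; [left|right];
  by apply/mapP; exists (pi, pj, l, r); rewrite // mem_filter /= h mem_enum.
Qed.

Lemma card_gadget_tiles : #|` gadget_tiles| <= 10 ^ 6.
Proof.
have cl := card_label; set m := #|{: label}| in cl.
have sz (p : pred (bool * bool * label * label)) : size [seq x <- enum {: bool * bool * label * label} | p x] <= 4 * (m * m).
  rewrite size_filter (leq_trans (count_size _ _)) // -cardE !card_prod card_bool -/m.
  by rewrite !mulnA.
have : #|` gadget_tiles| <= 4 * (m * m) + 4 * (m * m).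
  rewrite /gadget_tiles card_fseq (leq_trans (size_undup _)) //.
  by rewrite size_cat !size_map leq_add.
(* [416 * 832] is [8 * 208 ^ 2]: two kinds of tiles, four pairs of parities and two labels. *)
move=> /leq_trans; apply; apply: (@leq_trans (416 * 832)).
  by have := leq_mul cl cl; lia.
by rewrite -[6]/(3 + 3) expnD; apply: leq_mul.
Qed.

Theorem count_assignments (R : realType) n f : 0 < n -> cnf_bounded n f ->
  nb_tilings R gadget_tiles (gadget_squares (height f) (width n) (border n f)) =
  #|[pred a : n.-tuple bool | cnf_holds a f]|.
Proof.
move=> n0 fn; have M0 : 0 < height f by [].
have W0 : 0 < width n by [].
apply: (nb_tilings_card (F := fun a : n.-tuple bool =>
   labelling_tiling (height f) (width n) (labels_of n f (assignment_choices n f a)))).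
- move=> a b; rewrite !inE => ha hb e; apply/val_inj.
  have la := assignment_labelling n0 fn (size_tuple a) ha; have lb := assignment_labelling n0 fn (size_tuple b) hb.
  apply: (labels_of_inj n0 fn (size_tuple a) (size_tuple b)) => i j hi hj.
  by apply: (gadget_labels_inj M0 W0 la lb) => //; exact: labelling_tiling_eq e.
- move=> a; rewrite inE => ha; have la := assignment_labelling n0 fn (size_tuple a) ha.
  exact: (labelling_is_tiling R mem_gadget_tiles M0 W0 la).
- move=> P /(tiling_is_labelling mem_gadget_tiles M0 W0)[q lq <-].
  have [a [sa ha e]] := labelling_assignment n0 fn lq; have sa' : size a == n by rewrite sa.
  exists (Tuple sa'); first by rewrite inE.
  by apply: labelling_tiling_ext => i j hi hj; rewrite e.
Qed.

(** * Hardness *)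

Section PointwisePtime.
Variables (A X Y : encType).
Implicit Types (f g : A -> nat).

Lemma ptimeS f : ptime f -> ptime (fun a => (f a).+1).
Proof. exact: (ptime1 (g := succn) ptime_succ). Qed.

Lemma ptimeP f : ptime f -> ptime (fun a => (f a).-1).
Proof. exact: (ptime1 (g := predn) ptime_pred). Qed.

Lemma ptimeD f g : ptime f -> ptime g -> ptime (fun a => f a + g a).
Proof. exact: (ptime2 (g := addn) ptime_add). Qed.

Lemma ptimeB f g : ptime f -> ptime g -> ptime (fun a => f a - g a).
Proof. exact: (ptime2 (g := subn) ptime_sub). Qed.

Lemma ptimeM f g : ptime f -> ptime g -> ptime (fun a => f a * g a).
Proof. exact: (ptime2 (g := muln) ptime_mul). Qed.

Lemma ptimeE f g : ptime f -> ptime g -> ptime (fun a => f a == g a).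
Proof. exact: (ptime2 (g := fun m n : nat => m == n) ptime_eqn). Qed.

Lemma ptimeL f g : ptime f -> ptime g -> ptime (fun a => f a < g a).
Proof. by move=> Pf Pg; exact: (ptime2 (g := leq) ptime_leq (ptimeS Pf) Pg). Qed.

Lemma ptimeI f g : ptime f -> ptime g -> ptime (fun a => iota (f a) (g a)).
Proof. exact: (ptime2 (g := iota) ptime_iota). Qed.

Lemma ptimeN f (x : A -> X) : ptime f -> ptime x -> ptime (fun a => nseq (f a) (x a)).
Proof. exact: (ptime2 (g := fun n (x : X) => nseq n x) (@ptime_nseq X)). Qed.

Lemma ptime_append (u v : A -> seq X) : ptime u -> ptime v -> ptime (fun a => u a ++ v a).
Proof. exact: (ptime2 (g := fun s t : seq X => s ++ t) (@ptime_cat X)). Qed.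

Lemma ptime_push (x : A -> X) (v : A -> seq X) : ptime x -> ptime v -> ptime (fun a => x a :: v a).
Proof. exact: (ptime2 (g := fun (x : X) (t : seq X) => x :: t) (@ptime_cons X)). Qed.

Lemma ptime_zips (u : A -> seq X) (v : A -> seq Y) : ptime u -> ptime v -> ptime (fun a => zip (u a) (v a)).
Proof. exact: (ptime2 (g := fun (s : seq X) (t : seq Y) => zip s t) (@ptime_zip X Y)). Qed.

Lemma ptime_at (x0 : X) (u : A -> seq X) f : ptime u -> ptime f -> ptime (fun a => nth x0 (u a) (f a)).
Proof. exact: (ptime2 (g := fun (s : seq X) n => nth x0 s n) (@ptime_nth X x0)). Qed.

Lemma ptime_flatmap (h : A -> X -> seq Y) (l : A -> seq X) :
  ptime (fun p : A * X => h p.1 p.2) -> ptime l -> ptime (fun a => flatten (map (h a) (l a))).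
Proof. by move=> Ph Pl; apply: ptime1 (@ptime_flatten Y) _; exact: ptime_map. Qed.

End PointwisePtime.

Lemma ptime_horner (p : {poly nat}) : ptime (fun n : nat => (p.[n])%R : nat).
Proof.
elim/poly_ind: p => [|p c IH].
  by apply: (eq_ptime (ptime_const 0)) => n; rewrite horner0.
apply: (eq_ptime (ptimeD (ptimeM IH ptime_id) (ptime_const c))) => n.
by rewrite hornerMXaddC.
Qed.

Lemma poly_bounded_horner (p : {poly nat}) : poly_bounded (fun n => (p.[n])%R).
Proof.
elim/poly_ind: p => [|p c IH].
  by apply: poly_bounded_le (poly_boundedC 0) => n; rewrite horner0.
apply: poly_bounded_le (poly_boundedD (poly_boundedM IH poly_bounded_id) (poly_boundedC c)) => n.
by rewrite hornerMXaddC.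
Qed.

Lemma ptime_odd : ptime odd.
Proof.
apply: (eq_ptime (f := fun n : nat => iter n negb false)); last by elim=> //= n ->.
apply: (ptime_iter_add (f := fun (n : nat) (b : bool) => ~~ b) (c := 2) _ ptime_id (ptime_const false)).
  exact: ptime1 ptime_negb ptime_snd.
by move=> a b; have := csize_bool (~~ b); have := csize_gt0 b; lia.
Qed.

(** A function on a finite type is a table lookup, whatever the size of its values; this is how
    constants such as the label codes enter the reduction. *)
Lemma ptime_finite (X B : encType) (k : X -> nat) (s : seq X) (x0 : X) :
  (forall x, encode (k x) = encode x) -> (forall x, k x < size s /\ nth x0 s (k x) = x) ->
  forall f : X -> B, ptime f.
Proof.
move=> kE sE f; have Pk : ptime k by exact: ptime_recode_id kE.
apply: (eq_ptime (ptime_at (f x0) (ptime_const (map f s)) Pk)) => x.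
by have [h e] := sE x; rewrite (nth_map x0) // e.
Qed.

Definition instr_code (op : instr) : nat := mode_code (Start op).

Canonical instr_encType := EncType (fun op : instr => encode (instr_code op)).

Lemma ptime_instr (B : encType) (f : instr -> B) : ptime f.
Proof.
apply: (@ptime_finite _ _ instr_code [:: Guess; Reset; Step; Pos; Neg; Assert; Clear; Nop] Nop) => //.
by case.
Qed.

Definition kind_code (s : option (option bool)) : nat :=
  match s with None => 0 | Some None => 1 | Some (Some b) => b.+2 end.

Canonical kind_encType := EncType (fun s : option (option bool) => encode (kind_code s)).

Lemma ptime_kind (B : encType) (f : option (option bool) -> B) : ptime f.
Proof.
apply: (@ptime_finite _ _ kind_code [:: None; Some None; Some (Some false); Some (Some true)] None) => //.
by case=> [[[]|]|].
Qed.

Lemma ptime_literal_program : ptime literal_program.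
Proof.
apply: ptime_push; first exact: ptime_const.
apply: ptime_append; first exact: ptimeN ptime_fst (ptime_const Step).
apply: ptime_push; last exact: ptime_const.
exact: ptime_if ptime_snd (ptime_const Pos) (ptime_const Neg).
Qed.

Lemma ptime_clause_program : ptime clause_program.
Proof.
apply: ptime_append; last exact: ptime_const.
apply: (ptime_flatmap (h := fun _ : seq (nat * bool) => literal_program)); last exact: ptime_id.
exact: ptime1 ptime_literal_program ptime_snd.
Qed.

Lemma ptime_program : ptime program.
Proof.
apply: ptime_push; first exact: ptime_const.
apply: ptime_append; last exact: ptime_const.
apply: (ptime_flatmap (h := fun _ : seq (seq (nat * bool)) => clause_program)); last exact: ptime_id.
exact: ptime1 ptime_clause_program ptime_snd.
Qed.

Lemma ptime_var_bits (C : finType) : ptime (var_bits C).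
Proof.
apply: (ptime_flatmap (h := fun (_ : seq nat) v => iota (v * #|C|) #|C|)); last exact: ptime_id.
exact: ptimeI (ptimeM ptime_snd (ptime_const _)) (ptime_const _).
Qed.

Lemma ptime_bad_clauses (C : finType) (A : encType) (vs : A -> seq nat) (ws : A -> seq (seq bool)) :
  ptime vs -> ptime ws -> ptime (fun a => bad_clauses C (vs a) (ws a)).
Proof.
move=> Pv Pw; apply: (ptime_map (f := fun a (w : seq bool) => zip (var_bits C (vs a)) (map negb w))) => //.
apply: ptime_zips.
  exact: ptime1 (ptime_var_bits C) (ptime1 Pv ptime_fst).
apply: (ptime_map (f := fun (_ : A * seq bool) b => ~~ b)); last exact: ptime_snd.
exact: ptime1 ptime_negb ptime_snd.
Qed.

(** * The formula is computed in polynomial time *)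

Section TableauPtime.
Variables (M : machine) (A : encType) (steps c N m : A -> nat) (x : A -> seq bool).
Hypotheses (Ps : ptime steps) (Pc : ptime c) (PN : ptime N) (Pm : ptime m) (Px : ptime x).

Lemma ptime_column_kind (j : A -> nat) : ptime j -> ptime (fun a => column_kind (c a) (j a)).
Proof.
move=> Pj; apply: ptime_if; [exact: ptimeE Pj (ptimeS Pc)|exact: ptime_const|].
apply: ptime_if; [exact: ptimeE Pj Pc|exact: ptime_const|].
by apply: ptime_if; [exact: ptimeE (ptimeS Pj) Pc|exact: ptime_const|exact: ptime_const].
Qed.

Lemma ptime_cell_var (t j : A -> nat) : ptime t -> ptime j -> ptime (fun a => cell_var (N a) (t a) (j a)).
Proof. by move=> Pt Pj; exact: ptimeD (ptimeM Pt PN) Pj. Qed.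

Lemma ptime_initial_kinds : ptime (fun a => initial_kinds (steps a) (c a) (x a) (m a)).
Proof.
apply: ptime_append; first exact: ptimeN Pc (ptime_const _).
apply: ptime_append.
  apply: (ptime_map (f := fun (_ : A) (b : bool) => Some (Some b))); last exact: ptime1 ptime_delimited Px.
  apply: (eq_ptime (ptime_if ptime_snd (ptime_const (Some (Some true))) (ptime_const (Some (Some false))))).
  by case=> a [].
apply: ptime_append; first exact: ptimeN Pm (ptime_const _).
exact: ptimeN (ptimeS (ptimeS (ptimeS (ptimeS Ps)))) (ptime_const _).
Qed.

Lemma ptime_initial_clauses : ptime (fun a => initial_clauses M (steps a) (c a) (N a) (x a) (m a)).
Proof.
apply: (ptime_flatmap (h := fun (_ : A) (p : nat * option (option bool)) =>
  bad_clauses (column M) [:: p.1] (bad_words 1 (initial_test (M := M) p.2)))); last first.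
  exact: ptime_zips (ptimeI (ptime_const 0) PN) ptime_initial_kinds.
apply: ptime_bad_clauses.
  exact: ptime_push (ptime1 ptime_fst ptime_snd) (ptime_const _).
exact: ptime1 (ptime_kind (fun s => bad_words 1 (initial_test (M := M) s))) (ptime1 ptime_snd ptime_snd).
Qed.

(** [column_kind] has only four values, so the excluded words form a constant table. *)
Definition step_words (k : nat) : seq (seq bool) :=
  nth [::] [:: bad_words 5 (step_test (M := M) 0); bad_words 5 (step_test (M := M) 1);
    bad_words 5 (step_test (M := M) 2); bad_words 5 (step_test (M := M) 3)] k.

Lemma step_wordsE c0 j : bad_words 5 (step_test (M := M) (column_kind c0 j)) = step_words (column_kind c0 j).
Proof. by rewrite /column_kind; do 3 (case: (_ == _); first by []). Qed.

End TableauPtime.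

Lemma ptime_step_vars (A : encType) (c N t j : A -> nat) : ptime c -> ptime N -> ptime t -> ptime j ->
  ptime (fun a => step_vars (c a) (N a) (t a) (j a)).
Proof.
move=> Pc PN Pt Pj; have Pv := ptime_cell_var PN.
apply: ptime_push; first exact: Pv (ptimeS Pt) Pj.
apply: ptime_push; first exact: Pv Pt Pc.
apply: ptime_push; first exact: Pv Pt (ptimeP Pj).
apply: ptime_push; first exact: Pv Pt Pj.
apply: ptime_push; last exact: ptime_const.
by apply: Pv Pt _; apply: ptime_if; [exact: ptimeE (ptimeS Pj) PN|exact: Pj|exact: ptimeS].
Qed.

Lemma ptime_step_clauses (M : machine) (A : encType) (steps c N : A -> nat) :
  ptime steps -> ptime c -> ptime N -> ptime (fun a => step_clauses M (steps a) (c a) (N a)).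
Proof.
move=> Ps Pc PN.
pose G (q : A * nat * nat) := bad_clauses (column M) (step_vars (c q.1.1) (N q.1.1) q.1.2 q.2)
  (step_words M (column_kind (c q.1.1) q.2)).
have PG : ptime G.
  have P1 : ptime (fun q : A * nat * nat => q.1.1) by exact: ptime1 ptime_fst ptime_fst.
  have Pc' := ptime1 Pc P1.
  apply: ptime_bad_clauses.
    exact: ptime_step_vars Pc' (ptime1 PN P1) (ptime1 ptime_snd ptime_fst) ptime_snd.
  apply: ptime_at; first exact: ptime_const.
  exact: ptime_column_kind Pc' _ ptime_snd.
apply: (eq_ptime (f := fun a => flatten [seq flatten [seq G (a, t, j) | j <- iota 0 (N a)] | t <- iota 0 (steps a)])).
  apply: (ptime_flatmap (h := fun a t => flatten [seq G (a, t, j) | j <- iota 0 (N a)])); last first.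
    exact: ptimeI (ptime_const 0) Ps.
  apply: (ptime_flatmap (h := fun (p : A * nat) j => G (p.1, p.2, j))); last first.
    exact: ptimeI (ptime_const 0) (ptime1 PN ptime_fst).
  apply: ptime1 PG _; apply: ptime_pair ptime_snd.
  exact: ptime_pair (ptime1 ptime_fst ptime_fst) (ptime1 ptime_snd ptime_fst).
move=> a; congr flatten; apply: eq_map => t; congr flatten; apply: eq_map => j.
by rewrite /G /clauses_at /= step_wordsE.
Qed.

Lemma ptime_tableau_cnf (M : machine) (A : encType) (steps c N m : A -> nat) (x : A -> seq bool) :
  ptime steps -> ptime c -> ptime N -> ptime m -> ptime x ->
  ptime (fun a => tableau_cnf M (steps a) (c a) (N a) (x a) (m a)).
Proof.
move=> Ps Pc PN Pm Px; apply: ptime_append; first exact: ptime_initial_clauses.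
apply: ptime_append; first exact: ptime_step_clauses.
apply: (ptime_bad_clauses (column M) (ws := fun=> bad_words 1 (accept_test (M := M)))); last exact: ptime_const.
exact: ptime_push (ptime_cell_var PN Ps Pc) (ptime_const _).
Qed.

(** * The region is computed in polynomial time *)

Section GadgetPtime.
Variables (A : encType).

Lemma ptime_label_code (b b' : A -> bool) (op : A -> instr) (g : instr -> label) :
  ptime b -> ptime b' -> ptime op -> ptime (fun a => label_code (b a) (b' a) (g (op a))).
Proof.
move=> Pb Pb' Po.
have P u v : ptime (fun a => label_code u v (g (op a))).
  exact: ptime1 (ptime_instr (fun o => label_code u v (g o))) Po.
apply: (eq_ptime (ptime_if Pb (ptime_if Pb' (P true true) (P true false))
  (ptime_if Pb' (P false true) (P false false)))) => a.
by case: (b a); case: (b' a).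
Qed.

Lemma nth_blank_syms n k : nth (inl false) (blank_syms n) k =
  if (k == 0) || (n < k) then inl false else inr (false, false).
Proof.
rewrite /blank_syms /acc_cells cells_plain ?size_nseq //; case: k => //= k.
case: ltnP => h; first by rewrite nth_default // size_map size_nseq.
by rewrite (nth_map false) ?size_nseq // nth_nseq h.
Qed.

(** [Nop] and [Guess] serve merely as tags for the two symbols of a blank row. Every border label
    thus becomes a function of an instruction, whose code [ptime_instr] can look up. *)
Definition middle_label (op : instr) : label :=
  inr (Start Nop, if op is Nop then inl false else inr (false, false), false).

Lemma borderE n f i j : border n f i j =
  if j == 0 then inl (Start (if i == 0 then Nop else row_instr f i))
  else if j == width n then inl (final_mode (if i == 0 then Nop else row_instr f i))
  else middle_label (if (j.-1 == 0) || (n < j.-1) then Nop else Guess).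
Proof.
rewrite /border nth_blank_syms; case: (j == 0) => //; case: (j == width n); first by case: (i == 0).
by rewrite /middle_label; case: ifP.
Qed.

Lemma ptime_border_code (n i j : A -> nat) (f : A -> cnf) : ptime n -> ptime f -> ptime i -> ptime j ->
  ptime (fun a => code_at (border (n a) (f a)) (i a) (j a)).
Proof.
move=> Pn Pf Pi Pj; have Po := ptime1 ptime_odd Pi; have Po' := ptime1 ptime_odd Pj.
have Pr : ptime (fun a => if i a == 0 then Nop else row_instr (f a) (i a)).
  apply: ptime_if (ptimeE Pi (ptime_const 0)) (ptime_const Nop) _.
  exact: ptime_at (ptime1 ptime_program Pf) (ptimeP Pi).
have Pk : ptime (fun a => if ((j a).-1 == 0) || (n a < (j a).-1) then Nop else Guess).
  apply: ptime_if (ptime_const Nop) (ptime_const Guess).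
  exact: (ptime2 (g := orb) ptime_or (ptimeE (ptimeP Pj) (ptime_const 0)) (ptimeL Pn (ptimeP Pj))).
apply: (eq_ptime (ptime_if (ptimeE Pj (ptime_const 0)) (ptime_label_code (fun o => inl (Start o)) Po Po' Pr)
  (ptime_if (ptimeE Pj (ptimeS (ptimeS Pn))) (ptime_label_code (fun o => inl (final_mode o)) Po Po' Pr)
    (ptime_label_code middle_label Po Po' Pk)))) => a.
by rewrite /code_at borderE; case: (j a == 0) => //; case: (j a == width (n a)).
Qed.

Lemma ptime_height (f : A -> cnf) : ptime f -> ptime (fun a => height (f a)).
Proof. by move=> Pf; exact: ptimeS (ptime1 (@ptime_size _) (ptime1 ptime_program Pf)). Qed.

Lemma ptime_cut (n i j : A -> nat) (f : A -> cnf) : ptime n -> ptime f -> ptime i -> ptime j ->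
  ptime (fun a => cut (height (f a)) (border (n a) (f a)) (i a) (j a)).
Proof.
move=> Pn Pf Pi Pj; apply: ptimeD (ptime_border_code Pn Pf Pi Pj).
apply: ptimeD (ptimeM (ptime_const _) Pj).
exact: ptimeM (ptime_const _) (ptimeB (ptimeS (ptime_height Pf)) Pi).
Qed.

Lemma ptime_blocks (h v : A -> nat -> nat) (n : A -> nat) : ptime (fun p : A * nat => h p.1 p.2) ->
  ptime (fun p : A * nat => v p.1 p.2) -> ptime n -> ptime (fun a => blocks (h a) (v a) (n a)).
Proof.
move=> Ph Pv Pn; apply: (ptime_flatmap (h := fun a j => nseq (h a j) (v a j))); first exact: ptimeN.
exact: ptimeI (ptime_const 1) Pn.
Qed.

End GadgetPtime.

Lemma ptime_step_height : ptime (fun j : nat => filler_height (odd j)).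
Proof. exact: ptime_if ptime_odd (ptime_const 3) (ptime_const 2). Qed.

Lemma ptime_posz (A : encType) (f : A -> nat) : ptime f -> ptime (fun a => Posz (f a)).
Proof. by move=> Pf; apply: (eq_ptime (f := fun a => (0 + Posz (f a))%R)) => [|a]; [exact: ptime_addz (ptime_const (0%R : int)) Pf|rewrite add0r]. Qed.

Lemma ptime_row_squares (A : encType) (rows : A -> seq (nat * nat)) : ptime rows ->
  ptime (fun a => row_squares 4 (rows a)).
Proof.
move=> Pr; apply: (ptime_flatmap (h := fun (_ : A) (p : nat * (nat * nat)) =>
  [seq (Posz x, Posz p.1) | x <- iota p.2.1 (p.2.2 - p.2.1)])); last first.
  exact: ptime_zips (ptimeI (ptime_const 4) (ptime1 (@ptime_size _) Pr)) Pr.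
have P2 : ptime (fun p : A * (nat * (nat * nat)) => p.2.2) by exact: ptime1 ptime_snd ptime_snd.
apply: (ptime_map (f := fun (p : A * (nat * (nat * nat))) x => (Posz x, Posz p.2.1))).
  apply: ptime_pair; apply: ptime_posz; first exact: ptime_snd.
  exact: ptime1 ptime_fst (ptime1 ptime_snd ptime_fst).
exact: ptimeI (ptime1 ptime_fst P2) (ptimeB (ptime1 ptime_snd P2) (ptime1 ptime_fst P2)).
Qed.

Lemma ptime_gadget_squares (A : encType) (n : A -> nat) (f : A -> cnf) : ptime n -> ptime f ->
  ptime (fun a => gadget_squares (height (f a)) (width (n a)) (border (n a) (f a))).
Proof.
move=> Pn Pf; have PM := ptime_height Pf; have PW := ptimeS (ptimeS Pn).
have Pn' := ptime1 Pn (@ptime_fst A nat); have Pf' := ptime1 Pf (@ptime_fst A nat).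
have PM' := ptime_height Pf'; have PW' := ptimeS (ptimeS Pn').
have P4 : ptime (fun p : A * nat => 4) by exact: ptime_const.
have Ph : ptime (fun p : A * nat => filler_height (odd p.2)) by exact: ptime1 ptime_step_height ptime_snd.
apply: ptime_row_squares; apply: ptime_zips.
  apply: ptime_append.
    apply: (ptime_blocks (h := fun _ _ => 4) (v := fun a i => cut (height (f a)) (border (n a) (f a)) i 0)) P4 _ PM.
    exact: ptime_cut Pn' Pf' ptime_snd (ptime_const 0).
  apply: (ptime_blocks (h := fun _ j => filler_height (odd j))
    (v := fun a j => cut (height (f a)) (border (n a) (f a)) (height (f a)) j)) Ph _ (ptimeS Pn).
  exact: ptime_cut Pn' Pf' PM' ptime_snd.
apply: ptime_append.
  apply: (ptime_blocks (h := fun _ j => filler_height (odd j))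
    (v := fun a j => cut (height (f a)) (border (n a) (f a)) 0 j)) Ph _ PW.
  exact: ptime_cut Pn' Pf' (ptime_const 0) ptime_snd.
apply: (ptime_blocks (h := fun _ _ => 4) (v := fun a i => cut (height (f a)) (border (n a) (f a)) i (width (n a)))) P4 _ PM.
exact: ptime_cut Pn' Pf' ptime_snd PW'.
Qed.

Lemma bits_value_ge w : canonical_bits w -> w != [::] -> 2 ^ (size w).-1 <= bits_value w.
Proof.
elim: w => [//|b [|b' w] IH]; first by case: b.
move=> cw _; have {}IH := IH cw isT; rewrite [(size _).-1]/= expnS mul2n.
apply: leq_trans (_ : (bits_value (b' :: w)).*2 <= _); first by rewrite leq_double.
exact: leq_addl.
Qed.

Lemma size_bits_le n m : n <= 2 ^ m -> size (bits n) <= m.+1.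
Proof.
move=> h; have := @bits_value_ge (bits n) (canonical_bits_bits n); rewrite bits_valueK.
case: (bits n) => //= b w /(_ isT) h'; rewrite ltnS -(leq_exp2l (m := 2)) //.
exact: leq_trans h' h.
Qed.

Lemma tiling_problem_encode (R : realType) (T : {fset tile}) s : simply_connected_region R s ->
  tiling_problem R T (encode_squares s) = nb_tilings R T s.
Proof.
move=> Ds; rewrite /tiling_problem /counting_problem; case: pselect => [ex|[]]; last by exists s.
by case: (cid ex) => s' [Ds' /= /encode_squares_inj ->].
Qed.

Theorem gadget_sharpP_hard (R : realType) : sharpP_hard (tiling_problem R gadget_tiles).
Proof.
move=> g [p [V [[M M_free [P run]] gE]]].
pose m (x : seq bool) : nat := (p.[size x])%R.
pose steps (x : seq bool) : nat := (P.[(size (delimited x) + m x)%N])%R.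
pose c x := (steps x).+2.
pose N x := c x + (size (delimited x) + m x + steps x).+4.
pose f x := tableau_cnf M (steps x) (c x) (N x) x (m x).
pose n x := tableau_vars M (steps x) (N x).
pose sq x := gadget_squares (height (f x)) (width (n x)) (border (n x) (f x)).
have run_V x y : size y = m x ->
    computes_within M (fun=> [::]) (string_pair x y) [:: V (string_pair x y)] (steps x).
  by move=> sy; have := run (string_pair x y); rewrite {3}/string_pair size_cat sy.
have n_gt0 x : 0 < n x.
  rewrite /n /tableau_vars !muln_gt0 [0 < N x]/(0 < c x + _) addnS /=.
  by apply/card_gt0P; exists (tm_start M, [ffun=> None]).
have count x : tiling_problem R gadget_tiles (encode_squares (sq x)) = g x.
  rewrite tiling_problem_encode; last by apply: gadget_squares_region.
  rewrite count_assignments //; last by apply: tableau_bounded.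
  by rewrite gE -(count_tableau M_free (erefl _) (erefl _) (run_V x)).
have Psize : ptime (fun x : seq bool => size x) by exact: ptime_size.
have Pm : ptime m by exact: ptime1 (ptime_horner p) Psize.
have Pd : ptime (fun x => size (delimited x)) by exact: ptime1 (@ptime_size _) ptime_delimited.
have Ps : ptime steps by exact: ptime1 (ptime_horner P) (ptimeD Pd Pm).
have Pc : ptime c by exact: ptimeS (ptimeS Ps).
have PN : ptime N.
  exact: ptimeD Pc (ptimeS (ptimeS (ptimeS (ptimeS (ptimeD (ptimeD Pd Pm) Ps))))).
have Pf : ptime f by exact: ptime_tableau_cnf Ps Pc PN Pm ptime_id.
have Pn : ptime n by exact: ptimeM (ptimeM (ptimeS Ps) PN) (ptime_const _).
have PF_sq : ptime (fun x => encode_squares (sq x)).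
  exact: ptime1 ptime_encode_squares (ptime_gadget_squares Pn Pf).
(* The count is at most the number of witnesses, [2 ^ p.[size x]], and so has at most one bit more
   than the exponent. *)
apply: (polytime_turing_query (b := fun k => (p.[k])%R + 1) (ptime_PF PF_sq)).
- by move=> x; rewrite /= count.
- exact: poly_boundedD (poly_bounded_horner p) (poly_boundedC 1).
- move=> x; rewrite addn1; apply: size_bits_le; rewrite gE; apply: leq_trans (max_card _) _.
  by rewrite card_tuple card_bool.
Qed.

Theorem theorem1p2 (R : realType) :
  exists T : {fset tile},
    [/\ (#|` T| <= 10 ^ 6)%N,
        forall t : tile, t \in T -> is_tile t &
        sharpP_complete (tiling_problem R T)].
Proof.
have T_pos t : t \in gadget_tiles -> is_tile t by move/mem_gadget_tiles/gadget_tile_pos.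
exists gadget_tiles; split=> //; first exact: card_gadget_tiles.
by split; [exact: tiling_sharpP T_pos|exact: gadget_sharpP_hard].
Qed.
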